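(* Let $p\geq 2$ and let $X_N=I_p(f_N)$, $N\geq 1$, with $f_N\in H^{\odot p}$ for all $N\geq 1$, be such that $X_N\xrightarrow[N\to\infty]{(d)}N(0,\sigma^2)$ with $\sigma^2>0$. Let $Y_N=I_q(g_N)$, $g_N\in H^{\odot q}$, with $ap<q<(a+1)p$ for some integer $a\geq 1$. Define $Y_{0,N}=Y_N$ and $Y_{r+1,N}=\langle DX_N,DY_{r,N}\rangle_H$ for $r\geq 0$. Assume that $$(Y_N,Y_{1,N},\ldots,Y_{a,N})\xrightarrow[N\to\infty]{(d)}(Y,Y_1,\ldots,Y_a).$$ Then $(X_N,Y_N)\xrightarrow[N\to\infty]{(d)}(Z,Y)$, where $Z\sim N(0,\sigma^2)$ and the characteristic function $\varphi$ of $(Z,Y)$ is given, for every $(u,v)\in\mathbb R^2$, by $$\varphi(u,v)=e^{-\sigma^2u^2/2}\sum_{\ell=0}^\infty\frac{u^\ell}{\ell!}\sum_{\substack{m=(m_1,\ldots,m_a)\in\mathbb N^a\\ |m|=m_1+\cdots+m_a\leq\ell}}A_{\ell,m}(v)\,\mathbf E\left[\prod_{r=1}^aY_r^{m_r}\,e^{ivY}\right],$$ where the coefficients $A_{\ell,m}=A_{\ell,m}(v)$ are polynomials in $v/p$ defined by the recursion $$A_{0,(0,\ldots,0)}=1,\qquad A_{\ell,m}=0\ \text{ if }|m|>\ell,$$ $$A_{\ell+1,m}=-\frac vp\,A_{\ell,m-e_1}+\frac ip\sum_{s=1}^a(m_s+1)\,A_{\ell,m+e_s-e_{s+1}},$$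 with the convention $A_{\ell,m}=0$ whenever any component of $m$ is negative or $m$ has more than $a$ components (so the term $s=a$, which would involve $e_{a+1}$, is zero). The series converges absolutely for every $(u,v)\in\mathbb R^2$.
   Context: $H$ is a real separable Hilbert space, $H^{\odot n}$ is the symmetric $n$-th tensor power of $H$ (symmetric elements of $H^{\otimes n}$), $(W(h),h\in H)$ is an isonormal Gaussian process on a probability space $(\Omega,\mathcal A,P)$, and $I_n$ is the multiple Wiener–Itô integral of order $n$ with respect to $W$, normalized so that $\mathbf E[I_n(f)I_m(g)]=n!\langle f,g\rangle_{H^{\otimes n}}$ if $n=m$ and $0$ otherwise, for symmetric $f,g$. $D$ is the Malliavin derivative with respect to $W$. $\mathbb N=\{0,1,2,\ldots\}$, $e_s$ is the $s$-th canonical unit vector of $\mathbb N^a$, and $i$ is the imaginary unit. $\xrightarrow{(d)}$ denotes convergence in distribution. *)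

(* Defs.v *)
From HB Require Import structures.
From mathcomp Require Import all_boot all_order all_algebra.
From mathcomp Require Import perm complex.
From mathcomp Require Import all_classical all_reals all_analysis.

Set Implicit Arguments.
Unset Strict Implicit.
Unset Printing Implicit Defensive.

Import Order.TTheory GRing.Theory Num.Theory.
Import numFieldNormedType.Exports.

Local Open Scope classical_set_scope.
Local Open Scope ring_scope.

Section law.
Context {R : realType}.

(* Weak convergence, tested against bounded continuous functions; the limit may
   live on another probability space. *)
Definition cvg_law d (T : measurableType d) (P : probability T R)
    d' (T' : measurableType d') (P' : probability T' R) (V : topologicalType)
    (X : nat -> T -> V) (Y : T' -> V) : Prop :=
  forall g : V -> R, continuous g -> (exists M, forall v, `|g v| <= M) ->
    (fun N => expectation P (g \o X N)) @ \oo --> expectation P' (g \o Y).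

(* [normal_prob 0 0] is a junk (uniform) law in the library, whence the Dirac
   mass for degenerate Gaussians. *)
Definition has_centered_gaussian_law d (T : measurableType d)
    (P : probability T R) (X : T -> R) (s : R) : Prop :=
  forall A : set R, measurable A ->
    P (X @^-1` A) = if s == 0 then \d_(0 : R) A else normal_prob 0 s A.

Definition cvg_L2 d (T : measurableType d) (P : probability T R)
    (X : nat -> T -> R) (Y : T -> R) : Prop :=
  (fun k => expectation P (fun w => (X k w - Y w) ^+ 2)) @ \oo --> 0%E.

Definition cexpectation d (T : measurableType d) (P : probability T R)
    (X : T -> R[i]) : R[i] :=
  (fine (expectation P (fun w => complex.Re (X w))) +i*
   fine (expectation P (fun w => complex.Im (X w))))%C.

Definition expi (x : R) : R[i] := (cos x +i* sin x)%C.

Definition abs_summable (t : nat -> R[i]) : Prop :=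
  cvgn (series (fun l => ComplexField.Normc.normc (t l))).

Definition csum (t : nat -> R[i]) : R[i] :=
  (limn (series (fun l => complex.Re (t l))) +i*
   limn (series (fun l => complex.Im (t l))))%C.

End law.

Section hilbert.
Context {R : realType} (H : completeNormedModType R).
Variable dot : H -> H -> R.

Definition separable_space : Prop :=
  exists2 D : set H, countable D & dense D.

(* The Hilbert tensor power of order n of H is realized as the space of
   Hilbert-Schmidt n-linear forms on H: the elementary tensor
   h_1 (x) .. (x) h_n is the form t |-> \prod_i dot (h_i) (t_i). *)
Definition multilinear_form n (f : ('I_n -> H) -> R) : Prop :=
  forall (t : 'I_n -> H) (i : 'I_n) (a : R) (x y : H),
    f (dfwith t i (a *: x + y)) =
    a * f (dfwith t i x) + f (dfwith t i y).

(* Squared tensor (= Hilbert-Schmidt) norm, the sum of the squared coordinates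
   in an orthonormal basis; by Bessel, it is the supremum of the partial sums
   over all finite orthonormal families. *)
Definition tensor_norm2 n (f : ('I_n -> H) -> R) : \bar R :=
  ereal_sup [set z | exists k, exists2 e : 'I_k -> H,
    (forall i j, dot (e i) (e j) = (i == j)%:R) &
    z = (\sum_(J : {ffun 'I_n -> 'I_k}) (f (e \o J)) ^+ 2)%:E].

Definition symmetric_tensor n (f : ('I_n -> H) -> R) : Prop :=
  [/\ multilinear_form f, (tensor_norm2 f < +oo)%E &
      forall (s : {perm 'I_n}) (t : 'I_n -> H), f (t \o s) = f t].

(* The linear combination \sum_j c_j h_j^{(x) n}, coded by [:: (c_j, h_j)]. *)
Definition power_tensor n (s : seq (R * H)) (t : 'I_n -> H) : R :=
  \sum_(x <- s) x.1 * \prod_(i < n) dot x.2 (t i).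

End hilbert.

(* Probabilists' Hermite polynomials, of squared L^2-norm n! under N(0,1). *)
Fixpoint hermite (R : comNzRingType) (n : nat) : {poly R} :=
  if n is m.+1 then 'X * hermite R m - deriv (hermite R m) else 1.

Section smooth.
Context {R : realType}.

Definition partial k (j : 'I_k.+1) (phi : 'rV[R]_k.+1 -> R) (x : 'rV[R]_k.+1) :
    R :=
  'D_(delta_mx 0 j) phi x.

Definition poly_growth k (phi : 'rV[R]_k.+1 -> R) : Prop :=
  exists C m, forall x, `|phi x| <= C * (1 + `|x|) ^+ m.

Fixpoint diff_poly_growth (n k : nat) (phi : 'rV[R]_k.+1 -> R) : Prop :=
  match n with
  | 0 => poly_growth phi
  | m.+1 => [/\ poly_growth phi, forall x, differentiable phi x &
                forall j, diff_poly_growth m (partial j phi)]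
  end.

(* The class C^oo_p: infinitely differentiable, all partial derivatives having
   at most polynomial growth. *)
Definition smooth_poly_growth k (phi : 'rV[R]_k.+1 -> R) : Prop :=
  forall n, diff_poly_growth n phi.

End smooth.

Section isonormal.
Context {R : realType} (H : completeNormedModType R).
Variable dot : H -> H -> R.
Context d (T : measurableType d) (P : probability T R).
Variable W : H -> {RV P >-> R}.

Definition isonormal_process : Prop :=
  (forall k (h : 'I_k -> H) (c : 'I_k -> R), exists s : R,
     has_centered_gaussian_law P (fun w => \sum_i c i * W (h i) w) s) /\
  (forall g h : H, expectation P (fun w => W g w * W h w) = (dot g h)%:E).

Definition hermite_comb n (s : seq (R * H)) (w : T) : R :=
  \sum_(x <- s) x.1 * (hermite R n).[W x.2 w].

(* [is_multiple_integral n f X]: X is a version of I_n(f). I_n is the linear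
   continuous extension of h^{(x) n} |-> He_n(W(h)), |h| = 1, so that
   E[I_n(f)^2] = n! |f|^2; its graph is described by approximating sequences of
   linear combinations of such powers, whose span is dense in the symmetric
   tensors. *)
Definition is_multiple_integral n (f : ('I_n -> H) -> R) (X : T -> R) : Prop :=
  exists s : nat -> seq (R * H),
    [/\ forall j x, x \in s j -> `|x.2| = 1,
        (fun j => tensor_norm2 dot (fun t => power_tensor dot (s j) t - f t))
          @ \oo --> 0%E &
        cvg_L2 P (fun j => hermite_comb n (s j)) X].

Definition smooth_functional (F : T -> R) (DF : T -> H) : Prop :=
  exists k (h : 'I_k.+1 -> H) (phi : 'rV[R]_k.+1 -> R),
    let Wh w := \row_i W (h i) w in
    [/\ smooth_poly_growth phi,
        forall w, F w = phi (Wh w) &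
        forall w, DF w = \sum_i partial i phi (Wh w) *: h i].

(* [is_malliavin_derivative F G]: F is in D^{1,2} and G is a version of DF, D
   being the closure from L^2(P) to L^2(P; H) of the derivative of smooth
   functionals. *)
Definition is_malliavin_derivative (F : T -> R) (G : T -> H) : Prop :=
  [/\ measurable_fun setT F,
      forall A : set H, open A -> measurable (G @^-1` A) &
      exists (Fk : nat -> T -> R) (DFk : nat -> T -> H),
        [/\ forall k, smooth_functional (Fk k) (DFk k),
            cvg_L2 P Fk F &
            (fun k => expectation P (fun w => `|DFk k w - G w| ^+ 2))
              @ \oo --> 0%E]].

(* Z is a version of <DF, DG>_H. *)
Definition is_derivative_product (F G Z : T -> R) : Prop :=
  exists DF DG : T -> H,
    [/\ is_malliavin_derivative F DF, is_malliavin_derivative G DG &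
        {ae P, forall w, Z w = dot (DF w) (DG w)}].

End isonormal.

Section coefficients.
Context {R : realType} (a : nat).

(* Multi-indices take integer values so that the negative ones, for which the
   coefficient vanishes by convention, make sense. Components are numbered from
   0, hence the shift: [unit_index s] is e_s for 1 <= s <= a. *)
Definition unit_index (s : nat) : {ffun 'I_a -> int} :=
  [ffun r : 'I_a => ((r.+1 == s)%N : nat)%:Z].

(* The sum omits s = a, whose term is 0 by convention. *)
Fixpoint coefA (p : nat) (v : R) (l : nat) (m : {ffun 'I_a -> int}) : R[i] :=
  if [exists r, m r < 0] || (l%:Z < \sum_r m r) then 0 else
  match l with
  | 0 => 1
  | l'.+1 =>
      - (v / p%:R)%:C%C * coefA p v l' (m - unit_index 1) +
      'i%C / p%:R *
      \sum_(s < a | (s.+1 < a)%N)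
        (m s + 1)%:~R *
        coefA p v l' (m + unit_index s.+1 - unit_index s.+2)
  end.

Definition limit_cf_term d (T : measurableType d) (P : probability T R)
    (p : nat) (Y : T -> R) (Yr : 'I_a -> T -> R) (u v : R) (l : nat) : R[i] :=
  (u ^+ l / l`!%:R)%:C%C *
  \sum_(m : {ffun 'I_a -> 'I_l.+1} | (\sum_r m r <= l)%N)
    coefA p v l [ffun r => (m r : nat)%:Z] *
    cexpectation P (fun w => (\prod_r Yr r w ^+ m r)%:C%C * expi (v * Y w)).

End coefficients.

(* Main.v *)
(** [W] is replaced by finitely many coordinates: since the Malliavin derivative is closable and
    chaoses are hypercontractive, [X_N], [Y_N] and the iterated brackets [Y_{r,N}] are
    [L^1]-limits of polynomials [x], [y], [Gam x (.. (Gam x y))] in independent standard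
    Gaussian variables, where [Gam F G] stands for [<DF, DG>].  Integration by parts reads
    [p E (x u e^{ivy}) = E (Gam x u e^{ivy}) + i v E (u Gam x y e^{ivy})].  As the fourth
    cumulant of [X_N] tends to [0], all contractions of [x] vanish asymptotically, so that
    [Gam x x] tends to [p sigma^2] and [Gam x] lowers the order of a chaos by [p]; the bracket of
    order [a+1] therefore vanishes.  Hence, by induction on [l], the moments
    [E (H_l(x) prod_r y_r^{m_r} e^{ivy})] converge to limits obeying the recursion dual to that
    of [A_{l,m}].  A limit [(Z, Y)] of the pair along an ultrafilter is realized on a Loeb
    space; expanding [e^{iuZ}] in Hermite polynomials of the Gaussian variable [Z] gives its
    characteristic function, which does not depend on the ultrafilter. *)
Require Import Defs.
From HB Require Import structures.
From mathcomp Require Import all_boot all_order all_algebra.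
From mathcomp Require Import complex.
From mathcomp Require Import all_classical all_reals all_analysis measurable_realfun.
From mathcomp Require Import -(notations) mpoly.
From mathcomp Require Import zify ring lra.
Import Order.TTheory GRing.Theory Num.Theory.
Import numFieldNormedType.Exports.
Local Open Scope classical_set_scope.
Local Open Scope ring_scope.
Set Implicit Arguments.
Unset Strict Implicit.
Unset Printing Implicit Defensive.

(** * Expectations *)

(** Convergence is assumed for [Y] and its brackets, not for them jointly with [X], so the recursion
    must remove [X] completely. Hence the Hermite polynomials of the limiting variance: when
    [x H_l(x)] is integrated by parts, the term [H_l'(x) Gam x x] is asymptotically cancelled by the
    subtraction in [H_{l+1} = x H_l - sigma^2 H_l']; each step lowers [l] until only moments of [Y]
    and its brackets remain. Orthogonality then bounds the square of each phase moment
    [E (H_l(Z) cos (vY + b))] by [sigma^(2l) l!], so the series converges absolutely without any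
    estimate on the growth of the moments of the [Y_r]. Convergence in law bounds no moment. On
    chaoses of bounded order, however, the L^1, L^2 and higher norms are comparable: tightness alone
    bounds every moment, and polynomials that are L^1-close to [X] and [Y] have gradients close to
    theirs. Complex exponentials are carried by [cos (v * y + b)] with a free phase [b]; adding
    [pi / 2] to [b] stands for multiplication by the imaginary unit. *)

Section expect.
Context {R : realType} d (T : measurableType d) (P : probability T R).
Implicit Types (F G : T -> R).

Definition itg F : Prop := P.-integrable setT (EFin \o F).
Definition Ex F : R := (\int[P]_w F w)%R.

Lemma itg_meas F : itg F -> measurable_fun setT F.
Proof. by move=> /measurable_int /measurable_EFinP. Qed.

Lemma itg_le F G : measurable_fun setT F -> (forall w, `|F w| <= G w) ->
  itg G -> itg F.
Proof.
move=> mF FG iG; apply: (le_integrable _ _ _ iG) => //; first exact/measurable_EFinP.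
by move=> w _ /=; rewrite lee_fin (le_trans (FG w))// ler_norm.
Qed.

Lemma itg_cst (c : R) : itg (fun=> c).
Proof. exact: finite_measure_integrable_cst. Qed.

Lemma itg_bounded F (M : R) : measurable_fun setT F ->
  (forall w, `|F w| <= M) -> itg F.
Proof. by move=> mF FM; exact: itg_le mF FM (itg_cst M). Qed.

Lemma itgD F G : itg F -> itg G -> itg (fun w => F w + G w).
Proof.
move=> iF iG; rewrite /itg.
have -> : EFin \o (fun w => F w + G w) = ((EFin \o F) \+ (EFin \o G))%E by [].
exact: integrableD.
Qed.

Lemma itgZ (c : R) F : itg F -> itg (fun w => c * F w).
Proof.
move=> iF; rewrite /itg.
have -> : EFin \o (fun w => c * F w) = (fun w => c%:E * (EFin \o F) w)%E by [].
exact: integrableZl.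
Qed.

Lemma itgN F : itg F -> itg (fun w => - F w).
Proof. by move=> /(itgZ (-1)); under eq_fun do rewrite mulN1r. Qed.

Lemma itgB F G : itg F -> itg G -> itg (fun w => F w - G w).
Proof. by move=> iF /itgN; exact: itgD. Qed.

Lemma itg_sum I (s : seq I) (F : I -> T -> R) : (forall i, itg (F i)) ->
  itg (fun w => \sum_(i <- s) F i w).
Proof.
move=> iF; elim: s => [|i s IHs].
  by under eq_fun do rewrite big_nil; exact: itg_cst.
by under eq_fun do rewrite big_cons; exact: itgD.
Qed.

Lemma itg_abs F : itg F -> itg (fun w => `|F w|).
Proof.
by move=> iF; apply: (itg_le _ _ (integrable_norm iF)) => [|w];
  [apply: measurableT_comp => //; exact: itg_meas|rewrite normr_id].
Qed.

Lemma eq_Ex F G : F =1 G -> Ex F = Ex G.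
Proof. by move=> FG; congr (Rintegral _ _ _); apply/funext. Qed.

Lemma Ex_cst (c : R) : Ex (fun=> c) = c.
Proof. by rewrite /Ex Rintegral_cst//= probability_setT mulr1. Qed.

Lemma ExZ (c : R) F : itg F -> Ex (fun w => c * F w) = c * Ex F.
Proof. exact: RintegralZl. Qed.

Lemma ExD F G : itg F -> itg G -> Ex (fun w => F w + G w) = Ex F + Ex G.
Proof. exact: RintegralD. Qed.

Lemma ExB F G : itg F -> itg G -> Ex (fun w => F w - G w) = Ex F - Ex G.
Proof. exact: RintegralB. Qed.

Lemma ExN F : itg F -> Ex (fun w => - F w) = - Ex F.
Proof.
by move=> iF; rewrite -mulN1r -ExZ//; apply: eq_Ex => w; rewrite mulN1r.
Qed.

Lemma Ex_sum I (s : seq I) (F : I -> T -> R) : (forall i, itg (F i)) ->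
  Ex (fun w => \sum_(i <- s) F i w) = \sum_(i <- s) Ex (F i).
Proof.
move=> iF; elim: s => [|i s IHs].
  by rewrite big_nil -[RHS](Ex_cst 0); apply: eq_Ex => w; rewrite big_nil.
rewrite big_cons -IHs -ExD//; last exact: itg_sum.
by apply: eq_Ex => w; rewrite big_cons.
Qed.

Lemma Ex_ge0 F : (forall w, 0 <= F w) -> 0 <= Ex F.
Proof. by move=> F0; apply: Rintegral_ge0. Qed.

Lemma le_Ex F G : itg F -> itg G -> (forall w, F w <= G w) -> Ex F <= Ex G.
Proof. by move=> iF iG FG; apply: le_Rintegral => // w _. Qed.

Lemma le_abs_Ex F G : measurable_fun setT F -> itg G ->
  (forall w, `|F w| <= G w) -> `|Ex F| <= Ex G.
Proof.
move=> mF iG FG; have iF := itg_le mF FG iG.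
apply: (le_trans (le_normr_Rintegral _ iF)) => //.
by apply: le_Ex => //; exact: itg_abs.
Qed.

Lemma abs_Ex F : itg F -> `|Ex F| <= Ex (fun w => `|F w|).
Proof. by move=> iF; apply: le_abs_Ex (itg_meas iF) (itg_abs iF) _. Qed.

Lemma expectationE F : itg F -> expectation P F = (Ex F)%:E.
Proof.
move=> iF; rewrite unlock /Ex /Rintegral fineK//.
exact: integrable_fin_num.
Qed.

Lemma fine_expectation F : fine (expectation P F) = Ex F.
Proof. by rewrite unlock. Qed.

Lemma ae_eq_Ex F G : measurable_fun setT F -> measurable_fun setT G ->
  {ae P, forall w, F w = G w} -> Ex F = Ex G.
Proof.
move=> mF mG FG; congr fine; apply: ae_eq_integral => //.
- exact/measurable_EFinP.
- exact/measurable_EFinP.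
- by apply: filterS FG => w /= -> _.
Qed.

Lemma ae_itg F G : measurable_fun setT F -> measurable_fun setT G ->
  {ae P, forall w, F w = G w} -> itg F -> itg G.
Proof.
move=> mF mG FG iF; apply/integrableP; split; first exact/measurable_EFinP.
case/integrableP: iF => _; congr (_ < _)%E; apply: ae_eq_integral => //.
- by apply: measurableT_comp => //; exact/measurable_EFinP.
- by apply: measurableT_comp => //; exact/measurable_EFinP.
- by apply: filterS FG => w /= -> _.
Qed.

Lemma measX F n : measurable_fun setT F -> measurable_fun setT (fun w => F w ^+ n).
Proof.
move=> mF; elim: n => [|n IH].
  by under eq_fun do rewrite expr0; exact: measurable_cst.
by under eq_fun do rewrite exprS; exact: measurable_funM.
Qed.

Lemma meas_abs F : measurable_fun setT F -> measurable_fun setT (fun w => `|F w|).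
Proof. by move=> mF; exact: measurableT_comp. Qed.

Lemma Ex_le_L2 F G : measurable_fun setT F -> measurable_fun setT G ->
  itg (fun w => F w ^+ 2) -> itg (fun w => G w ^+ 2) ->
  itg (fun w => F w * G w).
Proof.
move=> mF mG iF iG; apply: itg_le (itgD iF iG); first exact: measurable_funM.
move=> w /=; rewrite normrM -(real_normK (num_real (F w))).
rewrite -(real_normK (num_real (G w))).
have := sqr_ge0 (`|F w| - `|G w|); have := normr_ge0 (F w).
by have := normr_ge0 (G w); nra.
Qed.

Lemma Ex_CS F G : measurable_fun setT F -> measurable_fun setT G ->
  itg (fun w => F w ^+ 2) -> itg (fun w => G w ^+ 2) ->
  (Ex (fun w => F w * G w)) ^+ 2 <=
  Ex (fun w => F w ^+ 2) * Ex (fun w => G w ^+ 2).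
Proof.
move=> mF mG iF iG; have iFG := Ex_le_L2 mF mG iF iG.
set a := Ex (fun w => F w ^+ 2); set b := Ex (fun w => F w * G w).
set c := Ex (fun w => G w ^+ 2).
have q x y : 0 <= x ^+ 2 * a + 2 * x * y * b + y ^+ 2 * c.
  rewrite /a /b /c -!ExZ// -!ExD; try exact: itgZ; last first.
    by apply: itgD; exact: itgZ.
  apply: Ex_ge0 => w; apply: le_trans (sqr_ge0 (x * F w + y * G w)) _.
  by rewrite le_eqVlt; apply/orP; left; apply/eqP; ring.
have a0 : 0 <= a by apply: Ex_ge0 => w; exact: sqr_ge0.
have c0 : 0 <= c by apply: Ex_ge0 => w; exact: sqr_ge0.
have [c00|] := eqVneq c 0.
  have [->|b0] := eqVneq b 0; first by rewrite c00 mulr0 expr0n.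
  (* For [c = 0] the form is affine in [y]; at this point it equals [-1], a contradiction. For
     [c > 0] the point [(c, - b)] below gives [c * (a * c - b ^+ 2)]. *)
  have := q 1 (- (a + 1) / (2 * b)); rewrite c00 mulr0 addr0 expr1n mul1r mulr1.
  have -> : 2 * (- (a + 1) / (2 * b)) * b = - (a + 1) by field.
  by lra.
rewrite neq_lt ltNge c0/= => cp.
have := q c (- b).
have -> : c ^+ 2 * a + 2 * c * - b * b + (- b) ^+ 2 * c = c * (a * c - b ^+ 2).
  by ring.
by rewrite pmulr_rge0// subr_ge0.
Qed.

Lemma dct_Ex (f_ : nat -> T -> R) F G : (forall n, measurable_fun setT (f_ n)) ->
  (forall w, f_ ^~ w @ \oo --> F w) -> (forall n w, `|f_ n w| <= G w) ->
  itg G -> itg F /\ (fun n => Ex (f_ n)) @ \oo --> Ex F.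
Proof.
move=> mf cvf fG iG; have mF := measurable_fun_cvg mf (fun w _ => cvf w).
have /(_ (fun n => EFin \o f_ n) (EFin \o F) (EFin \o G))[] :=
  @dominated_convergence _ _ _ P setT measurableT.
- by move=> n; exact/measurable_EFinP.
- exact/measurable_EFinP.
- apply: aeW => w _; change ((fun n => (f_ n w)%:E) @ \oo --> (F w)%:E).
  by apply/fine_cvgP; split; [exact: nearW|exact: cvf].
- exact: iG.
- by apply: aeW => w n _ /=; rewrite lee_fin.
move=> iF _ cv; split=> //; rewrite /Ex /Rintegral.
have fF : (\int[P]_w (F w)%:E)%E \is a fin_num by exact: integrable_fin_num.
by apply: fine_cvg; rewrite fineK.
Qed.

(** Monotone convergence along the truncations. Limits in law come with bounds on truncated
    expectations only, and this is where their integrability comes from. *)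
Lemma itg_trunc F (C : R) : measurable_fun setT F -> (forall w, 0 <= F w) ->
  (forall M : nat, Ex (fun w => Num.min (F w) M%:R) <= C) ->
  itg F /\ Ex F <= C.
Proof.
move=> mF F0 FC.
pose f n w := (Num.min (F w) n%:R)%:E.
have f0 n w : (0 <= f n w)%E by rewrite lee_fin le_min F0/=.
have mf n : measurable_fun setT (f n).
  by apply/measurable_EFinP; exact: measurable_minr.
have cvf w : f ^~ w @ \oo --> (F w)%:E.
  apply: cvg_near_cst; near=> n; rewrite /f; congr EFin; apply/min_idPl.
  near: n; exists (Num.truncn (F w)).+1 => // n /=.
  move=> hn; apply: ltW; apply: lt_le_trans (_ : (Num.truncn (F w)).+1%:R <= _).
    exact: truncnS_gt.
  by rewrite ler_nat.
have iE : (\int[P]_w (F w)%:E <= C%:E)%E.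
  have -> : (\int[P]_w (F w)%:E = \int[P]_w limn (f ^~ w))%E.
    by apply: eq_integral => w _; apply/esym/cvg_lim.
  have cv := @cvg_monotone_convergence _ _ _ P _ measurableT f mf
    (fun n w _ => f0 n w) _.
  have {}cv : (fun n => \int[P]_w f n w)%E @ \oo --> (\int[P]_w limn (f ^~ w))%E.
    apply: cv => w _ m n mn; rewrite lee_fin le_min ge_min lexx/=.
    by rewrite ge_min ler_nat mn orbT.
  rewrite -(cvg_lim _ cv)//; apply: lime_le; first by apply/cvg_ex; eexists; exact: cv.
  apply: nearW => n; have := FC n; rewrite -lee_fin; apply: le_trans.
  rewrite /Ex /Rintegral fineK//; apply: integrable_fin_num => //.
  apply: (@itg_bounded _ n%:R); first exact: measurable_minr.
  move=> w; rewrite ger0_norm ?ge_min ?lexx ?orbT//.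
  by rewrite le_min F0/=.
have iF : itg F.
  apply/integrableP; split; first exact/measurable_EFinP.
  under eq_integral do rewrite /= ger0_norm//.
  by apply: le_lt_trans iE _; rewrite ltry.
by split=> //; rewrite -lee_fin -expectationE// unlock.
Unshelve. all: end_near. Qed.

(** Finite absolute moments of every order. The class is closed under sums and products, so that
    integrability of polynomial expressions needs no bookkeeping of exponents. *)
Definition am F : Prop :=
  measurable_fun setT F /\ forall n, itg (fun w => `|F w| ^+ n).

Lemma am_meas F : am F -> measurable_fun setT F.
Proof. by case. Qed.

Lemma am_itg F : am F -> itg F.
Proof.
by move=> [mF /(_ 1%N)]; under eq_fun do rewrite expr1; exact: itg_le.
Qed.

Lemma am_le F G : measurable_fun setT F -> (forall w, `|F w| <= `|G w|) ->
  am G -> am F.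
Proof.
move=> mF FG [mG iG]; split=> // n.
apply: itg_le (iG n) => [|w]; first exact/measX/meas_abs.
by rewrite normrX normr_id lerXn2r// ?nnegrE.
Qed.

Lemma am_cst (c : R) : am (fun=> c).
Proof. by split=> [|n]; [exact: measurable_cst|exact: itg_cst]. Qed.

Lemma am_bounded F (M : R) : measurable_fun setT F ->
  (forall w, `|F w| <= M) -> am F.
Proof.
move=> mF FM; apply: am_le mF _ (am_cst M) => w.
by apply: le_trans (FM w) _; exact: ler_norm.
Qed.

Lemma amM F G : am F -> am G -> am (fun w => F w * G w).
Proof.
move=> [mF iF] [mG iG]; split=> [|n]; first exact: measurable_funM.
apply: itg_le (itgD (iF (2 * n)%N) (iG (2 * n)%N)).
  by apply/measX/meas_abs; exact: measurable_funM.
move=> w; rewrite normrX normr_id normrM exprMn.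
rewrite ![in leRHS]exprM -!(exprAC _ n).
set a := `|F w| ^+ n; set b := `|G w| ^+ n.
have a0 : 0 <= a by exact: exprn_ge0.
have b0 : 0 <= b by exact: exprn_ge0.
by have := sqr_ge0 (a - b); nra.
Qed.

Lemma amD F G : am F -> am G -> am (fun w => F w + G w).
Proof.
move=> [mF iF] [mG iG]; split=> [|n]; first exact: measurable_funD.
apply: itg_le (itgD (itgZ (2 ^+ n) (iF n)) (itgZ (2 ^+ n) (iG n))).
  by apply/measX/meas_abs; exact: measurable_funD.
move=> w; rewrite normrX normr_id -!exprMn.
have : `|F w + G w| <= 2 * Num.max `|F w| `|G w|.
  apply: le_trans (ler_normD _ _) _; rewrite mulr_natl mulr2n lerD//.
    by rewrite le_max lexx.
  by rewrite le_max lexx orbT.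
move=> h; apply: le_trans (_ : (2 * Num.max `|F w| `|G w|) ^+ n <= _).
  by rewrite lerXn2r// nnegrE mulr_ge0// le_max normr_ge0.
have [_|_] := leP `|F w| `|G w|.
  by rewrite lerDr exprn_ge0// mulr_ge0.
by rewrite lerDl exprn_ge0// mulr_ge0.
Qed.

Lemma amZ (c : R) F : am F -> am (fun w => c * F w).
Proof. by move=> iF; apply: amM => //; exact: am_cst. Qed.

Lemma amN F : am F -> am (fun w => - F w).
Proof. by move=> /(amZ (-1)); under eq_fun do rewrite mulN1r. Qed.

Lemma amB F G : am F -> am G -> am (fun w => F w - G w).
Proof. by move=> iF /amN; exact: amD. Qed.

Lemma amX F n : am F -> am (fun w => F w ^+ n).
Proof.
move=> aF; elim: n => [|n IH].
  by under eq_fun do rewrite expr0; exact: am_cst.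
by under eq_fun do rewrite exprS; exact: amM.
Qed.

Lemma am_abs F : am F -> am (fun w => `|F w|).
Proof.
move=> aF; apply: (am_le _ _ aF) => [|w]; last by rewrite normr_id.
exact/meas_abs/am_meas.
Qed.

Lemma am_sum I (s : seq I) (F : I -> T -> R) : (forall i, am (F i)) ->
  am (fun w => \sum_(i <- s) F i w).
Proof.
move=> iF; elim: s => [|i s IHs].
  by under eq_fun do rewrite big_nil; exact: am_cst.
by under eq_fun do rewrite big_cons; exact: amD.
Qed.

Lemma am_prod I (s : seq I) (F : I -> T -> R) : (forall i, am (F i)) ->
  am (fun w => \prod_(i <- s) F i w).
Proof.
move=> iF; elim: s => [|i s IHs].
  by under eq_fun do rewrite big_nil; exact: am_cst.
by under eq_fun do rewrite big_cons; exact: amM.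
Qed.

(* Each preimage of an open set is a countable union of preimages of balls with
   rational centre. *)
Lemma meas_continuous_row n (xi : T -> 'rV[R]_n) (g : 'rV[R]_n -> R) :
  (forall i, measurable_fun setT (fun w => xi w 0 i)) -> continuous g ->
  measurable_fun setT (g \o xi).
Proof.
move=> mxi cg.
apply: (measurability _ (RGenOInfty.measurableE R)) => _ [_ [a ->] <-].
rewrite setTI; set O := g @^-1` `]a, +oo[%classic.
have oO : open O by apply: open_comp => // x _; exact: cg.
rewrite -[X in measurable X]/(xi @^-1` O).
pose c (q : 'rV[rat]_n) : 'rV[R]_n := map_mx ratr q.
have -> : xi @^-1` O = \bigcup_(q in [set: 'rV[rat]_n])
    \bigcup_(m in [set m | ball (c q) (m.+1%:R^-1 : R) `<=` O])
      \bigcap_(i in [set: 'I_n]) [set w | `|c q 0 i - xi w 0 i| < m.+1%:R^-1].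
  apply/seteqP; split=> w /=; last first.
    move=> [q _ [m /= sO bw]]; apply: sO; split; first by rewrite invr_gt0.
    by move=> i j; rewrite (ord1 i); exact: bw.
  move=> Ow; have : nbhs (xi w) O by exact: open_nbhs_nbhs.
  move=> /nbhs_ballP[e /= e0 sO].
  have [m me] : exists m : nat, m.+1%:R^-1 < e / 2.
    exists (Num.truncn (e / 2)^-1); rewrite invf_plt ?posrE ?divr_gt0//.
    exact: truncnS_gt.
  pose m' := (m.+1%:R^-1 : R).
  have m0 : 0 < m' by rewrite invr_gt0.
  have hq i : exists q : rat, `|ratr q - xi w 0 i| < m'.
    have [q] := @rat_in_itvoo R (xi w 0 i - m') (xi w 0 i + m') ltac:(lra).
    by rewrite in_itv/= => /andP[h1 h2]; exists q; rewrite ltr_norml; lra.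
  exists (\row_i sval (cid (hq i))) => //; exists m.
    move=> y /= yb; apply: sO; split => // i j; rewrite (ord1 i) /ball/=.
    have := yb.2 0 j; rewrite /ball/= !mxE; have := svalP (cid (hq j)).
    set q := ratr _; rewrite -/m' => h1 h2; rewrite -/m' in me.
    have -> : xi w 0 j - y 0 j = - (q - xi w 0 j) + (q - y 0 j) by ring.
    by apply: le_lt_trans (ler_normD _ _) _; rewrite normrN; lra.
  by move=> i _ /=; rewrite !mxE; exact: svalP (cid (hq i)).
apply: countable_bigcupT_measurable => [|q]; first exact/countableP.
apply: bigcup_measurable => m _; apply: fin_bigcap_measurable => // i _.
rewrite -[X in measurable X]setTI.
have -> : [set w | `|c q 0 i - xi w 0 i| < m.+1%:R^-1] =
    (fun w => `|c q 0 i - xi w 0 i|) @^-1` [set` `]-oo, (m.+1%:R^-1 : R)[].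
  by apply/seteqP; split=> w /=; rewrite in_itv.
by apply: meas_abs => //; apply: measurable_funB => //; exact: measurable_cst.
Qed.

End expect.

(** * Derivatives on the line and truncation to segments *)

Section derive_fun.
Context {R : realType}.
Implicit Types f g : R -> R.

Lemma is_deriveMf f g (x df dg : R) : is_derive x 1 f df -> is_derive x 1 g dg ->
  is_derive x 1 (fun y => f y * g y) (f x * dg + df * g x).
Proof.
move=> h1 h2; have -> : (fun y => f y * g y) = f * g by [].
by apply: is_derive_eq; rewrite /GRing.scale/= mulrC [dg * _]mulrC addrC [g x * _]mulrC
  addrC [f x * _]mulrC.
Qed.

Lemma is_deriveZf f (c x df : R) : is_derive x 1 f df ->
  is_derive x 1 (fun y => c * f y) (c * df).
Proof.
move=> h1; have -> : (fun y => c * f y) = c \*: f by [].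
exact: is_deriveZ.
Qed.

Lemma is_derive_compf f g (x df dg : R) : is_derive (g x) 1 f df ->
  is_derive x 1 g dg -> is_derive x 1 (fun y => f (g y)) (df * dg).
Proof. by move=> h1 h2; exact: is_derive1_comp. Qed.

Lemma is_derive_Xn (n : nat) (x : R) :
  is_derive x 1 (fun y : R => y ^+ n) (n%:R * x ^+ n.-1).
Proof.
elim: n => [|n IH].
  under eq_fun do rewrite expr0; rewrite mul0r; exact: is_derive_cst.
under eq_fun do rewrite exprS.
move/is_derive_eq: (is_deriveMf (is_derive_id x 1) IH); apply.
by case: n {IH} => [|n]; rewrite /= ?mul0r ?mulr0 ?expr0 ?mul1r ?add0r// exprS -[n.+2%:R]natr1; ring.
Qed.

Lemma is_derive_cont f f' : (forall x : R, is_derive x 1 f (f' x)) -> continuous f.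
Proof.
by move=> df x; apply/differentiable_continuous/derivable1_diffP; case: (df x).
Qed.

(** Window onto a segment: the fundamental theorem of calculus applies there, and dominated
    convergence removes the window afterwards. *)
Definition win (n : nat) : R -> R := \1_(`[- (n.+1%:R : R), (n.+1%:R : R)]%classic).

Lemma win_bound n x : 0 <= win n x <= 1.
Proof. by rewrite /win indicE; case: (_ \in _); rewrite /= ?lexx ler01. Qed.

Lemma win_cvg (x : R) : (fun n : nat => win n x) @ \oo --> (1 : R).
Proof.
apply: cvg_near_cst; exists (Num.truncn `|x|) => // n /= hn.
rewrite /win indicE mem_set//= in_itv/= -ler_norml ltW//.
by apply: lt_le_trans (truncnS_gt _) _; rewrite ler_nat ltnS.
Qed.

Lemma win_absM n x (y : R) : `|y * win n x| <= `|y|.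
Proof.
have /andP[i0 i1] := win_bound n x; rewrite normrM (ger0_norm i0).
by rewrite ler_piMr.
Qed.

End derive_fun.

(** * Stein's identity and moments of the normal law *)

Section normal_law.
Context {R : realType} (s : R) (s0 : s != 0).
Local Notation mu := (@lebesgue_measure R).
Local Notation pdf := (normal_pdf 0 s).
Local Notation N := (normal_prob 0 s).

Lemma continuous_R_meas (h : R -> R) : continuous h ->
  measurable_fun [set: measurableTypeR R] h.
Proof. exact: continuous_measurable_fun. Qed.

(** On a segment [h] is bounded, hence integrable for the normal law, and the Radon-Nikodym
    derivative agrees almost everywhere with the density because both have the same integrals over
    measurable sets. *)
Lemma normal_itvE (h : R -> R) (a b : R) : continuous h ->
  (\int[N]_(x in `[a, b]) (h x)%:E =
   \int[mu]_(x in `[a, b]) (h x * pdf x)%:E)%E.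
Proof.
move=> ch; have mh := continuous_R_meas ch.
have ih : (N).-integrable `[a, b] (EFin \o h).
  have cab : {within `[a, b], continuous h} by exact: continuous_subspaceT.
  apply: measurable_bounded_integrable => //.
  - by apply: le_lt_trans (probability_le1 _ _) _ => //; rewrite ltry.
  - exact: measurable_funTS.
  - have /= := continuous_compact cab (@segment_compact _ a b).
    by move=> /compact_bounded [M [Mr HM]]; exists M; split=> // x Mx y yab;
      apply: HM Mx _ _; exists y.
rewrite -(Radon_Nikodym_change_of_variables (@normal_prob_dominates R 0 s))//=.
under [RHS]eq_integral do rewrite EFinM.
apply: ae_eq_integral => //.
- apply: emeasurable_funM => //.
    by apply/measurable_EFinP; exact: measurable_funTS.
  apply: (measurable_int mu); apply: (integrableS _ _ (@subsetT _ _)) => //=.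
  by apply: Radon_Nikodym_integrable; exact: normal_prob_dominates.
- apply: emeasurable_funM => //=.
    by apply/measurable_EFinP; exact: measurable_funTS.
  by apply/measurable_EFinP/measurable_funTS; exact: measurable_normal_pdf.
apply: ae_eqe_mul2l => /=.
rewrite Radon_NikodymE//=; first exact: normal_prob_dominates.
move=> Nmu; case: cid => /= k [k1 k2 k3].
apply: integral_ae_eq => //=.
- exact: integrableS k2.
- by apply/measurable_EFinP/measurable_funTS; exact: measurable_normal_pdf.
- by move=> E EU mE; rewrite -k3//=.
Qed.

Lemma is_derive_normal_pdf (x : R) : is_derive x 1 pdf (- (x / s ^+ 2) * pdf x).
Proof.
have -> : pdf = (fun x => normal_peak s * expR (- (2 * s ^+ 2)^-1 * x ^+ 2)).
  apply/funext => y; rewrite normal_pdfE// /normal_fun; congr (_ * expR _).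
  by rewrite subr0 -mulr_natl; field.
have h2 : is_derive x 1 (fun y : R => y ^+ 2) (2 * x).
  exact: is_derive_Xn.
have := is_deriveZf (normal_peak s)
  (is_derive_compf (is_derive_expR _) (is_deriveZf (- (2 * s ^+ 2)^-1) h2)).
by move/is_derive_eq; apply; field.
Qed.

(** The density satisfies [pdf' = - (x / s ^+ 2) * pdf], so the integrand times the density is the
    derivative of [- s ^+ 2 * f * pdf] and only boundary values remain. *)
Lemma stein_itv (f f' : R -> R) (n : nat) :
  (forall x : R, is_derive x 1 f (f' x)) -> continuous f' ->
  (\int[N]_(x in `[(- n.+1%:R)%R, (n.+1%:R : R)%R]) (x * f x - s ^+ 2 * f' x)%:E)%E =
  (- s ^+ 2 * (f n.+1%:R * pdf n.+1%:R - f (- n.+1%:R) * pdf (- n.+1%:R)))%:E.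
Proof.
move=> df cf'.
have cf := is_derive_cont df.
have cpdf := @continuous_normal_pdf R 0 s s0.
rewrite normal_itvE; last first.
  move=> x; apply: cvgB; apply: cvgM; try exact: cf; try exact: cf'.
    exact: cvg_id.
  exact: cvg_cst.
pose F (x : R) := - s ^+ 2 * (f x * pdf x).
have dF (x : R) : is_derive x 1 F ((x * f x - s ^+ 2 * f' x) * pdf x).
  have h1 := df x; have h2 := is_derive_normal_pdf x.
  have := is_deriveZf (- s ^+ 2) (is_deriveMf h1 h2).
  by move/is_derive_eq; apply; field.
have cF := is_derive_cont dF.
rewrite (@continuous_FTC2 _ _ F).
- by rewrite /F -EFinB; congr EFin; ring.
- by rewrite (@lt_trans _ _ 0)// oppr_lt0.
- apply: continuous_subspaceT => x; apply: cvgM; last exact: cpdf.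
  apply: cvgB; apply: cvgM; try exact: cf; try exact: cf'.
    exact: cvg_id.
  exact: cvg_cst.
- split.
  + by move=> x _; case: (dF x).
  + by apply: cvg_at_right_filter; exact: cF.
  + by apply: cvg_at_left_filter; exact: cF.
- by move=> x _; rewrite derive1E; apply: derive_val.
Qed.

Definition pgrow (f : R -> R) := exists C m, forall x, `|f x| <= C * (1 + `|x|) ^+ m.

Lemma pgrow_pdf (f : R -> R) : pgrow f ->
  (fun n : nat => f n.+1%:R * pdf n.+1%:R - f (- n.+1%:R) * pdf (- n.+1%:R)) @ \oo --> (0 : R).
Proof.
move=> [C [m Cm]].
have C0 : 0 <= C.
  by have := Cm 0; rewrite normr0 addr0 expr1n mulr1; apply: le_trans.
(* By the bound of [expR t] below by [t ^+ m.+1] over the factorial, at [t = y ^+ 2 / (2 * s ^+ 2)],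
   the density is at most a constant times [y ^- (2 * m.+1)]. Against [C * (2 * y) ^+ m], which
   dominates [f] for [y >= 1], each boundary value is at most [D / 2 / y]. *)
pose D := 2 * C * 2 ^+ m * normal_peak s * (m.+1`!%:R * (2 * s ^+ 2) ^+ m.+1).
have pk0 := normal_peak_ge0 s.
have D0 : 0 <= D.
  by rewrite /D !mulr_ge0// ?exprn_ge0// mulr_ge0// sqr_ge0.
suff h n : `|f n.+1%:R * pdf n.+1%:R - f (- n.+1%:R) * pdf (- n.+1%:R)|
    <= D * n.+1%:R^-1.
  have cv : (fun n : nat => D * n.+1%:R^-1) @ \oo --> (0 : R).
    rewrite -(mulr0 D); apply: cvgM; first exact: cvg_cst.
    exact: cvg_harmonic.
  apply/norm_cvg0P; apply: (@squeeze_cvgr _ _ _ _ (fun=> 0)) cv.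
    by apply: nearW => n; rewrite normr_ge0 h.
  exact: cvg_cst.
set y : R := n.+1%:R; have y0 : 0 < y by [].
have y1 : 1 <= y by rewrite ler1n.
have pdfE z : `|z| = y -> pdf z <= normal_peak s * (m.+1`!%:R * (2 * s ^+ 2) ^+ m.+1) * y ^- (2 * m.+1).
  move=> zy; rewrite normal_pdfE// -mulrA ler_wpM2l//.
  rewrite /normal_fun subr0 -(real_normK (num_real z)) zy mulNr expRN.
  set t := y ^+ 2 / _.
  have t0 : 0 < t by rewrite divr_gt0 ?exprn_gt0// pmulrn_lgt0// exprn_even_gt0.
  have := expR_ge1Dxn m (ltW t0).
  move=> h; have {}h : t ^+ m.+1 / m.+1`!%:R <= expR t.
    by apply: le_trans h; rewrite lerDr.
  have tm : 0 < t ^+ m.+1 / m.+1`!%:R.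
    by rewrite divr_gt0 ?exprn_gt0// ltr0n fact_gt0.
  rewrite -lef_pV2 ?posrE ?expR_gt0// in h; apply: le_trans h _.
  rewrite le_eqVlt; apply/orP; left; apply/eqP.
  rewrite /t invf_div expr_div_n -exprM -[s ^+ 2 *+ 2]mulr_natl.
  by rewrite invf_div mulrA.
have bd z : `|z| = y -> `|f z * pdf z| <= D / 2 * y^-1.
  move=> zy; rewrite normrM (ger0_norm (normal_pdf_ge0 _ _ _)).
  apply: le_trans (ler_pM _ _ (Cm z) (pdfE z zy)) _ => //.
    exact: normal_pdf_ge0.
  rewrite zy; have : (1 + y) ^+ m <= (2 * y) ^+ m.
    by rewrite lerXn2r ?nnegrE; lra.
  move=> /(ler_wpM2l C0)/le_trans; set K := normal_peak s * _.
  have K0 : 0 <= K by rewrite !mulr_ge0// exprn_ge0// mulr_ge0// sqr_ge0.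
  have yi : 0 <= y ^- (2 * m.+1) by rewrite invr_ge0 exprn_ge0// ltW.
  move=> h; apply: le_trans (ler_wpM2r _ (h _ (lexx _))) _.
    by rewrite mulr_ge0.
  have -> : D = 2 * C * 2 ^+ m * K by rewrite /D /K; ring.
  rewrite exprMn.
  have -> : C * (2 ^+ m * y ^+ m) * (K * y ^- (2 * m.+1)) =
     (C * 2 ^+ m * K) * (y ^+ m * y ^- (2 * m.+1)) by ring.
  have -> : 2 * C * 2 ^+ m * K / 2 / y = (C * 2 ^+ m * K) / y by field; lra.
  apply: ler_wpM2l; first by rewrite (mulr_ge0 _ K0)// mulr_ge0// exprn_ge0.
  rewrite ler_pdivrMr ?exprn_gt0// mulrC ler_pdivlMr// -exprSr.
  by apply: ler_weXn2l => //; rewrite mul2n -addnn leq_addr.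
apply: le_trans (ler_normB _ _) _.
have := bd y (gtr0_norm y0); have := bd (- y); rewrite normrN => /(_ (gtr0_norm y0)).
have -> : D / y = D / 2 / y + D / 2 / y by field; lra.
by move=> h1 h2; exact: lerD.
Qed.

Lemma Ex_normal_indic (h : R -> R) (n : nat) :
  Ex N (fun x => h x * win n x) =
  fine (\int[N]_(x in `[(- n.+1%:R)%R, (n.+1%:R : R)%R]) (h x)%:E)%E.
Proof.
rewrite /Ex /Rintegral; congr fine; rewrite [RHS]integral_mkcond.
apply: eq_integral => x _; rewrite patchE /win indicE.
by case: ifP => _; rewrite ?mulr1// mulr0.
Qed.

Lemma normal_moment (k : nat) : itg N (fun x : R => x ^+ (2 * k)).
Proof.
have mX j : measurable_fun [set: measurableTypeR R] (fun x : R => x ^+ j).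
  by apply: measX; exact: measurable_id.
have mI (n : nat) : measurable_fun [set: measurableTypeR R] (win n : R -> R).
  exact: measurable_indic.
have iI j n : itg N (fun x => x ^+ j * win n x).
  apply: (@itg_bounded _ _ _ _ _ (n.+1%:R ^+ j)) => [|x].
    exact: measurable_funM.
  rewrite /win indicE; case: (boolP (_ \in _)); last by rewrite mulr0 normr0 exprn_ge0.
  rewrite inE/= in_itv/= -ler_norml => h.
  by rewrite mulr1 normrX lerXn2r// nnegrE.
suff [C HC] : exists C, forall n : nat,
    Ex N (fun x => x ^+ (2 * k) * win n x) <= C.
  apply: (proj1 (@itg_trunc _ _ _ _ _ C _ _ _)) => //.
    by move=> w; rewrite exprM; exact/exprn_ge0/sqr_ge0.
  move=> M; pose f (n : nat) (x : R) := Num.min (x ^+ (2 * k)) M%:R * win n x.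
  have f0 (x : R) : 0 <= Num.min (x ^+ (2 * k)) M%:R.
    by rewrite le_min ler0n exprM exprn_ge0// sqr_ge0.
  have mm : measurable_fun [set: measurableTypeR R] (fun x => Num.min (x ^+ (2 * k)) M%:R).
    by apply: measurable_minr.
  have [||||_ cv] := @dct_Ex _ _ _ N f (fun x => Num.min (x ^+ (2 * k)) M%:R) (fun=> M%:R).
  - by move=> n; apply: measurable_funM.
  - move=> x; rewrite -[X in _ --> X]mulr1; apply: cvgM; first exact: cvg_cst.
    exact: win_cvg.
  - move=> n x; rewrite normrM (ger0_norm (f0 x)).
    have /andP[i0 i1] := win_bound n x; rewrite (ger0_norm i0).
    apply: le_trans (ler_wpM2l (f0 x) i1) _.
    by rewrite mulr1 ge_min lexx orbT.
  - exact: itg_cst.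
  rewrite -(cvg_lim _ cv)//; apply: limr_le; first by apply/cvg_ex; eexists; exact: cv.
  apply: nearW => n; apply: le_trans (HC n).
  have /(itg_le _ _) iM : itg N (fun=> M%:R : R) by exact: itg_cst.
  apply: le_Ex => // [|x].
    apply: iM => [|x]; first exact: measurable_funM.
    rewrite normrM (ger0_norm (f0 x)).
    have /andP[i0 i1] := win_bound n x; rewrite (ger0_norm i0).
    apply: le_trans (ler_wpM2l (f0 x) i1) _.
    by rewrite mulr1 ge_min lexx orbT.
  have /andP[i0 _] := win_bound n x.
  by apply: ler_wpM2r => //; rewrite ge_min lexx.
elim: k => [|k [C HC]].
  exists 1 => n; rewrite -[leRHS](Ex_cst N 1); apply: le_Ex => [||x].
  - exact: iI.
  - exact: itg_cst.
  - by have /andP[_] := win_bound n x; rewrite muln0 expr0 mul1r.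
exists (s ^+ 2 * (2 * k).+1%:R * C) => n.
have dX (x : R) : is_derive x 1 (fun x : R => x ^+ (2 * k).+1) ((2 * k).+1%:R * x ^+ (2 * k)).
  exact: is_derive_Xn.
have := stein_itv n dX; set c := n.+1%:R : R.
have ck : continuous (fun x : R => (2 * k).+1%:R * x ^+ (2 * k)).
  by move=> x; apply: cvgM; [exact: cvg_cst|exact: exprn_continuous].
move=> /(_ ck) /(congr1 fine) /=.
rewrite -Ex_normal_indic => E.
have {E} : Ex N (fun x => x ^+ (2 * k.+1) * win n x) -
   s ^+ 2 * (2 * k).+1%:R * Ex N (fun x => x ^+ (2 * k) * win n x) =
   - s ^+ 2 * (c ^+ (2 * k).+1 * pdf c - (- c) ^+ (2 * k).+1 * pdf (- c)).
  rewrite -E -ExZ// -ExB//; last exact: itgZ.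
  apply: eq_Ex => x; have -> : (2 * k.+1 = (2 * k).+2)%N by rewrite mulnS.
  by rewrite -/c !exprS; ring.
have -> : (- c) ^+ (2 * k).+1 = - c ^+ (2 * k).+1.
  by rewrite exprNn -signr_odd/= oddM/= expr1 mulN1r.
have h1 := normal_pdf_ge0 0 s c; have h2 := normal_pdf_ge0 0 s (- c).
have h3 : 0 <= c ^+ (2 * k).+1 by rewrite exprn_ge0.
have h4 := sqr_ge0 s.
have h5 : 0 <= s ^+ 2 * (c ^+ (2 * k).+1 * pdf c + c ^+ (2 * k).+1 * pdf (- c)).
  by rewrite mulr_ge0// addr_ge0// mulr_ge0.
have h6 : s ^+ 2 * (2 * k).+1%:R * Ex N (fun x => x ^+ (2 * k) * win n x)
    <= s ^+ 2 * (2 * k).+1%:R * C.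
  by apply: ler_wpM2l; [rewrite mulr_ge0|exact: HC].
by move=> E; lra.
Qed.

Lemma am_normal : am N (fun x : R => x).
Proof.
split=> [|n]; first exact: measurable_id.
apply: itg_le (itgD (itg_cst N 1) (normal_moment n)).
  by apply/measX/meas_abs; exact: measurable_id.
move=> x /=; rewrite normrX normr_id exprM -(real_normK (num_real x)).
set a := `|x|; rewrite -exprM mulnC exprM.
rewrite -[2%N]/(1 + 1)%N; move: (a ^+ n) (sqr_ge0 (a ^+ n - 1)) => b h.
by rewrite expr2; nra.
Qed.

Lemma am_pgrow (f : R -> R) : continuous f -> pgrow f -> am N f.
Proof.
move=> cf [C [m Cm]].
apply: am_le (_ : am N (fun x => C * (1 + `|x|) ^+ m)).
- exact: continuous_R_meas.
- by move=> x; apply: le_trans (Cm x) _; exact: ler_norm.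
- apply: amZ; apply: amX; apply: amD; first exact: am_cst.
  exact/am_abs/am_normal.
Qed.

Lemma stein (f f' : R -> R) :
  (forall x : R, is_derive x 1 f (f' x)) -> continuous f' -> pgrow f -> pgrow f' ->
  Ex N (fun x => x * f x) = s ^+ 2 * Ex N f'.
Proof.
move=> df cf' gf gf'.
have cf := is_derive_cont df.
have af := am_pgrow cf gf; have af' := am_pgrow cf' gf'.
have a1 : am N (fun x => x * f x) by apply: amM => //; exact: am_normal.
have a2 : am N (fun x => s ^+ 2 * f' x) by exact: amZ.
apply/eqP; rewrite -subr_eq0 -ExZ; last exact: am_itg.
rewrite -ExB; try exact: am_itg; apply/eqP.
pose F (x : R) := x * f x - s ^+ 2 * f' x.
have aF : am N F by exact: amB.
have [||||_ cv] := @dct_Ex _ _ _ N (fun n x => F x * win n x) F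
   (fun x => `|F x|).
- by move=> n; apply: measurable_funM; [exact: am_meas aF|exact: measurable_indic].
- move=> x; rewrite -[X in _ --> X]mulr1; apply: cvgM; first exact: cvg_cst.
  exact: win_cvg.
- by move=> n x; exact: win_absM.
- exact/am_itg/am_abs.
apply: (cvg_unique _ cv) => //=.
have -> : (fun n => Ex N (fun x => F x * win n x)) =
  (fun n : nat => - s ^+ 2 * (f n.+1%:R * pdf n.+1%:R - f (- n.+1%:R) * pdf (- n.+1%:R))).
  by apply/funext => n; rewrite Ex_normal_indic /F stein_itv.
rewrite -[X in _ --> X](mulr0 (- s ^+ 2)).
by apply: cvgM; [exact: cvg_cst|exact: pgrow_pdf].
Qed.

End normal_law.

(** * Centred Gaussian variables, degenerate ones included *)

Section gaussian_variable.
Context {R : realType} d (T : measurableType d) (P : probability T R).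
Variables (X : T -> R) (s : R).
Hypothesis mX : measurable_fun setT X.
Hypothesis gX : has_centered_gaussian_law P X s.

Lemma gaussian_transfer (h : R -> R) : s != 0 -> measurable_fun [set: measurableTypeR R] h ->
  itg (normal_prob 0 s) h ->
  itg P (fun w => h (X w)) /\ Ex P (fun w => h (X w)) = Ex (normal_prob 0 s) h.
Proof.
move=> s0 mh ih.
pose X0 : T -> measurableTypeR R := X.
pose X' : {RV P >-> measurableTypeR R} :=
  HB.pack X0 (isMeasurableFun.Build _ _ T (measurableTypeR R) X0 mX).
have eqm (A : set (measurableTypeR R)) : measurable A -> A `<=` setT ->
    normal_prob 0 s A = distribution P X' A.
  by move=> mA _; rewrite /distribution/= /pushforward gX// (negbTE s0).
have iX : itg P (fun w => h (X w)).
  apply/integrableP; split; first exact/measurable_EFinP/(measurableT_comp mh).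
  have mh' : measurable_fun [set: measurableTypeR R] (fun x => `|(h x)%:E|%E).
    by apply: measurableT_comp => //; exact/measurable_EFinP.
  have := ge0_integral_distribution X' mh' (fun x => abse_ge0 _).
  rewrite /comp/= => <-.
  case/integrableP: ih => _; congr (_ < _)%E.
  exact: eq_measure_integral.
split=> //; congr fine.
have mhE : measurable_fun [set: measurableTypeR R] (EFin \o h) by exact/measurable_EFinP.
have := @integral_distribution _ _ _ _ _ P X' (EFin \o h) mhE
  (iX : P.-integrable setT ((EFin \o h) \o X')); rewrite /comp/= => <-.
by apply/esym; exact: eq_measure_integral.
Qed.

Lemma gaussian_degenerate : s = 0 -> {ae P, forall w, X w = 0}.
Proof.
move=> s0; have m0 : measurable (X @^-1` (~` [set 0])).
  by rewrite -[X in measurable X]setTI; apply: mX => //; exact: measurableC.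
exists (X @^-1` (~` [set 0])); split=> //.
have := gX (measurableC (measurable_set1 (0 : R))).
by rewrite s0 eqxx /= => ->; rewrite diracE memNset//= => /(_ erefl).
Qed.

Lemma am_gaussian : am P X.
Proof.
split=> // n.
have [s0|s0] := eqVneq s 0.
  have ae0 : {ae P, forall w, `|0 : R| ^+ n = `|X w| ^+ n}.
    by apply: filterS (gaussian_degenerate s0) => w ->.
  exact: (ae_itg (measurable_cst _) (measX n (meas_abs mX)) ae0 (itg_cst P _)).
have [mi /(_ n) im] := am_normal s0.
apply: (proj1 (@gaussian_transfer (fun x => `|x| ^+ n) s0 _ im)).
by apply/measX/meas_abs; exact: measurable_id.
Qed.

Lemma gaussian_stein (f f' : R -> R) :
  (forall x : R, is_derive x 1 f (f' x)) -> continuous f' -> pgrow f -> pgrow f' ->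
  Ex P (fun w => X w * f (X w)) = s ^+ 2 * Ex P (fun w => f' (X w)).
Proof.
move=> df cf' gf gf'; have cf := is_derive_cont df.
have [s0|s0] := eqVneq s 0.
  rewrite s0 expr0n mul0r -[RHS](Ex_cst P 0); apply: ae_eq_Ex.
  - by apply: measurable_funM => //; apply: measurableT_comp mX; exact: continuous_R_meas.
  - exact: measurable_cst.
  - by apply: filterS (gaussian_degenerate s0) => w ->; rewrite mul0r.
have a1 := am_pgrow s0 cf gf; have a2 := am_pgrow s0 cf' gf'.
have a3 := amM (am_normal s0) a1.
rewrite (gaussian_transfer s0 (am_meas a3) (am_itg a3)).2.
by rewrite (gaussian_transfer s0 (am_meas a2) (am_itg a2)).2; exact: stein.
Qed.

Lemma pgrow_bounded (f : R -> R) (M : R) : (forall x, `|f x| <= M) -> pgrow f.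
Proof. by move=> h; exists M, 0 => x; rewrite expr0 mulr1. Qed.

(* [t |-> E cos (t X + b)] solves the equation [g' = - s^2 t g]. *)
Lemma gaussian_cos (t b : R) :
  Ex P (fun w => cos (t * X w + b)) = cos b * expR (- (s ^+ 2 * t ^+ 2 / 2)).
Proof.
have mcos (u c : R) : measurable_fun setT (fun w => cos (u * X w + c)).
  apply: (@measurableT_comp _ _ _ _ _ _ cos) => //.
    by apply: continuous_R_meas; exact: continuous_cos.
  apply: measurable_funD; last exact: measurable_cst.
  by apply: measurable_funM => //; exact: measurable_cst.
have aX := am_gaussian.
have icos u : itg P (fun w => cos (u * X w + b)).
  by apply: (@itg_bounded _ _ _ _ _ 1) => // w; exact: cos_max.
have dlin (a c x : R) : is_derive x 1 (fun y => a * y + c) a.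
  by apply: is_derive_eq; rewrite /GRing.scale/= mulr1 addr0.
pose g u := Ex P (fun w => cos (u * X w + b)).
have dg (u : R) : is_derive u 1 g (- (s ^+ 2 * u) * g u).
  have h1 (w : T) (x : R) : is_derive x 1 (fun y : R => cos (y * X w + b)) (- sin (x * X w + b) * X w).
    apply: (is_derive_compf (is_derive_cos _)).
    by under eq_fun do rewrite mulrC; exact: dlin.
  have hd x w : partial1of2 (fun x w => cos (x * X w + b)) x w = - sin (x * X w + b) * X w.
    by rewrite partial1of2E; case: (h1 w x).
  have der := @derivable_under_integral R _ T P (fun u w => cos (u * X w + b)) setT
     measurableT u (u - 1) (u + 1).
  have val := @differentiation_under_integral R _ T P (fun u w => cos (u * X w + b)) setT
     measurableT u (u - 1) (u + 1).
  have Iu : `]u - 1, u + 1[%classic u by rewrite /= in_itv/=; apply/andP; split; lra.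
  have i1 x : P.-integrable setT (EFin \o (fun w => cos (x * X w + b))) by exact: icos.
  have i2 : P.-integrable setT (EFin \o (fun w => `|X w|)) by exact/am_itg/am_abs.
  have i3 x w : `|partial1of2 (fun x w => cos (x * X w + b)) x w| <= `|X w|.
    by rewrite hd normrM normrN ler_piMl// sin_max.
  have dv := der Iu (fun x _ => i1 x) (fun x w _ _ => @ex_derive _ _ _ _ _ _ _ (h1 w x))
    (fun w => `|X w|) (fun w => normr_ge0 _) i2 (fun x w _ _ => i3 x w).
  have vl := val Iu (fun x _ => i1 x) (fun x w _ _ => @ex_derive _ _ _ _ _ _ _ (h1 w x))
    (fun w => `|X w|) (fun w => normr_ge0 _) i2 (fun x w _ _ => i3 x w).
  split; first exact: dv.
  rewrite -derive1E [LHS]vl /g.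
  have -> : Rintegral P setT (fun w => partial1of2 (fun x w => cos (x * X w + b)) u w)
     = Ex P (fun w => X w * (- sin (u * X w + b))).
    by apply: eq_Ex => w; rewrite hd mulrC.
  rewrite (_ : Ex P _ = s ^+ 2 * Ex P (fun w => - u * cos (u * X w + b))); last first.
    apply: (@gaussian_stein (fun y => - sin (u * y + b)) (fun y => - u * cos (u * y + b))).
  - move=> x; have := is_deriveZf (-1) (is_derive_compf (is_derive_sin _) (dlin u b x)).
    by under eq_fun do rewrite mulN1r; move/is_derive_eq; apply; ring.
  - move=> x; apply: cvgM; first exact: cvg_cst.
    apply: (continuous_comp (f := fun x => u * x + b) (g := cos)); last exact: continuous_cos.
    exact: (is_derive_cont (dlin u b)).
  - by apply: (@pgrow_bounded _ 1) => x; rewrite normrN sin_max.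
  - apply: (@pgrow_bounded _ `|u|) => x; rewrite normrM normrN ler_piMr//.
    exact: cos_max.
  by rewrite ExZ; [ring|exact: icos].
(* Integrating factor of the equation: [k] has derivative zero. *)
pose k u := g u * expR ((s ^+ 2 / 2) * u ^+ 2).
have dk (u : R) : is_derive u 1 k 0.
  have h := is_derive_compf (is_derive_expR _) (is_deriveZf (s ^+ 2 / 2) (is_derive_Xn 2 u)).
  by move/is_derive_eq: (is_deriveMf (dg u) h); apply; rewrite /=; field.
have kc := is_derive_0_is_cst t 0 dk.
have g0 : k 0 = cos b.
  rewrite /k /g expr0n mulr0 expR0 mulr1 -[RHS](Ex_cst P (cos b)).
  by apply: eq_Ex => w; rewrite mul0r add0r.
have {kc} : g t * expR (s ^+ 2 / 2 * t ^+ 2) = cos b by rewrite -g0 -kc.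
rewrite -/(g t) => <-; rewrite -mulrA -expRD.
have -> : s ^+ 2 / 2 * t ^+ 2 + - (s ^+ 2 * t ^+ 2 / 2) = 0 by field.
by rewrite expR0 mulr1.
Qed.

End gaussian_variable.

(** * Characteristic functions determine the law *)

Section row_vectors.
Context {R : realType}.

Lemma cvg_row n I (F : set_system I) {FF : Filter F} (f : I -> 'rV[R]_n) (l : 'rV[R]_n) :
  (forall i, (fun x => f x 0 i) @ F --> l 0 i) -> f @ F --> l.
Proof.
move=> h; apply/cvg_ballP => e e0.
have : \forall x \near F, forall i, ball (l 0 i) e (f x 0 i).
  by apply: filter_forall => i; move/cvg_ballP: (h i) => /(_ e e0).
by apply: filterS => x hx; split=> // i j; rewrite (ord1 i); exact: hx.
Qed.

Lemma cvgr_sum (J : Type) (s : seq J) (V : Type) (F : set_system V) {FF : Filter F}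
    (f : J -> V -> R) (l : J -> R) : (forall j, f j @ F --> l j) ->
  (fun x => \sum_(j <- s) f j x) @ F --> \sum_(j <- s) l j.
Proof.
move=> h; elim: s => [|j s IH].
  by rewrite big_nil; under eq_fun do rewrite big_nil; exact: cvg_cst.
by rewrite big_cons; under eq_fun do rewrite big_cons; exact: cvgD.
Qed.

Section continuous_fun.
Context (V : topologicalType).
Implicit Types f g : V -> R.

Lemma cont_cst (c : R) : continuous (fun _ : V => c).
Proof. by move=> x; exact: cvg_cst. Qed.

Lemma contD f g : continuous f -> continuous g -> continuous (fun x => f x + g x).
Proof. by move=> cf cg x; apply: cvgD; [exact: cf|exact: cg]. Qed.

Lemma contM f g : continuous f -> continuous g -> continuous (fun x => f x * g x).
Proof. by move=> cf cg x; apply: cvgM; [exact: cf|exact: cg]. Qed.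

Lemma cont_sum (J : Type) (s : seq J) (f : J -> V -> R) : (forall j, continuous (f j)) ->
  continuous (fun x => \sum_(j <- s) f j x).
Proof. by move=> h x; apply: cvgr_sum => j; exact: h. Qed.

Lemma cont_comp (U : topologicalType) (h : V -> U) (k : U -> R) :
  continuous h -> continuous k -> continuous (fun x => k (h x)).
Proof. by move=> ch ck x; apply: (continuous_comp (f := h)); [exact: ch|exact: ck]. Qed.

Lemma cont_row n (h : V -> 'rV[R]_n) : (forall i, continuous (fun x => h x 0 i)) ->
  continuous h.
Proof. by move=> ch x; apply: cvg_row => i; exact: ch. Qed.

Lemma cont_clamp (a b : R) f : continuous f ->
  continuous (fun x => Num.max a (Num.min b (f x))).
Proof.
move=> cf; apply: (@cont_comp _ f (fun y => Num.max a (Num.min b y))) => // y.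
apply: (@continuous_max _ R^o (fun=> a) (fun y : R => Num.min b y)); first exact: cvg_cst.
by apply: (@continuous_min _ R^o (fun=> b) id); [exact: cvg_cst|exact: cvg_id].
Qed.

End continuous_fun.

Lemma coord_cont n (i : 'I_n) : continuous (fun x : 'rV[R]_n => x 0 i).
Proof. exact: coord_continuous. Qed.

(** Exponent of a character. With a free shift [b], the functions [cos (phase t x + b)] carry the
    real and imaginary parts of all characters while test functions stay real. *)
Definition phase n (t x : 'rV[R]_n) : R := \sum_i t 0 i * x 0 i.

Lemma phase_cont n (t : 'rV[R]_n) : continuous (phase t).
Proof. by apply: cont_sum => i; apply: contM; [exact: cont_cst|exact: coord_cont]. Qed.

Lemma cos_phase_cont n (t : 'rV[R]_n) (b : R) : continuous (fun x => cos (phase t x + b)).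
Proof.
apply: (@cont_comp _ _ (fun x => phase t x + b) cos); last exact: continuous_cos.
by apply: contD; [exact: phase_cont|exact: cont_cst].
Qed.

End row_vectors.

(** * Bernstein approximation *)

Section bernstein.
Context {R : realType}.

(* Expectation of [h] under the binomial law with parameters [m] and [y]. *)
Fixpoint bern (m : nat) (h : nat -> R) (y : R) : R :=
  if m is m'.+1 then y * bern m' (h \o S) y + (1 - y) * bern m' h y else h 0%N.

Lemma bern_cst m a y : bern m (fun=> a) y = a.
Proof. by elim: m => //= m IH; rewrite IH; ring. Qed.

Lemma bern_lin m (a b : R) (h : nat -> R) y :
  bern m (fun k => a + b * h k) y = a + b * bern m h y.
Proof.
elim: m h => //= m IH h; have -> : (fun k => a + b * h k) \o S = (fun k => a + b * (h \o S) k) by [].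
by rewrite !IH; ring.
Qed.

Lemma bern_le m (h h' : nat -> R) y : 0 <= y <= 1 -> (forall k, h k <= h' k) ->
  bern m h y <= bern m h' y.
Proof.
move=> /andP[y0 y1]; elim: m h h' => //= m IH h h' hh.
by apply: lerD; apply: ler_wpM2l; rewrite ?subr_ge0//; apply: IH => k /=.
Qed.

(** Squared mean plus variance of an affine image of a binomial variable. The free [a] absorbs the
    shift by [S] in the induction. *)
Lemma bern_sqr m (a b y : R) : bern m (fun k => (a + b * k%:R) ^+ 2) y =
  (a + b * m%:R * y) ^+ 2 + b ^+ 2 * m%:R * y * (1 - y).
Proof.
elim: m a => [|m IH] a /=; first by rewrite !mulr0 !mul0r !addr0.
have -> : (fun k => (a + b * k%:R) ^+ 2) \o S = (fun k => ((a + b) + b * k%:R) ^+ 2).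
  by apply/funext => k /=; congr (_ ^+ 2); rewrite -natr1; ring.
by rewrite !IH -[m.+1%:R]natr1; ring.
Qed.

(* Chebyshev's argument. *)
Lemma bern_approx m (u : R -> R) (a b y x M e del : R) :
  0 <= y <= 1 -> (forall s, `|u s| <= M) -> 0 < del ->
  (forall s, `|s - x| < del -> `|u s - u x| <= e) -> 0 <= e ->
  `|bern m (fun k => u (a + b * k%:R)) y - u x| <=
  e + 2 * M / del ^+ 2 * ((a + b * m%:R * y - x) ^+ 2 + b ^+ 2 * m%:R * y * (1 - y)).
Proof.
move=> y01 uM d0 hu e0.
have d2 : 0 < del ^+ 2 by rewrite exprn_gt0.
have M0 : 0 <= M by exact: le_trans (uM 0).
have key s : `|u s - u x| <= e + 2 * M / del ^+ 2 * (s - x) ^+ 2.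
  have c0 : 0 <= 2 * M / del ^+ 2 * (s - x) ^+ 2.
    by rewrite mulr_ge0 ?sqr_ge0// divr_ge0 ?mulr_ge0// ltW.
  have [/hu h|h] := ltP `|s - x| del; first by lra.
  have : 2 * M <= 2 * M / del ^+ 2 * (s - x) ^+ 2.
    rewrite -mulrA ler_peMr ?mulr_ge0// mulrC ler_pdivlMr// mul1r.
    rewrite -(real_normK (num_real (s - x))).
    by rewrite lerXn2r ?nnegrE// ltW.
  have := ler_normB (u s) (u x); have := uM s; have := uM x.
  by lra.
set V := (X in _ <= e + _ * X); set c := 2 * M / del ^+ 2 in key *.
have E : bern m (fun k => (a + b * k%:R - x) ^+ 2) y = V.
  have -> : (fun k : nat => (a + b * k%:R - x) ^+ 2) = (fun k => ((a - x) + b * k%:R) ^+ 2).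
    by apply/funext => k; congr (_ ^+ 2); ring.
  by rewrite bern_sqr /V; ring.
have hk (k : nat) := key (a + b * k%:R).
have up : bern m (fun k => u (a + b * k%:R)) y <= (u x + e) + c * V.
  rewrite -E -bern_lin; apply: bern_le => // k.
  by have := hk k; rewrite ler_norml; lra.
have lo : (u x - e) + (- c) * V <= bern m (fun k => u (a + b * k%:R)) y.
  rewrite -E -bern_lin; apply: bern_le => // k.
  by have := hk k; rewrite ler_norml; lra.
by rewrite ler_norml; lra.
Qed.

(** A coordinate is recovered from sines of long period; this is the derivative of [sin (x * z)] at
    [z = 0], read along [z = n.+1%:R^-1]. *)
Lemma scaled_sin_cvg (x : R) : (fun n : nat => n.+1%:R * sin (x / n.+1%:R)) @ \oo --> x.
Proof.
have h : is_derive (0 : R) 1 (fun z : R => sin (x * z)) x.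
  have := is_derive_compf (is_derive_sin (x * 0)) (is_deriveZf x (is_derive_id (0 : R) 1)).
  by move/is_derive_eq; apply; rewrite mulr0 cos0; ring.
case: h => hd hv.
have {}hd : (fun h : R => h^-1 *: (sin (x * (h *: 1 + 0)) - sin (x * 0))) @ 0^' --> x.
  by rewrite -{3}hv; exact: hd.
have hn : (fun n : nat => n.+1%:R^-1 : R) @ \oo --> (0 : R)^'.
  move/cvgr_dnbhsP : hd => hd; move: hd => _.
  move=> A /= [e /= e0 eA]; have := @cvg_harmonic R.
  move=> /cvgrPdist_lt/(_ e e0); apply: filterS => n /= hn.
  by apply: eA; [exact: hn|rewrite gt_eqF].
have := cvg_comp _ _ hn hd; apply: cvg_trans; apply: near_eq_cvg; apply: nearW => n /=.
by rewrite invrK addr0 mulr0 sin0 subr0 /GRing.scale/= mulr1.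
Qed.

End bernstein.

Section char_fun_uniqueness.
Context {R : realType} d (T : measurableType d) (P : probability T R).
Context d' (T' : measurableType d') (P' : probability T' R).
Context n (xi : T -> 'rV[R]_n) (eta : T' -> 'rV[R]_n).
Hypothesis mxi : forall i, measurable_fun setT (fun w => xi w 0 i).
Hypothesis meta : forall i, measurable_fun setT (fun w => eta w 0 i).

(** Bounded continuous functions that do not separate the laws of [xi] and [eta]; the aim is to show
    that all of them belong to this class. *)
Let gd (F : 'rV[R]_n -> R) := [/\ continuous F, exists M : R, forall x, `|F x| <= M &
  Ex P (F \o xi) = Ex P' (F \o eta)].

Let gd_itg (F : 'rV[R]_n -> R) : continuous F -> (exists M : R, forall x, `|F x| <= M) ->
  itg P (F \o xi) /\ itg P' (F \o eta).
Proof.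
move=> cF [M FM]; split; apply: (@itg_bounded _ _ _ _ _ M) => [|w]; try exact: FM;
  exact: meas_continuous_row.
Qed.

Let gdD F G : gd F -> gd G -> gd (fun x => F x + G x).
Proof.
move=> [cF bF eF] [cG bG eG]; split.
- exact: contD.
- move: bF bG => [M FM] [M' GM]; exists (M + M') => x.
  by apply: le_trans (ler_normD _ _) _; exact: lerD.
- have [? ?] := gd_itg cF bF; have [? ?] := gd_itg cG bG.
  by rewrite [LHS]ExD// [RHS]ExD// eF eG.
Qed.

Let gdZ (c : R) F : gd F -> gd (fun x => c * F x).
Proof.
move=> [cF bF eF]; split.
- by apply: contM => //; exact: cont_cst.
- move: bF => [M FM]; exists (`|c| * M) => x.
  by rewrite normrM ler_wpM2l.
- have [? ?] := gd_itg cF bF.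
  by rewrite [LHS]ExZ// [RHS]ExZ// eF.
Qed.

Let gd_lim (F_ : nat -> 'rV[R]_n -> R) F (M : R) : (forall k, gd (F_ k)) ->
  continuous F -> (forall x k, `|F_ k x| <= M) ->
  (forall x, F_ ^~ x @ \oo --> F x) -> gd F.
Proof.
move=> gF cF FM cv; have bF x : `|F x| <= M.
  have b k : - M <= F_ k x <= M by rewrite -ler_norml.
  have ic : cvgn (F_ ^~ x) by apply/cvg_ex; eexists; exact: cv.
  rewrite -(cvg_lim _ (cv x))// ler_norml; apply/andP; split.
    by apply: limr_ge => //; apply: nearW => k; case/andP: (b k).
  by apply: limr_le => //; apply: nearW => k; case/andP: (b k).
split=> //; first by exists M.
have [||||_ c1] := @dct_Ex _ _ _ P (fun k => F_ k \o xi) (F \o xi) (fun=> M).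
- by move=> k; case: (gF k) => h _ _; exact: meas_continuous_row.
- by move=> w; exact: cv.
- by move=> k w; exact: FM.
- exact: itg_cst.
have [||||_ c2] := @dct_Ex _ _ _ P' (fun k => F_ k \o eta) (F \o eta) (fun=> M).
- by move=> k; case: (gF k) => h _ _; exact: meas_continuous_row.
- by move=> w; exact: cv.
- by move=> k w; exact: FM.
- exact: itg_cst.
apply: (cvg_unique _ c1) => //; apply: cvg_trans c2; apply: near_eq_cvg.
by apply: nearW => k; case: (gF k).
Qed.

Hypothesis cf : forall t b, Ex P (fun w => cos (phase t (xi w) + b)) =
  Ex P' (fun w => cos (phase t (eta w) + b)).

Let mix (j : nat) (x c : 'rV[R]_n) : 'rV[R]_n :=
  \row_i if (i < j)%N then x 0 i else c 0 i.

Let upd (j : 'I_n) (s : R) (c : 'rV[R]_n) : 'rV[R]_n :=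
  \row_i if i == j then s else c 0 i.

(** Amplitudes that stay in [gd] after multiplication by any trigonometric function. This stronger
    property is preserved by multiplication with a sine, thanks to the product-to-sum formula;
    membership in [gd] alone says nothing about such products. *)
Let ampl (F : 'rV[R]_n -> R) := forall t b, gd (fun x => F x * cos (phase t x + b)).

Let amplD F G : ampl F -> ampl G -> ampl (fun x => F x + G x).
Proof. by move=> h1 h2 t b; under eq_fun do rewrite mulrDl; exact: gdD. Qed.

Let amplZ (c : R) F : ampl F -> ampl (fun x => c * F x).
Proof. by move=> h1 t b; under eq_fun do rewrite -mulrA; exact: gdZ. Qed.

Let ampl_sin (j : 'I_n) (K : R) F : ampl F -> ampl (fun x => sin (x 0 j / K) * F x).
Proof.
move=> h t b; pose e : 'rV[R]_n := \row_i (if i == j then K^-1 else 0).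
have pe x : phase e x = x 0 j / K.
  rewrite /phase (bigD1 j)//= mxE eqxx big1 ?addr0 1?mulrC// => i ij.
  by rewrite mxE (negbTE ij) mul0r.
have pD (t1 t2 x : 'rV[R]_n) : phase (t1 + t2) x = phase t1 x + phase t2 x.
  by rewrite /phase -big_split; apply: eq_bigr => i _; rewrite mxE mulrDl.
have pN (t1 x : 'rV[R]_n) : phase (- t1) x = - phase t1 x.
  by rewrite /phase -sumrN; apply: eq_bigr => i _; rewrite mxE mulNr.
have := gdD (gdZ (1/2) (h (t + e) (b - pi / 2))) (gdZ (-(1/2)) (h (t - e) (b - pi / 2))).
congr gd; apply/funext => x; rewrite !pD pN pe.
have E z : cos (z + (b - pi / 2)) = sin (z + b).
  by rewrite addrA cosB cos_pihalf sin_pihalf mulr0 mulr1 add0r.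
rewrite !E; set p := phase t x; set q := x 0 j / K.
rewrite (_ : p + q + b = (p + b) + q); last by ring.
rewrite (_ : p - q + b = (p + b) - q); last by ring.
by rewrite sinD sinB; field.
Qed.

(** A trigonometric polynomial of one coordinate with values in [[0, 1]], so that it can serve as
    parameter of [bern]. *)
Let y (j : 'I_n) (K : R) (x : 'rV[R]_n) : R := (1 + sin (x 0 j / K)) / 2.

Let ampl_bern (j : 'I_n) (K : R) m (h : nat -> 'rV[R]_n -> R) : (forall k, ampl (h k)) ->
  ampl (fun x => bern m (h^~ x) (y j K x)).
Proof.
elim: m h => [|m IH] h ah /=; first exact: ah.
have h1 := IH (h \o S) (fun k => ah k.+1); have h2 := IH h ah.
have := amplD (amplD (amplZ (1/2) h1) (amplZ (1/2) h2))
  (amplD (amplZ (1/2) (ampl_sin j K h1)) (amplZ (-(1/2)) (ampl_sin j K h2))).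
congr ampl; apply/funext => x /=; rewrite /y.
have -> : (h \o S)^~ x = (h^~ x) \o S by [].
by field.
Qed.

Let mix_cont j c : continuous (mix j ^~ c).
Proof.
apply: cont_row => i.
have -> : (fun x => mix j x c 0 i) = if (i < j)%N then (fun x => x 0 i) else fun=> c 0 i.
  by apply/funext => x; rewrite mxE; case: ifP.
by case: (i < j)%N; [exact: coord_cont|exact: cont_cst].
Qed.

(** Induction on the number [j] of free coordinates, the others being frozen at [c]. One more
    coordinate is freed by sampling [g] at nodes of that coordinate and weighting the samples with
    Bernstein polynomials in [y], under which [ampl] is stable. *)
Let mix_ampl (j : nat) : (j <= n)%N -> forall (g : 'rV[R]_n -> R), continuous g ->
  (exists M : R, forall x, `|g x| <= M) -> forall c, ampl (fun x => g (mix j x c)).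
Proof.
elim: j => [|j IH] jn g cg [M gM] c.
  move=> t b; have E x : mix 0 x c = c by apply/rowP => i; rewrite mxE.
  under eq_fun do rewrite E; apply: gdZ; split; first exact: cos_phase_cont.
    by exists 1 => x; exact: cos_max.
  exact: cf.
pose jo := Ordinal jn.
(* With [L = K.+1], the nodes fill [[- L, L]] and the degree is [L ^ 3]. For the parameter [z] given
   by [y], the binomial mean is [L * sin (x / L)], which tends to the coordinate [x], and the
   variance is [4 * z * (1 - z) / L <= 1 / L]: a cubic degree makes it vanish although the range
   grows. *)
pose node (K : nat) (k : nat) : R := (- K.+1%:R) + (2 * K.+1%:R / (K.+1 ^ 3)%:R) * k%:R.
pose F K x := bern (K.+1 ^ 3) (fun k => g (mix j x (upd jo (node K k) c))) (y jo K.+1%:R x).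
have aF K : ampl (F K).
  by apply: ampl_bern => k; apply: IH => //; [exact: ltnW|exists M].
have y01 K x : 0 <= y jo K x <= 1.
  rewrite /y; have := sin_geN1 (x 0 jo / K); have := sin_le1 (x 0 jo / K).
  by move=> h1 h2; apply/andP; split; lra.
have FM K x : `|F K x| <= M.
  rewrite /F -[X in _ <= X](bern_cst (K.+1 ^ 3) M (y jo K.+1%:R x)) ler_norml; apply/andP; split.
    rewrite bern_cst -[X in X <= _](bern_cst (K.+1 ^ 3) (- M) (y jo K.+1%:R x)); apply: bern_le => // k.
    by have := gM (mix j x (upd jo (node K k) c)); rewrite ler_norml => /andP[].
  apply: bern_le => // k.
  by have := gM (mix j x (upd jo (node K k) c)); rewrite ler_norml => /andP[].
move=> t b; apply: (@gd_lim (fun K x => F K x * cos (phase t x + b)) _ M).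
- by move=> K; exact: aF.
- have c1 : continuous (g \o (mix j.+1 ^~ c)).
    by move=> x; apply: continuous_comp; [exact: mix_cont|exact: cg].
  exact: (contM c1 (@cos_phase_cont _ _ t b)).
- move=> x K; rewrite normrM -[M]mulr1; apply: ler_pM => //; exact: cos_max.
move=> x; apply: cvgM; last exact: cvg_cst.
pose u s := g (mix j x (upd jo s c)).
have ux : g (mix j.+1 x c) = u (x 0 jo).
  congr g; apply/rowP => i; rewrite !mxE ltnS leq_eqVlt.
  have [ij|ij] := eqVneq i jo; first by rewrite ij ltnn eqxx.
  have -> : (i == j :> nat) = false by apply/negbTE; move: ij; apply: contraNN => /eqP e; apply/eqP/val_inj.
  by [].
rewrite ux.
have cu : {for x 0 jo, continuous u}.
  suff: continuous u by apply.
  apply: (@cont_comp _ _ _ (fun s : R => mix j x (upd jo s c)) g) => //.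
  apply: cont_row => i.
  have -> : (fun s => mix j x (upd jo s c) 0 i) =
      if (i < j)%N then fun=> x 0 i else if i == jo then id else fun=> c 0 i.
    by apply/funext => s; rewrite !mxE; case: ifP => // _; case: ifP.
  case: (i < j)%N; first exact: cont_cst.
  by case: (i == jo); [move=> z; exact: cvg_id|exact: cont_cst].
apply/cvgrPdist_le => e e0.
have M0 : 0 <= M by exact: le_trans (gM 0).
move/cvgrPdist_le: cu => /(_ (e / 2)); rewrite divr_gt0// => /(_ isT).
move=> /nbhs_ballP[del /= d0 hdel].
have hu s : `|s - x 0 jo| < del -> `|u s - u (x 0 jo)| <= e / 2.
  by move=> h; rewrite distrC; apply: hdel; rewrite /ball/= distrC.
have d2 : 0 < del ^+ 2 by rewrite exprn_gt0.
pose r (K : nat) : R := (K.+1%:R * sin (x 0 jo / K.+1%:R) - x 0 jo) ^+ 2 + K.+1%:R^-1.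
have r0 : r @ \oo --> (0 : R).
  rewrite -[X in _ --> X](_ : (x 0 jo - x 0 jo) ^+ 2 + 0 = 0); last by rewrite subrr expr0n addr0.
  apply: cvgD; last exact: cvg_harmonic.
  have h : (fun K : nat => K.+1%:R * sin (x 0 jo / K.+1%:R) - x 0 jo) @ \oo --> x 0 jo - x 0 jo.
    by apply: cvgB; [exact: scaled_sin_cvg|exact: cvg_cst].
  by under eq_fun do rewrite expr2; rewrite expr2; exact: cvgM.
pose C := 2 * M / del ^+ 2.
have C0 : 0 <= C by rewrite divr_ge0 ?mulr_ge0// ltW.
have : (fun K => C * r K) @ \oo --> (0 : R).
  by rewrite -(mulr0 C); apply: cvgM; [exact: cvg_cst|exact: r0].
move/cvgrPdist_le => /(_ (e / 2)); rewrite divr_gt0// => /(_ isT); apply: filterS => K.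
rewrite sub0r normrN => hK; rewrite distrC.
have := @bern_approx R (K.+1 ^ 3) u (- K.+1%:R) (2 * K.+1%:R / (K.+1 ^ 3)%:R)
  (y jo K.+1%:R x) (x 0 jo) M (e / 2) del (y01 _ _) (fun s => gM _) d0 hu.
have e2 : 0 <= e / 2 by rewrite divr_ge0// ltW.
move=> /(_ e2); rewrite -/(F K x) => h; apply: le_trans h _.
rewrite -/C [leRHS](_ : e = e / 2 + e / 2); last by field.
apply: lerD => //; apply: le_trans hK; apply: le_trans (ler_norm _); apply: ler_wpM2l => //.
have K0 : (K.+1%:R : R) != 0 by rewrite pnatr_eq0.
have Kp : 0 < (K.+1%:R : R) by [].
rewrite natrX /r; apply: lerD.
  rewrite le_eqVlt; apply/orP; left; apply/eqP; congr (_ ^+ 2).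
  by rewrite /y; field.
have := y01 K.+1%:R x; set z := y _ _ _; move=> /andP[z0 z1].
have -> : (2 * K.+1%:R / K.+1%:R ^+ 3) ^+ 2 * K.+1%:R ^+ 3 * z * (1 - z) =
  K.+1%:R^-1 * (4 * z * (1 - z)) by field.
rewrite -[leRHS]mulr1; apply: ler_wpM2l; first by rewrite invr_ge0 ltW.
by have := sqr_ge0 (2 * z - 1); nra.
Qed.

Lemma cf_unique_bounded (g : 'rV[R]_n -> R) : continuous g ->
  (exists M : R, forall x, `|g x| <= M) -> Ex P (g \o xi) = Ex P' (g \o eta).
Proof.
move=> cg bg; have [_ _] := mix_ampl (leqnn n) cg bg 0 0 0.
have E x : g (mix n x 0) * cos (phase 0 x + 0) = g x.
  rewrite /phase big1 ?addr0 ?cos0 ?mulr1 => [|i _]; last by rewrite mxE mul0r.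
  by congr g; apply/rowP => i; rewrite mxE ltn_ord.
move=> h; rewrite -[g](_ : (fun x => g (mix n x 0) * cos (phase 0 x + 0)) = g) //.
by apply/funext.
Qed.

Lemma cf_unique (g : 'rV[R]_n -> R) : continuous g ->
  itg P (g \o xi) -> itg P' (g \o eta) -> Ex P (g \o xi) = Ex P' (g \o eta).
Proof.
move=> cg i1 i2.
pose g_ (k : nat) x := Num.max (- k%:R) (Num.min k%:R (g x)).
have cgk k : continuous (g_ k).
  by apply: cont_clamp.
have bk k x : `|g_ k x| <= k%:R.
  rewrite /g_ ler_norml le_max lexx/= ge_max ge_min lexx/= andbT.
  by rewrite (@le_trans _ _ 0)// oppr_le0.
have lek k x : `|g_ k x| <= `|g x|.
  rewrite /g_; have [h1|h1] := leP k%:R (g x); last first.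
    have [h2|h2] := leP (- k%:R) (g x); first by [].
    by rewrite normrN ger0_norm// ler_normr; apply/orP; right; lra.
  have -> : Num.max (- k%:R) (k%:R : R) = k%:R.
    by apply/max_idPr; rewrite (@le_trans _ _ 0)// oppr_le0.
  by rewrite ger0_norm// (le_trans h1)// ler_norm.
have cv x : g_ ^~ x @ \oo --> g x.
  apply: cvg_near_cst; exists (Num.truncn `|g x|).+1 => // k /= hk; rewrite /g_.
  have h : `|g x| < k%:R by apply: lt_le_trans (truncnS_gt _) _; rewrite ler_nat.
  move: h; rewrite ltr_norml => /andP[h1 h2].
  have -> : Num.min k%:R (g x) = g x by apply/min_idPr; exact: ltW.
  by apply/max_idPr; exact: ltW.
have [||||_ c1] := @dct_Ex _ _ _ P (fun k => g_ k \o xi) (g \o xi) (fun w => `|g (xi w)|).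
- by move=> k; exact: meas_continuous_row.
- by move=> w; exact: cv.
- by move=> k w; exact: lek.
- exact: (itg_abs i1).
have [||||_ c2] := @dct_Ex _ _ _ P' (fun k => g_ k \o eta) (g \o eta) (fun w => `|g (eta w)|).
- by move=> k; exact: meas_continuous_row.
- by move=> w; exact: cv.
- by move=> k w; exact: lek.
- exact: (itg_abs i2).
apply: (cvg_unique _ c1) => //; apply: cvg_trans c2; apply: near_eq_cvg.
by apply: nearW => k; apply/esym; apply: cf_unique_bounded => //; exists k%:R.
Qed.

End char_fun_uniqueness.

(** * Expectations on a product space *)

Section product_expectation.
Context {R : realType} d (T : measurableType d) (P : probability T R).
Context d' (T' : measurableType d') (P' : probability T' R).
Local Notation PP := (P \x P')%E.

Lemma meas_fst (F : T -> R) : measurable_fun setT F ->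
  measurable_fun [set: T * T'] (fun w => F w.1).
Proof. by move=> mF; exact: (measurableT_comp mF measurable_fst). Qed.

Lemma meas_snd (F : T' -> R) : measurable_fun setT F ->
  measurable_fun [set: T * T'] (fun w => F w.2).
Proof. by move=> mF; exact: (measurableT_comp mF measurable_snd). Qed.

Lemma am_fst (F : T -> R) : am P F -> am PP (fun w => F w.1).
Proof.
move=> [mF iF]; split=> [|n]; first exact: meas_fst.
have mF' : measurable_fun [set: T * T'] (fun w => `|F w.1| ^+ n).
  by apply/measX/meas_abs; exact: meas_fst.
apply/integrableP; split; first exact/measurable_EFinP.
rewrite fubini_tonelli1//=; last first.
  by apply/measurable_EFinP; exact: meas_abs.
rewrite /fubini_F /=; under eq_integral do rewrite integral_cst//= probability_setT mule1.
by case/integrableP: (iF n).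
Qed.

Lemma am_snd (F : T' -> R) : am P' F -> am PP (fun w => F w.2).
Proof.
move=> [mF iF]; split=> [|n]; first exact: meas_snd.
have mF' : measurable_fun [set: T * T'] (fun w => `|F w.2| ^+ n).
  by apply/measX/meas_abs; exact: meas_snd.
apply/integrableP; split; first exact/measurable_EFinP.
rewrite fubini_tonelli1//=; last first.
  by apply/measurable_EFinP; exact: meas_abs.
rewrite /fubini_F /= integral_cst//= probability_setT mule1.
by case/integrableP: (iF n).
Qed.

Lemma Ex_prod (F : T * T' -> R) : itg PP F -> (forall x, itg P' (fun y => F (x, y))) ->
  Ex PP F = Ex P (fun x => Ex P' (fun y => F (x, y))).
Proof.
move=> iF iFx; rewrite /Ex /Rintegral; congr fine.
have := integral12_prod_meas1 iF; rewrite /fubini_F => <-.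
apply: eq_integral => x _ /=.
by rewrite fineK//; apply: integrable_fin_num => //; exact: iFx.
Qed.

Lemma itg_prod (F : T * T' -> R) : itg PP F -> (forall x, itg P' (fun y => F (x, y))) ->
  itg P (fun x => Ex P' (fun y => F (x, y))).
Proof.
move=> iF iFx; apply: eq_integrable (integrable_fubini_F iF) => // x _.
by rewrite /fubini_F /= /Ex /Rintegral fineK//; apply: integrable_fin_num => //; exact: iFx.
Qed.

End product_expectation.

(** * Calculus of functions of polynomial growth *)

Section row_calculus.
Context {R : realType}.

Lemma coord_norm_le n (x : 'rV[R]_n) i : `|x 0 i| <= `|x|.
Proof.
rewrite [leRHS]mx_normrE.
exact: (le_bigmax _ (fun ij : 'I_1 * 'I_n => `|x ij.1 ij.2|) (0, i)).
Qed.

Lemma norm_le_sum n (x : 'rV[R]_n) : `|x| <= \sum_i `|x 0 i|.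
Proof.
rewrite [leLHS]mx_normrE; apply/bigmax_leP; split=> [|[i j] _ /=].
  exact: sumr_ge0.
by rewrite (ord1 i) (bigD1 j)//= lerDl sumr_ge0.
Qed.

Lemma derive_sum_partial k (phi : 'rV[R]_k.+1 -> R) x v : differentiable phi x ->
  'D_v phi x = \sum_j v 0 j * partial j phi x.
Proof.
move=> dphi; rewrite deriveE// [in LHS](row_sum_delta v) linear_sum.
by apply: eq_bigr => j _; rewrite linearZ /= /partial deriveE.
Qed.

Lemma poly_growthD k (f g : 'rV[R]_k.+1 -> R) : poly_growth f -> poly_growth g ->
  poly_growth (fun x => f x + g x).
Proof.
move=> [C [m h]] [C' [m' h']]; exists (`|C| + `|C'|), (m + m')%N => x.
have x1 : 1 <= 1 + `|x| by rewrite lerDl.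
apply: le_trans (ler_normD _ _) _; rewrite mulrDl; apply: lerD.
  apply: le_trans (h x) _; apply: le_trans (_ : `|C| * (1 + `|x|) ^+ m <= _).
    by rewrite ler_wpM2r ?ler_norm// exprn_ge0// addr_ge0.
  by rewrite ler_wpM2l// ler_weXn2l// leq_addr.
apply: le_trans (h' x) _; apply: le_trans (_ : `|C'| * (1 + `|x|) ^+ m' <= _).
  by rewrite ler_wpM2r ?ler_norm// exprn_ge0// addr_ge0.
by rewrite ler_wpM2l// ler_weXn2l// leq_addl.
Qed.

Lemma poly_growthM k (f g : 'rV[R]_k.+1 -> R) : poly_growth f -> poly_growth g ->
  poly_growth (fun x => f x * g x).
Proof.
move=> [C [m h]] [C' [m' h']]; exists (C * C'), (m + m')%N => x.
by rewrite normrM exprD mulrACA ler_pM.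
Qed.

Lemma poly_growth_bounded k (f : 'rV[R]_k.+1 -> R) (M : R) :
  (forall x, `|f x| <= M) -> poly_growth f.
Proof. by move=> h; exists M, 0%N => x; rewrite expr0 mulr1. Qed.

Lemma poly_growth_coord k (i : 'I_k.+1) : poly_growth (fun x : 'rV[R]_k.+1 => x 0 i).
Proof.
exists 1, 1%N => x; rewrite mul1r expr1 (le_trans (coord_norm_le _ _))//.
by rewrite lerDr.
Qed.

Lemma poly_growth_mx k l (f : 'rV[R]_k.+1 -> R) (M : 'M[R]_(l.+1, k.+1)) :
  poly_growth f -> poly_growth (fun x => f (x *m M)).
Proof.
move=> [C [m h]].
pose c := \sum_j \sum_i `|M i j|.
have c0 : 0 <= c by apply: sumr_ge0 => j _; apply: sumr_ge0.
have hx (x : 'rV[R]_l.+1) : `|x *m M| <= c * `|x|.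
  apply: le_trans (norm_le_sum _) _; rewrite /c mulr_suml; apply: ler_sum => j _.
  rewrite mxE mulr_suml; apply: le_trans (ler_norm_sum _ _ _) _; apply: ler_sum => i _.
  by rewrite normrM mulrC ler_wpM2l// coord_norm_le.
exists (`|C| * (1 + c) ^+ m), m => x.
apply: le_trans (h _) _; apply: le_trans (_ : `|C| * (1 + `|x *m M|) ^+ m <= _).
  by rewrite ler_wpM2r ?ler_norm// exprn_ge0// addr_ge0.
rewrite -mulrA ler_wpM2l// -exprMn lerXn2r ?nnegrE ?addr_ge0 ?mulr_ge0 ?addr_ge0//.
by have := hx x; have := normr_ge0 x; nra.
Qed.

Lemma dpg0 n k (f : 'rV[R]_k.+1 -> R) : diff_poly_growth n f -> poly_growth f.
Proof. by case: n => [|n] //= []. Qed.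

Lemma dpgS n k (f : 'rV[R]_k.+1 -> R) : diff_poly_growth n.+1 f -> diff_poly_growth n f.
Proof.
elim: n f => [|n IH] f; first by case.
by move=> [h1 h2 h3]; split=> // j; apply: IH; exact: h3.
Qed.

Lemma dpg_cst n k (c : R) : diff_poly_growth n (fun _ : 'rV[R]_k.+1 => c).
Proof.
elim: n c => [|n IH] c /=; first by apply: (@poly_growth_bounded _ _ `|c|).
split; first by apply: (@poly_growth_bounded _ _ `|c|).
  by move=> x; exact: differentiable_cst.
move=> j; have -> : partial j (fun _ : 'rV[R]_k.+1 => c) = fun=> 0; last exact: IH.
by apply/funext => x; rewrite /partial derive_cst.
Qed.

Lemma partialD k (f g : 'rV[R]_k.+1 -> R) j x : differentiable f x -> differentiable g x ->
  partial j (fun x => f x + g x) x = partial j f x + partial j g x.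
Proof. by move=> df dg; rewrite /partial deriveD//; exact: diff_derivable. Qed.

Lemma partialM k (f g : 'rV[R]_k.+1 -> R) j x : differentiable f x -> differentiable g x ->
  partial j (fun x => f x * g x) x = partial j f x * g x + f x * partial j g x.
Proof.
move=> df dg; rewrite /partial deriveM; try exact: diff_derivable.
by rewrite /GRing.scale/= addrC [g x * _]mulrC.
Qed.

Lemma dpgD n k (f g : 'rV[R]_k.+1 -> R) : diff_poly_growth n f -> diff_poly_growth n g ->
  diff_poly_growth n (fun x => f x + g x).
Proof.
elim: n f g => [|n IH] f g /=; first exact: poly_growthD.
move=> [h1 h2 h3] [h1' h2' h3']; split; first exact: poly_growthD.
  by move=> x; exact: differentiableD.
move=> j; have -> : partial j (fun x => f x + g x) = fun x => partial j f x + partial j g x.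
  by apply/funext => x; rewrite partialD.
exact: IH.
Qed.

Lemma dpgM n k (f g : 'rV[R]_k.+1 -> R) : diff_poly_growth n f -> diff_poly_growth n g ->
  diff_poly_growth n (fun x => f x * g x).
Proof.
elim: n f g => [|n IH] f g /=; first exact: poly_growthM.
move=> hf hg; have [h1 h2 h3] := hf; have [h1' h2' h3'] := hg.
split; first exact: poly_growthM.
  by move=> x; exact: differentiableM.
move=> j; have -> : partial j (fun x => f x * g x) =
    fun x => partial j f x * g x + f x * partial j g x.
  by apply/funext => x; rewrite partialM.
by apply: dpgD; apply: IH => //; [exact: dpgS hg|exact: dpgS hf].
Qed.

Lemma dpgZ n k (c : R) (f : 'rV[R]_k.+1 -> R) : diff_poly_growth n f ->
  diff_poly_growth n (fun x => c * f x).
Proof. by move=> hf; apply: dpgM => //; exact: dpg_cst. Qed.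

Lemma dpg_sum n k I (s : seq I) (f : I -> 'rV[R]_k.+1 -> R) :
  (forall i, diff_poly_growth n (f i)) -> diff_poly_growth n (fun x => \sum_(i <- s) f i x).
Proof.
move=> h; elim: s => [|i s IH].
  by under eq_fun do rewrite big_nil; exact: dpg_cst.
by under eq_fun do rewrite big_cons; exact: dpgD.
Qed.

Lemma differentiable_coord k (i : 'I_k.+1) (x : 'rV[R]_k.+1) :
  differentiable (fun y : 'rV[R]_k.+1 => y 0 i) x.
Proof. exact: differentiable_coord. Qed.

Lemma partial_coord k (i j : 'I_k.+1) (x : 'rV[R]_k.+1) :
  partial j (fun y : 'rV[R]_k.+1 => y 0 i) x = (i == j)%:R.
Proof.
rewrite /partial; apply/cvg_lim => //=.
apply: (@cvg_near_cst _ _ (_ : R^o)); near=> h.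
have h0 : h != 0 by near: h; exact: nbhs_dnbhs_neq.
by rewrite !mxE eqxx/= addrK /GRing.scale/= mulrA mulVf// mul1r.
Unshelve. all: by end_near.
Qed.

Lemma dpg_coord n k (i : 'I_k.+1) : diff_poly_growth n (fun x : 'rV[R]_k.+1 => x 0 i).
Proof.
case: n => [|n] /=; first exact: poly_growth_coord.
split; [exact: poly_growth_coord|exact: differentiable_coord|move=> j].
have -> : partial j (fun x : 'rV[R]_k.+1 => x 0 i) = fun=> (i == j)%:R.
  by apply/funext => x; rewrite partial_coord.
exact: dpg_cst.
Qed.

Lemma derivable_diff (h : R -> R) (y : R) (h' : R) : is_derive y 1 h h' -> differentiable h y.
Proof. by move=> hh; apply/derivable1_diffP; case: hh. Qed.

Lemma partial_comp k (f : 'rV[R]_k.+1 -> R) (h h' : R -> R) j x :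
  (forall y : R, is_derive y 1 h (h' y)) -> differentiable f x ->
  partial j (fun x => h (f x)) x = h' (f x) * partial j f x.
Proof.
move=> dh df; have dhf := derivable_diff (dh (f x)).
rewrite /partial deriveE; last exact: differentiable_comp.
have E (r : R) : 'd h (f x) r = h' (f x) * r.
  have -> : r = r *: (1 : R) by rewrite /GRing.scale/= mulr1.
  rewrite linearZ/= -deriveE// (@derive_val _ _ _ _ _ _ _ (dh (f x))).
  by rewrite /GRing.scale/= mulr1 mulrC.
have -> : (fun x => h (f x)) = h \o f by [].
by rewrite diff_comp// /= E deriveE.
Qed.

(** Both functions are treated at once because differentiation exchanges them. *)
Lemma dpg_trig n k (f : 'rV[R]_k.+1 -> R) : diff_poly_growth n f ->
  diff_poly_growth n (fun x => cos (f x)) /\ diff_poly_growth n (fun x => sin (f x)).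
Proof.
elim: n f => [|n IH] f /=.
  by split; apply: (@poly_growth_bounded _ _ 1) => x; [exact: cos_max|exact: sin_max].
move=> hf; have [h1 h2 h3] := hf; have [c1 c2] := IH f (dpgS hf).
split; split.
- by apply: (@poly_growth_bounded _ _ 1) => x; exact: cos_max.
- by move=> x; apply: differentiable_comp => //; exact: derivable_diff (is_derive_cos _).
- move=> j; have -> : partial j (fun x => cos (f x)) = fun x => (-1 * sin (f x)) * partial j f x.
    apply/funext => x; rewrite (@partial_comp _ f cos (fun y => - sin y))//.
    by rewrite mulN1r.
  by apply: dpgM => //; apply: dpgZ.
- by apply: (@poly_growth_bounded _ _ 1) => x; exact: sin_max.
- by move=> x; apply: differentiable_comp => //; exact: derivable_diff (is_derive_sin _).
- move=> j; have -> : partial j (fun x => sin (f x)) = fun x => cos (f x) * partial j f x.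
    by apply/funext => x; rewrite (@partial_comp _ f sin cos).
  exact: dpgM.
Qed.

Lemma differentiable_mx k l (M : 'M[R]_(l.+1, k.+1)) (x : 'rV[R]_l.+1) :
  differentiable (fun y : 'rV[R]_l.+1 => y *m M) x.
Proof.
have -> : (fun y : 'rV[R]_l.+1 => y *m M) = mulmxr M by [].
apply: linear_differentiable => y.
apply: cont_row => i; under eq_fun do rewrite mxE.
by apply: cont_sum => j; apply: contM; [exact: coord_cont|exact: cont_cst].
Qed.

Lemma partial_mx k l (f : 'rV[R]_k.+1 -> R) (M : 'M[R]_(l.+1, k.+1)) i x :
  differentiable f (x *m M) ->
  partial i (fun x => f (x *m M)) x = \sum_j M i j * partial j f (x *m M).
Proof.
move=> df; rewrite /partial deriveE; last first.
  by apply: differentiable_comp => //; exact: differentiable_mx.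
have -> : (fun x => f (x *m M)) = f \o (mulmxr M) by [].
rewrite diff_comp//; last exact: differentiable_mx.
rewrite /= diff_lin; last first.
  move=> y; apply: cont_row => i0; under eq_fun do rewrite mxE.
  by apply: cont_sum => j; apply: contM; [exact: coord_cont|exact: cont_cst].
rewrite -deriveE// derive_sum_partial//; apply: eq_bigr => j _.
by rewrite /= -rowE mxE.
Qed.

Lemma dpg_mx n k l (f : 'rV[R]_k.+1 -> R) (M : 'M[R]_(l.+1, k.+1)) :
  diff_poly_growth n f -> diff_poly_growth n (fun x => f (x *m M)).
Proof.
elim: n f => [|n IH] f /=; first exact: poly_growth_mx.
move=> [h1 h2 h3]; split; first exact: poly_growth_mx.
  by move=> x; apply: differentiable_comp => //; exact: differentiable_mx.
move=> i; have -> : partial i (fun x => f (x *m M)) =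
    fun x => \sum_j M i j * partial j f (x *m M).
  by apply/funext => x; rewrite partial_mx.
by apply: dpg_sum => j; apply: dpgZ; apply: (IH _ (h3 j)).
Qed.

End row_calculus.

(** * Gaussian integration by parts *)

Section row_functions.
Context {R : realType} d (T : measurableType d) (P : probability T R).

Lemma differentiable_cont k (phi : 'rV[R]_k.+1 -> R) :
  (forall x, differentiable phi x) -> continuous phi.
Proof. by move=> h x; exact: differentiable_continuous. Qed.

Lemma cont_mx k l (M : 'M[R]_(l.+1, k.+1)) (F : 'rV[R]_k.+1 -> R) :
  continuous F -> continuous (fun x : 'rV[R]_l.+1 => F (x *m M)).
Proof.
move=> cF; have cM : continuous (fun x : 'rV[R]_l.+1 => x *m M).
  by move=> x; apply: differentiable_continuous; exact: differentiable_mx.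
exact: (cont_comp cM cF).
Qed.

Lemma dpg_cont n k (phi : 'rV[R]_k.+1 -> R) : diff_poly_growth n.+1 phi -> continuous phi.
Proof. by case=> _ h _; exact: differentiable_cont. Qed.

Lemma am_row k (xi : T -> 'rV[R]_k.+1) (phi : 'rV[R]_k.+1 -> R) :
  (forall i, am P (fun w => xi w 0 i)) -> continuous phi -> poly_growth phi ->
  am P (fun w => phi (xi w)).
Proof.
move=> axi cphi [C [m h]].
apply: (@am_le _ _ _ _ _ (fun w => `|C| * (1 + \sum_i `|xi w 0 i|) ^+ m)).
- by apply: meas_continuous_row => // i; exact: am_meas.
- move=> w; rewrite [leRHS]ger0_norm; last first.
    by rewrite mulr_ge0// exprn_ge0// addr_ge0// sumr_ge0.
  apply: le_trans (h _) _; apply: le_trans (_ : `|C| * (1 + `|xi w|) ^+ m <= _).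
    by rewrite ler_wpM2r ?ler_norm// exprn_ge0// addr_ge0.
  rewrite ler_wpM2l// lerXn2r ?nnegrE ?addr_ge0 ?sumr_ge0//.
  by rewrite lerD2l norm_le_sum.
- apply/amZ/amX/amD; first exact: am_cst.
  by apply: am_sum => i; exact: am_abs.
Qed.

Lemma is_derive_line k (phi : 'rV[R]_k.+1 -> R) (y c : 'rV[R]_k.+1) (z : R) :
  (forall x, differentiable phi x) ->
  is_derive z 1 (fun z : R => phi (y + z *: c)) (\sum_j c 0 j * partial j phi (y + z *: c)).
Proof.
move=> dphi; have E : (fun h : R => h^-1 *: (phi (y + (h *: 1 + z) *: c) - phi (y + z *: c)))
    = (fun h : R => h^-1 *: (phi (h *: c + (y + z *: c)) - phi (y + z *: c))).
  apply/funext => h; congr (_ *: (phi _ - _)).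
  have -> : h%:A = h :> R by rewrite /GRing.scale/= mulr1.
  by rewrite scalerDl addrCA.
have dd : derivable phi (y + z *: c) c by exact: diff_derivable.
split; first by rewrite /derivable /= E; exact: dd.
by rewrite -derive_sum_partial// /derive /= E.
Qed.

Lemma pgrow_line k (phi : 'rV[R]_k.+1 -> R) (y c : 'rV[R]_k.+1) : poly_growth phi ->
  pgrow (fun z : R => phi (y + z *: c)).
Proof.
move=> [C [m h]]; exists (`|C| * (1 + `|y| + `|c|) ^+ m), m => z.
apply: le_trans (h _) _.
apply: le_trans (_ : `|C| * (1 + `|y + z *: c|) ^+ m <= _).
  by rewrite ler_wpM2r ?ler_norm// exprn_ge0// addr_ge0.
rewrite -mulrA ler_wpM2l// -exprMn lerXn2r ?nnegrE ?addr_ge0 ?mulr_ge0 ?addr_ge0//.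
apply: le_trans (_ : 1 + (`|y| + `|z| * `|c|) <= _).
  by rewrite lerD2l; apply: le_trans (ler_normD _ _) _; rewrite normrZ.
by have := normr_ge0 y; have := normr_ge0 z; have := normr_ge0 c; nra.
Qed.

Lemma pgrow_sum I (s : seq I) (c : I -> R) (f : I -> R -> R) : (forall i, pgrow (f i)) ->
  pgrow (fun z => \sum_(i <- s) c i * f i z).
Proof.
move=> h; elim: s => [|i s [C [m IH]]].
  by exists 0, 0%N => x; rewrite big_nil normr0 mul0r.
have [C' [m' h']] := h i; exists (`|c i| * `|C'| + `|C|), (m + m')%N => x.
have x1 : 1 <= 1 + `|x| by rewrite lerDl.
rewrite big_cons; apply: le_trans (ler_normD _ _) _; rewrite mulrDl; apply: lerD.
  rewrite normrM -mulrA ler_wpM2l//; apply: le_trans (h' x) _.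
  apply: le_trans (_ : `|C'| * (1 + `|x|) ^+ m' <= _).
    by rewrite ler_wpM2r ?ler_norm// exprn_ge0// addr_ge0.
  by rewrite ler_wpM2l// ler_weXn2l// leq_addl.
apply: le_trans (IH x) _; apply: le_trans (_ : `|C| * (1 + `|x|) ^+ m <= _).
  by rewrite ler_wpM2r ?ler_norm// exprn_ge0// addr_ge0.
by rewrite ler_wpM2l// ler_weXn2l// leq_addr.
Qed.

End row_functions.

Section isonormal_ibp.
Context {R : realType} (H : completeNormedModType R).
Variable dot : H -> H -> R.
Context d (T : measurableType d) (P : probability T R).
Variable W : H -> {RV P >-> R}.
Hypothesis iso : isonormal_process dot W.

(** The linear span of [W], with explicit combinations because [W] is linear in [h] only almost
    surely. Joint Gaussianity in [isonormal_process] makes every element Gaussian. *)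
Definition W_linear (F : T -> R) :=
  exists s : seq (R * H), forall w, F w = \sum_(x <- s) x.1 * W x.2 w.

Lemma W_linear_gaussian F : W_linear F -> exists s, has_centered_gaussian_law P F s.
Proof.
move=> [s hF]; have [/(_ (size s) (fun i => (tnth (in_tuple s) i).2)
  (fun i => (tnth (in_tuple s) i).1)) [v hv] _] := iso.
exists v; rewrite (_ : F = (fun w => \sum_i (tnth (in_tuple s) i).1 * W (tnth (in_tuple s) i).2 w))//.
by apply/funext => w; rewrite hF big_tnth.
Qed.

Lemma W_linear_W h : W_linear (W h).
Proof. by exists [:: (1, h)] => w; rewrite big_seq1 mul1r. Qed.

Lemma W_linearD F G : W_linear F -> W_linear G -> W_linear (fun w => F w + G w).
Proof. by move=> [s hs] [t ht]; exists (s ++ t) => w; rewrite big_cat hs ht. Qed.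

Lemma W_linearZ c F : W_linear F -> W_linear (fun w => c * F w).
Proof.
move=> [s hs]; exists [seq (c * x.1, x.2) | x <- s] => w.
by rewrite hs mulr_sumr big_map; apply: eq_bigr => x _ /=; rewrite mulrA.
Qed.

Lemma W_linear_sum I (s : seq I) (c : I -> R) (F : I -> T -> R) : (forall i, W_linear (F i)) ->
  W_linear (fun w => \sum_(i <- s) c i * F i w).
Proof.
move=> h; elim: s => [|i s IH].
  by exists [::] => w; rewrite !big_nil.
by under eq_fun do rewrite big_cons; apply: W_linearD => //; exact: W_linearZ.
Qed.

Lemma W_linear_meas F : W_linear F -> measurable_fun setT F.
Proof.
move=> [s hs]; rewrite (_ : F = (fun w => \sum_(x <- s) x.1 * W x.2 w)); last exact/funext.
apply: measurable_sum => x; apply: measurable_funM; first exact: measurable_cst.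
exact: measurable_funP.
Qed.

Lemma W_linear_am F : W_linear F -> am P F.
Proof.
move=> lF; have [s hs] := W_linear_gaussian lF.
exact: am_gaussian (W_linear_meas lF) hs.
Qed.

Lemma am_W h : am P (W h).
Proof. exact/W_linear_am/W_linear_W. Qed.

Lemma gaussian_var (F : T -> R) s : measurable_fun setT F -> has_centered_gaussian_law P F s ->
  s ^+ 2 = Ex P (fun w => F w ^+ 2).
Proof.
move=> mF hs; have := @gaussian_stein R _ T P F s mF hs id (fun=> 1) (fun x => is_derive_id x 1).
rewrite Ex_cst mulr1 => <-.
- by apply: eq_Ex => w; rewrite expr2.
- by move=> x; exact: cvg_cst.
- by exists 1, 1%N => x; rewrite mul1r expr1 lerDr.
- by apply: (@pgrow_bounded _ _ 1) => x; rewrite normr1.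
Qed.

Lemma W_linear_cos F b : W_linear F ->
  Ex P (fun w => cos (F w + b)) = cos b * expR (- (Ex P (fun w => F w ^+ 2) / 2)).
Proof.
move=> lF; have [s hs] := W_linear_gaussian lF; have mF := W_linear_meas lF.
have := gaussian_cos mF hs 1 b; rewrite expr1n mulr1 (gaussian_var mF hs) => <-.
by apply: eq_Ex => w; rewrite mul1r.
Qed.

Lemma dot_Ex g h : dot g h = Ex P (fun w => W g w * W h w).
Proof.
have [_ /(_ g h)] := iso; rewrite expectationE; first by case.
by apply: am_itg; apply: amM; exact: am_W.
Qed.

Lemma dot_sym g h : dot g h = dot h g.
Proof. by rewrite !dot_Ex; apply: eq_Ex => w; rewrite mulrC. Qed.

Lemma dot_CS g h : dot g h ^+ 2 <= dot g g * dot h h.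
Proof.
rewrite !dot_Ex; have a1 := am_W g; have a2 := am_W h.
have := Ex_CS (am_meas a1) (am_meas a2) (am_itg (amX 2 a1)) (am_itg (amX 2 a2)).
have E k : Ex P (fun w => W k w ^+ 2) = Ex P (fun w => W k w * W k w).
  by apply: eq_Ex => w; rewrite expr2.
by rewrite !E.
Qed.

Definition Wrow k (h : 'I_k -> H) (w : T) : 'rV[R]_k := \row_i W (h i) w.

Lemma am_Wrow k (h : 'I_k.+1 -> H) (phi : 'rV[R]_k.+1 -> R) n : diff_poly_growth n.+1 phi ->
  am P (fun w => phi (Wrow h w)).
Proof.
move=> hphi; apply: am_row; [|exact: dpg_cont hphi|exact: dpg0 hphi].
by move=> i; under eq_fun do rewrite mxE; exact: am_W.
Qed.

(* The part of [W (h i)] orthogonal to [W g] is independent of it, which reduces the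
   claim to the one-dimensional identity. *)
Lemma isonormal_ibp k (h : 'I_k.+1 -> H) (phi : 'rV[R]_k.+1 -> R) (g : H) :
  diff_poly_growth 2 phi ->
  Ex P (fun w => W g w * phi (Wrow h w)) =
  \sum_i dot (h i) g * Ex P (fun w => partial i phi (Wrow h w)).
Proof.
move=> hphi; have [gphi dphi _] := hphi.
have hpar j : diff_poly_growth 1 (partial j phi) by case: hphi => _ _ /(_ j).
have cphi := dpg_cont hphi; have cpar j := dpg_cont (hpar j).
set v := dot g g.
(* Regression coefficient of [W (h i)] on [W g]. If [v = 0], division by zero gives [0], which is
   right because Cauchy-Schwarz then forces [dot (h i) g = 0]. *)
pose c (i : 'I_k.+1) := dot (h i) g / v.
have cv i : c i * v = dot (h i) g.
  rewrite /c; have [v0|v0] := eqVneq v 0; last by rewrite divfK.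
  rewrite v0 mulr0; have := dot_CS (h i) g; rewrite -/v v0 mulr0 => le0.
  by apply/esym/eqP; rewrite -sqrf_eq0 eq_le le0 sqr_ge0.
pose eta (i : 'I_k.+1) (w : T) := W (h i) w + (- c i) * W g w.
have leta i : W_linear (eta i).
  by apply: W_linearD; [exact: W_linear_W|apply: W_linearZ; exact: W_linear_W].
pose mk (z : R) (e : 'I_k.+1 -> R) : 'rV[R]_k.+2 :=
  \row_i (if unlift ord0 i is Some j then e j else z).
have mk0 z e : mk z e 0 ord0 = z by rewrite mxE unlift_none.
have mkS z e j : mk z e 0 (lift ord0 j) = e j by rewrite mxE liftK.
pose xi w := mk (W g w) (eta^~ w).
(* The same vector with [W g] taken from an independent copy. The equality [cf] of characteristic
   functions shows that [pp] and [xi] have the same law, so that Stein's identity can be applied in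
   [W g] alone with the first component fixed. *)
pose pp (w : T * T) := mk (W g w.2) (eta^~ w.1).
have aW := am_W g; have aeta i := W_linear_am (leta i).
have axi i : am P (fun w => xi w 0 i).
  case: (unliftP ord0 i) => [j|] ->; first by under eq_fun do rewrite mkS; exact: aeta.
  by under eq_fun do rewrite mk0; exact: aW.
have app i : am (P \x P)%E (fun w => pp w 0 i).
  case: (unliftP ord0 i) => [j|] ->; first by under eq_fun do rewrite mkS; exact: am_fst.
  by under eq_fun do rewrite mk0; exact: am_snd.
have phE t z e : phase t (mk z e) = t 0 ord0 * z + \sum_j t 0 (lift ord0 j) * e j.
  by rewrite /phase big_ord_recl mk0; congr (_ + _); apply: eq_bigr => j _; rewrite mkS.
have orth i : Ex P (fun w => W g w * eta i w) = 0.
  rewrite (_ : (fun w => W g w * eta i w) =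
      (fun w => W g w * W (h i) w + (- c i) * (W g w * W g w))); last first.
    by apply/funext => w; rewrite /eta; ring.
  rewrite ExD ?ExZ; try by apply: am_itg; try apply: amZ; apply: amM; exact: am_W.
  by rewrite -!dot_Ex -/v mulNr cv dot_sym subrr.
have cf t b : Ex P (fun w => cos (phase t (xi w) + b)) =
    Ex (P \x P)%E (fun w => cos (phase t (pp w) + b)).
  pose Q w := \sum_j t 0 (lift ord0 j) * eta j w.
  have lQ : W_linear Q by exact: W_linear_sum.
  have aQ := W_linear_am lQ.
  have lL : W_linear (fun w => t 0 ord0 * W g w + Q w).
    by apply: W_linearD => //; apply: W_linearZ; exact: W_linear_W.
  under eq_Ex do rewrite phE -/(Q _).
  rewrite W_linear_cos//.
  have -> : Ex P (fun w => (t 0 ord0 * W g w + Q w) ^+ 2) =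
     t 0 ord0 ^+ 2 * v + Ex P (fun w => Q w ^+ 2).
    rewrite (_ : (fun w => (t 0 ord0 * W g w + Q w) ^+ 2) = (fun w =>
       t 0 ord0 ^+ 2 * (W g w * W g w) + Q w ^+ 2 + (2 * t 0 ord0) * (W g w * Q w))); last first.
      by apply/funext => w; ring.
    have EQ : Ex P (fun w => W g w * Q w) = 0.
      rewrite (_ : (fun w => W g w * Q w) = (fun w => \sum_j t 0 (lift ord0 j) * (W g w * eta j w))).
        rewrite Ex_sum => [|j]; last by apply/itgZ/am_itg/amM.
        rewrite big1// => j _; rewrite ExZ ?orth ?mulr0//; exact/am_itg/amM.
      by apply/funext => w; rewrite mulr_sumr; apply: eq_bigr => j _; ring.
    have i1 : itg P (fun w => t 0 ord0 ^+ 2 * (W g w * W g w)) by apply/itgZ/am_itg/amM.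
    have i2 : itg P (fun w => Q w ^+ 2) by exact/am_itg/amX.
    have i3 : itg P (fun w => W g w * Q w) by exact/am_itg/amM.
    by rewrite ExD ?ExD ?ExZ ?EQ ?mulr0 ?addr0 -?dot_Ex//; try exact: itgD; try exact: itgZ; exact/am_itg/amM.
  rewrite Ex_prod; last 2 first.
  - apply: am_itg; apply: (@am_bounded _ _ _ _ _ 1) => [|w]; last exact: cos_max.
    apply: (@measurableT_comp _ _ _ _ _ _ cos).
      by apply: continuous_R_meas; exact: continuous_cos.
    apply: measurable_funD; last exact: measurable_cst.
    apply: (@meas_continuous_row _ _ _ _ pp (phase t)); last exact: phase_cont.
    by move=> i; exact: am_meas (app i).
  - move=> y; apply: am_itg; apply: (@am_bounded _ _ _ _ _ 1) => [|w]; last exact: cos_max.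
    apply: (@measurableT_comp _ _ _ _ _ _ cos).
      by apply: continuous_R_meas; exact: continuous_cos.
    under eq_fun do rewrite phE /=.
    apply: measurable_funD; last exact: measurable_cst.
    apply: measurable_funD; last exact: measurable_cst.
    by apply: measurable_funM; [exact: measurable_cst|exact: am_meas aW].
  rewrite (_ : (fun y => Ex P _) = (fun y => expR (- (t 0 ord0 ^+ 2 * v / 2)) * cos (Q y + b))).
    rewrite ExZ ?W_linear_cos//; last first.
      apply: (@itg_bounded _ _ _ _ _ 1) => [|w]; last exact: cos_max.
      apply: (@measurableT_comp _ _ _ _ _ _ cos).
        by apply: continuous_R_meas; exact: continuous_cos.
      by apply: measurable_funD; [exact: am_meas aQ|exact: measurable_cst].
    rewrite mulrCA -expRD; congr (_ * expR _); lra.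
  apply/funext => y; under eq_Ex do rewrite phE /= -/(Q y) -addrA.
  rewrite (W_linear_cos _ (W_linearZ _ (W_linear_W g))) mulrC; congr (expR (- (_ / 2)) * _).
  under eq_Ex do rewrite exprMn expr2.
  by rewrite ExZ -?dot_Ex//; exact/am_itg/amM.
(* [sh] rebuilds [W h] from the orthogonal parts *)
pose M : 'M[R]_(k.+2, k.+1) := \matrix_(i, j) (if unlift ord0 i is Some i' then (i' == j)%:R else c j).
have mkM z e : mk z e *m M = \row_j e j + z *: \row_j c j.
  apply/rowP => j; rewrite !mxE big_ord_recl mk0 mxE unlift_none addrC; congr (_ + _).
  rewrite (bigD1 j)//= mkS mxE liftK eqxx mulr1 big1 ?addr0// => i ij.
  by rewrite mkS mxE liftK (negbTE ij) mulr0.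
have xiM w : xi w *m M = Wrow h w.
  by rewrite mkM; apply/rowP => j; rewrite !mxE /eta; ring.
have aGxi (F : 'rV[R]_k.+1 -> R) : continuous F -> poly_growth F ->
    [/\ continuous (fun x : 'rV[R]_k.+2 => F (x *m M)), am P (fun w => F (xi w *m M)) &
        am (P \x P)%E (fun w => F (pp w *m M))].
  move=> cF gF; have c1 : continuous (fun x : 'rV[R]_k.+2 => F (x *m M)).
    exact: cont_mx.
  have g1 := poly_growth_mx M gF.
  split; [exact: c1|exact: am_row axi c1 g1|exact: am_row app c1 g1].
have [c1 a1 a2] := aGxi phi cphi gphi.
have mxi i := am_meas (axi i); have mpp i := am_meas (app i).
transitivity (Ex P (fun w => xi w 0 ord0 * phi (xi w *m M))).
  by apply: eq_Ex => w; rewrite xiM mk0.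
rewrite (@cf_unique _ _ _ P _ _ (P \x P)%E _ xi pp mxi mpp cf (fun x => x 0 ord0 * phi (x *m M))); last 3 first.
- by apply: contM => //; exact: coord_cont.
- by apply/am_itg/amM.
- by apply/am_itg/amM.
rewrite Ex_prod; last 2 first.
- by apply/am_itg/amM => //; exact: app.
- move=> y; rewrite (_ : (fun _ => _) =
      (fun x => W g x * phi (\row_j eta j y + W g x *: \row_j c j))); last first.
    by apply/funext => x /=; rewrite /pp mk0 mkM.
  apply/am_itg/amM => //.
  apply: (@am_row _ _ _ _ _ (fun w => \row_j eta j y + W g w *: \row_j c j) phi) => // i.
  under eq_fun do rewrite !mxE.
  by apply: amD; [exact: am_cst|under eq_fun do rewrite mulrC; exact: amZ].
have [s hs] := W_linear_gaussian (W_linear_W g).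
have sv : s ^+ 2 = v.
  rewrite (gaussian_var _ hs); last exact: am_meas aW.
  by rewrite /v dot_Ex; apply: eq_Ex => w; rewrite expr2.
have step (y : T) : Ex P (fun x => pp (y, x) 0 ord0 * phi (pp (y, x) *m M)) =
    \sum_j dot (h j) g * Ex P (fun x => partial j phi (pp (y, x) *m M)).
  set e := \row_j eta j y; set cc := \row_j c j.
  have aL j : am P (fun x => partial j phi (e + W g x *: cc)).
    apply: (@am_row _ _ _ _ _ (fun w => e + W g w *: cc) (partial j phi)); last 2 first.
    - exact: cpar.
    - exact: dpg0 (hpar j).
    move=> i; under eq_fun do rewrite !mxE.
    by apply: amD; [exact: am_cst|under eq_fun do rewrite mulrC; exact: amZ].
  rewrite (_ : (fun x => _) = (fun x => W g x * phi (e + W g x *: cc))); last first.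
    by apply/funext => x /=; rewrite /pp mk0 mkM.
  transitivity (s ^+ 2 * Ex P (fun x => \sum_j cc 0 j * partial j phi (e + W g x *: cc))).
    apply: (@gaussian_stein _ _ _ P (W g) s (am_meas aW) hs (fun z => phi (e + z *: cc))
      (fun z => \sum_j cc 0 j * partial j phi (e + z *: cc))).
    - by move=> x; exact: is_derive_line.
    - apply: cont_sum => j; apply: contM; first exact: cont_cst.
      apply: (@cont_comp _ _ _ (fun z : R => e + z *: cc) (partial j phi)); last exact: cpar.
      apply: cont_row => i; under eq_fun do rewrite !mxE.
      apply: contD; first exact: cont_cst.
      by apply: contM; [move=> z; exact: cvg_id|exact: cont_cst].
    - exact: pgrow_line.
    - by apply: pgrow_sum => j; apply: pgrow_line; exact: dpg0 (hpar j).
  rewrite sv Ex_sum => [|j]; last exact/itgZ/am_itg.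
  rewrite mulr_sumr; apply: eq_bigr => j _; rewrite ExZ; last exact/am_itg.
  rewrite mulrA mxE [v * _]mulrC cv; congr (_ * _); apply: eq_Ex => x.
  by rewrite mkM.
under eq_Ex do rewrite step.
have /all_and3 [c3 a3 a4] : (forall j, [/\ continuous (fun x : 'rV[R]_k.+2 => partial j phi (x *m M)),
    am P (fun w => partial j phi (xi w *m M)) &
    am (P \x P)%E (fun w => partial j phi (pp w *m M))]).
  by move=> j; apply: aGxi; [exact: cpar|exact: dpg0 (hpar j)].
have iy j y : itg P (fun x => partial j phi (pp (y, x) *m M)).
  rewrite (_ : (fun x => _) = (fun x => partial j phi (\row_j eta j y + W g x *: \row_j c j))).
    apply: am_itg.
    apply: (@am_row _ _ _ _ _ (fun w => \row_j eta j y + W g w *: \row_j c j) (partial j phi)) => //.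
      move=> i; under eq_fun do rewrite !mxE.
      by apply: amD; [exact: am_cst|under eq_fun do rewrite mulrC; exact: amZ].
    exact: dpg0 (hpar j).
  by apply/funext => x; rewrite /pp mkM.
have E j : Ex P (fun w => partial j phi (Wrow h w)) =
    Ex P (fun y => Ex P (fun x => partial j phi (pp (y, x) *m M))).
  rewrite -(@Ex_prod _ _ _ P _ _ P (fun w => partial j phi (pp w *m M)) (am_itg (a4 j)) (iy j)).
  under eq_Ex do rewrite -xiM.
  exact: (@cf_unique _ _ _ P _ _ (P \x P)%E _ xi pp mxi mpp cf (fun x => partial j phi (x *m M))
    (c3 j) (am_itg (a3 j)) (am_itg (a4 j))).
have iiy j : itg P (fun y => Ex P (fun x => partial j phi (pp (y, x) *m M))).
  exact: (@itg_prod _ _ _ P _ _ P (fun w => partial j phi (pp w *m M)) (am_itg (a4 j)) (iy j)).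
rewrite Ex_sum; last by move=> j; exact: itgZ.
by apply: eq_bigr => j _; rewrite E ExZ.
Qed.

End isonormal_ibp.

(** * Gaussian algebras *)

(** All derivatives of order [n] are constant: degree at most [n], expressed without monomials so
    that inductions can follow the derivatives. *)
Fixpoint Ddeg (R : realType) (A : comAlgType R) k (D : 'I_k -> A -> A) (n : nat) (p : A) : Prop :=
  if n is m.+1 then forall i, Ddeg D m (D i p) else exists c : R, p = c%:A.

(* Polynomials in independent standard Gaussian variables [ga_x], seen through partial
   derivatives and expectation. *)
Record gauss_alg (R : realType) := GaussAlg {
  ga_car :> comAlgType R;
  ga_dim : nat;
  ga_D : 'I_ga_dim -> {linear ga_car -> ga_car};
  ga_x : 'I_ga_dim -> ga_car;
  ga_E : ga_car -> R;
  ga_DM : forall i p q, ga_D i (p * q) = ga_D i p * q + p * ga_D i q;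
  ga_DC : forall i j p, ga_D i (ga_D j p) = ga_D j (ga_D i p);
  ga_Dx : forall i j, ga_D i (ga_x j) = (i == j)%:R;
  ga_ED : forall p q, ga_E (p + q) = ga_E p + ga_E q;
  ga_EZ : forall c p, ga_E (c *: p) = c * ga_E p;
  ga_E1 : ga_E 1 = 1;
  ga_ibp : forall i p, ga_E (ga_x i * p) = ga_E (ga_D i p);
  ga_E_ge0 : forall p, 0 <= ga_E (p * p);
  ga_const : forall p, (forall i, ga_D i p = 0) -> exists c : R, p = c%:A;
  ga_fin : forall p, exists n, Ddeg (fun i => ga_D i) n p }.

(** * Chaos decomposition and hypercontractivity *)

Section gauss_alg_theory.
Context {R : realType} (A : gauss_alg R).
Implicit Types (p q F U V : A).
Local Notation k := (ga_dim A).
Local Notation D := (@ga_D R A).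
Local Notation x := (@ga_x R A).
Local Notation E := (@ga_E R A).

Definition deg n p := Ddeg (fun i => D i) n p.

Lemma E0 : E 0 = 0.
Proof. by rewrite -(scale0r (0 : A)) ga_EZ mul0r. Qed.

Lemma EN p : E (- p) = - E p.
Proof. by rewrite -scaleN1r ga_EZ mulN1r. Qed.

Lemma EB p q : E (p - q) = E p - E q.
Proof. by rewrite ga_ED EN. Qed.

Lemma E_sum I (s : seq I) (P : pred I) (f : I -> A) :
  E (\sum_(i <- s | P i) f i) = \sum_(i <- s | P i) E (f i).
Proof. exact: (big_morph E (@ga_ED R A) E0). Qed.

Lemma Ec (c : R) : E c%:A = c.
Proof. by rewrite ga_EZ ga_E1 mulr1. Qed.

Lemma D1 i : D i 1 = 0.
Proof.
have := ga_DM i 1 1; rewrite !mulr1 mul1r => h.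
by apply/eqP; rewrite -(inj_eq (addrI (D i 1))) -h addr0.
Qed.

Lemma Dc i (c : R) : D i c%:A = 0.
Proof. by rewrite linearZ /= D1 scaler0. Qed.

Lemma scalarM (a b : R) : a%:A * b%:A = (a * b)%:A :> A.
Proof. by rewrite -scalerAl mul1r scalerA. Qed.

Definition Gam p q : A := \sum_i D i p * D i q.

(** The number operator, minus the Ornstein-Uhlenbeck generator, in coordinates; the chaoses are its
    eigenspaces. *)
Definition L p : A := \sum_i (x i * D i p - D i (D i p)).

Lemma GamC p q : Gam p q = Gam q p.
Proof. by apply: eq_bigr => i _; rewrite mulrC. Qed.

Lemma GamDr p q q' : Gam p (q + q') = Gam p q + Gam p q'.
Proof. by rewrite /Gam -big_split; apply: eq_bigr => i _ /=; rewrite linearD mulrDr. Qed.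

Lemma GamZr c p q : Gam p (c *: q) = c *: Gam p q.
Proof. by rewrite /Gam scaler_sumr; apply: eq_bigr => i _; rewrite linearZ /= scalerAr. Qed.

Lemma GamBr p q q' : Gam p (q - q') = Gam p q - Gam p q'.
Proof. by rewrite GamDr -scaleN1r GamZr scaleN1r. Qed.

Lemma GamMr p q q' : Gam p (q * q') = Gam p q * q' + q * Gam p q'.
Proof.
rewrite /Gam mulr_suml mulr_sumr -big_split; apply: eq_bigr => i _ /=.
by rewrite ga_DM mulrDr mulrA [D i p * (q * _)]mulrCA.
Qed.

Lemma D_lin i (c : R) p q : D i (c *: p + q) = c *: D i p + D i q.
Proof. exact: linearP. Qed.

Lemma L_is_linear : linear L.
Proof.
move=> c p q; rewrite /L scaler_sumr -big_split; apply: eq_bigr => i _ /=.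
by rewrite !D_lin mulrDr -scalerAr scalerBr opprD addrACA.
Qed.
HB.instance Definition _ := GRing.isLinear.Build R A A _ L L_is_linear.

(** The commutation relation behind [ch_D]: a derivative shifts the spectrum of [L] down by one. The
    extra term comes from differentiating the factor [x i] in [L]. *)
Lemma DL i p : D i (L p) = L (D i p) + D i p.
Proof.
rewrite /L linear_sum /=.
rewrite (eq_bigr (fun j => (x j * D j (D i p) - D j (D j (D i p))) + (i == j)%:R * D j p)).
  rewrite big_split /= (bigD1 i) //= [X in _ + X](bigD1 i)//= eqxx mul1r.
  by rewrite [X in _ + (_ + X)]big1 ?addr0// => j; rewrite eq_sym => /negbTE ->; rewrite mul0r.
move=> j _; rewrite linearB /= ga_DM ga_Dx !(ga_DC i j).
by rewrite [RHS]addrC addrA.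
Qed.

Lemma E_L p q : E (q * L p) = E (Gam p q).
Proof.
rewrite /L mulr_sumr !E_sum; apply: eq_bigr => i _.
rewrite mulrBr EB mulrCA ga_ibp ga_DM ga_ED addrK.
by rewrite mulrC.
Qed.

Lemma E_CS p q : E (p * q) ^+ 2 <= E (p * p) * E (q * q).
Proof.
set a := E (p * p); set b := E (p * q); set c := E (q * q).
have h (s t : R) : 0 <= s ^+ 2 * a + 2 * s * t * b + t ^+ 2 * c.
  have e : E ((s *: p + t *: q) * (s *: p + t *: q)) =
      s * (s * a) + s * (t * b) + (t * (s * b) + t * (t * c)).
    rewrite mulrDl !mulrDr !ga_ED -![in LHS]scalerAl !ga_EZ -![in LHS]scalerAr !ga_EZ.
    by rewrite [q * p]mulrC.
  by have := ga_E_ge0 (s *: p + t *: q); rewrite e; lra.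
have a0 : 0 <= a := ga_E_ge0 p; have c0 : 0 <= c := ga_E_ge0 q.
have [c00|cn] := eqVneq c 0.
  have [->|b0] := eqVneq b 0; first by rewrite c00 mulr0 expr0n.
  have := h 1 (- (a + 1) / (2 * b)); rewrite c00 mulr0 addr0 expr1n mul1r mulr1.
  have -> : 2 * (- (a + 1) / (2 * b)) * b = - (a + 1) by field.
  by lra.
have cp : 0 < c by rewrite lt_neqAle eq_sym cn.
have := h c (- b).
have -> : c ^+ 2 * a + 2 * c * - b * b + (- b) ^+ 2 * c = c * (a * c - b ^+ 2) by ring.
by rewrite pmulr_rge0// subr_ge0.
Qed.

Lemma E_null p q : E (p * p) = 0 -> E (p * q) = 0.
Proof.
move=> p0; have := E_CS p q; rewrite p0 mul0r => h.
by apply/eqP; rewrite -sqrf_eq0 eq_le h sqr_ge0.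
Qed.

(** Induction on the degree. Integration by parts of [x i * (p * D i p)] leaves [E (D i p * D i p)]
    plus terms containing [p], which vanish by Cauchy-Schwarz; so all derivatives are zero and [p]
    is a constant of square zero. *)
Lemma E_eq0 p : E (p * p) = 0 -> p = 0.
Proof.
have [n] := ga_fin p; rewrite -/(deg n p).
have cst q : (exists c : R, q = c%:A) -> E (q * q) = 0 -> q = 0.
  by move=> [c ->]; rewrite -scalerAl mul1r ga_EZ Ec => /eqP; rewrite mulf_eq0 orbb => /eqP ->; rewrite scale0r.
elim: n p => [|n IH] p dp p0; first exact: cst.
apply: cst => //; apply: ga_const => i; apply: IH; first exact: dp.
have := ga_ibp i (p * D i p); rewrite ga_DM ga_ED mulrCA.
by rewrite (E_null (x i * D i p) p0) (E_null (D i (D i p)) p0) addr0 => <-.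
Qed.

Definition ch n p := L p = n%:R *: p.

Lemma ch_0 n : ch n 0.
Proof. by rewrite /ch linear0 scaler0. Qed.

Lemma chD n p q : ch n p -> ch n q -> ch n (p + q).
Proof. by rewrite /ch => hp hq; rewrite linearD /= hp hq scalerDr. Qed.

Lemma chZ n c p : ch n p -> ch n (c *: p).
Proof. by rewrite /ch => hp; rewrite linearZ /= hp !scalerA mulrC. Qed.

Lemma ch_D n p i : ch n.+1 p -> ch n (D i p).
Proof.
rewrite /ch => hp; have := DL i p; rewrite hp linearZ /= => h.
apply/eqP; rewrite -(inj_eq (addIr (D i p))) -h -natr1 scalerDl scale1r.
by [].
Qed.

Lemma ch_Gam n p q : ch n p -> E (Gam p q) = n%:R * E (p * q).
Proof. by move=> hp; rewrite -E_L hp -scalerAr ga_EZ [q * p]mulrC. Qed.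

Lemma ch0_D p i : ch 0 p -> D i p = 0.
Proof.
move=> hp; apply: E_eq0; have := ch_Gam p hp; rewrite mul0r /Gam E_sum => h.
have := psumr_eq0P (fun i _ => ga_E_ge0 (D i p)) h.
exact.
Qed.

Lemma ch0P p : ch 0 p <-> exists c : R, p = c%:A.
Proof.
split=> [hp|[c ->]]; first by apply: ga_const => i; exact: ch0_D.
by rewrite /ch scale0r /L big1// => i _; rewrite Dc linear0 mulr0 subrr.
Qed.

Lemma ch_D' n p i : ch n p -> ch n.-1 (D i p).
Proof. by case: n => [|n] hp; [rewrite ch0_D//; exact: ch_0|exact: ch_D]. Qed.

Lemma ch_orth m n p q : m != n -> ch m p -> ch n q -> E (p * q) = 0.
Proof.
move=> mn hp hq; have h1 := ch_Gam q hp; have := ch_Gam p hq.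
rewrite GamC h1 [q * p]mulrC => /eqP; rewrite -subr_eq0 -mulrBl mulf_eq0 subr_eq0 eqr_nat.
by rewrite (negbTE mn) => /eqP.
Qed.

Lemma ch_mean n p : ch n.+1 p -> E p = 0.
Proof.
move=> hp; have h1 : ch 0 1 by apply/ch0P; exists 1; rewrite scale1r.
by have := ch_orth (isT : n.+1 != 0) hp h1; rewrite mulr1.
Qed.

Lemma ch_deg n p : ch n p -> deg n p.
Proof.
by elim: n p => [|n IH] p hp; [exact/ch0P|move=> i; apply: IH; exact: ch_D].
Qed.

Lemma degS n p : deg n p -> deg n.+1 p.
Proof.
elim: n p => [|n IH] p; last by move=> hp i; apply: IH; exact: hp.
by move=> [c ->] i; exists 0; rewrite Dc scale0r.
Qed.

Lemma deg_le m n p : (m <= n)%N -> deg m p -> deg n p.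
Proof.
move=> /subnK <-; elim: (n - m)%N => [|j IH] // hp.
by rewrite addSn; apply: degS; exact: IH.
Qed.

Lemma degD n p q : deg n p -> deg n q -> deg n (p + q).
Proof.
elim: n p q => [|n IH] p q; last by move=> hp hq i; rewrite linearD; apply: IH; [exact: hp|exact: hq].
by move=> [c ->] [c' ->]; exists (c + c'); rewrite scalerDl.
Qed.

Lemma degZ n c p : deg n p -> deg n (c *: p).
Proof.
elim: n p => [|n IH] p; last by move=> hp i; rewrite linearZ /=; apply: IH; exact: hp.
by move=> [c' ->]; exists (c * c'); rewrite scalerA.
Qed.

Lemma degB n p q : deg n p -> deg n q -> deg n (p - q).
Proof. by move=> hp hq; apply: degD => //; rewrite -scaleN1r; exact: degZ. Qed.

Lemma deg0 n : deg n 0.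
Proof. by apply: (@deg_le 0) => //; exists 0; rewrite scale0r. Qed.

Lemma deg_sum n I (s : seq I) (f : I -> A) : (forall i, deg n (f i)) -> deg n (\sum_(i <- s) f i).
Proof.
move=> h; elim: s => [|i s IH]; first by rewrite big_nil; exact: deg0.
by rewrite big_cons; exact: degD.
Qed.

Lemma deg_D n p i : deg n p -> deg n.-1 (D i p).
Proof. by case: n => [[c ->]|n]; [rewrite Dc; exact: deg0|exact]. Qed.

Lemma degM m n p q : deg m p -> deg n q -> deg (m + n) (p * q).
Proof.
move: {2}(m + n)%N (erefl (m + n)%N) => s; elim: s m n p q => [|s IH] m n p q.
  move=> /eqP; rewrite addn_eq0 => /andP[/eqP -> /eqP ->] [c ->] [c' ->].
  by exists (c * c'); rewrite -scalerAl mul1r scalerA.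
case: m => [|m].
  rewrite add0n => _ [c ->] hq; rewrite -scalerAl mul1r; exact: degZ.
case: n => [|n].
  rewrite addn0 => _ hp [c ->]; rewrite -scalerAr mulr1; exact: degZ.
move=> [mns] hp hq; rewrite addSn => i; rewrite ga_DM; apply: degD.
  by apply: IH => //; exact: hp.
by have h := IH m.+1 n p (D i q); rewrite addSnnS in h; exact: h mns hp (hq i).
Qed.

Lemma deg_Gam m n p q : deg m p -> deg n q -> deg (m.-1 + n.-1) (Gam p q).
Proof. by move=> hp hq; apply: deg_sum => i; apply: degM; exact: deg_D. Qed.

(** Differentiation lowers the eigenvalue by one ([DL]), so the claim descends to first degree,
    where [D i p] is constant and killed by [L]. *)
Lemma deg_top n p : deg n.+1 p -> deg n (L p - n.+1%:R *: p).
Proof.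
elim: n p => [|n IH] p hp.
  apply: ga_const => i; rewrite linearB linearZ /= DL scale1r addrK.
  by have /ch0P := hp i; rewrite /ch scale0r.
move=> i; rewrite linearB linearZ /= DL -natr1 scalerDl scale1r opprD addrACA subrr addr0.
by apply: IH; exact: hp.
Qed.

(** [L - n.+1] sends degree [n.+1] to degree [n], and is invertible on the chaoses [j <= n] since
    its eigenvalue [j - n.+1] is nonzero there. Subtracting the preimage [p'] from [p] leaves an
    eigenvector of order [n.+1]. *)
Lemma deg_decomp n p : deg n p ->
  exists f : nat -> A, (forall j, ch j (f j)) /\ p = \sum_(j < n.+1) f j.
Proof.
elim: n p => [|n IH] p hp.
  exists (fun j => if j == 0%N then p else 0); split; last by rewrite big_ord1.
  by case=> [|j]; [exact/ch0P|exact: ch_0].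
have [f [hf ef]] := IH _ (deg_top hp).
pose c (j : nat) : R := (j%:R - n.+1%:R)^-1.
pose p' := \sum_(j < n.+1) c j *: f j.
have hp' : L p' - n.+1%:R *: p' = L p - n.+1%:R *: p.
  rewrite ef /p' linear_sum scaler_sumr -sumrB; apply: eq_bigr => j _ /=.
  rewrite linearZ /= hf !scalerA -scalerBl /c [n.+1%:R * _]mulrC -mulrBr mulVf ?scale1r//.
  by rewrite subr_eq0 eqr_nat neq_ltn ltn_ord.
exists (fun j => if (j < n.+1)%N then c j *: f j else if j == n.+1 then p - p' else 0); split.
  move=> j; case: ifP => _; first exact: chZ.
  case: eqP => [->|_]; last exact: ch_0.
  have e : L p' = L p - n.+1%:R *: p + n.+1%:R *: p' by rewrite -hp' subrK.
  rewrite /ch linearB /= scalerBr e; move: (n.+1%:R *: p) (n.+1%:R *: p') => u v; ring.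
rewrite big_ord_recr /= ltnn eqxx.
rewrite (eq_bigr (fun j : 'I_n.+1 => c j *: f j)) => [|j _]; last by rewrite ltn_ord.
by rewrite addrC subrK.
Qed.

Definition degl n p := if n is m.+1 then deg m p else p = 0.

Lemma deglD n p q : degl n p -> degl n q -> degl n (p + q).
Proof. by case: n => [-> ->|n]; [rewrite addr0|exact: degD]. Qed.

Lemma deglZ n c p : degl n p -> degl n (c *: p).
Proof. by case: n => [->|n]; [rewrite scaler0|exact: degZ]. Qed.

Lemma degl_D n p i : degl n p -> degl n.-1 (D i p).
Proof.
case: n => [->|[|n]]; rewrite /= ?linear0//; last exact.
by move=> [c ->]; rewrite Dc.
Qed.

Lemma ch_degl_orth n p q : ch n p -> degl n q -> E (p * q) = 0.
Proof.
case: n => [_ ->|n hp /deg_decomp[f [hf ->]]]; first by rewrite mulr0 E0.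
rewrite mulr_sumr E_sum big1// => j _; apply: ch_orth hp (hf j).
by rewrite gtn_eqF// ltn_ord.
Qed.

(* [t] is the chaos component of [p] of top order [n]. *)
Definition istop n p t := ch n t /\ degl n (p - t).

Lemma istop_deg n p t : istop n p t -> deg n p.
Proof.
move=> [ht hd]; rewrite -(subrK t p); apply: degD; last exact: ch_deg.
by case: n hd {ht} => [/= ->|n hd]; [exact: deg0|exact: degS].
Qed.

Lemma istop_ex n p : deg n p -> exists t, istop n p t.
Proof.
move=> /deg_decomp[f [hf ->]]; exists (f n); split=> //.
rewrite big_ord_recr /= addrK; case: n => [|n] /=; first by rewrite big_ord0.
apply: deg_sum => j; apply: (@deg_le j); last exact: ch_deg.
by rewrite -ltnS ltn_ord.
Qed.

Lemma istop_uniq n p t t' : istop n p t -> istop n p t' -> t = t'.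
Proof.
move=> [ht hd] [ht' hd']; apply/eqP; rewrite -subr_eq0; apply/eqP; apply: E_eq0.
have h : degl n (t - t').
  have -> : t - t' = (p - t') + (-1) *: (p - t) by rewrite scaleN1r; ring.
  by apply: deglD => //; exact: deglZ.
apply: (@ch_degl_orth n) h; apply: chD => //; rewrite -scaleN1r; exact: chZ.
Qed.

Lemma istop0 n : istop n 0 0.
Proof. by split; [exact: ch_0|rewrite subrr; case: n => // n; exact: deg0]. Qed.

Lemma istopD n p q t t' : istop n p t -> istop n q t' -> istop n (p + q) (t + t').
Proof.
move=> [ht hd] [ht' hd']; split; first exact: chD.
by rewrite opprD addrACA; exact: deglD.
Qed.

Lemma istop_sum n I (s : seq I) (f t : I -> A) : (forall i, istop n (f i) (t i)) ->
  istop n (\sum_(i <- s) f i) (\sum_(i <- s) t i).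
Proof.
move=> h; elim: s => [|i s IH]; first by rewrite !big_nil; exact: istop0.
by rewrite !big_cons; exact: istopD.
Qed.

Lemma istop_D n p t i : istop n p t -> istop n.-1 (D i p) (D i t).
Proof.
by move=> [ht hd]; split; [exact: ch_D'|rewrite -linearB; exact: degl_D].
Qed.

Lemma istop_ch n p : ch n p -> istop n p p.
Proof. by move=> hp; split=> //; rewrite subrr; case: n hp => // n _; exact: deg0. Qed.

Lemma istop_orth n p t q : istop n p t -> ch n q -> E (q * p) = E (q * t).
Proof.
move=> [ht hd] hq; apply/eqP; rewrite -subr_eq0 -EB -mulrBr.
by rewrite (ch_degl_orth hq hd).
Qed.

Definition topc n p : A := xget 0 [set t | istop n p t].

Lemma topcP n p : deg n p -> istop n p (topc n p).
Proof. by move=> /istop_ex [t ht]; rewrite /topc; case: xgetP => [y -> //|/(_ t)]. Qed.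

Lemma topcE n p t : istop n p t -> topc n p = t.
Proof. by move=> h; apply: (@istop_uniq n p) => //; apply: topcP; exact: istop_deg h. Qed.

Definition Nr p : R := Num.sqrt (E (p * p)).

Lemma Nr_ge0 p : 0 <= Nr p. Proof. exact: sqrtr_ge0. Qed.

Lemma NrX p : Nr p ^+ 2 = E (p * p).
Proof. by rewrite sqr_sqrtr// ga_E_ge0. Qed.

Lemma E_le_Nr p q : E (p * q) <= Nr p * Nr q.
Proof.
apply: le_trans (ler_norm _) _; rewrite -sqrtr_sqr -sqrtrM ?ga_E_ge0//.
by rewrite ler_wsqrtr// E_CS.
Qed.

Lemma NrD p q : Nr (p + q) <= Nr p + Nr q.
Proof.
rewrite -(@ler_pXn2r _ 2)// ?nnegrE ?Nr_ge0 ?addr_ge0 ?Nr_ge0//.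
rewrite NrX sqrrD !NrX mulrDl !mulrDr !ga_ED [q * p]mulrC.
by have := E_le_Nr p q; lra.
Qed.

Lemma NrZ c p : Nr (c *: p) = `|c| * Nr p.
Proof.
by rewrite /Nr -scalerAl -scalerAr scalerA ga_EZ sqrtrM ?sqrtr_sqr// -expr2 sqr_ge0.
Qed.

Lemma Nr_sum I (s : seq I) (f : I -> A) : Nr (\sum_(i <- s) f i) <= \sum_(i <- s) Nr (f i).
Proof.
elim: s => [|i s IH]; first by rewrite !big_nil /Nr mulr0 E0 sqrtr0.
by rewrite !big_cons; apply: le_trans (NrD _ _) _; rewrite lerD2l.
Qed.

(** Hypercontractivity by induction on the order. For order [n.+1], integration by parts gives
    [(n+1) E p^4 = 3 E (p^2 Gam p p)]. Cauchy-Schwarz bounds [E (p^2 (D i p)^2)] by [Nr (p * p)]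
    times [Nr (D i p * D i p)], the induction hypothesis bounds the latter, and one factor
    [Nr (p * p)] cancels. *)
Lemma ch_hyper n p : ch n p -> Nr (p * p) <= 3 ^+ n * Nr p ^+ 2.
Proof.
elim: n p => [|n IH] p hp.
  have /ch0P [c ->] := hp; rewrite expr0 mul1r NrX -scalerAl mul1r NrZ ga_EZ Ec.
  rewrite /Nr -scalerAl mul1r scalerA ga_EZ ga_E1 mulr1 -expr2 sqrtr_sqr.
  by rewrite -normrM ger0_norm// -expr2 sqr_ge0.
set a := Nr (p * p).
have a2 : a ^+ 2 * n.+1%:R <= 3 * (a * (3 ^+ n * (n.+1%:R * E (p * p)))).
  rewrite /a NrX mulrC.
  have -> : n.+1%:R * E (p * p * (p * p)) = 3 * E (p * p * Gam p p).
    have := ch_Gam (p * p * p) hp; rewrite !GamMr => h.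
    have -> : p * p * (p * p) = p * (p * p * p) by rewrite !mulrA.
    rewrite -h -[3]/(1 + 1 + 1)%:R natrD natrD !mulrDl !mul1r -!ga_ED; congr (E _).
    ring.
  rewrite ler_wpM2l// -(ch_Gam p hp) /Gam mulr_sumr !E_sum !mulr_sumr; apply: ler_sum => i _.
  apply: le_trans (E_le_Nr _ _) _; rewrite ler_wpM2l ?Nr_ge0//.
  by rewrite -NrX; apply: IH; exact: ch_D.
have a0 : 0 <= a by exact: Nr_ge0.
have [->|an] := eqVneq a 0; first by rewrite mulr_ge0 ?exprn_ge0 ?Nr_ge0.
have ap : 0 < a by rewrite lt_neqAle eq_sym an.
have np : 0 < n.+1%:R :> R by [].
have : (a * n.+1%:R) * a <= (a * n.+1%:R) * (3 ^+ n.+1 * E (p * p)).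
  have -> : a * n.+1%:R * a = a ^+ 2 * n.+1%:R by ring.
  by apply: le_trans a2 _; rewrite exprS le_eqVlt; apply/orP; left; apply/eqP; ring.
by rewrite NrX ler_pM2l// mulr_gt0.
Qed.

Lemma sqrt_mono (a b : R) : 0 <= b -> a ^+ 2 <= b ^+ 2 -> a <= b.
Proof.
move=> b0 h; apply: le_trans (ler_norm _) _.
by rewrite -(@ler_pXn2r _ 2) ?nnegrE// real_normK ?num_real.
Qed.

Lemma Nr_mul_le p q (a b : R) : 0 <= a -> 0 <= b -> Nr (p * p) <= a * Nr p ^+ 2 ->
  Nr (q * q) <= b * Nr q ^+ 2 -> Nr (p * q) ^+ 2 <= a * b * (Nr p * Nr q) ^+ 2.
Proof.
move=> a0 b0 hp hq; rewrite NrX mulrACA; apply: le_trans (E_le_Nr _ _) _.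
rewrite exprMn mulrACA; apply: ler_pM => //; exact: Nr_ge0.
Qed.

Lemma CS_sum m (a : 'I_m -> R) : (\sum_i a i) ^+ 2 <= m%:R * \sum_i a i ^+ 2.
Proof.
elim: m a => [|m IH] a; first by rewrite !big_ord0 expr0n mulr0.
rewrite !big_ord_recr /=; set s := \sum_(i < m) a _; set b := a ord_max.
have := IH (fun i => a (widen_ord (leqnSn m) i)); rewrite -/s; set S := \sum_(i < m) _ => h.
rewrite -[m.+1%:R]natr1 -/s.
have [m0|m0] := posnP m.
  have s0 : s = 0 by rewrite /s; move: (a); rewrite m0 => ?; rewrite big_ord0.
  have S0 : S = 0 by rewrite /S; move: (a); rewrite m0 => ?; rewrite big_ord0.
  by rewrite s0 S0 m0 !add0r mul1r.
have mp : 0 < m%:R :> R by rewrite ltr0n.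
suff : 2 * s * b <= S + m%:R * b ^+ 2 by rewrite sqrrD; lra.
have : 0 <= (s - m%:R * b) ^+ 2 by exact: sqr_ge0.
rewrite sqrrB exprMn => h2.
rewrite -(ler_pM2l mp); nra.
Qed.

(** [3 ^+ n] is the constant on a single chaos, and [n.+1] the cost of Cauchy-Schwarz over the
    chaoses of order at most [n]. *)
Definition hc n : R := 3 ^+ n * n.+1%:R.

Lemma hc_ge1 n : 1 <= hc n.
Proof. by rewrite /hc mulr_ege1 ?ler1n// exprn_ege1// (ler1n _ 3). Qed.

Lemma deg_hyper n p : deg n p -> Nr (p * p) <= hc n * Nr p ^+ 2.
Proof.
move=> /deg_decomp [f [hf ->]]; set S := \sum_(j < n.+1) f j.
have N2 : Nr S ^+ 2 = \sum_(j < n.+1) Nr (f j) ^+ 2.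
  rewrite NrX /S mulr_suml E_sum; apply: eq_bigr => i _.
  rewrite mulr_sumr E_sum (bigD1 i)//= NrX big1 ?addr0// => j ji.
  by apply: ch_orth (hf i) (hf j); rewrite eq_sym.
have h (i j : 'I_n.+1) : Nr (f i * f j) <= 3 ^+ n * (Nr (f i) * Nr (f j)).
  have h0 : 0 <= (3 : R) ^+ n by rewrite exprn_ge0.
  apply: sqrt_mono; first by rewrite !mulr_ge0 ?Nr_ge0.
  apply: le_trans (Nr_mul_le _ _ (ch_hyper (hf i)) (ch_hyper (hf j))) _; rewrite ?exprn_ge0//.
  rewrite [leRHS]exprMn ler_wpM2r ?sqr_ge0// [leRHS]expr2 ler_pM ?exprn_ge0// ler_weXn2l// ?(ler1n _ 3)//.
    exact: leq_ord.
  exact: leq_ord.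
rewrite {1 2}/S mulr_suml; apply: le_trans (Nr_sum _ _) _.
apply: le_trans (_ : \sum_(i < n.+1) \sum_(j < n.+1) 3 ^+ n * (Nr (f i) * Nr (f j)) <= _).
  apply: ler_sum => i _; rewrite mulr_sumr; apply: le_trans (Nr_sum _ _) _.
  by apply: ler_sum => j _.
have -> : \sum_(i < n.+1) \sum_(j < n.+1) 3 ^+ n * (Nr (f i) * Nr (f j)) =
    3 ^+ n * (\sum_(i < n.+1) Nr (f i)) ^+ 2.
  rewrite expr2 mulr_suml mulr_sumr; apply: eq_bigr => i _.
  by rewrite !mulr_sumr.
rewrite /hc -mulrA ler_wpM2l ?exprn_ge0// N2.
exact: CS_sum.
Qed.

Lemma deg_mulN m n p q : deg m p -> deg n q -> Nr (p * q) <= hc m * hc n * (Nr p * Nr q).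
Proof.
move=> hp hq; have h1 := hc_ge1 m; have h2 := hc_ge1 n.
have h0 : 1 <= hc m * hc n by rewrite -[1]mulr1 ler_pM.
apply: sqrt_mono; first by rewrite !mulr_ge0 ?Nr_ge0//; lra.
apply: le_trans (Nr_mul_le _ _ (deg_hyper hp) (deg_hyper hq)) _; try lra.
rewrite [leRHS]exprMn ler_wpM2r ?sqr_ge0// [leRHS]expr2 ler_peMl//; lra.
Qed.

Lemma deg_Gam_le m p : deg m p -> E (Gam p p) <= m%:R * Nr p ^+ 2.
Proof.
move=> /deg_decomp [f [hf ->]]; set S := \sum_(j < m.+1) f j.
have N2 : Nr S ^+ 2 = \sum_(j < m.+1) Nr (f j) ^+ 2.
  rewrite NrX /S mulr_suml E_sum; apply: eq_bigr => i _.
  rewrite mulr_sumr E_sum (bigD1 i)//= NrX big1 ?addr0// => j ji.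
  by apply: ch_orth (hf i) (hf j); rewrite eq_sym.
have -> : E (Gam S S) = \sum_(j < m.+1) j%:R * Nr (f j) ^+ 2.
  rewrite -E_L {2}/S linear_sum mulr_sumr E_sum; apply: eq_bigr => i _ /=.
  rewrite hf -scalerAr ga_EZ; congr (_ * _); rewrite /S mulr_suml E_sum (bigD1 i)//= NrX.
  by rewrite big1 ?addr0// => j ji; apply: ch_orth (hf j) (hf i).
rewrite N2 mulr_sumr; apply: ler_sum => j _; apply: ler_wpM2r; first exact: sqr_ge0.
by rewrite ler_nat -ltnS ltn_ord.
Qed.

Lemma E_GamE p : E (Gam p p) = \sum_i Nr (D i p) ^+ 2.
Proof. by rewrite /Gam E_sum; apply: eq_bigr => i _; rewrite NrX. Qed.

Lemma CS_sum2 I (s : seq I) (a b : I -> R) :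
  (\sum_(i <- s) a i * b i) ^+ 2 <= (\sum_(i <- s) a i ^+ 2) * (\sum_(i <- s) b i ^+ 2).
Proof.
have a0 t : 0 <= \sum_(i <- t) a i ^+ 2 by apply: sumr_ge0 => i _; exact: sqr_ge0.
have b0 t : 0 <= \sum_(i <- t) b i ^+ 2 by apply: sumr_ge0 => i _; exact: sqr_ge0.
elim: s => [|i s IH]; first by rewrite !big_nil expr0n mulr0.
rewrite !big_cons; have := a0 s; have := b0 s.
move: IH; set S := \sum_(j <- s) a j * b j; set u := \sum_(j <- s) a j ^+ 2.
set v := \sum_(j <- s) b j ^+ 2 => h v0 u0; set y := a i; set z := b i.
suff : 2 * (y * z) * S <= y ^+ 2 * v + u * z ^+ 2 by rewrite sqrrD exprMn; lra.
have w0 : 0 <= y ^+ 2 * v + u * z ^+ 2 by rewrite addr_ge0// mulr_ge0// sqr_ge0.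
apply: sqrt_mono => //.
have : 4 * (y * z) ^+ 2 * S ^+ 2 <= 4 * (y * z) ^+ 2 * (u * v).
  by apply: ler_wpM2l => //; rewrite mulr_ge0// sqr_ge0.
have : 0 <= (y ^+ 2 * v - u * z ^+ 2) ^+ 2 by exact: sqr_ge0.
move=> h1 h2; rewrite !exprMn in h2 *; nra.
Qed.

(** [deg_mulN] on each [D i p * D i q], then Cauchy-Schwarz over [i]; the sums of squares are
    energies, bounded by [deg_Gam_le]. *)
Lemma deg_GamN m n p q : deg m p -> deg n q ->
  Nr (Gam p q) ^+ 2 <= (hc m * hc n) ^+ 2 * (m%:R * n%:R) * (Nr p ^+ 2 * Nr q ^+ 2).
Proof.
move=> hp hq; have h1 := hc_ge1 m; have h2 := hc_ge1 n.
have hh n' : hc n'.-1 <= hc n'.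
  rewrite /hc ler_pM ?exprn_ge0// ?ler_nat ?ler_weXn2l ?ler1n ?leq_pred//.
  by case: n'.
have h0 : 0 <= hc m * hc n by rewrite mulr_ge0//; lra.
have b : Nr (Gam p q) <= hc m * hc n * \sum_i Nr (D i p) * Nr (D i q).
  apply: le_trans (Nr_sum _ _) _; rewrite mulr_sumr; apply: ler_sum => i _.
  apply: le_trans (deg_mulN (deg_D i hp) (deg_D i hq)) _.
  have q1 := hc_ge1 m.-1; have q2 := hc_ge1 n.-1.
  rewrite ler_wpM2r ?mulr_ge0 ?Nr_ge0// ler_pM// ?hh//; lra.
have b0 : 0 <= \sum_i Nr (D i p) * Nr (D i q).
  by apply: sumr_ge0 => i _; rewrite mulr_ge0 ?Nr_ge0.
apply: le_trans (_ : (hc m * hc n * \sum_i Nr (D i p) * Nr (D i q)) ^+ 2 <= _).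
  by rewrite lerXn2r ?nnegrE ?Nr_ge0// mulr_ge0.
rewrite exprMn -mulrA ler_wpM2l ?sqr_ge0//; apply: le_trans (CS_sum2 _ _ _) _.
rewrite -!E_GamE mulrACA; apply: ler_pM; try exact: deg_Gam_le.
  by rewrite E_GamE; apply: sumr_ge0 => i _; exact: sqr_ge0.
by rewrite E_GamE; apply: sumr_ge0 => i _; exact: sqr_ge0.
Qed.

End gauss_alg_theory.

(** * Contractions and the fourth moment *)

Section contractions.
Context {R : realType} (A : gauss_alg R).
Implicit Types (F U V X : A).
Local Notation k := (ga_dim A).
Local Notation D := (@ga_D R A).
Local Notation E := (@ga_E R A).

(** For chaos elements the top component is, up to a factor, the multiple integral of the
    symmetrized contraction of order [r]. *)
Fixpoint Gr (r : nat) F U : A := if r is r'.+1 then \sum_i Gr r' (D i F) (D i U) else F * U.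

Lemma Gr_D i r F U : D i (Gr r F U) = Gr r (D i F) U + Gr r F (D i U).
Proof.
elim: r F U => [|r IH] F U /=; first exact: ga_DM.
rewrite linear_sum -big_split; apply: eq_bigr => j _ /=.
by rewrite IH !(ga_DC i j).
Qed.

Lemma Gr0l r U : Gr r 0 U = 0.
Proof. by elim: r U => [|r IH] U /=; rewrite ?mul0r// big1// => i _; rewrite linear0 IH. Qed.

Lemma GrC r F U : Gr r F U = Gr r U F.
Proof. by elim: r F U => [|r IH] F U /=; [rewrite mulrC|apply: eq_bigr => i _]. Qed.

Lemma Gr_over m r F U : ch m F -> (m < r)%N -> Gr r F U = 0.
Proof.
elim: r m F U => [|r IH] m F U //= hF mr; apply: big1 => i _.
case: m hF mr => [|m] hF mr; first by rewrite ch0_D// Gr0l.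
by apply: (IH m) => //; exact: ch_D.
Qed.

Lemma deg_Gr m n r F U : (r <= m)%N -> (r <= n)%N -> ch m F -> ch n U ->
  deg ((m - r) + (n - r)) (Gr r F U).
Proof.
elim: r m n F U => [|r IH] m n F U /=.
  by move=> _ _ hF hU; rewrite !subn0; apply: degM; exact: ch_deg.
case: m => [|m] //; case: n => [|n] // rm rn hF hU.
by apply: deg_sum => i; rewrite !subSS; apply: IH => //; exact: ch_D.
Qed.

Lemma E_Gr m r F U : ch m F -> E (Gr r F U) = (m ^_ r)%:R * E (F * U).
Proof.
elim: r m F U => [|r IH] m F U hF /=; first by rewrite ffactn0 mul1r.
case: m hF => [|m] hF.
  rewrite ffact0n mul0r big1 ?E0// => i _.
  by rewrite ch0_D// Gr0l.
rewrite E_sum (eq_bigr (fun i => (m ^_ r)%:R * E (D i F * D i U))) => [|i _]; last first.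
  by apply: IH; exact: ch_D.
rewrite -mulr_sumr -E_sum -/(Gam F U) (ch_Gam _ hF) mulrA -natrM mulnC.
by rewrite ffactSS.
Qed.

Lemma topc0 n : topc n (0 : A) = 0.
Proof. exact: (topcE (istop0 A n)). Qed.

Lemma istop_Gr m n r F U : (r <= m)%N -> (r <= n)%N -> ch m F -> ch n U ->
  istop ((m - r) + (n - r)) (Gr r F U) (topc ((m - r) + (n - r)) (Gr r F U)).
Proof. by move=> rm rn hF hU; apply: topcP; exact: deg_Gr. Qed.

Lemma topc_Gr_D m n r F U i : ch m F -> ch n U ->
  D i (topc ((m - r) + (n - r)) (Gr r F U)) =
  topc ((m.-1 - r) + (n - r)) (Gr r (D i F) U) + topc ((m - r) + (n.-1 - r)) (Gr r F (D i U)).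
Proof.
move=> hF hU; have hF' := ch_D' i hF; have hU' := ch_D' i hU.
have [rm|mr] := leqP r m; last first.
  rewrite !(Gr_over _ hF mr) !topc0 linear0 addr0 (Gr_over _ hF') ?topc0//.
  by apply: leq_ltn_trans mr; exact: leq_pred.
have [rn|nr] := leqP r n; last first.
  rewrite ![Gr _ _ U]GrC [Gr r F (D i U)]GrC !(Gr_over _ hU nr) !topc0 linear0 add0r (Gr_over _ hU') ?topc0//.
  by apply: leq_ltn_trans nr; exact: leq_pred.
have ht := istop_D i (istop_Gr rm rn hF hU).
have {ht} <- := topcE ht; rewrite Gr_D.
(* When [r = m] the order of the first summand does not drop, natural subtraction being truncated;
   that summand vanishes because it contains [r.+1] derivatives of [F]. The case [r = n] is
   symmetric. *)
have [Em|rm'] := eqVneq r m; have [En|rn'] := eqVneq r n.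
- have z1 : Gr r (D i F) U = 0.
    case: m {rm} Em hF hF' => [|m] -> hF hF'; first by rewrite ch0_D// Gr0l.
    by apply: (Gr_over _ hF').
  have z2 : Gr r F (D i U) = 0.
    rewrite GrC; case: n {rn} En hU hU' => [|n] -> hU hU'; first by rewrite ch0_D// Gr0l.
    by apply: (Gr_over _ hU').
  by rewrite z1 z2 !topc0 addr0 topc0.
- have z1 : Gr r (D i F) U = 0.
    case: m {rm} Em hF hF' => [|m] -> hF hF'; first by rewrite ch0_D// Gr0l.
    by apply: (Gr_over _ hF').
  rewrite z1 topc0 !add0r -Em subnn !add0n; congr (topc _ _).
  by rewrite -!subn1 subnAC.
- have z2 : Gr r F (D i U) = 0.
    rewrite GrC; case: n {rn} En hU hU' => [|n] -> hU hU'; first by rewrite ch0_D// Gr0l.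
    by apply: (Gr_over _ hU').
  rewrite z2 topc0 !addr0 -En subnn !addn0; congr (topc _ _).
  by rewrite -!subn1 subnAC.
have rm2 : (r < m)%N by rewrite ltn_neqAle rm' rm.
have rn2 : (r < n)%N by rewrite ltn_neqAle rn' rn.
case: m hF hF' rm rm' rm2 => // m hF hF' rm rm' rm2.
case: n hU hU' rn rn' rn2 => // n hU hU' rn rn' rn2.
have e1 : ((m.+1 - r) + (n.+1 - r)).-1 = ((m - r) + (n.+1 - r))%N by rewrite subSn.
have e2 : ((m.+1 - r) + (n.+1 - r)).-1 = ((m.+1 - r) + (n - r))%N.
  by rewrite [(n.+1 - r)%N]subSn// addnS.
by apply: topcE; apply: istopD; [rewrite e1|rewrite e2]; exact: istop_Gr.
Qed.

(** Product formula. By induction on [m + n] both sides have the same derivatives, so they differ by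
    a constant; it is zero because the means agree, the only term of order zero being [r = m = n].
    Terms with [r > m] or [r > n] vanish, so any large enough [K] is allowed. *)
Lemma ch_prod m n F U K : (m + n < K)%N -> ch m F -> ch n U ->
  F * U = \sum_(r < K) (r`!%:R : R)^-1 *: topc ((m - r) + (n - r)) (Gr r F U).
Proof.
move: {2}(m + n)%N (erefl (m + n)%N) => s; elim: s m n F U => [|s IH] m n F U.
  move=> /eqP; rewrite addn_eq0 => /andP[/eqP -> /eqP ->] K0 hF hU.
  case: K K0 => // K _; rewrite big_ord_recl big1 ?addr0 => [|r _]; last first.
    by rewrite (Gr_over _ hF)// topc0 scaler0.
  rewrite /= fact0 invr1 scale1r; apply/esym/topcE/istop_ch.
  by have /ch0P[c ->] := hF; rewrite -scalerAl mul1r; exact: chZ.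
move=> mns sK hF hU; apply/eqP; rewrite -subr_eq0; apply/eqP.
set Z := F * U - _.
have dZ i : D i Z = 0.
  rewrite /Z linearB linear_sum ga_DM.
  rewrite (eq_bigr (fun r : 'I_K => (r`!%:R : R)^-1 *: topc ((m.-1 - r) + (n - r)) (Gr r (D i F) U) +
      (r`!%:R : R)^-1 *: topc ((m - r) + (n.-1 - r)) (Gr r F (D i U)))); last first.
    by move=> r _; rewrite linearZ /= topc_Gr_D// scalerDr.
  rewrite big_split /= opprD addrACA.
  have -> : D i F * U = \sum_(r < K) (r`!%:R : R)^-1 *: topc ((m.-1 - r) + (n - r)) (Gr r (D i F) U).
    clear Z; case: m hF mns sK => [|m] hF mns sK.
      by rewrite ch0_D// mul0r big1// => r _; rewrite Gr0l topc0 scaler0.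
    apply: IH; [by case: mns|apply: ltn_trans sK|exact: ch_D|exact: hU].
    by rewrite addSn.
  have -> : F * D i U = \sum_(r < K) (r`!%:R : R)^-1 *: topc ((m - r) + (n.-1 - r)) (Gr r F (D i U)).
    clear Z; case: n hU mns sK => [|n] hU mns sK.
      by rewrite ch0_D// mulr0 big1// => r _; rewrite GrC Gr0l topc0 scaler0.
    apply: IH; [by move: mns; rewrite addnS => -[]|apply: ltn_trans sK|exact: hF|exact: ch_D].
    by rewrite addnS.
  by rewrite !subrr addr0.
suff EZ : E Z = 0 by have [c Zc] := ga_const dZ; move: EZ; rewrite Zc Ec => ->; rewrite scale0r.
rewrite /Z EB E_sum; apply/eqP; rewrite subr_eq0; apply/eqP.
have tE (r : nat) : (r != m) || (r != n) -> E (topc ((m - r) + (n - r)) (Gr r F U)) = 0.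
  move=> rmn; have [rm|mr] := leqP r m; last by rewrite (Gr_over _ hF)// topc0 E0.
  have [rn|nr] := leqP r n; last by rewrite GrC (Gr_over _ hU)// topc0 E0.
  have [h _] := istop_Gr rm rn hF hU; move: h.
  case e : ((m - r) + (n - r))%N => [|j]; last exact: ch_mean.
  move/eqP: e; rewrite addn_eq0 !subn_eq0 => /andP[mr nr].
  by move: rmn; rewrite !eqn_leq rm mr rn nr.
have [Emn|mn] := eqVneq m n; last first.
  rewrite (ch_orth mn hF hU) big1// => r _; rewrite ga_EZ tE ?mulr0//.
  by have [->|//] := eqVneq (r : nat) m.
have mK : (m < K)%N by apply: leq_ltn_trans sK; exact: leq_addr.
rewrite (bigD1 (Ordinal mK))//= big1 ?addr0 => [|r rm]; last first.
  by rewrite ga_EZ tE ?mulr0//; apply/orP; left; apply: contraNN rm => /eqP e; apply/eqP/val_inj.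
rewrite ga_EZ.
have hm : (m <= n)%N by rewrite Emn.
have := istop_Gr (leqnn m) hm hF hU; rewrite -Emn subnn => -[_ /= /eqP].
rewrite subr_eq0 => /eqP <-; rewrite (E_Gr _ _ hF) ffactnn mulKf//.
Qed.

(** Symmetrizing a tensor increases its norm at most by a constant, here a crude one. A derivative
    of [t] splits as [t1 + t2], hitting [F] or [U], and each of the [m + n] derivations costs a
    factor [2] through [(a + b)^2 <= 2 a^2 + 2 b^2]. *)
Lemma top_bound m n I (s : seq I) (F U : I -> A) t :
  (forall j, ch m (F j)) -> (forall j, ch n (U j)) ->
  istop (m + n) (\sum_(j <- s) F j * U j) t ->
  E (t * t) <= 2 ^+ (m + n) *
    \sum_(j <- s) \sum_(j' <- s) E (F j * F j') * E (U j * U j').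
Proof.
move: {2}(m + n)%N (erefl (m + n)%N) => w; elim: w m n F U t => [|w IH] m n F U t.
  move=> /eqP; rewrite addn_eq0 => /andP[/eqP -> /eqP ->] hF hU [_ /eqP].
  rewrite expr0 mul1r subr_eq0 => /eqP <-.
  rewrite mulr_suml E_sum le_eqVlt; apply/orP; left; apply/eqP; apply: eq_bigr => j _.
  rewrite mulr_sumr E_sum; apply: eq_bigr => j' _.
  have /ch0P[a ->] := hF j; have /ch0P[b ->] := hU j; have /ch0P[c ->] := hF j'.
  have /ch0P[e ->] := hU j'.
  by rewrite !scalarM !Ec; ring.
move=> mnw hF hU ht.
have key i : exists t1 t2, [/\ D i t = t1 + t2,
    istop w (\sum_(j <- s) D i (F j) * U j) t1 & istop w (\sum_(j <- s) F j * D i (U j)) t2].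
  have d1 : deg w (\sum_(j <- s) D i (F j) * U j).
    apply: deg_sum => j; case: m mnw hF {ht} => [|m] mnw hF.
      by rewrite ch0_D// mul0r; exact: deg0.
    by move: mnw; rewrite addSn => -[<-]; apply: degM; apply: ch_deg => //; exact: ch_D.
  have d2 : deg w (\sum_(j <- s) F j * D i (U j)).
    apply: deg_sum => j; case: n mnw hU {ht} => [|n] mnw hU.
      by rewrite ch0_D// mulr0; exact: deg0.
    by move: mnw; rewrite addnS => -[<-]; apply: degM; apply: ch_deg => //; exact: ch_D.
  have [t1 h1] := istop_ex d1; have [t2 h2] := istop_ex d2.
  exists t1, t2; split=> //; have h := istop_D i ht; rewrite mnw /= in h.
  apply: (istop_uniq h); rewrite linear_sum.
  under eq_bigr do rewrite /= ga_DM.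
  by rewrite big_split; exact: istopD.
pose S (F' U' : I -> A) : R := \sum_(j <- s) \sum_(j' <- s) E (F' j * F' j') * E (U' j * U' j').
have b i : E (D i t * D i t) <= 2 ^+ w.+1 *
    ((0 < m)%N%:R * S (fun j => D i (F j)) U + (0 < n)%N%:R * S F (fun j => D i (U j))).
  have [t1 [t2 [-> h1 h2]]] := key i.
  have b1 : E (t1 * t1) <= 2 ^+ w * ((0 < m)%N%:R * S (fun j => D i (F j)) U).
    case: m mnw hF h1 {ht} => [|m] mnw hF h1.
      have -> : t1 = 0.
        apply: (istop_uniq h1); rewrite big1 => [|j _]; last by rewrite ch0_D// mul0r.
        exact: istop0.
      by rewrite mul0r E0 mul0r mulr0.
    move: mnw; rewrite addSn => -[mnw]; rewrite mul1r -mnw; rewrite -mnw in h1.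
    by apply: IH h1 => // j; exact: ch_D.
  have b2 : E (t2 * t2) <= 2 ^+ w * ((0 < n)%N%:R * S F (fun j => D i (U j))).
    case: n mnw hU h2 {ht} => [|n] mnw hU h2.
      have -> : t2 = 0.
        apply: (istop_uniq h2); rewrite big1 => [|j _]; last by rewrite ch0_D// mulr0.
        exact: istop0.
      by rewrite mul0r E0 mul0r mulr0.
    move: mnw; rewrite addnS => -[mnw]; rewrite mul1r -mnw; rewrite -mnw in h2.
    by apply: IH h2 => // j; exact: ch_D.
  have := ga_E_ge0 (t1 - t2).
  rewrite mulrBl !mulrBr !EB mulrDl !mulrDr !ga_ED exprS [t2 * t1]mulrC; lra.
have SF : \sum_i S (fun j => D i (F j)) U = m%:R * S F U.
  rewrite /S exchange_big mulr_sumr; apply: eq_bigr => j _.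
  rewrite exchange_big mulr_sumr; apply: eq_bigr => j' _.
  by rewrite -mulr_suml mulrA -(ch_Gam _ (hF j)) /Gam E_sum.
have SU : \sum_i S F (fun j => D i (U j)) = n%:R * S F U.
  rewrite /S exchange_big mulr_sumr; apply: eq_bigr => j _.
  rewrite exchange_big mulr_sumr; apply: eq_bigr => j' _.
  by rewrite -mulr_sumr mulrCA -(ch_Gam _ (hU j)) /Gam E_sum.
have mn0 : 0 < (m + n)%:R :> R by rewrite mnw ltr0n.
rewrite -(ler_pM2l mn0) -(ch_Gam _ (proj1 ht)) /Gam E_sum.
apply: le_trans (ler_sum _ (fun i _ => b i)) _.
rewrite -mulr_sumr big_split /= -!mulr_sumr SF SU -/(S F U) mnw.
have -> : (0 < m)%N%:R * (m%:R * S F U) = m%:R * S F U.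
  by case: (m) => [|m']; rewrite ?mul0r ?mul1r.
have -> : (0 < n)%N%:R * (n%:R * S F U) = n%:R * S F U.
  by case: (n) => [|n']; rewrite ?mul0r ?mul1r.
by rewrite -mulrDl -natrD mnw mulrCA.
Qed.

Fixpoint idx (r : nat) : seq (seq 'I_k) :=
  if r is r'.+1 then [seq i :: J | i <- enum 'I_k, J <- idx r'] else [:: [::]].

Definition DJ (J : seq 'I_k) F : A := foldl (fun F i => D i F) F J.

Lemma big_idxS (V : nmodType) r (f : seq 'I_k -> V) :
  \sum_(J <- idx r.+1) f J = \sum_i \sum_(J <- idx r) f (i :: J).
Proof.
rewrite /= big_flatten big_map big_enum /=; apply: eq_bigr => i _.
by rewrite big_map.
Qed.

Lemma Gr_idx r F U : Gr r F U = \sum_(J <- idx r) DJ J F * DJ J U.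
Proof.
elim: r F U => [|r IH] F U; first by rewrite /= big_seq1.
by rewrite big_idxS /=; apply: eq_bigr => i _; rewrite IH.
Qed.

Lemma idx_size r J : J \in idx r -> size J = r.
Proof.
elim: r J => [|r IH] J /=; first by rewrite inE => /eqP ->.
by move=> /allpairsP[[i J'] /= [_ /IH h ->]] /=; rewrite h.
Qed.

Lemma ch_DJ m J F : ch m F -> ch (m - size J) (DJ J F).
Proof.
elim: J m F => [|i J IH] m F hF /=; first by rewrite subn0.
have -> : (m - (size J).+1 = m.-1 - size J)%N by rewrite -subn1 -subnDA add1n.
by apply: IH; exact: ch_D'.
Qed.

Lemma DJ_D i J F : DJ J (D i F) = D i (DJ J F).
Proof. by elim: J F => //= j J IH F; rewrite ga_DC IH. Qed.

Lemma DJ_comm J J' F : DJ J (DJ J' F) = DJ J' (DJ J F).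
Proof. by elim: J F => //= j J IH F; rewrite -DJ_D IH. Qed.

(** For [F] of chaos order [p], this is up to a factor the squared norm of the contraction of [F]
    with itself over [p - r] arguments: the expectation integrates out what [J] and [J'] leave. *)
Definition Kr r F : R := \sum_(J <- idx r) \sum_(J' <- idx r) E (DJ J F * DJ J' F) ^+ 2.

Lemma Kr_ge0 r F : 0 <= Kr r F.
Proof. by apply: sumr_ge0 => J _; apply: sumr_ge0 => J' _; exact: sqr_ge0. Qed.

Lemma idx_contr_le n r F U : ch n U ->
  \sum_(J <- idx r) \sum_(J' <- idx r) E (DJ J F * DJ J' F) * E (DJ J U * DJ J' U) <=
  Num.sqrt (Kr r F) * ((n ^_ r)%:R * E (U * U)).
Proof.
move=> hU.
have u0 : 0 <= (n ^_ r)%:R * E (U * U) by rewrite mulr_ge0 ?ga_E_ge0.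
apply: sqrt_mono; first by rewrite mulr_ge0// sqrtr_ge0.
rewrite exprMn sqr_sqrtr ?Kr_ge0//.
set a := fun J J' => E (DJ J F * DJ J' F); set b := fun J J' => E (DJ J U * DJ J' U).
have pr (f : seq 'I_k -> seq 'I_k -> R) : \sum_(J <- idx r) \sum_(J' <- idx r) f J J' =
    \sum_(z <- [seq (J, J') | J <- idx r, J' <- idx r]) f z.1 z.2.
  by rewrite big_allpairs.
rewrite (pr (fun J J' => a J J' * b J J')); apply: le_trans (CS_sum2 _ _ _) _.
rewrite -(pr (fun J J' => a J J' ^+ 2)) -(pr (fun J J' => b J J' ^+ 2)) -/(Kr r F).
apply: ler_wpM2l; first exact: Kr_ge0.
rewrite -(E_Gr _ _ hU) Gr_idx E_sum expr2 mulr_suml; apply: ler_sum => J _.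
by rewrite mulr_sumr; apply: ler_sum => J' _; exact: E_CS.
Qed.

Lemma topc_Gr_bound m n r F U : (r <= m)%N -> (r <= n)%N -> ch m F -> ch n U ->
  let t := topc ((m - r) + (n - r)) (Gr r F U) in
  E (t * t) <= 2 ^+ (m + n) * (Num.sqrt (Kr r F) * ((n ^_ r)%:R * E (U * U))).
Proof.
move=> rm rn hF hU; have := istop_Gr rm rn hF hU; set t := topc _ _ => ht /=.
(* The guard on the size gives every member of the family the order [mm - r], as [top_bound]
   requires; on [idx r] it is transparent. *)
pose f (Q : A) (mm : nat) (J : seq 'I_k) : A := if size J == r then DJ J Q else 0.
have hf (Q : A) mm J : ch mm Q -> ch (mm - r) (f Q mm J).
  by move=> hQ; rewrite /f; case: eqP => [<-|_]; [exact: ch_DJ|exact: ch_0].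
have e (g : seq 'I_k -> A) (h : seq 'I_k -> A) : (forall J, size J = r -> g J = h J) ->
    \sum_(J <- idx r) g J = \sum_(J <- idx r) h J.
  by move=> gh; rewrite big_seq [RHS]big_seq; apply: eq_bigr => J /idx_size /gh.
have E1 : Gr r F U = \sum_(J <- idx r) f F m J * f U n J.
  by rewrite Gr_idx; apply: e => J hJ; rewrite /f hJ eqxx.
rewrite E1 in ht.
apply: le_trans (top_bound (fun J => hf F m J hF) (fun J => hf U n J hU) ht) _.
have -> : \sum_(J <- idx r) \sum_(J' <- idx r) E (f F m J * f F m J') * E (f U n J * f U n J') =
   \sum_(J <- idx r) \sum_(J' <- idx r) E (DJ J F * DJ J' F) * E (DJ J U * DJ J' U).
  rewrite big_seq [RHS]big_seq; apply: eq_bigr => J /idx_size hJ.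
  rewrite big_seq [RHS]big_seq; apply: eq_bigr => J' /idx_size hJ'.
  by rewrite /f hJ hJ' eqxx.
have R0 : 0 <= Num.sqrt (Kr r F) * ((n ^_ r)%:R * E (U * U)).
  by rewrite !mulr_ge0 ?sqrtr_ge0 ?ga_E_ge0.
apply: le_trans (ler_wpM2l _ (idx_contr_le _ _ hU)) _; first exact: exprn_ge0.
apply: ler_wpM2r => //; rewrite ler_weXn2l ?(ler1n _ 2)//.
by apply: leq_add; exact: leq_subr.
Qed.

(** Since [V] has the maximal order, a derivative falling on [U] leaves [D i F * D i U], of too low
    a degree to pair with [V]. So all derivatives fall on [V]. *)
Lemma E_mul3 m n F U V : ch m F -> deg n U -> ch (m + n) V ->
  E (F * U * V) = (m`!%:R)^-1 * \sum_(J <- idx m) E (DJ J F * U * DJ J V).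
Proof.
elim: m F V => [|m IH] F V hF hU hV.
  by rewrite /= big_seq1 fact0 invr1 mul1r.
have h : m.+1%:R * E (F * U * V) = \sum_i E (D i F * U * D i V).
  rewrite -mulrA -(ch_Gam _ hF) /Gam E_sum; apply: eq_bigr => i _.
  rewrite ga_DM mulrDr ga_ED [D i F * (U * _)]mulrA.
  suff -> : E (D i F * (D i U * V)) = 0 by rewrite add0r.
  rewrite mulrA mulrC; apply: (ch_degl_orth hV).
  have : deg (m + n.-1) (D i F * D i U) by apply: degM; [exact/ch_deg/ch_D|exact: deg_D].
  by rewrite addSn /= => /(deg_le _); apply; rewrite leq_add2l leq_pred.
have m0 : m.+1%:R != 0 :> R by rewrite pnatr_eq0.
apply: (mulfI m0); rewrite h big_idxS factS natrM invfM !mulrA divff// mul1r mulr_sumr.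
by apply: eq_bigr => i _; rewrite (IH (D i F) (D i V))//; exact: ch_D.
Qed.

(** The Leibniz terms of [Gr]: [s] of the derivatives of [F] are paired with [U], and [t] with
    [V]. *)
Fixpoint Hr (s t : nat) F U V : A :=
  if s is s'.+1 then \sum_i Hr s' t (D i F) (D i U) V else U * Gr t F V.

Lemma Hr_r s t F U V : \sum_i Hr s t (D i F) U (D i V) = Hr s t.+1 F U V.
Proof.
elim: s F U V => [|s IH] F U V /=; first by rewrite mulr_sumr.
rewrite exchange_big; apply: eq_bigr => i _; rewrite -IH.
by apply: eq_bigr => j _; rewrite ga_DC.
Qed.

Lemma Gr_leibniz n F U V : Gr n F (U * V) = \sum_(s < n.+1) 'C(n, s)%:R *: Hr s (n - s) F U V.
Proof.
have GrDr r F' U' V' : Gr r F' (U' + V') = Gr r F' U' + Gr r F' V'.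
  elim: r F' U' V' => [|r IH] F' U' V' /=; first by rewrite mulrDr.
  by rewrite -big_split; apply: eq_bigr => i _ /=; rewrite linearD IH.
elim: n F U V => [|n IH] F U V.
  by rewrite big_ord1 /= bin0 scale1r mulrCA.
have -> : Gr n.+1 F (U * V) = (\sum_(s < n.+1) 'C(n, s)%:R *: Hr s.+1 (n - s) F U V) +
    \sum_(s < n.+1) 'C(n, s)%:R *: Hr s (n - s).+1 F U V.
  rewrite /=.
  have e i : Gr n (D i F) (D i (U * V)) = (\sum_(s < n.+1) 'C(n, s)%:R *: Hr s (n - s) (D i F) (D i U) V) +
     \sum_(s < n.+1) 'C(n, s)%:R *: Hr s (n - s) (D i F) U (D i V).
    by rewrite ga_DM GrDr !IH.
  rewrite (eq_bigr _ (fun i _ => e i)) big_split /=; congr (_ + _).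
    by rewrite exchange_big; apply: eq_bigr => s _; rewrite scaler_sumr.
  by rewrite exchange_big; apply: eq_bigr => s _; rewrite -Hr_r scaler_sumr.
rewrite [RHS]big_ord_recl bin0 subn0.
rewrite [X in _ = _ + X](eq_bigr (fun s : 'I_n.+1 => 'C(n, s)%:R *: Hr s.+1 (n - s) F U V +
   'C(n, s.+1)%:R *: Hr s.+1 (n - s) F U V)); last first.
  move=> s _; rewrite -[X in 'C(_, X)]/(s.+1)%N -[X in Hr X]/(s.+1)%N subSS binS natrD scalerDl addrC.
  by [].
rewrite big_split /= addrCA; congr (_ + _).
rewrite big_ord_recl bin0 subn0; congr (_ + _).
rewrite [RHS]big_ord_recr /= bin_small// scale0r addr0; apply: eq_bigr => s _ /=.
by rewrite /bump leq0n !add1n add0n subnSK.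
Qed.

Lemma Hr_idx s t F U V : Hr s t F U V =
  \sum_(J <- idx s) \sum_(J' <- idx t) DJ J U * (DJ J' (DJ J F) * DJ J' V).
Proof.
elim: s F U => [|s IH] F U; first by rewrite /= big_seq1 Gr_idx mulr_sumr.
by rewrite big_idxS /=; apply: eq_bigr => i _; rewrite IH.
Qed.

Lemma ch_coef p X J : ch p X -> size J = p -> exists c : R, DJ J X = c%:A.
Proof. by move=> hX sJ; apply/ch0P; have := ch_DJ J hX; rewrite sJ subnn. Qed.

Lemma E_X_Hr p s X : ch p X -> (s <= p)%N ->
  E (X * Hr s (p - s) X X X) = (p - s)`!%:R / s`!%:R * Kr s X.
Proof.
move=> hX sp; rewrite Hr_idx mulr_sumr E_sum.
have key J : size J = s -> E (X * \sum_(J' <- idx (p - s)) DJ J X * (DJ J' (DJ J X) * DJ J' X)) =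
    (p - s)`!%:R / s`!%:R * \sum_(J3 <- idx s) E (DJ J X * DJ J3 X) ^+ 2.
  move=> hJ; rewrite mulr_sumr E_sum.
  have step J' : size J' = (p - s)%N -> E (X * (DJ J X * (DJ J' (DJ J X) * DJ J' X))) =
     (s`!%:R)^-1 * \sum_(J3 <- idx s) E (DJ J X * DJ J3 X) * E (DJ J' (DJ J X) * DJ J' (DJ J3 X)).
    move=> hJ'; have [c hc] : exists c : R, DJ J' (DJ J X) = c%:A.
      apply/ch0P; have := ch_DJ J' (ch_DJ J hX); rewrite hJ hJ' subnn; exact.
    rewrite hc -scalerAl mul1r -!scalerAr ga_EZ.
    have hV : ch s (DJ J' X) by have := ch_DJ J' hX; rewrite hJ' subKn.
    have hU : deg (p - s) (DJ J X) by apply: ch_deg; have := ch_DJ J hX; rewrite hJ.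
    have hX' : ch (s + (p - s)) X by rewrite subnKC.
    have -> : X * (DJ J X * DJ J' X) = DJ J' X * DJ J X * X by ring.
    rewrite (E_mul3 hV hU hX') mulrCA; congr (_ * _); rewrite mulr_sumr.
    rewrite big_seq [RHS]big_seq; apply: eq_bigr => J3 /idx_size hJ3.
    have [c3 hc3] : exists c : R, DJ J3 (DJ J' X) = c%:A.
      apply/ch0P; have := ch_DJ J3 (ch_DJ J' hX); rewrite hJ3 hJ' subKn// subnn; exact.
    rewrite [DJ J' (DJ J3 X)]DJ_comm hc3 -!scalerAl !mul1r scalerA Ec !ga_EZ; ring.
  rewrite big_seq (eq_bigr _ (fun J' hJ' => step J' (idx_size hJ'))) -big_seq -mulr_sumr.
  rewrite exchange_big -mulrA mulrCA; congr (_ * _); rewrite mulr_sumr.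
  rewrite big_seq [RHS]big_seq; apply: eq_bigr => J3 /idx_size hJ3.
  have hJ1 : ch (p - s) (DJ J X) by have := ch_DJ J hX; rewrite hJ.
  rewrite -mulr_sumr -E_sum -Gr_idx (E_Gr _ _ hJ1) ffactnn; ring.
rewrite big_seq (eq_bigr _ (fun J hJ => key J (idx_size hJ))) -big_seq -mulr_sumr.
by [].
Qed.

Lemma Kr0 X : Kr 0 X = E (X * X) ^+ 2.
Proof. by rewrite /Kr /= !big_seq1. Qed.

Lemma Krp p X : ch p X -> Kr p X = (p`!%:R * E (X * X)) ^+ 2.
Proof.
move=> hX; have := E_Gr p X hX; rewrite ffactnn => <-; rewrite Gr_idx E_sum expr2 mulr_suml.
rewrite /Kr big_seq [RHS]big_seq; apply: eq_bigr => J /idx_size hJ.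
rewrite mulr_sumr big_seq [RHS]big_seq; apply: eq_bigr => J' /idx_size hJ'.
have [c ->] := ch_coef hX hJ; have [c' ->] := ch_coef hX hJ'.
by rewrite !scalarM !Ec; ring.
Qed.

Lemma E_wick_sq p X t : ch p X -> istop (p + p) (X * X) t ->
  p`!%:R * E (t * t) = \sum_(s < p.+1) 'C(p, s)%:R * ((p - s)`!%:R / s`!%:R * Kr s X).
Proof.
move=> hX ht; have [ct _] := ht.
have -> : E (t * t) = E (X * X * t) by rewrite -(istop_orth ht ct) mulrC.
rewrite (E_mul3 hX (ch_deg hX) ct) mulrA divff ?mul1r; last by rewrite pnatr_eq0 -lt0n fact_gt0.
transitivity (E (X * Gr p X (X * X))).
  rewrite Gr_idx mulr_sumr E_sum big_seq [RHS]big_seq; apply: eq_bigr => J /idx_size hJ.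
  have [c ->] := ch_coef hX hJ; rewrite -!scalerAl !mul1r -scalerAr !ga_EZ; congr (_ * _).
  have hJt : istop p (DJ J (X * X)) (DJ J t).
    have e : p = (p + p - size J)%N by rewrite hJ addnK.
    have : forall n q u, istop n q u -> istop (n - size J) (DJ J q) (DJ J u).
      elim: (J) => [|i J' IH] n q u h /=; first by rewrite subn0.
      have -> : (n - (size J').+1 = n.-1 - size J')%N by rewrite -subn1 -subnDA add1n.
      by apply: IH; exact: istop_D.
    by move=> /(_ _ _ _ ht); rewrite -e.
  by rewrite (istop_orth hJt hX).
rewrite Gr_leibniz mulr_sumr E_sum; apply: eq_bigr => s _.
rewrite -scalerAr ga_EZ E_X_Hr//; exact: leq_ord.
Qed.

(* The excess of the fourth moment over that of a centred normal law controls the norms of the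
   contractions. *)
Lemma fourth_moment p X s : (0 < s < p)%N -> ch p X ->
  Kr s X <= (p`!%:R) ^+ 2 * (E (X * X * (X * X)) - 3 * E (X * X) ^+ 2).
Proof.
move=> /andP[s0 sp] hX.
have [t ht] := istop_ex (degM (ch_deg hX) (ch_deg hX)).
have h1 := E_wick_sq hX ht; have [ct dt] := ht.
have p0 : (0 < p)%N by apply: leq_ltn_trans sp.
set c := E (X * X); set f := p`!%:R : R.
have f1 : 1 <= f by rewrite ler1n fact_gt0.
(* [t] and the mean [c] are orthogonal components of [X * X], whose squared norm is therefore at
   least the sum of theirs. *)
have b1 : E (t * t) + c ^+ 2 <= E (X * X * (X * X)).
  have := ga_E_ge0 (X * X - t - c%:A).
  have e1 : E (X * X * t) = E (t * t) by rewrite -(istop_orth ht ct) mulrC.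
  have e2 : E t = 0 by apply: (@ch_mean _ _ (p + p).-1); rewrite prednK ?addn_gt0 ?p0.
  have -> : (X * X - t - c%:A) * (X * X - t - c%:A) =
      X * X * (X * X) + t * t + c%:A * c%:A - 2%:R *: (X * X * t) - (2 * c) *: (X * X) + (2 * c) *: t.
    rewrite -!scalerA; set cc := c%:A.
    have -> : c *: (X * X) = cc * (X * X) by rewrite /cc -scalerAl mul1r.
    have -> : c *: t = cc * t by rewrite /cc -scalerAl mul1r.
    rewrite !scaler_nat; ring.
  rewrite ga_ED EB EB ga_ED ga_ED !ga_EZ e1 e2 -/c -scalerAl mul1r ga_EZ Ec; lra.
(* Together with [b1] this accounts for [3 c^2]: the indices [0] and [p] of the sum each give
   [f * c ^+ 2], and the index [s] gives the contraction. *)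
suff b2 : f * (2 * c ^+ 2) + f^-1 * Kr s X <= f * E (t * t).
  have fp : 0 < f by lra.
  have -> : Kr s X = f * (f^-1 * Kr s X) by field; lra.
  rewrite expr2 -mulrA ler_pM2l//.
  have : f * (E (t * t) + c ^+ 2) <= f * E (X * X * (X * X)) by rewrite ler_wpM2l//; lra.
  by lra.
rewrite h1.
have tn r : 0 <= 'C(p, r)%:R * ((p - r)`!%:R / r`!%:R * Kr r X) :> R.
  by rewrite mulr_ge0// mulr_ge0 ?Kr_ge0// divr_ge0.
have so : (s < p.+1)%N by rewrite ltnS ltnW.
rewrite (bigD1 ord0)//= (bigD1 ord_max)/=; last by rewrite -val_eqE /= -lt0n.
rewrite (bigD1 (Ordinal so))/=; last by rewrite -!val_eqE /= -lt0n s0 neq_ltn sp.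
rewrite bin0 subn0 fact0 divr1 mul1r Kr0 binn subnn fact0 !mul1r (Krp hX) -/f -/c.
have -> : f^-1 * (f * c) ^+ 2 = f * c ^+ 2 by field; lra.
have : 0 <= \sum_(i < p.+1 | (i != ord0) && (i != ord_max) && (i != Ordinal so))
   'C(p, i)%:R * ((p - i)`!%:R / i`!%:R * Kr i X) by apply: sumr_ge0 => i _; exact: tn.
have : f^-1 * Kr s X <= 'C(p, s)%:R * ((p - s)`!%:R / s`!%:R * Kr s X).
  rewrite !mulrA; apply: ler_wpM2r; first exact: Kr_ge0.
  have h2 : 1 <= 'C(p, s)%:R :> R by rewrite ler1n bin_gt0 ltnW.
  have h3 : 1 <= (p - s)`!%:R :> R by rewrite ler1n fact_gt0.
  have h4 : f^-1 <= (s`!%:R : R)^-1.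
    rewrite lef_pV2 ?posrE ?ltr0n ?fact_gt0// ler_nat.
    by rewrite -(ffact_fact (leq_subr s p)) subKn ?(ltnW sp)// leq_pmull// ffact_gt0 leq_subr.
  by apply: le_trans h4 _; rewrite ler_peMl ?invr_ge0// mulr_ege1.
by lra.
Qed.

(** Crude product of four losses: [p^2] from adding the remainder terms, [2 ^+ (p + n)] from
    [top_bound], the factorial of [n] from a falling factorial, that of [p] from [fourth_moment]. *)
Definition contr_cst (p n : nat) : R := p%:R ^+ 2 * 2 ^+ (p + n) * n`!%:R * p`!%:R.

(* [V] is the only component of [Gam X U] that survives when the contractions vanish. *)
Lemma Gam_shift p n X U : (0 < p)%N -> ch p X -> ch n U -> exists V,
  [/\ (p <= n)%N -> ch (n - p) V, (n < p)%N -> V = 0 &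
      E ((Gam X U - V) * (Gam X U - V)) <= contr_cst p n *
        (Num.sqrt (E (X * X * (X * X)) - 3 * E (X * X) ^+ 2) * E (U * U))].
Proof.
case: p => // p _ hX hU.
set del := _ - 3 * _.
pose t r : A := (r`!%:R : R)^-1 *: topc ((p.+1 - r.+1) + (n - r.+1)) (Gr r.+1 X U).
pose K := (p.+1 + n)%N.
have GE : Gam X U = \sum_(r < K) t r.
  case: n hU @t @K => [|n] hU t K.
    rewrite /Gam big1 => [|i _]; last by rewrite [D i U]ch0_D// mulr0.
    by apply/esym/big1 => r _; rewrite /t GrC (Gr_over _ hU)// topc0 scaler0.
  have e i : D i X * D i U = \sum_(r < K) (r`!%:R : R)^-1 *: topc ((p - r) + (n - r)) (Gr r (D i X) (D i U)).
    apply: ch_prod; [by rewrite /K addSn addnS ltnW|exact: ch_D|exact: ch_D].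
  rewrite /Gam (eq_bigr _ (fun i _ => e i)) exchange_big; apply: eq_bigr => r _.
  rewrite -scaler_sumr /t !subSS; congr (_ *: _).
  have [rp|pr] := leqP r p; last first.
    rewrite (Gr_over _ hX)// topc0 big1// => i _.
    by rewrite (Gr_over _ (ch_D i hX))// topc0.
  have [rn|nr] := leqP r n; last first.
    rewrite GrC (Gr_over _ hU)// topc0 big1// => i _.
    by rewrite GrC (Gr_over _ (ch_D i hU))// topc0.
  apply/esym/topcE => /=; apply: istop_sum => i.
  by apply: istop_Gr => //; exact: ch_D.
(* This term contracts all arguments of [X]. It is the only one outside the range of
   [fourth_moment], as the later ones vanish. *)
exists (t p); split.
- move=> pn; apply: chZ; rewrite subnn add0n.
  have := istop_Gr (leqnn p.+1) pn hX hU; rewrite subnn add0n; exact: proj1.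
- by move=> np; rewrite /t GrC (Gr_over _ hU)// topc0 scaler0.
have pK : (p < K)%N by rewrite /K addSn ltnS leq_addr.
have GV : Gam X U - t p = \sum_(r < p) t r.
  rewrite GE (bigD1 (Ordinal pK))//= addrC addrK.
  rewrite (big_ord_widen_cond K predT t (ltnW pK)) [RHS]big_mkcond [LHS]big_mkcond.
  apply: eq_bigr => r _; rewrite /= -val_eqE /=.
  case: ltngtP => // pr.
  by rewrite /t (Gr_over _ hX)// topc0 scaler0.
have u0 := ga_E_ge0 U.
set B := 2 ^+ (p.+1 + n) * (n`!%:R * (p.+1`!%:R * Num.sqrt del * E (U * U))) : R.
have tb (r : 'I_p) : Nr (t r) ^+ 2 <= B.
  have B0 : 0 <= B by rewrite /B !mulr_ge0// ?exprn_ge0 ?sqrtr_ge0.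
  have [rn|nr] := leqP r.+1 n; last first.
    by rewrite /t GrC (Gr_over _ hU)// topc0 scaler0 NrX mulr0 E0.
  have rp : (r.+1 <= p.+1)%N by apply: ltnW; rewrite ltnS ltn_ord.
  have h := topc_Gr_bound rp rn hX hU.
  have ks : Num.sqrt (Kr r.+1 X) <= p.+1`!%:R * Num.sqrt del.
    have h1 : (0 < r.+1 < p.+1)%N by rewrite /= ltnS ltn_ord.
    have h2 := fourth_moment h1 hX; rewrite -/del in h2.
    apply: le_trans (ler_wsqrtr h2) _; rewrite sqrtrM ?sqr_ge0// sqrtr_sqr.
    by rewrite ger0_norm.
  have nf : (n ^_ r.+1)%:R <= n`!%:R :> R.
    by rewrite ler_nat -(ffact_fact rn) leq_pmulr// fact_gt0.
  rewrite NrX /t -scalerAl -scalerAr scalerA ga_EZ.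
  set tt := topc _ _; apply: le_trans (_ : E (tt * tt) <= _).
    have [->|] := eqVneq (E (tt * tt)) 0; first by rewrite mulr0.
    move=> _; rewrite ler_piMl ?ga_E_ge0// -invfM invf_le1 ?mulr_gt0 ?ltr0n ?fact_gt0//.
    by rewrite mulr_ege1// ler1n fact_gt0.
  apply: le_trans h _; rewrite /B ler_wpM2l ?exprn_ge0//.
  rewrite [leRHS](_ : _ = (p.+1`!%:R * Num.sqrt del) * (n`!%:R * E (U * U))); last by ring.
  apply: ler_pM; rewrite ?sqrtr_ge0 ?mulr_ge0//.
  by rewrite ler_wpM2r.
rewrite GV -NrX; apply: le_trans (_ : (\sum_(r < p) Nr (t r)) ^+ 2 <= _).
  rewrite lerXn2r ?nnegrE ?Nr_ge0 ?Nr_sum// sumr_ge0// => r _; exact: Nr_ge0.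
apply: le_trans (CS_sum _) _.
apply: le_trans (_ : p%:R * (p%:R * B) <= _).
  rewrite ler_wpM2l//; apply: le_trans (ler_sum _ (fun r _ => tb r)) _.
  by rewrite sumr_const cardT size_enum_ord mulr_natl.
have B0 : 0 <= B by rewrite /B !mulr_ge0// ?exprn_ge0 ?sqrtr_ge0.
have pp : p%:R <= p.+1%:R :> R by rewrite ler_nat.
apply: le_trans (_ : p.+1%:R ^+ 2 * B <= _).
  by rewrite mulrA ler_wpM2r// -expr2 lerXn2r ?nnegrE.
by rewrite /contr_cst /B le_eqVlt; apply/orP; left; apply/eqP; ring.
Qed.

End contractions.

(** * Asymptotics of iterated brackets *)

Section iterated_gamma.
Context {R : realType}.

Definition itG (A : gauss_alg R) (r : nat) (X Y : A) : A := iter r (Gam X) Y.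

Definition fourth_defect (A : gauss_alg R) (X : A) : R :=
  ga_E (X * X * (X * X)) - 3 * ga_E (X * X) ^+ 2.

Lemma deg_itG (A : gauss_alg R) p q r (X Y : A) : deg p X -> deg q Y -> deg (q + r * p) (itG r X Y).
Proof.
move=> hX hY; elim: r => [|r IH]; first by rewrite mul0n addn0.
apply: deg_le (deg_Gam hX IH); lia.
Qed.

Lemma itG_bounded p q r (B : R) : 0 <= B -> exists2 M : R, 0 <= M &
  forall (A : gauss_alg R) (X Y : A), deg p X -> deg q Y -> Nr X <= B -> Nr Y <= B ->
    Nr (itG r X Y) <= M.
Proof.
move=> B0; elim: r => [|r [M M0 IH]]; first by exists B.
pose c : R := (@hc R p * @hc R (q + r * p)) ^+ 2 * (p%:R * (q + r * p)%:R).
have c0 : 0 <= c by rewrite /c mulr_ge0 ?sqr_ge0.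
exists ((c + 1) * (B * M)); first by rewrite mulr_ge0 ?mulr_ge0// addr_ge0.
move=> A X Y hX hY bX bY; apply: sqrt_mono; first by rewrite !mulr_ge0// addr_ge0.
have := deg_GamN hX (deg_itG r hX hY); rewrite -/c => h.
apply: le_trans h _; rewrite [leRHS]exprMn.
apply: ler_pM => //; first by rewrite mulr_ge0 ?sqr_ge0.
  by nra.
rewrite exprMn ler_pM ?sqr_ge0// lerXn2r ?nnegrE ?Nr_ge0//.
exact: IH.
Qed.

Lemma Gam_shift_Nr p n (A : gauss_alg R) (X U : A) : (0 < p)%N -> ch p X -> ch n U ->
  exists V : A, [/\ (p <= n)%N -> ch (n - p) V, (n < p)%N -> V = 0 &
    Nr (Gam X U - V) <= @contr_cst R p n * Num.sqrt (Num.sqrt (fourth_defect X)) * Nr U].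
Proof.
move=> p0 hX hU; have [V [h1 h2 h3]] := Gam_shift p0 hX hU; exists V; split=> //.
have c0 : 0 <= @contr_cst R p n by rewrite /contr_cst !mulr_ge0 ?exprn_ge0.
apply: sqrt_mono; first by rewrite !mulr_ge0 ?sqrtr_ge0 ?Nr_ge0.
rewrite [_ ^+ 2]NrX -expr2; apply: le_trans h3 _.
set w := Num.sqrt (fourth_defect X); rewrite -/(fourth_defect X) -/w.
rewrite (_ : (_ * Nr U) ^+ 2 = contr_cst p n ^+ 2 * (Num.sqrt w ^+ 2 * Nr U ^+ 2)); last by ring.
rewrite NrX sqr_sqrtr ?sqrtr_ge0// ler_wpM2r ?mulr_ge0 ?ga_E_ge0 ?sqrtr_ge0//.
have [->|pn] := eqVneq (@contr_cst R p n) 0; first by rewrite expr0n.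
rewrite expr2 ler_peMl//.
by rewrite /contr_cst !mulr_ege1 ?exprn_ege1 ?ler1n ?fact_gt0.
Qed.

Lemma itG_chaos p q r (B : R) : (0 < p)%N -> 0 <= B -> exists2 K : R, 0 <= K &
  forall (A : gauss_alg R) (X Y : A), ch p X -> ch q Y -> Nr X <= B -> Nr Y <= B ->
    Num.sqrt (Num.sqrt (fourth_defect X)) <= 1 ->
    exists V : A, [/\ (r * p <= q)%N -> ch (q - r * p) V, (q < r * p)%N -> V = 0 &
      Nr (itG r X Y - V) <= K * Num.sqrt (Num.sqrt (fourth_defect X))].
Proof.
move=> p0 B0; elim: r => [|r [K K0 IH]].
  exists 0 => // A X Y hX hY _ _ _; exists Y; split=> //; first by rewrite subn0.
  by rewrite mul0r subrr /Nr mulr0 E0 sqrtr0.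
have [M M0 hM] := itG_bounded p q r B0.
pose n := (q - r * p)%N.
(* The degree [q + r * p + q] is generous: it bounds both the iterated bracket and its approximation
   [V]. *)
pose c : R := @hc R p * @hc R (q + r * p + q) * (p%:R * (q + r * p + q)%:R + 1).
have c0 : 0 <= c.
  by rewrite /c !mulr_ge0 ?addr_ge0 ?mulr_ge0// (le_trans ler01) ?hc_ge1.
have cc0 : 0 <= @contr_cst R p n by rewrite /contr_cst !mulr_ge0 ?exprn_ge0.
exists (c * (B * K) + @contr_cst R p n * (K + M)).
  by rewrite addr_ge0 ?mulr_ge0 ?addr_ge0.
move=> A X Y hX hY bX bY; set s := Num.sqrt _ => s1.
have s0 : 0 <= s by rewrite /s sqrtr_ge0.
have [V [V1 V2 V3]] := IH A X Y hX hY bX bY s1; rewrite -/s in V3.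
have dX := ch_deg hX; have dY := ch_deg hY.
have dV : deg (q + r * p + q) V.
  have [h|h] := leqP (r * p) q; last by rewrite V2//; exact: deg0.
  by apply: deg_le (ch_deg (V1 h)); exact: leq_trans (leq_subr _ _) (leq_addl _ _).
have dI : deg (q + r * p + q) (itG r X Y - V).
  by apply: degB => //; apply: deg_le (deg_itG r dX dY); exact: leq_addr.
have bV : Nr V <= K + M.
  rewrite -[V](subKr (itG r X Y)); apply: le_trans (NrD _ _) _; rewrite addrC lerD//.
    by rewrite -scaleN1r NrZ normrN1 mul1r; apply: le_trans V3 _; rewrite ler_piMr.
  exact: hM.
have h1 : Nr (Gam X (itG r X Y - V)) <= c * (B * K) * s.
  apply: sqrt_mono; first by rewrite !mulr_ge0.
  apply: le_trans (deg_GamN dX dI) _.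
  rewrite (_ : (c * _ * s) ^+ 2 = c ^+ 2 * (B ^+ 2 * (K * s) ^+ 2)); last by ring.
  apply: ler_pM; rewrite ?mulr_ge0 ?sqr_ge0 ?Nr_ge0//.
    rewrite /c [leRHS]exprMn ler_wpM2l ?sqr_ge0//.
    have : 0 <= p%:R * (q + r * p + q)%:R :> R by rewrite mulr_ge0.
    by nra.
  by rewrite ler_pM ?sqr_ge0// lerXn2r ?nnegrE ?Nr_ge0 ?mulr_ge0.
have [rq|qr] := leqP (r * p) q; last first.
  exists 0; split=> //.
  - by rewrite mulSn => h; have := leq_trans (leq_addl p (r * p)) h; rewrite leqNgt qr.
  - rewrite (V2 qr) in h1 *; rewrite !subr0 in h1 *; apply: le_trans h1 _.
    by rewrite mulrDl lerDl !mulr_ge0// addr_ge0.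
have [V' [h2 h3 h4]] := Gam_shift_Nr p0 hX (V1 rq).
exists V'; split.
- by move=> h; rewrite mulSn addnC subnDA; apply: h2; rewrite leq_subRL// addnC -mulSn.
- by move=> h; apply: h3; rewrite ltn_subLR// addnC -mulSn.
- have -> : itG r.+1 X Y - V' = Gam X (itG r X Y - V) + (Gam X V - V') by rewrite GamBr addrA subrK.
  apply: le_trans (NrD _ _) _; rewrite mulrDl lerD//.
  apply: le_trans h4 _; rewrite -/s -/n mulrAC ler_wpM2r// ler_wpM2l//.
Qed.

Lemma itG_vanish p q r (B : R) : (0 < p)%N -> (q < r * p)%N -> 0 <= B -> exists2 K : R, 0 <= K &
  forall (A : gauss_alg R) (X Y : A), ch p X -> ch q Y -> Nr X <= B -> Nr Y <= B ->
    Num.sqrt (Num.sqrt (fourth_defect X)) <= 1 ->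
    Nr (itG r X Y) <= K * Num.sqrt (Num.sqrt (fourth_defect X)).
Proof.
move=> p0 qr B0; have [K K0 h] := itG_chaos q r p0 B0; exists K => // A X Y hX hY bX bY s1.
by have [V [_ h2 h3]] := h A X Y hX hY bX bY s1; rewrite h2// subr0 in h3.
Qed.

Lemma Nr_center (A : gauss_alg R) (U : A) : Nr (U - (ga_E U)%:A) <= Nr U.
Proof.
apply: sqrt_mono; rewrite ?Nr_ge0// !NrX mulrBl !mulrBr !EB -!scalerAl -!scalerAr !mulr1 !mul1r !ga_EZ ga_E1.
rewrite mulr1; have := sqr_ge0 (ga_E U); rewrite expr2; lra.
Qed.

(** The surviving component has order [0], hence is a constant, and centring at the mean
    [p * E (X * X)] instead can only decrease the norm of the remainder ([Nr_center]). *)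
Lemma Gam_const p (A : gauss_alg R) (X : A) : (0 < p)%N -> ch p X ->
  Nr (Gam X X - (p%:R * ga_E (X * X))%:A) <=
    @contr_cst R p p * Num.sqrt (Num.sqrt (fourth_defect X)) * Nr X.
Proof.
move=> p0 hX; have [V [h1 _ h3]] := Gam_shift_Nr p0 hX hX.
apply: le_trans h3; have := h1 (leqnn p); rewrite subnn => /ch0P[c Vc].
rewrite -(ch_Gam X hX); apply: le_trans (Nr_center _).
rewrite EB Vc Ec scalerBl opprB addrA subrK lexx//.
Qed.

Lemma deg_exp (A : gauss_alg R) n m (u : A) : deg n u -> deg (n * m) (u ^+ m).
Proof.
move=> h; elim: m => [|m IH]; first by rewrite muln0 expr0; exists 1; rewrite scale1r.
by rewrite exprS mulnS; exact: degM.
Qed.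

Lemma deg_moments n j : exists2 C : R, 0 <= C &
  forall (A : gauss_alg R) (u : A), deg n u -> Nr (u ^+ (2 ^ j)%N) <= C * Nr u ^+ (2 ^ j)%N.
Proof.
elim: j => [|j [C C0 IH]]; first by exists 1 => // A u _; rewrite expn0 !expr1 mul1r.
exists (@hc R (n * 2 ^ j) * C ^+ 2); first by rewrite mulr_ge0 ?sqr_ge0// (le_trans ler01) ?hc_ge1.
move=> A u hu; rewrite expnSr !exprM expr2; apply: le_trans (deg_hyper (deg_exp _ hu)) _.
rewrite -mulrA ler_wpM2l ?(le_trans ler01) ?hc_ge1// -[leRHS]exprMn.
by rewrite lerXn2r ?nnegrE ?Nr_ge0 ?IH// mulr_ge0 ?exprn_ge0 ?Nr_ge0.
Qed.

End iterated_gamma.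

(** * Polynomial functionals of an isonormal process *)

Section polynomial_functions.
Context {R : realType} (k : nat).
Implicit Types p q : mpoly k.+1 R.

Definition pfun p (x : 'rV[R]_k.+1) : R := meval (fun i => x 0 i) p.

Let smooth p := (forall n, diff_poly_growth n (pfun p)) /\
  (forall i, partial i (pfun p) = pfun (mderiv i p)).

Let smooth_diff p x : smooth p -> differentiable (pfun p) x.
Proof. by case=> h _; have [_ + _] := h 1%N; exact. Qed.

Let smooth_cst c : smooth (mpolyC k.+1 c).
Proof.
have e c' : pfun (mpolyC k.+1 c') = fun=> c' by apply/funext => x; rewrite /pfun mevalC.
split=> [n|i]; first by rewrite e; exact: dpg_cst.
by rewrite mderivC e -mpolyC0 e; apply/funext => x; rewrite /partial derive_cst.
Qed.

Let smoothD p q : smooth p -> smooth q -> smooth (p + q).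
Proof.
move=> hp hq; have e p' q' : pfun (p' + q') = fun x => pfun p' x + pfun q' x.
  by apply/funext => x; rewrite /pfun mevalD.
split=> [n|i]; first by rewrite e; apply: dpgD; [apply: hp.1|apply: hq.1].
by rewrite mderivD !e; apply/funext => x; rewrite partialD ?hp.2 ?hq.2//; exact: smooth_diff.
Qed.

Let smoothM p q : smooth p -> smooth q -> smooth (p * q).
Proof.
move=> hp hq; have e p' q' : pfun (p' * q') = fun x => pfun p' x * pfun q' x.
  by apply/funext => x; rewrite /pfun mevalM.
split=> [n|i]; first by rewrite e; apply: dpgM; [apply: hp.1|apply: hq.1].
rewrite mderivM e; apply/funext => x; rewrite partialM; try exact: smooth_diff.
by rewrite hp.2 hq.2 /pfun mevalD !mevalM.
Qed.

Let smoothX i : smooth (mpolyX R (mnm1 i)).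
Proof.
have e : pfun (mpolyX R (mnm1 i)) = fun x => x 0 i by apply/funext => x; rewrite /pfun mevalXU.
split=> [n|j]; first by rewrite e; exact: dpg_coord.
rewrite mderivX e; apply/funext => x; rewrite partial_coord /pfun mevalZ mevalX mnm1E.
case: eqP => [->|_]; last by rewrite mul0r.
by rewrite big1 ?mulr1// => l _; rewrite mnmBE subnn expr0.
Qed.

Let smooth_all p : smooth p.
Proof.
have s1 : smooth 1 by rewrite -mpolyC1; exact: smooth_cst.
elim/mpolyind: p => [|c m p _ _ hp]; first by rewrite -mpolyC0; exact: smooth_cst.
apply: smoothD => //; rewrite -mul_mpolyC; apply: smoothM => //; rewrite mpolyXE_id.
apply: (big_ind smooth) => // i _.
by elim: (m i) => [|j IH]; rewrite ?expr0// exprS; exact: smoothM.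
Qed.

Lemma pfun_smooth n p : diff_poly_growth n (pfun p).
Proof. by have [] := smooth_all p. Qed.

Lemma pfun_partial i p : partial i (pfun p) = pfun (mderiv i p).
Proof. by have [] := smooth_all p. Qed.

Lemma mderiv_const p : (forall i, mderiv i p = 0) -> exists c : R, p = c%:A.
Proof.
move=> h; exists (mcoeff (@mnm0 k.+1) p); rewrite alg_mpolyC; apply/mpolyP => m; rewrite mcoeffC.
have [->|m0] := eqVneq m (@mnm0 k.+1); rewrite ?mulr1 ?mulr0//.
have [i mi] : exists i, m i != 0%N.
  apply/existsP; rewrite -negb_forall; apply: contra m0 => /forallP m0.
  by apply/eqP/mnmP => i; rewrite mnm0E; exact/eqP.
have := congr1 (mcoeff (mnm_sub m (mnm1 i))) (h i); rewrite mcoeff_deriv mcoeff0 submK.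
  by move=> /eqP; rewrite mulrn_eq0 => /eqP.
by apply/mnm_lepP => l; rewrite mnm1E; case: eqP => // <-; rewrite lt0n.
Qed.

Lemma mderiv_nilpotent p : exists n, Ddeg (fun i => mderiv i) n p.
Proof.
suff h n q : (msize q <= n)%N -> Ddeg (fun i => mderiv i) n q by exists (msize p); exact: h.
elim: n q => [|n IH] {}p hp.
  by exists (mcoeff (@mnm0 k.+1) p); rewrite alg_mpolyC; apply: msize1_polyC; exact: leq_trans hp _.
move=> i; apply: IH; rewrite msizeE; apply/bigmax_leqP_seq => m + _.
rewrite mcoeff_msupp mcoeff_deriv mulrn_eq0 /= -mcoeff_msupp => /msize_mdeg_lt.
by rewrite mdegD mdeg1 addn1 => h; rewrite -ltnS; exact: leq_trans h hp.
Qed.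

End polynomial_functions.

Section gaussian_polynomials.
Context {R : realType} (H : completeNormedModType R).
Variable dot : H -> H -> R.
Context d (T : measurableType d) (P : probability T R).
Variable W : H -> {RV P >-> R}.
Hypothesis iso : isonormal_process dot W.

Definition orthonormal_family k (e : 'I_k.+1 -> H) := forall i j, dot (e i) (e j) = (i == j)%:R.

Section family.
Context k (e : 'I_k.+1 -> H).
Implicit Types p q : mpoly k.+1 R.

Definition Wpoly p (w : T) : R := pfun p (Wrow W e w).

Lemma am_Wpoly p : am P (Wpoly p).
Proof. exact: (am_Wrow iso e (pfun_smooth 1 p)). Qed.

Lemma WpolyD p q w : Wpoly (p + q) w = Wpoly p w + Wpoly q w.
Proof. exact: mevalD. Qed.

Lemma WpolyZ c p w : Wpoly (c *: p) w = c * Wpoly p w.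
Proof. exact: mevalZ. Qed.

Lemma WpolyM p q w : Wpoly (p * q) w = Wpoly p w * Wpoly q w.
Proof. exact: mevalM. Qed.

Lemma Wpolyc c w : Wpoly c%:A w = c.
Proof. by rewrite alg_mpolyC; exact: mevalC. Qed.

Lemma WpolyX i w : Wpoly (mpolyX R (mnm1 i)) w = W (e i) w.
Proof. by rewrite /Wpoly /pfun mevalXU mxE. Qed.

Definition Epoly p := Ex P (Wpoly p).

Lemma EpolyD p q : Epoly (p + q) = Epoly p + Epoly q.
Proof.
rewrite /Epoly; under eq_Ex do rewrite WpolyD.
by rewrite ExD//; exact: am_itg (am_Wpoly _).
Qed.

Lemma EpolyZ c p : Epoly (c *: p) = c * Epoly p.
Proof.
rewrite /Epoly; under eq_Ex do rewrite WpolyZ.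
by rewrite ExZ//; exact: am_itg (am_Wpoly _).
Qed.

Lemma Epoly1 : Epoly 1 = 1.
Proof.
rewrite /Epoly; under eq_Ex do rewrite -[1]scale1r Wpolyc.
by rewrite Ex_cst.
Qed.

Lemma Epoly_ge0 p : 0 <= Epoly (p * p).
Proof. by apply: Ex_ge0 => w; rewrite WpolyM -expr2 sqr_ge0. Qed.

Hypothesis he : orthonormal_family e.

Lemma Epoly_ibp i p : Epoly (mpolyX R (mnm1 i) * p) = Epoly (mderiv i p).
Proof.
rewrite /Epoly; under eq_Ex do rewrite WpolyM WpolyX.
rewrite (isonormal_ibp iso e (e i) (pfun_smooth 2 p)) (bigD1 i)//= he eqxx mul1r big1 ?addr0.
  by rewrite pfun_partial.
by move=> j ji; rewrite he (negbTE ji) mul0r.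
Qed.

Let mderivXU i j : mderiv i (mpolyX R (mnm1 j)) = (i == j)%:R :> mpoly k.+1 R.
Proof.
rewrite mderivX mnm1E; case: (eqVneq j i) => [->|ji]; last by rewrite scale0r.
rewrite scale1r; rewrite (_ : mnm_sub _ _ = @mnm0 k.+1) ?mpolyX0//.
by apply/mnmP => l; rewrite mnmBE subnn mnm0E.
Qed.

Definition Walg : gauss_alg R :=
  @GaussAlg R (mpoly k.+1 R : comAlgType R) k.+1 (fun i => mderiv i : {linear mpoly k.+1 R -> mpoly k.+1 R})
    (fun i => mpolyX R (mnm1 i)) Epoly (@mderivM _ R) (fun i j p => mderiv_comm j i p) mderivXU
    EpolyD EpolyZ Epoly1 Epoly_ibp Epoly_ge0 (@mderiv_const R k) (@mderiv_nilpotent R k).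

End family.
End gaussian_polynomials.

(** * Gradient and divergence of smooth functionals *)

Section smooth_calculus.
Context {R : realType} (H : completeNormedModType R).
Variable dot : {dot H for idfun}.
Hypothesis dot_norm : forall x : H, dot x x = `|x| ^+ 2.
Context d (T : measurableType d) (P : probability T R).
Variable W : H -> {RV P >-> R}.
Hypothesis iso : isonormal_process dot W.

Lemma dotDl x y z : dot (x + y) z = dot x z + dot y z.
Proof. exact: linearDl. Qed.

Lemma dotZl a x y : dot (a *: x) y = a * dot x y.
Proof. exact: linearZl_LR. Qed.

Lemma dotDr x y z : dot z (x + y) = dot z x + dot z y.
Proof. exact: linearDr. Qed.

Lemma dotZr a x y : dot y (a *: x) = a * dot y x.
Proof. exact: linearZr_LR. Qed.

Lemma dotBl x y z : dot (x - y) z = dot x z - dot y z.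
Proof. by rewrite dotDl -scaleN1r dotZl mulN1r. Qed.

Lemma dotBr x y z : dot z (x - y) = dot z x - dot z y.
Proof. by rewrite dotDr -scaleN1r dotZr mulN1r. Qed.

Lemma dot0l x : dot 0 x = 0.
Proof. by rewrite -(scale0r (0 : H)) dotZl mul0r. Qed.

Lemma dot_suml I (s : seq I) (f : I -> H) z : dot (\sum_(i <- s) f i) z = \sum_(i <- s) dot (f i) z.
Proof. by elim: s => [|i s IH]; rewrite ?big_nil ?dot0l// !big_cons dotDl IH. Qed.

Lemma normB_sq x y : `|x - y| ^+ 2 = `|x| ^+ 2 - 2 * dot x y + `|y| ^+ 2.
Proof.
rewrite -!dot_norm dotBl !dotBr (dot_sym iso y x); ring.
Qed.

Lemma dot_le_norm x y : `|dot x y| <= `|x| * `|y|.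
Proof.
rewrite -(@ler_pXn2r _ 2) ?nnegrE ?mulr_ge0// real_normK ?num_real// exprMn -!dot_norm.
exact: dot_CS iso x y.
Qed.

Lemma dot_cont x : continuous (fun y : H => dot x y : R).
Proof.
move=> y; apply/cvgrPdist_lt => eps e0.
have x1 : 0 < `|x| + 1 by rewrite ltr_wpDl.
near=> z; rewrite -dotBr; apply: le_lt_trans (dot_le_norm _ _) _.
apply: (@le_lt_trans _ _ ((`|x| + 1) * `|y - z|)); first by rewrite ler_wpM2r// lerDl.
rewrite -ltr_pdivlMl//; near: z.
by apply: (@cvgr_dist_lt _ _ _ (nbhs y) _ id); [exact: cvg_id|rewrite mulr_gt0// invr_gt0].
Unshelve. all: by end_near.
Qed.

Section family.
Context k (h : 'I_k.+1 -> H) (phi : 'rV[R]_k.+1 -> R).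

Definition grad (w : T) : H := \sum_i partial i phi (Wrow W h w) *: h i.

(** Divergence of the gradient, that is, the number operator on smooth functionals. The vectors
    [h i] need not be orthonormal, so their Gram matrix enters. *)
Definition div_grad (w : T) : R := \sum_i (partial i phi (Wrow W h w) * W (h i) w -
  \sum_j dot (h j) (h i) * partial j (partial i phi) (Wrow W h w)).

Hypothesis sphi : smooth_poly_growth phi.

Lemma partial_smooth i : smooth_poly_growth (partial i phi).
Proof. by move=> n; have [_ _] := sphi n.+1; exact. Qed.

Lemma am_smooth : am P (fun w => phi (Wrow W h w)).
Proof. exact: (am_Wrow iso h (sphi 1)). Qed.

End family.

Lemma am_div_grad k (h : 'I_k.+1 -> H) phi : smooth_poly_growth phi -> am P (div_grad h phi).
Proof.
move=> sphi; apply: am_sum => i; apply: amB.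
  by apply: amM; [exact: am_smooth (partial_smooth sphi i)|exact: am_W iso (h i)].
by apply: am_sum => j; apply: amZ; exact: am_smooth (partial_smooth (partial_smooth sphi i) j).
Qed.

Lemma dot_grad k (h : 'I_k.+1 -> H) phi w x :
  dot (grad h phi w) x = \sum_i partial i phi (Wrow W h w) * dot (h i) x.
Proof. by rewrite dot_suml; apply: eq_bigr => i _; rewrite dotZl. Qed.

Section joinv.
Context k l (h : 'I_k.+1 -> H) (h' : 'I_l.+1 -> H).

(** Concatenation turns a product of functionals of two families into one functional, to which
    [isonormal_ibp] applies; [mx_left] and [mx_right] are the coordinate projections. *)
Definition joinv (c : 'I_(k.+1 + l.+1)) : H :=
  match fintype.split c with inl i => h i | inr j => h' j end.

Definition mx_left : 'M[R]_((k + l.+1).+1, k.+1) := \matrix_(c, j) ((c : 'I_(k.+1 + l.+1)) == lshift l.+1 j)%:R.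

Definition mx_right : 'M[R]_((k + l.+1).+1, l.+1) := \matrix_(c, j) ((c : 'I_(k.+1 + l.+1)) == rshift k.+1 j)%:R.

Lemma joinv_l i : joinv (lshift l.+1 i) = h i.
Proof. by rewrite /joinv; case: splitP => j /= e; [congr h; apply: val_inj|have := ltn_ord i; rewrite e; lia]. Qed.

Lemma joinv_r j : joinv (rshift k.+1 j) = h' j.
Proof.
rewrite /joinv; case: splitP => i /= e; first by have := ltn_ord i; rewrite -e; lia.
by congr h'; apply: val_inj; apply/eqP; rewrite -(eqn_add2l k.+1) e.
Qed.

Lemma Wrow_left w : Wrow W joinv w *m mx_left = Wrow W h w.
Proof.
apply/rowP => j; rewrite !mxE (bigD1 (lshift l.+1 j))//= !mxE eqxx mulr1 joinv_l big1 ?addr0//.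
by move=> c /negbTE cj; rewrite !mxE cj mulr0.
Qed.

Lemma Wrow_right w : Wrow W joinv w *m mx_right = Wrow W h' w.
Proof.
apply/rowP => j; rewrite !mxE (bigD1 (rshift k.+1 j))//= !mxE eqxx mulr1 joinv_r big1 ?addr0//.
by move=> c /negbTE cj; rewrite !mxE cj mulr0.
Qed.

Lemma joinv_ibp f g x : smooth_poly_growth f -> smooth_poly_growth g ->
  Ex P (fun w => W x w * (f (Wrow W h w) * g (Wrow W h' w))) =
  Ex P (fun w => dot (grad h f w) x * g (Wrow W h' w)) +
  Ex P (fun w => f (Wrow W h w) * dot (grad h' g w) x).
Proof.
move=> sf sg; have [_ df _] := sf 1%N; have [_ dg _] := sg 1%N.
pose F (y : 'rV[R]_(k + l.+1).+1) := f (y *m mx_left) * g (y *m mx_right).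
have af i := am_smooth h (partial_smooth sf i).
have ag i := am_smooth h' (partial_smooth sg i).
have af0 := am_smooth h sf; have ag0 := am_smooth h' sg.
have sF : diff_poly_growth 2 F by apply: dpgM; apply: dpg_mx; [exact: sf|exact: sg].
have := isonormal_ibp iso (joinv : 'I_(k + l.+1).+1 -> H) x sF.
under eq_Ex do rewrite /F Wrow_left Wrow_right.
move=> ->; rewrite -ExD; first last.
- apply: am_itg; apply: amM => //; under eq_fun do rewrite dot_grad.
  by apply: am_sum => i; under eq_fun do rewrite mulrC; exact: amZ.
- apply: am_itg; apply: amM => //; under eq_fun do rewrite dot_grad.
  by apply: am_sum => i; under eq_fun do rewrite mulrC; exact: amZ.
have pF c w : partial c F (Wrow W joinv w) =
    (\sum_j mx_left c j * partial j f (Wrow W h w)) * g (Wrow W h' w) +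
    f (Wrow W h w) * (\sum_j mx_right c j * partial j g (Wrow W h' w)).
  rewrite /F partialM; first last.
  - by apply: differentiable_comp => //; exact: differentiable_mx.
  - by apply: differentiable_comp => //; exact: differentiable_mx.
  by rewrite !partial_mx// Wrow_left Wrow_right.
under eq_bigr => c _ do under eq_Ex do rewrite pF.
have aF c : am P (fun w => (\sum_j mx_left c j * partial j f (Wrow W h w)) * g (Wrow W h' w) +
    f (Wrow W h w) * (\sum_j mx_right c j * partial j g (Wrow W h' w))).
  by apply/amD; apply: amM => //; apply: am_sum => i; exact: amZ.
under eq_bigr => c _ do rewrite -(ExZ _ (am_itg (aF c))).
rewrite -Ex_sum; last by move=> c; exact: am_itg (amZ _ (aF c)).
apply: eq_Ex => w; rewrite !dot_grad.
rewrite -[(k + l.+1).+1]/(k.+1 + l.+1)%N big_split_ord /=; congr (_ + _).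
  rewrite mulr_suml; apply: eq_bigr => i _; rewrite joinv_l (bigD1 i)//= mxE eqxx mul1r big1.
    rewrite addr0 big1 ?mulr0 ?addr0; first by ring.
    by move=> j _; rewrite mxE eq_lrshift mul0r.
  by move=> j ji; rewrite mxE eq_lshift eq_sym (negbTE ji) mul0r.
rewrite mulr_sumr; apply: eq_bigr => i _; rewrite joinv_r big1.
  rewrite mul0r add0r (bigD1 i)//= mxE eqxx mul1r big1 ?addr0; first by ring.
  by move=> j ji; rewrite mxE eq_rshift eq_sym (negbTE ji) mul0r.
by move=> j _; rewrite mxE eq_rlshift mul0r.
Qed.

End joinv.

(** This is [joinv_ibp] in direction [h i] for the product of [partial i f] and [g], summed over
    [i]: the derivative falling on [partial i f] is the second-order term of [div_grad]. *)
Lemma grad_duality k l (h : 'I_k.+1 -> H) (h' : 'I_l.+1 -> H) f g :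
  smooth_poly_growth f -> smooth_poly_growth g ->
  Ex P (fun w => dot (grad h f w) (grad h' g w)) =
  Ex P (fun w => div_grad h f w * g (Wrow W h' w)).
Proof.
move=> sf sg.
have ag i := am_smooth h' (partial_smooth sg i).
have ag0 := am_smooth h' sg.
have aD f' x : smooth_poly_growth f' -> am P (fun w => dot (grad h f' w) x).
  move=> sf'; under eq_fun do rewrite dot_grad.
  by apply: am_sum => i; under eq_fun do rewrite mulrC; apply: amZ; exact: am_smooth (partial_smooth sf' i).
have aD' x : am P (fun w => dot (grad h' g w) x).
  by under eq_fun do rewrite dot_grad; apply: am_sum => i; under eq_fun do rewrite mulrC; exact: amZ.
have spf i := partial_smooth sf i.
under eq_Ex do rewrite dot_grad.
rewrite Ex_sum; last first.
  move=> i; apply: am_itg; apply: amM; first exact: am_smooth (spf i).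
  by under eq_fun do rewrite (dot_sym iso); exact: aD'.
rewrite /div_grad; under [RHS]eq_Ex do rewrite mulr_suml.
rewrite Ex_sum; last first.
  move=> i; apply: am_itg; apply: amM => //; apply: amB.
    by apply: amM; [exact: am_smooth (spf i)|exact: am_W iso (h i)].
  by apply: am_sum => j; apply: amZ; exact: am_smooth (partial_smooth (spf i) j).
apply: eq_bigr => i _.
have := joinv_ibp h h' (h i) (spf i) sg.
under [X in _ = _ + X -> _]eq_Ex do rewrite (dot_sym iso).
move=> e; apply/eqP; rewrite eq_sym -(inj_eq (addrI (Ex P (fun w => dot (grad h (partial i f) w) (h i) * g (Wrow W h' w))))) -e.
rewrite -ExD; first last.
- apply: am_itg; apply: amM => //; apply: amB.
    by apply: amM; [exact: am_smooth (spf i)|exact: am_W iso (h i)].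
  by apply: am_sum => j; apply: amZ; exact: am_smooth (partial_smooth (spf i) j).
- by apply: am_itg; apply: amM => //; exact: aD.
apply/eqP/eq_Ex => w; rewrite dot_grad.
under eq_bigr do rewrite mulrC.
by rewrite -mulrDl addrC subrK mulrCA mulrA.
Qed.

End smooth_calculus.

(** * Comparison of L^1, L^2 and L^4 norms *)

Section square_integrable.
Context {R : realType} d (T : measurableType d) (P : probability T R).
Implicit Types F G a b u : T -> R.

Definition l2 F := measurable_fun setT F /\ itg P (fun w => F w ^+ 2).

Lemma am_l2 F : am P F -> l2 F.
Proof. by move=> aF; split; [exact: am_meas aF|exact: am_itg (amX 2 aF)]. Qed.

Lemma l2_itg F : l2 F -> itg P F.
Proof.
move=> [mF iF]; apply: itg_le mF _ (itgD (itg_cst P 1) iF) => w.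
by have := sqr_ge0 (`|F w| - 1); rewrite sqrrB real_normK ?num_real//; have := normr_ge0 (F w); lra.
Qed.

Lemma l2M_itg F G : l2 F -> l2 G -> itg P (fun w => F w * G w).
Proof. by move=> [mF iF] [mG iG]; exact: Ex_le_L2. Qed.

Lemma l2_abs F : l2 F -> l2 (fun w => `|F w|).
Proof.
move=> [mF iF]; split; first exact: meas_abs.
by under eq_fun do rewrite real_normK ?num_real//.
Qed.

Lemma sqrD_le (x y : R) : (x + y) ^+ 2 <= 2 * x ^+ 2 + 2 * y ^+ 2.
Proof. by have := sqr_ge0 (x - y); rewrite sqrrB sqrrD; lra. Qed.

Lemma l2D F G : l2 F -> l2 G -> l2 (fun w => F w + G w).
Proof.
move=> [mF iF] [mG iG]; split; first exact: measurable_funD.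
apply: itg_le (itgD (itgZ 2 iF) (itgZ 2 iG)) => [|w]; first by apply: measX; exact: measurable_funD.
by rewrite ger0_norm ?sqr_ge0//; exact: sqrD_le.
Qed.

Lemma l2N F : l2 F -> l2 (fun w => - F w).
Proof.
move=> [mF iF]; split; first exact: measurable_funN.
by under eq_fun do rewrite sqrrN.
Qed.

Lemma l2B F G : l2 F -> l2 G -> l2 (fun w => F w - G w).
Proof. by move=> lF lG; apply: l2D => //; exact: l2N. Qed.

Lemma Ex_sqD_le F G : l2 F -> l2 G ->
  Ex P (fun w => (F w + G w) ^+ 2) <= 2 * Ex P (fun w => F w ^+ 2) + 2 * Ex P (fun w => G w ^+ 2).
Proof.
move=> lF lG; have [_ iFG] := l2D lF lG; case: lF lG => _ iF [_ iG].
rewrite -!ExZ// -ExD; try exact: itgZ.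
by apply: le_Ex => // [|w]; [apply: itgD; exact: itgZ|exact: sqrD_le].
Qed.

Lemma Ex_abs_sq F : l2 F -> Ex P (fun w => `|F w|) ^+ 2 <= Ex P (fun w => F w ^+ 2).
Proof.
move=> lF; have [m i] := l2_abs lF; have l1 := am_l2 (am_cst P 1).
have := Ex_CS m l1.1 i l1.2.
under eq_Ex do rewrite mulr1; under [X in _ <= _ * X -> _]eq_Ex do rewrite expr1n.
rewrite Ex_cst mulr1; under [X in _ <= X -> _]eq_Ex do rewrite real_normK ?num_real//.
exact.
Qed.

(** Pointwise [|a| <= M + a^2 / M], then Cauchy-Schwarz. It makes a product small when [b] is small
    in L^1 and merely bounded in L^2: [M] is chosen large first, then [b] small. *)
Lemma Ex_abs_mul_le a b (M : R) : 0 < M -> am P a -> l2 b ->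
  Ex P (fun w => `|a w * b w|) <=
  M * Ex P (fun w => `|b w|) + M^-1 * Num.sqrt (Ex P (fun w => a w ^+ 4) * Ex P (fun w => b w ^+ 2)).
Proof.
move=> M0 aa lb; have lb' := l2_abs lb; have l2a := am_l2 (amX 2 aa).
have i2 := l2M_itg l2a lb'; have ib := l2_itg lb'.
have h : Ex P (fun w => a w ^+ 2 * `|b w|) <=
    Num.sqrt (Ex P (fun w => a w ^+ 4) * Ex P (fun w => b w ^+ 2)).
  apply: sqrt_mono; first exact: sqrtr_ge0.
  rewrite sqr_sqrtr; last by rewrite mulr_ge0// Ex_ge0// => w; rewrite ?sqr_ge0// -[4%N]/(2 * 2)%N exprM sqr_ge0.
  have := Ex_CS l2a.1 lb'.1 l2a.2 lb'.2.
  under [X in _ <= X * _ -> _]eq_Ex do rewrite -exprM.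
  by under [X in _ <= _ * X -> _]eq_Ex do rewrite real_normK ?num_real//.
apply: le_trans (_ : M * Ex P (fun w => `|b w|) + M^-1 * Ex P (fun w => a w ^+ 2 * `|b w|) <= _); last first.
  by rewrite lerD2l ler_wpM2l// invr_ge0 ltW.
rewrite -!ExZ// -ExD; try exact: itgZ.
apply: le_Ex; [by apply: itg_abs; exact: l2M_itg (am_l2 aa) lb|by apply: itgD; exact: itgZ|move=> w].
rewrite normrM mulrA -mulrDl ler_wpM2r// -(ler_pM2l M0) mulrDr mulrA divff ?gt_eqF// mul1r.
have := sqr_ge0 (`|a w| - M); rewrite sqrrB real_normK ?num_real//.
by have := sqr_ge0 (`|a w|); rewrite real_normK ?num_real//; have := sqr_ge0 M; lra.
Qed.

(** Reverse of Jensen's inequality under an L^4 bound, from the pointwise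
    [u^2 <= M |u| + u^4 / M^2]. *)
Lemma Ex_sq_le_abs u (c : R) : 1 <= c -> am P u ->
  Ex P (fun w => u w ^+ 4) <= c * Ex P (fun w => u w ^+ 2) ^+ 2 ->
  Ex P (fun w => u w ^+ 2) <= 8 * c * Ex P (fun w => `|u w|) ^+ 2.
Proof.
move=> c1 au h4; set s := Ex P (fun w => u w ^+ 2) in h4 *.
have s0 : 0 <= s by apply: Ex_ge0 => w; exact: sqr_ge0.
have [s00|sn] := eqVneq s 0; first by rewrite s00 mulr_ge0 ?sqr_ge0//; lra.
have sp : 0 < s by rewrite lt_neqAle eq_sym sn.
(* Chosen so that the fourth-moment term is at most [s / 2] and can be absorbed on the left. *)
set M := Num.sqrt (2 * c * s).
have M2 : M ^+ 2 = 2 * c * s by rewrite sqr_sqrtr// !mulr_ge0//; lra.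
have Mp : 0 < M by rewrite sqrtr_gt0 !mulr_gt0//; lra.
have i1 := am_itg (am_abs au); have i4 := am_itg (amX 4 au).
have : s <= M * Ex P (fun w => `|u w|) + (M ^+ 2)^-1 * Ex P (fun w => u w ^+ 4).
  rewrite -!ExZ// -ExD; try exact: itgZ.
  apply: le_Ex; [exact: am_itg (amX 2 au)|by apply: itgD; exact: itgZ|move=> w].
  have M2p : 0 < M ^+ 2 by rewrite exprn_gt0.
  rewrite -(ler_pM2l M2p) mulrDr mulrA [_ * (_^-1 * _)]mulrA divff ?gt_eqF// mul1r.
  have := normr_ge0 (u w); set z := `|u w| => z0.
  have e2 : u w ^+ 2 = z ^+ 2 by rewrite /z real_normK ?num_real.
  have e4 : u w ^+ 4 = z ^+ 4 by rewrite -[4%N]/(2 * 2)%N !exprM e2.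
  rewrite -[_ * u w * u w]mulrA -expr2 e2 e4 {e2 e4}.
  have [zM|Mz] := leP z M.
    have : 0 <= M ^+ 2 * (z * (M - z)) by rewrite !mulr_ge0 ?sqr_ge0//; lra.
    by have := sqr_ge0 (z ^+ 2); lra.
  have : 0 <= z ^+ 2 * (z ^+ 2 - M ^+ 2).
    by rewrite mulr_ge0 ?sqr_ge0// subr_ge0 lerXn2r ?nnegrE//; lra.
  have : 0 <= M ^+ 2 * M * z by rewrite !mulr_ge0 ?sqr_ge0//; lra.
  by rewrite !mulrA; lra.
have : (M ^+ 2)^-1 * Ex P (fun w => u w ^+ 4) <= s / 2.
  rewrite M2 ler_pdivrMl ?mulr_gt0//; last by lra.
  by apply: le_trans h4 _; rewrite le_eqVlt; apply/orP; left; apply/eqP; field.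
set E1 := Ex P (fun w => `|u w|) => h2 h3.
have h5 : s <= 2 * M * E1 by lra.
have E0' : 0 <= E1 by apply: Ex_ge0.
have : s ^+ 2 <= s * (8 * c * E1 ^+ 2).
  rewrite (_ : s * _ = (2 * M * E1) ^+ 2); last by rewrite !exprMn M2; ring.
  by rewrite lerXn2r ?nnegrE// !mulr_ge0// ltW.
by rewrite expr2 ler_pM2l.
Qed.

Lemma le_ae_Ex F G : measurable_fun setT F -> itg P G -> (forall w, 0 <= F w) ->
  (forall w, 0 <= G w) -> {ae P, forall w, F w <= G w} -> Ex P F <= Ex P G.
Proof.
move=> mF iG F0 G0 FG; have mG := itg_meas iG.
have mm : measurable_fun setT (fun w => Num.min (F w) (G w)) by exact: measurable_minr.
have e : {ae P, forall w, Num.min (F w) (G w) = F w}.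
  by apply: filterS FG => w h; exact/min_idPl.
rewrite -(ae_eq_Ex mm mF e); apply: le_Ex => // [|w]; last by rewrite ge_min lexx orbT.
apply: itg_le mm _ iG => w.
by rewrite ger0_norm ?le_min ?F0 ?G0//= ge_min lexx orbT.
Qed.

Lemma small_expectation F (c : R) : measurable_fun setT F -> (forall w, 0 <= F w) ->
  (expectation P F < c%:E)%E -> itg P F /\ Ex P F <= c.
Proof.
move=> mF F0 h; have iF : itg P F.
  apply/integrableP; split; first exact/measurable_EFinP.
  apply: le_lt_trans (ltry c); apply: ltW; move: h; rewrite unlock.
  by under eq_integral do rewrite -[_%:E]gee0_abs ?lee_fin//.
by split=> //; move: h; rewrite expectationE// lte_fin => /ltW.
Qed.

End square_integrable.

Lemma cvg0_lt (R : realType) (u : nat -> \bar R) (eps : R) : u @ \oo --> 0%E -> 0 < eps ->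
  \forall n \near \oo, (u n < eps%:E)%E.
Proof.
move=> cu e0; apply: (cu (fun x => (x < eps%:E)%E)).
suff : \forall x \near (0 : R), (x%:E < eps%:E)%E by [].
apply/nbhs_ballP; exists eps => //= x; rewrite /ball/= sub0r normrN lte_fin.
by apply: le_lt_trans; exact: ler_norm.
Qed.

Section generator_bounds.
Context {R : realType} (A : gauss_alg R).

Lemma deg_L n (u : A) : deg n u -> deg n (L u) /\ Nr (L u) <= n%:R * Nr u.
Proof.
move=> du; have [f [hf eu]] := deg_decomp du.
have eL : L u = \sum_(j < n.+1) (j : nat)%:R *: f j.
  by rewrite eu linear_sum; apply: eq_bigr => j _; exact: hf.
have orth (c c' : 'I_n.+1 -> R) :
    ga_E ((\sum_j c j *: f j) * (\sum_j c' j *: f j)) = \sum_j c j * c' j * Nr (f j) ^+ 2.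
  rewrite mulr_suml E_sum; apply: eq_bigr => i _; rewrite mulr_sumr E_sum (bigD1 i)//= big1 ?addr0.
    by rewrite -scalerAl -scalerAr scalerA ga_EZ NrX.
  move=> j ji; rewrite -scalerAl -scalerAr scalerA ga_EZ.
  by rewrite (ch_orth _ (hf i) (hf j)) ?mulr0// eq_sym.
split.
  rewrite eL; apply: deg_sum => j; apply: degZ; apply: (@deg_le _ _ j); last exact: ch_deg.
  by rewrite -ltnS ltn_ord.
apply: sqrt_mono; first by rewrite mulr_ge0 ?Nr_ge0.
rewrite [leRHS]exprMn !NrX eL orth eu.
under [X in _ * ga_E (X * _)]eq_bigr do rewrite -[f _]scale1r.
under [X in _ * ga_E (_ * X)]eq_bigr do rewrite -[f _]scale1r.
rewrite orth mulr_sumr; apply: ler_sum => j _; rewrite !mul1r -expr2 ler_wpM2r ?sqr_ge0//.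
by rewrite lerXn2r ?nnegrE// ler_nat -ltnS ltn_ord.
Qed.

End generator_bounds.

(** * Malliavin derivatives and gradients of polynomials *)

Section closability.
Context {R : realType} (H : completeNormedModType R).
Variable dot : {dot H for idfun}.
Hypothesis dot_norm : forall x : H, dot x x = `|x| ^+ 2.
Context d (T : measurableType d) (P : probability T R).
Variable W : H -> {RV P >-> R}.
Hypothesis iso : isonormal_process dot W.

Definition hmeas (G : T -> H) := forall A : set H, open A -> measurable (G @^-1` A).

Lemma hmeas_comp (G : T -> H) (g : H -> R) : hmeas G -> continuous g ->
  measurable_fun setT (fun w => g (G w)).
Proof.
move=> mG cg; apply: (measurability _ (RGenOInfty.measurableE R)) => _ [_ [a ->] <-].
rewrite setTI -[X in measurable X]/(G @^-1` (g @^-1` `]a, +oo[%classic)).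
by apply: mG; apply: open_comp => // x _; exact: cg.
Qed.

Lemma am_dot_grad k (h : 'I_k.+1 -> H) phi x : smooth_poly_growth phi ->
  am P (fun w => dot (grad W h phi w) x).
Proof.
move=> sphi; under eq_fun do rewrite dot_grad.
apply: am_sum => i; under eq_fun do rewrite mulrC.
by apply: amZ; exact: (am_smooth iso h (partial_smooth sphi i)).
Qed.

Lemma am_grad_dot k l (h : 'I_k.+1 -> H) phi (h' : 'I_l.+1 -> H) psi :
  smooth_poly_growth phi -> smooth_poly_growth psi ->
  am P (fun w => dot (grad W h phi w) (grad W h' psi w)).
Proof.
move=> sphi spsi; under eq_fun do rewrite dot_grad.
apply: am_sum => i; apply: amM; first exact: (am_smooth iso h (partial_smooth sphi i)).
by under eq_fun do rewrite (dot_sym iso); exact: am_dot_grad.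
Qed.

Lemma meas_gradB k (h : 'I_k.+1 -> H) phi (G : T -> H) : smooth_poly_growth phi -> hmeas G ->
  measurable_fun setT (fun w => `|grad W h phi w - G w| ^+ 2).
Proof.
move=> sphi mG; under eq_fun do rewrite (normB_sq dot_norm iso).
apply: measurable_funD; last by apply: (hmeas_comp (g := fun y => `|y| ^+ 2)) => // y;
  apply: cvgM; apply: cvg_norm; exact: cvg_id.
apply: measurable_funB.
  by under eq_fun do rewrite -dot_norm; exact: am_meas (am_grad_dot h h sphi sphi).
apply: measurable_funM; first exact: measurable_cst.
under eq_fun do rewrite dot_grad.
apply: measurable_sum => i; apply: measurable_funM.
  exact: am_meas (am_smooth iso h (partial_smooth sphi i)).
by apply: (hmeas_comp (g := fun y => dot (h i) y)) => // y; exact: (dot_cont dot_norm iso).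
Qed.

Lemma normD_sq_le (x y : H) : `|x + y| ^+ 2 <= 2 * `|x| ^+ 2 + 2 * `|y| ^+ 2.
Proof.
apply: le_trans (sqrD_le `|x| `|y|).
by rewrite lerXn2r ?nnegrE// ?addr_ge0// ler_normD.
Qed.

Section malliavin.
Variables (F : T -> R) (DF : T -> H).
Hypothesis mall : is_malliavin_derivative W F DF.

Lemma mall_meas : measurable_fun setT F. Proof. by case: mall. Qed.

Lemma mall_hmeas : hmeas DF. Proof. by case: mall. Qed.

Lemma mall_approx (eps : R) : 0 < eps -> exists k (h : 'I_k.+1 -> H) phi,
  [/\ smooth_poly_growth phi,
      itg P (fun w => (phi (Wrow W h w) - F w) ^+ 2) /\
      Ex P (fun w => (phi (Wrow W h w) - F w) ^+ 2) <= eps &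
      itg P (fun w => `|grad W h phi w - DF w| ^+ 2) /\
      Ex P (fun w => `|grad W h phi w - DF w| ^+ 2) <= eps].
Proof.
move=> e0; have [mF mDF [Fk [DFk [sF cF cDF]]]] := mall.
have [i hi] : exists i, (expectation P (fun w => ((Fk i w - F w) ^+ 2)%R) < eps%:E)%E /\
    (expectation P (fun w => (`|DFk i w - DF w| ^+ 2)%R) < eps%:E)%E.
  have h1 := cvg0_lt cF e0; have h2 := cvg0_lt cDF e0.
  by have [i hi] := filter_ex (filterI h1 h2); exists i.
have [k [h [phi [sphi eF eD]]]] := sF i; exists k, h, phi.
have {}eF : Fk i = fun w => phi (Wrow W h w) by apply/funext.
have {}eD : DFk i = grad W h phi by apply/funext.
rewrite eF eD in hi; case: hi => h1 h2.
split=> //.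
  apply: small_expectation h1 => [|w]; last exact: sqr_ge0.
  by apply: measX; apply: measurable_funB => //; exact: am_meas (am_smooth iso h sphi).
by apply: small_expectation h2 => [|w]; [exact: meas_gradB|exact: sqr_ge0].
Qed.

Lemma mall_l2 : l2 P F.
Proof.
have [k [h [phi [sphi [iF _] _]]]] := mall_approx ltr01.
have l1 := am_l2 (am_smooth iso h sphi).
have l3 : l2 P (fun w => phi (Wrow W h w) - F w).
  by split=> //; apply: measurable_funB; [exact: l1.1|exact: mall_meas].
have -> : F = fun w => phi (Wrow W h w) - (phi (Wrow W h w) - F w) by apply/funext => w; rewrite subKr.
exact: l2B.
Qed.

Lemma mall_itg : itg P (fun w => `|DF w| ^+ 2).
Proof.
have [k [h [phi [sphi _ [iD _]]]]] := mall_approx ltr01.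
apply: itg_le (itgD (itgZ 2 (am_itg (am_grad_dot h h sphi sphi))) (itgZ 2 iD)) => [|w].
  by apply: (hmeas_comp (g := fun y => `|y| ^+ 2)); [exact: mall_hmeas|move=> y; apply: cvgM; apply: cvg_norm; exact: cvg_id].
rewrite ger0_norm ?sqr_ge0// -{1}[DF w](subKr (grad W h phi w)).
by apply: le_trans (normD_sq_le _ _) _; rewrite normrN dot_norm.
Qed.

Lemma gradB_itg k (h : 'I_k.+1 -> H) phi : smooth_poly_growth phi ->
  itg P (fun w => `|grad W h phi w - DF w| ^+ 2).
Proof.
move=> sphi.
apply: itg_le (itgD (itgZ 2 (am_itg (am_grad_dot h h sphi sphi))) (itgZ 2 mall_itg)) => [|w].
  exact: meas_gradB sphi mall_hmeas.
by rewrite ger0_norm ?sqr_ge0//; apply: le_trans (normD_sq_le _ _) _; rewrite normrN dot_norm.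
Qed.

End malliavin.

Section polynomials.
Context k (e : 'I_k.+1 -> H) (he : orthonormal_family dot e).
Local Notation A := (Walg iso he).
Implicit Types u v : A.

Definition gradp (u : mpoly k.+1 R) : T -> H := grad W e (pfun u).

Lemma dot_gradp u v w : dot (gradp u w) (gradp v w) = Wpoly W e (Gam u v) w.
Proof.
rewrite dot_grad /Gam /Wpoly /pfun [RHS]raddf_sum; apply: eq_bigr => i _ /=.
rewrite mevalM pfun_partial; congr (_ * _).
rewrite (dot_sym iso) dot_grad (bigD1 i)//= he eqxx mulr1 pfun_partial big1 ?addr0//.
by move=> j ji; rewrite he (negbTE ji) mulr0.
Qed.

Lemma div_gradp u w : div_grad dot W e (pfun u) w = Wpoly W e (L u) w.
Proof.
rewrite /div_grad /L /Wpoly /pfun [RHS]raddf_sum; apply: eq_bigr => i _ /=.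
rewrite mevalB mevalM mevalXU mxE !pfun_partial mulrC; congr (_ - _).
rewrite (bigD1 i)//= he eqxx mul1r pfun_partial big1 ?addr0//.
by move=> j ji; rewrite he (negbTE ji) mul0r.
Qed.

Lemma Ex_Wpoly_sq u : Ex P (fun w => Wpoly W e u w ^+ 2) = Nr u ^+ 2.
Proof. by rewrite NrX; apply: eq_Ex => w; rewrite WpolyM expr2. Qed.

Lemma Ex_Wpoly_4 n u : deg n u ->
  Ex P (fun w => Wpoly W e u w ^+ 4) <= hc n ^+ 2 * Ex P (fun w => Wpoly W e u w ^+ 2) ^+ 2.
Proof.
move=> du; rewrite Ex_Wpoly_sq -exprMn.
have -> : Ex P (fun w => Wpoly W e u w ^+ 4) = Ex P (fun w => Wpoly W e (u * u) w ^+ 2).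
  by apply: eq_Ex => w; rewrite WpolyM -expr2 -exprM.
have h0 : 0 <= hc n :> R by apply: le_trans ler01 _; exact: hc_ge1.
rewrite (Ex_Wpoly_sq (u * u)) lerXn2r ?nnegrE ?mulr_ge0 ?sqr_ge0 ?Nr_ge0//.
exact: deg_hyper.
Qed.

Lemma Nr_le_abs n u : deg n u -> Nr u ^+ 2 <= 8 * hc n ^+ 2 * Ex P (fun w => `|Wpoly W e u w|) ^+ 2.
Proof.
move=> du; rewrite -Ex_Wpoly_sq; apply: Ex_sq_le_abs; last exact: Ex_Wpoly_4.
  by rewrite exprn_ege1// hc_ge1.
exact: (am_Wpoly iso).
Qed.

Lemma Ex_gradp_le n u : deg n u -> Ex P (fun w => `|gradp u w| ^+ 2) <= n%:R * Nr u ^+ 2.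
Proof.
move=> du; under eq_Ex do rewrite -dot_norm dot_gradp.
rewrite -[leLHS]/(ga_E (Gam u u)); exact: deg_Gam_le.
Qed.

End polynomials.

End closability.

(** * Closability on chaoses *)

Section chaos_closability.
Context {R : realType} (H : completeNormedModType R).
Variable dot : {dot H for idfun}.
Hypothesis dot_norm : forall x : H, dot x x = `|x| ^+ 2.
Context d (T : measurableType d) (P : probability T R).
Variable W : H -> {RV P >-> R}.
Hypothesis iso : isonormal_process dot W.

Lemma itg_gradB k l (h : 'I_k.+1 -> H) phi (h' : 'I_l.+1 -> H) psi :
  smooth_poly_growth phi -> smooth_poly_growth psi ->
  itg P (fun w => `|grad W h phi w - grad W h' psi w| ^+ 2).
Proof.
move=> sf sg; under eq_fun do rewrite (normB_sq dot_norm iso) -!dot_norm.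
by apply: am_itg; apply: amD; [apply: amB; [|apply: amZ]|]; exact: (am_grad_dot iso).
Qed.

(* Integration by parts against the gradient of a fixed smooth functional [f] replaces
   the gradients by [V = div_grad f], at the price of the distance between the gradients of
   [f] and [g]. *)
Lemma gradB_duality k (e : 'I_k.+1 -> H) (he : orthonormal_family dot e) (u : Walg iso he)
    l (h : 'I_l.+1 -> H) f l' (h' : 'I_l'.+1 -> H) g :
  smooth_poly_growth f -> smooth_poly_growth g ->
  Ex P (fun w => `|gradp W e u w - grad W h' g w| ^+ 2) <=
  2 * Ex P (fun w => `|(Wpoly W e (L u) w - div_grad dot W h f w) *
                       (Wpoly W e u w - g (Wrow W h' w))|) +
  Ex P (fun w => `|grad W h' g w - grad W h f w| ^+ 2).
Proof.
move=> sf sg.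
have su : smooth_poly_growth (pfun u) by move=> n; exact: pfun_smooth.
have ad := am_grad_dot iso; have iE F : am P F -> itg P F by exact: am_itg.
have aV := am_div_grad iso h sf; have ag := am_smooth iso h' sg; have au := am_Wpoly iso e u.
have aL := am_Wpoly iso e (L u).
set Du := gradp W e u; set Dg := grad W h' g; set Df := grad W h f.
have e1 : Ex P (fun w => (Wpoly W e (L u) w - div_grad dot W h f w) * (Wpoly W e u w - g (Wrow W h' w))) =
    Ex P (fun w => dot (Du w - Df w) (Du w - Dg w)).
  have := grad_duality iso e e su su; have := grad_duality iso e h' su sg.
  have := grad_duality iso h e sf su; have := grad_duality iso h h' sf sg.
  under [X in _ = X -> _ -> _ -> _ = _ -> _]eq_Ex do idtac.
  have d1 := ad _ _ e _ e _ su su; have d2 := ad _ _ e _ h' _ su sg.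
  have d3 := ad _ _ h _ e _ sf su; have d4 := ad _ _ h _ h' _ sf sg.
  move=> h4 h3 h2 h1.
  under eq_Ex do rewrite mulrBl !mulrBr.
  under [RHS]eq_Ex do rewrite dotBl !dotBr.
  rewrite !ExB; do ?[by apply: iE; do ?apply: amB; do ?apply: amM].
  rewrite h1 h2 h3 h4; congr (_ - _ - (_ - _)); apply: eq_Ex => w; by rewrite div_gradp.
have iD : itg P (fun w => `|Du w - Dg w| ^+ 2) by exact: itg_gradB.
have iD' : itg P (fun w => `|Dg w - Df w| ^+ 2) by exact: itg_gradB.
have iab : am P (fun w => (Wpoly W e (L u) w - div_grad dot W h f w) * (Wpoly W e u w - g (Wrow W h' w))).
  by apply: amM; apply: amB.
have ic : itg P (fun w => dot (Du w - Df w) (Du w - Dg w)).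
  under eq_fun do rewrite dotBl !dotBr.
  by apply: iE; do ?apply: amB; exact: ad.
have : Ex P (fun w => `|Du w - Dg w| ^+ 2) <= Ex P (fun w => dot (Du w - Df w) (Du w - Dg w) +
    (2^-1 * `|Dg w - Df w| ^+ 2 + 2^-1 * `|Du w - Dg w| ^+ 2)).
  apply: le_Ex => // [|w]; first by apply: itgD => //; apply: itgD; exact: itgZ.
  have -> : Du w - Df w = (Du w - Dg w) + (Dg w - Df w) by rewrite addrA subrK.
  rewrite dotDl dot_norm; have := dot_le_norm dot_norm iso (Dg w - Df w) (Du w - Dg w).
  rewrite ler_norml => /andP[h1 _].
  have := sqr_ge0 (`|Dg w - Df w| - `|Du w - Dg w|); rewrite sqrrB; lra.
rewrite ExD//; last by apply: itgD; exact: itgZ.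
rewrite ExD; try exact: itgZ.
rewrite !ExZ// -e1; have := abs_Ex (iE _ iab); have := ler_norm (Ex P (fun w =>
  (Wpoly W e (L u) w - div_grad dot W h f w) * (Wpoly W e u w - g (Wrow W h' w)))).
lra.
Qed.

(** Closability in uniform form: [eta] depends neither on the finite family nor on [u]. Bounded
    degree turns the L^1 bound into bounds on the moments of [u] and [L u]; then [gradB_duality] and
    [Ex_abs_mul_le] control the gradient by the L^1 distance to [F]. *)
Lemma grad_closable n F DF (eps : R) : is_malliavin_derivative W F DF -> 0 < eps ->
  exists2 eta : R, 0 < eta & forall k (e : 'I_k.+1 -> H) (he : orthonormal_family dot e) (u : Walg iso he),
    deg n u -> Ex P (fun w => `|Wpoly W e u w - F w|) <= eta ->
    Ex P (fun w => `|gradp W e u w - DF w| ^+ 2) <= eps.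
Proof.
move=> mall e0; have lF := mall_l2 dot_norm iso mall.
pose c : R := hc n ^+ 2.
have c1 : 1 <= c by rewrite exprn_ege1// hc_ge1.
pose K1 := Ex P (fun w => `|F w|) + 1.
have K10 : 0 <= K1 by rewrite addr_ge0// Ex_ge0.
pose K := 8 * c * K1 ^+ 2.
have K0 : 0 <= K by rewrite !mulr_ge0 ?sqr_ge0//; lra.
have [l [h [f [sf [_ _] [if_ hf]]]]] := mall_approx dot_norm iso mall (ltac:(lra) : 0 < eps / 16).
set V := div_grad dot W h f; have aV : am P V := am_div_grad iso h sf.
(* [K] bounds [Nr u ^+ 2], [K4] the fourth moment of [L u - V], and [K2] the second moment of
   [u - g]. Then [M] makes the Cauchy-Schwarz term at most [eps / 16], and [eta] makes [M * eta] at
   most [eps / 16]. *)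
pose K4 := 8 * (c * (n%:R ^+ 2 * K) ^+ 2 + Ex P (fun w => V w ^+ 4)).
pose K2 := 2 * K + 4 * (Ex P (fun w => F w ^+ 2) + eps).
pose S := Num.sqrt (K4 * K2).
have S0 : 0 <= S by exact: sqrtr_ge0.
pose M := 16 * (S + 1) / eps.
have M0 : 0 < M by rewrite divr_gt0// mulr_gt0//; lra.
pose eta := Num.min 1 (eps / (16 * M)).
have eta0 : 0 < eta by rewrite lt_min ltr01 divr_gt0// mulr_gt0.
exists eta => // k e he u du hu.
pose t := eps / (32 * M).
have t0 : 0 < t by rewrite divr_gt0// mulr_gt0.
pose e2 := Num.min (Num.min (eps / 48) eps) (t ^+ 2).
have e20 : 0 < e2 by rewrite !lt_min e0 exprn_gt0//= andbT; lra.
(* A second approximant is needed: [M] depends on [f] through [V], and the distance of [g] to [F]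
   has to be small compared with [1 / M]. *)
have [l' [h' [g [sg [ig hg] [ig' hg']]]]] := mall_approx dot_norm iso mall e20.
have e2a : e2 <= eps / 48 by rewrite /e2 !ge_min lexx.
have e2b : e2 <= eps by rewrite /e2 !ge_min lexx orbT.
have e2c : e2 <= t ^+ 2 by rewrite /e2 !ge_min lexx !orbT.
have au := am_Wpoly iso e u; have lu := am_l2 au.
have ag := am_smooth iso h' sg; have lg := am_l2 ag.
have su : smooth_poly_growth (pfun u) by move=> ?; exact: pfun_smooth.
have lgF : l2 P (fun w => g (Wrow W h' w) - F w) by exact: l2B.
have Eu : Ex P (fun w => `|Wpoly W e u w|) <= K1.
  apply: le_trans (_ : Ex P (fun w => `|Wpoly W e u w - F w| + `|F w|) <= _).
    apply: le_Ex => [||w]; first exact: l2_itg (l2_abs lu).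
      by apply: itgD; apply: l2_itg; apply: l2_abs => //; exact: l2B.
    by rewrite -{1}[Wpoly W e u w](subrK (F w)) ler_normD.
  rewrite ExD; [|by apply: l2_itg; apply: l2_abs; exact: l2B|by apply: l2_itg; exact: l2_abs].
  rewrite /K1 addrC lerD2l; apply: le_trans hu _; by rewrite ge_min lexx.
have Nu : Nr u ^+ 2 <= K.
  apply: le_trans (Nr_le_abs du) _; rewrite -/c /K ler_wpM2l//; first by rewrite mulr_ge0//; lra.
  by rewrite lerXn2r ?nnegrE// Ex_ge0.
have [dL NL] := deg_L du.
pose a w := Wpoly W e (L u) w - V w.
pose b w := Wpoly W e u w - g (Wrow W h' w).
have aa : am P a by apply: amB => //; exact: (am_Wpoly iso).
have lb : l2 P b by apply: l2B.
have Ea : Ex P (fun w => a w ^+ 4) <= K4.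
  apply: le_trans (_ : Ex P (fun w => 8 * (Wpoly W e (L u) w ^+ 4 + V w ^+ 4)) <= _).
    have aL := am_Wpoly iso e (L u).
    apply: le_Ex => [||w]; first exact: am_itg (amX 4 aa).
      by apply: am_itg; apply: amZ; apply: amD; exact: amX.
    rewrite /a -[(_ - _) ^+ 4]/(_ ^+ (2 * 2)) exprM.
    set x := Wpoly _ _ _ _; set y := V w.
    have h1 : (x - y) ^+ 2 <= 2 * x ^+ 2 + 2 * y ^+ 2 by have := sqrD_le x (- y); rewrite sqrrN.
    apply: le_trans (_ : (2 * x ^+ 2 + 2 * y ^+ 2) ^+ 2 <= _).
      by rewrite lerXn2r ?nnegrE ?sqr_ge0// addr_ge0// mulr_ge0 ?sqr_ge0.
    have x4 (z : R) : z ^+ 4 = (z ^+ 2) ^+ 2 by rewrite -exprM.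
    by rewrite !x4; have := sqrD_le (2 * x ^+ 2) (2 * y ^+ 2); lra.
  have aL4 := am_itg (amX 4 (am_Wpoly iso e (L u))); have aV4 := am_itg (amX 4 aV).
  rewrite ExZ ?ExD//; last exact: itgD.
  rewrite /K4 ler_wpM2l// lerD2r; apply: le_trans (Ex_Wpoly_4 dL) _.
  rewrite -/c ler_wpM2l//; first by lra.
  rewrite Ex_Wpoly_sq lerXn2r ?nnegrE ?sqr_ge0// ?mulr_ge0 ?sqr_ge0//.
  apply: le_trans (_ : (n%:R * Nr u) ^+ 2 <= _).
    by rewrite lerXn2r ?nnegrE ?Nr_ge0// mulr_ge0 ?Nr_ge0.
  by rewrite exprMn ler_wpM2l// sqr_ge0.
have Eb : Ex P (fun w => b w ^+ 2) <= K2.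
  apply: le_trans (Ex_sqD_le lu (l2N lg)) _; under [X in _ + _ * X <= _]eq_Ex do rewrite sqrrN.
  rewrite Ex_Wpoly_sq /K2; have := Ex_sqD_le lF lgF.
  under [X in X <= _ -> _]eq_Ex do rewrite addrC subrK.
  by lra.
have Eb1 : Ex P (fun w => `|b w|) <= eta + t.
  apply: le_trans (_ : Ex P (fun w => `|Wpoly W e u w - F w| + `|g (Wrow W h' w) - F w|) <= _).
    apply: le_Ex => [||w]; first exact: l2_itg (l2_abs lb).
      by apply: itgD; apply: l2_itg; apply: l2_abs => //; exact: l2B.
    rewrite /b [X in `|X|](_ : _ = (Wpoly W e u w - F w) - (g (Wrow W h' w) - F w)); last by ring.
    exact: ler_normB.
  rewrite ExD; try by apply: l2_itg; apply: l2_abs => //; exact: l2B.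
  apply: lerD => //; apply: sqrt_mono; first exact: ltW.
  by apply: le_trans (Ex_abs_sq lgF) _; exact: le_trans hg e2c.
have h1 := gradB_duality u h h' sf sg.
have h2 : Ex P (fun w => `|grad W h' g w - grad W h f w| ^+ 2) <= 2 * e2 + 2 * (eps / 16).
  apply: le_trans (_ : Ex P (fun w => 2 * `|grad W h' g w - DF w| ^+ 2 + 2 * `|grad W h f w - DF w| ^+ 2) <= _).
    apply: le_Ex => [||w]; last 1 first.
    - rewrite -[_ - grad W h f w](subrKA (DF w)) -[DF w - _]opprB.
      by apply: le_trans (normD_sq_le _ _) _; rewrite normrN.
    - exact: itg_gradB.
    - by apply: itgD; exact: itgZ.
  by rewrite ExD ?ExZ//; try exact: itgZ; lra.
have h3 : Ex P (fun w => `|gradp W e u w - DF w| ^+ 2) <=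
    2 * Ex P (fun w => `|gradp W e u w - grad W h' g w| ^+ 2) + 2 * e2.
  have i1 : itg P (fun w => `|gradp W e u w - grad W h' g w| ^+ 2) by exact: itg_gradB.
  apply: le_trans (_ : Ex P (fun w => 2 * `|gradp W e u w - grad W h' g w| ^+ 2 + 2 * `|grad W h' g w - DF w| ^+ 2) <= _).
    apply: le_Ex => [||w]; last 1 first.
    - by rewrite -[gradp W e u w - _](subrKA (grad W h' g w)); exact: normD_sq_le.
    - exact: (gradB_itg dot_norm iso mall e su).
    - by apply: itgD; exact: itgZ.
  by rewrite ExD ?ExZ//; try exact: itgZ; lra.
have h4 := Ex_abs_mul_le M0 aa lb.
have h5 : Num.sqrt (Ex P (fun w => a w ^+ 4) * Ex P (fun w => b w ^+ 2)) <= S.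
  apply: ler_wsqrtr; apply: ler_pM => //; apply: Ex_ge0 => w; last exact: sqr_ge0.
  by rewrite -[4%N]/(2 * 2)%N exprM sqr_ge0.
have h6 : M * (eta + t) <= eps / 16 + eps / 32.
  have hM : M * eta <= eps / 16.
    apply: le_trans (_ : M * (eps / (16 * M)) <= _).
      by rewrite ler_pM2l// /eta ge_min lexx orbT.
    by rewrite le_eqVlt; apply/orP; left; apply/eqP; field; rewrite gt_eqF.
  have -> : M * (eta + t) = M * eta + eps / 32 by rewrite /t; field; rewrite gt_eqF.
  by rewrite lerD2r.
have h7 : M^-1 * S <= eps / 16.
  rewrite /M ler_pdivrMl//.
  rewrite [leRHS](_ : _ = S + 1); last by field; rewrite gt_eqF.
  by lra.
have h8 : M * Ex P (fun w => `|b w|) <= M * (eta + t) by rewrite ler_pM2l.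
have h9 : M^-1 * Num.sqrt (Ex P (fun w => a w ^+ 4) * Ex P (fun w => b w ^+ 2)) <= M^-1 * S.
  by rewrite ler_pM2l// invr_gt0.
rewrite -/V in h1; rewrite /a /b in h4 h8 h9; lra.
Qed.

(** Continuity of the bracket: [<Du, Dv> - <DF, DG>] splits as [<Du - DF, Dv> + <DF, Dv - DG>], and
    Young's inequality with weight [t] plays the small gradient distances against the bounded
    energies of [v] and [F]. *)
Lemma Gam_approx m n F G Z (eps : R) : is_derivative_product dot W F G Z ->
  measurable_fun setT Z -> 0 < eps ->
  exists2 eta : R, 0 < eta & forall k (e : 'I_k.+1 -> H) (he : orthonormal_family dot e) (u v : Walg iso he),
    deg m u -> deg n v -> Ex P (fun w => `|Wpoly W e u w - F w|) <= eta ->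
    Ex P (fun w => `|Wpoly W e v w - G w|) <= eta ->
    Ex P (fun w => `|Wpoly W e (Gam u v) w - Z w|) <= eps.
Proof.
move=> [DF [DG [mF mG hZ]]] mZ e0.
have lF := mall_l2 dot_norm iso mF; have lG := mall_l2 dot_norm iso mG.
have iDF := mall_itg dot_norm iso mF; have iDG := mall_itg dot_norm iso mG.
pose K := n%:R * (8 * hc n ^+ 2 * (Ex P (fun w => `|G w|) + 1) ^+ 2) : R.
have K0 : 0 <= K by apply: mulr_ge0 => //; apply: mulr_ge0; rewrite ?sqr_ge0// mulr_ge0 ?sqr_ge0.
pose D := Ex P (fun w => `|DF w| ^+ 2).
have D0 : 0 <= D by apply: Ex_ge0 => w; exact: sqr_ge0.
pose t := eps / (K + D + 1).
have t0 : 0 < t by rewrite divr_gt0//; lra.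
have te0 : 0 < t * eps / 2 by rewrite divr_gt0// mulr_gt0.
have [eta1 eta10 h1] := grad_closable m mF te0.
have [eta2 eta20 h2] := grad_closable n mG te0.
exists (Num.min (Num.min eta1 eta2) 1); first by rewrite !lt_min eta10 eta20 ltr01.
move=> k e he u v du dv hu hv.
move: hu hv; rewrite !le_min => /andP[/andP[hu _] _] /andP[/andP[_ hv'] hv].
have {}h1 := h1 _ _ he u du hu; have {}h2 := h2 _ _ he v dv hv'.
have su (x : Walg iso he) : smooth_poly_growth (pfun x) by move=> ?; exact: pfun_smooth.
have lv := am_l2 (am_Wpoly iso e v).
have Ev : Ex P (fun w => `|gradp W e v w| ^+ 2) <= K.
  apply: le_trans (Ex_gradp_le dot_norm dv) _; rewrite ler_wpM2l//.
  apply: le_trans (Nr_le_abs dv) _; rewrite ler_wpM2l ?mulr_ge0 ?sqr_ge0//.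
  rewrite lerXn2r ?nnegrE ?addr_ge0 ?Ex_ge0//.
  apply: le_trans (_ : Ex P (fun w => `|G w| + `|Wpoly W e v w - G w|) <= _).
    apply: le_Ex => [||w]; first exact: l2_itg (l2_abs lv).
      by apply: itgD; apply: l2_itg; apply: l2_abs => //; exact: l2B.
    by rewrite -{1}[Wpoly W e v w](subrK (G w)) addrC; exact: ler_normD.
  rewrite ExD ?lerD2l//; apply: l2_itg; apply: l2_abs => //; exact: l2B.
have iu := gradB_itg dot_norm iso mF e (su u).
have iv := gradB_itg dot_norm iso mG e (su v).
have igv : itg P (fun w => `|gradp W e v w| ^+ 2).
  by under eq_fun do rewrite -dot_norm; apply: am_itg; exact: (am_grad_dot iso).
pose B w := (2 * t)^-1 * (`|gradp W e u w - DF w| ^+ 2 + `|gradp W e v w - DG w| ^+ 2) +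
  t / 2 * (`|gradp W e v w| ^+ 2 + `|DF w| ^+ 2).
have t2 : 0 <= (2 * t)^-1 by rewrite invr_ge0 mulr_ge0// ltW.
have iB : itg P B by apply: itgD; apply: itgZ; exact: itgD.
have young (x y : R) : x * y <= (2 * t)^-1 * x ^+ 2 + t / 2 * y ^+ 2.
  have -> : (2 * t)^-1 * x ^+ 2 + t / 2 * y ^+ 2 = x * y + (2 * t)^-1 * (x - t * y) ^+ 2.
    by field; rewrite gt_eqF.
  by rewrite lerDl mulr_ge0// sqr_ge0.
apply: le_trans (_ : Ex P B <= _).
  apply: le_ae_Ex => //.
  - apply: meas_abs; apply: measurable_funB => //; exact: am_meas (am_Wpoly iso e _).
  - by move=> w; rewrite /B addr_ge0// mulr_ge0// ?addr_ge0 ?sqr_ge0// divr_ge0// ltW.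
  apply: filterS hZ => w ->; rewrite -dot_gradp.
  set a := gradp W e u w; set b := gradp W e v w.
  have -> : dot a b - dot (DF w) (DG w) = dot (a - DF w) b + dot (DF w) (b - DG w).
    by rewrite dotBl dotBr addrA subrK.
  apply: le_trans (ler_normD _ _) _.
  have := dot_le_norm dot_norm iso (a - DF w) b; have := dot_le_norm dot_norm iso (DF w) (b - DG w).
  have := young `|a - DF w| `|b|; have := young `|b - DG w| `|DF w|.
  by rewrite /B -/a -/b; lra.
have tK : t * (K + D) <= eps by rewrite /t mulrAC ler_pdivrMr ?ler_pM2l//; lra.
rewrite /B ExD ?ExZ ?ExD//; try (by apply: itgZ; exact: itgD); try exact: itgD.
have : (2 * t)^-1 * (Ex P (fun w => `|gradp W e u w - DF w| ^+ 2) + Ex P (fun w => `|gradp W e v w - DG w| ^+ 2)) <= eps / 2.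
  have t20 : 0 < 2 * t by rewrite pmulr_rgt0.
  rewrite ler_pdivrMl//.
  rewrite [leRHS](_ : _ = t * eps / 2 + t * eps / 2); last by field.
  exact: lerD.
have : t / 2 * (Ex P (fun w => `|gradp W e v w| ^+ 2) + Ex P (fun w => `|DF w| ^+ 2)) <= eps / 2.
  rewrite -/D [leLHS](_ : _ = t * (Ex P (fun w => `|gradp W e v w| ^+ 2) + D) / 2); last by field.
  rewrite ler_wpM2r//; apply: le_trans tK.
  by rewrite ler_wpM2l ?(ltW t0)// lerD2r.
by lra.
Qed.

Lemma itG_approx p q (X : T -> R) (Y : nat -> T -> R) (r : nat) (eps : R) :
  (forall r, is_derivative_product dot W X (Y r) (Y r.+1)) -> (forall r, measurable_fun setT (Y r)) ->
  0 < eps ->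
  exists2 eta : R, 0 < eta & forall k (e : 'I_k.+1 -> H) (he : orthonormal_family dot e) (x y : Walg iso he),
    deg p x -> deg q y -> Ex P (fun w => `|Wpoly W e x w - X w|) <= eta ->
    Ex P (fun w => `|Wpoly W e y w - Y 0%N w|) <= eta ->
    Ex P (fun w => `|Wpoly W e (itG r x y) w - Y r w|) <= eps.
Proof.
move=> hd mY; elim: r eps => [|r IH] eps e0; first by exists eps.
have [eta1 eta10 h1] := Gam_approx p (q + r * p) (hd r) (mY r.+1) e0.
have [eta2 eta20 h2] := IH _ eta10.
exists (Num.min eta1 eta2); first by rewrite lt_min eta10.
move=> k e he x y dx dy; rewrite !le_min => /andP[hx1 hx2] /andP[hy1 hy2].
apply: h1 => //; last exact: h2.
exact: deg_itG.
Qed.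

End chaos_closability.

(** * Hermite polynomials and approximation of multiple integrals *)

Section hermite_chaos.
Context {R : realType} (A : gauss_alg R).

Lemma deriv_hermite n : deriv (hermite R n.+1) = n.+1%:R *: hermite R n.
Proof.
elim: n => [|n IH].
  by rewrite /= (_ : deriv 1 = 0 :> {poly R}) -?polyC1 ?derivC// polyC1 mulr1 subr0 derivX scale1r.
have e1 : hermite R n.+1 = 'X * hermite R n - deriv (hermite R n) by [].
have e2 : hermite R n.+2 = 'X * hermite R n.+1 - deriv (hermite R n.+1) by [].
rewrite e2 IH derivB derivM derivX derivZ IH mul1r -scalerAr -addrA -scalerBr -e1.
by rewrite -[n.+2%:R]natr1 scalerDl scale1r addrC.
Qed.

Lemma hermite_eq n : 'X * deriv (hermite R n) - deriv (deriv (hermite R n)) = n%:R *: hermite R n.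
Proof.
case: n => [|n]; first by rewrite /= !derivC mulr0 subrr scale0r.
rewrite deriv_hermite derivZ -scalerAr -scalerBr; congr (_ *: _).
Qed.

Variables (z : A) (t : 'I_(ga_dim A) -> R).
Hypothesis z_eq : z = \sum_i t i *: ga_x i.
Hypothesis t_unit : \sum_i t i ^+ 2 = 1.

Lemma D_horner_alg i q : ga_D i (horner_alg z q) = t i *: horner_alg z (deriv q).
Proof.
have Dz : ga_D i z = (t i)%:A.
  rewrite z_eq linear_sum (bigD1 i)//= linearZ /= ga_Dx eqxx big1 ?addr0// => j ji.
  by rewrite linearZ /= ga_Dx eq_sym (negbTE ji) scaler0.
elim/poly_ind: q => [|q c IH]; first by rewrite derivC !rmorph0 linear0 scaler0.
rewrite derivD derivC addr0 derivM derivX mulr1 !rmorphD !rmorphM /= !horner_algX horner_algC.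
rewrite linearD /= Dc addr0 ga_DM IH Dz -scalerAl -scalerAr mulr1 scalerDr.
by [].
Qed.

(** For a unit linear form the chain rule reduces [L] to the Hermite operator [z q' - q''], of which
    the Hermite polynomial is an eigenvector. *)
Lemma ch_hermite n : ch n (horner_alg z (hermite R n)).
Proof.
rewrite /ch /L; set h := hermite R n.
under eq_bigr do rewrite !D_horner_alg linearZ /= D_horner_alg scalerA -expr2 -scalerAr scalerAl.
rewrite sumrB -scaler_suml t_unit scale1r.
rewrite -mulr_suml -z_eq -[X in X * _]horner_algX -rmorphM -rmorphB /= hermite_eq.
by rewrite -mul_polyC rmorphM /= horner_algC -scalerAl mul1r.
Qed.

End hermite_chaos.

Section chaos_approximation.
Context {R : realType} (H : completeNormedModType R).
Variable dot : {dot H for idfun}.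
Hypothesis dot_norm : forall x : H, dot x x = `|x| ^+ 2.
Context d (T : measurableType d) (P : probability T R).
Variable W : H -> {RV P >-> R}.
Hypothesis iso : isonormal_process dot W.

(** The unit vector [v0] starts the family, which is nonempty by its index type; a vector already in
    the span adds nothing. *)
Lemma gram_schmidt (s : seq H) (v0 : H) : `|v0| = 1 -> exists k (e : 'I_k.+1 -> H),
  orthonormal_family dot e /\ forall v, v \in s -> v = \sum_i dot v (e i) *: e i.
Proof.
move=> v1; elim: s => [|v s [k [e [he hs]]]].
  by exists 0%N, (fun=> v0); split=> // i j; rewrite !ord1 eqxx dot_norm v1 expr1n.
pose r := v - \sum_i dot v (e i) *: e i.
have re i : dot r (e i) = 0.
  rewrite /r dotBl dot_suml (bigD1 i)//= dotZl he eqxx mulr1 big1 ?addr0 ?subrr// => j ji.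
  by rewrite dotZl he (negbTE ji) mulr0.
have [r0|r0] := eqVneq r 0.
  exists k, e; split=> // x; rewrite inE => /orP[/eqP ->|]; last exact: hs.
  by apply/eqP; rewrite -subr_eq0 -/r r0.
have nr : `|r| != 0 by rewrite normr_eq0.
pose e' (i : 'I_k.+2) : H := if unlift ord0 i is Some j then e j else `|r|^-1 *: r.
have e'0 : e' ord0 = `|r|^-1 *: r by rewrite /e' unlift_none.
have e'S j : e' (lift ord0 j) = e j by rewrite /e' liftK.
exists k.+1, e'; split.
  move=> i j; case: (unliftP ord0 i) => [i' ->|->]; case: (unliftP ord0 j) => [j' ->|->].
  - by rewrite !e'S he (inj_eq lift_inj).
  - by rewrite e'S e'0 dotZr (dot_sym iso) re mulr0 eq_sym (negbTE (neq_lift _ _)).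
  - by rewrite e'S e'0 dotZl re mulr0 (negbTE (neq_lift _ _)).
  - by rewrite e'0 dotZl dotZr dot_norm eqxx expr2 mulKf ?mulVf.
have spanS x : x = \sum_i dot x (e i) *: e i -> x = \sum_i dot x (e' i) *: e' i.
  move=> hx; rewrite big_ord_recl (_ : dot x (e' ord0) = 0).
    by rewrite scale0r add0r {1}hx; apply: eq_bigr => i _; rewrite e'S.
  rewrite hx dot_suml big1// => i _; by rewrite dotZl e'0 dotZr (dot_sym iso (e i) r) re !mulr0.
move=> x; rewrite inE => /orP[/eqP ->|xs]; last exact: spanS (hs _ xs).
rewrite big_ord_recl e'0 dotZr scalerA.
have vr : dot v r = `|r| ^+ 2.
  rewrite -[v in LHS](subrK (\sum_i dot v (e i) *: e i)) -/r dotDl dot_norm dot_suml big1 ?addr0// => i _.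
  by rewrite dotZl (dot_sym iso (e i) r) re mulr0.
rewrite vr expr2 mulKf// mulfV// scale1r.
under eq_bigr do rewrite e'S.
by rewrite /r subrK.
Qed.

Section family.
Context k (e : 'I_k.+1 -> H) (he : orthonormal_family dot e).

(** Almost sure linearity of [W]: by the covariance formula the difference of the two sides has
    second moment zero. *)
Lemma W_comb v : v = \sum_i dot v (e i) *: e i ->
  {ae P, forall w, W v w = \sum_i dot v (e i) * W (e i) w}.
Proof.
move=> hv; pose S w := \sum_i dot v (e i) * W (e i) w.
have aW h := am_W iso h; have aS : am P S by apply: am_sum => i; apply: amZ; exact: aW.
have vv : \sum_i dot v (e i) ^+ 2 = dot v v.
  by rewrite [in RHS]hv dot_suml; apply: eq_bigr => i _; rewrite dotZl expr2 -hv (dot_sym iso (e i)).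
have E1 : Ex P (fun w => W v w * S w) = dot v v.
  rewrite /S; under eq_Ex do rewrite mulr_sumr.
  rewrite Ex_sum => [|i]; last by apply: am_itg; apply: amM => //; exact: amZ.
  rewrite -vv; apply: eq_bigr => i _; under eq_Ex do rewrite mulrCA.
  by rewrite ExZ -?(dot_Ex iso) ?expr2//; apply: am_itg; exact: amM.
have E2 : Ex P (fun w => S w * S w) = dot v v.
  rewrite {1}/S; under eq_Ex do rewrite mulr_suml.
  rewrite Ex_sum => [|i]; last by apply: am_itg; apply: amM => //; exact: amZ.
  rewrite -vv; apply: eq_bigr => i _; under eq_Ex do rewrite -mulrA.
  rewrite ExZ; last by apply: am_itg; exact: amM.
  rewrite expr2; congr (_ * _); rewrite /S; under eq_Ex do rewrite mulr_sumr.
  rewrite Ex_sum => [|j]; last by apply: am_itg; apply: amM => //; exact: amZ.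
  rewrite (bigD1 i)//= [X in _ + X]big1 => [|j ji].
    under eq_Ex do rewrite mulrCA.
    by rewrite ExZ -?(dot_Ex iso) ?he ?eqxx ?mulr1 ?addr0//; apply: am_itg; exact: amM.
  under eq_Ex do rewrite mulrCA.
  rewrite ExZ -?(dot_Ex iso) ?he 1?eq_sym ?(negbTE ji) ?mulr0//; apply: am_itg; exact: amM.
have aB : am P (fun w => W v w - S w) by exact: amB.
have E0 : Ex P (fun w => (W v w - S w) ^+ 2) = 0.
  rewrite (@eq_Ex _ _ _ _ _ (fun w => (W v w * W v w - 2 * (W v w * S w)) + S w * S w)) => [|w]; last by ring.
  have aWS := amM (aW v) aS; have aWW := amM (aW v) (aW v); have aSS := amM aS aS.
  rewrite ExD ?ExB ?ExZ ?E1 ?E2 -?(dot_Ex iso); do ?[by apply: am_itg; do ?apply: amB; do ?apply: amZ].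
  by ring.
have i2 := am_itg (amX 2 aB).
have : (\int[P]_w `|((W v w - S w) ^+ 2)%:E| = 0)%E.
  have : expectation P (fun w => (W v w - S w) ^+ 2) = 0%E by rewrite expectationE// E0.
  by rewrite unlock => h0; rewrite -[RHS]h0; apply: eq_integral => w _; rewrite gee0_abs// lee_fin sqr_ge0.
have mB : measurable_fun setT (fun w => ((W v w - S w) ^+ 2)%:E).
  by apply/measurable_EFinP; exact: itg_meas i2.
move/(ae_eq_integral_abs _ measurableT mB); apply: filterS => w /(_ I) /= /eqP.
by rewrite eqe sqrf_eq0 subr_eq0 => /eqP.
Qed.

Definition Whermite (n : nat) v : Walg iso he :=
  horner_alg (\sum_i dot v (e i) *: @ga_x R (Walg iso he) i) (hermite R n).

Lemma ch_Whermite n v : `|v| = 1 -> v = \sum_i dot v (e i) *: e i -> ch n (Whermite n v).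
Proof.
move=> v1 hv; apply: ch_hermite => //.
have := dot_norm v; rewrite v1 expr1n => <-; rewrite [in RHS]hv dot_suml.
by apply: eq_bigr => i _; rewrite dotZl expr2 -hv (dot_sym iso (e i)).
Qed.

Lemma Wpoly_horner_alg (z : mpoly k.+1 R) (q : {poly R}) w :
  Wpoly W e (horner_alg z q) w = q.[Wpoly W e z w].
Proof.
elim/poly_ind: q => [|q c IH]; first by rewrite horner0 rmorph0 -(scale0r (1 : mpoly k.+1 R)) Wpolyc.
rewrite rmorphD rmorphM /= horner_algX horner_algC WpolyD WpolyM IH Wpolyc.
by rewrite hornerD hornerM hornerX hornerC.
Qed.

Lemma Wpoly_sum I (s : seq I) (f : I -> mpoly k.+1 R) w :
  Wpoly W e (\sum_(i <- s) f i) w = \sum_(i <- s) Wpoly W e (f i) w.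
Proof.
elim: s => [|i s IH]; last by rewrite !big_cons WpolyD IH.
by rewrite !big_nil -(scale0r (1 : mpoly k.+1 R)) Wpolyc.
Qed.

Lemma Wpoly_Whermite n v : v = \sum_i dot v (e i) *: e i ->
  {ae P, forall w, Wpoly W e (Whermite n v) w = (hermite R n).[W v w]}.
Proof.
move=> hv; apply: filterS (W_comb hv) => w ->.
rewrite /Whermite Wpoly_horner_alg Wpoly_sum; congr (_.[_]); apply: eq_bigr => i _.
by rewrite WpolyZ WpolyX.
Qed.

Lemma hermite_comb_poly n (s : seq (R * H)) :
  (forall x, x \in s -> `|x.2| = 1 /\ x.2 = \sum_i dot x.2 (e i) *: e i) ->
  exists u : Walg iso he, ch n u /\ {ae P, forall w, Wpoly W e u w = hermite_comb W n s w}.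
Proof.
elim: s => [|x s IH] hs.
  exists 0; split; first exact: ch_0.
  by apply: aeW => w; rewrite /hermite_comb big_nil -(scale0r (1 : mpoly k.+1 R)) Wpolyc.
have [u [hu eu]] := IH (fun y ys => hs y (mem_behead (s := x :: s) ys)).
have [x1 xe] := hs x (mem_head _ _).
exists (x.1 *: Whermite n x.2 + u); split.
  by apply: chD => //; apply: chZ; exact: ch_Whermite.
apply: filterS2 eu (Wpoly_Whermite n xe) => w e1 e2.
by rewrite /hermite_comb big_cons WpolyD WpolyZ e1 e2.
Qed.

End family.

Lemma meas_hermite_comb n (s : seq (R * H)) : measurable_fun setT (hermite_comb W n s).
Proof.
apply: measurable_sum => x; apply: measurable_funM; first exact: measurable_cst.
move: (hermite R n) => q; elim/poly_ind: q => [|q c IH].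
  by under eq_fun do rewrite horner0; exact: measurable_cst.
under eq_fun do rewrite hornerMXaddC.
by apply: measurable_funD; [apply: measurable_funM|exact: measurable_cst].
Qed.

Lemma multiple_integral_comb n (f : ('I_n -> H) -> R) F (eps : R) : is_multiple_integral dot W f F ->
  measurable_fun setT F -> 0 < eps -> exists s : seq (R * H),
  (forall x, x \in s -> `|x.2| = 1) /\ Ex P (fun w => `|hermite_comb W n s w - F w|) <= eps.
Proof.
move=> [s [hs _ cs]] mF e0.
have [j hj] := filter_ex (cvg0_lt cs (exprn_gt0 2 e0)).
exists (s j); split; first exact: hs.
have mB : measurable_fun setT (fun w => hermite_comb W n (s j) w - F w).
  by apply: measurable_funB => //; exact: meas_hermite_comb.
have [i2 E2] := small_expectation (measX 2 mB) (fun w => sqr_ge0 _) hj.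
have := Ex_abs_sq (conj mB i2); move=> h; apply: sqrt_mono (ltW e0) _; exact: le_trans h E2.
Qed.

Lemma chaos_approximation p q (f : ('I_p -> H) -> R) (g : ('I_q -> H) -> R) X Y0 (v0 : H) (eps : R) : `|v0| = 1 ->
  is_multiple_integral dot W f X -> is_multiple_integral dot W g Y0 ->
  measurable_fun setT X -> measurable_fun setT Y0 -> 0 < eps ->
  exists k (e : 'I_k.+1 -> H) (he : orthonormal_family dot e) (x y : Walg iso he),
    [/\ ch p x, ch q y, Ex P (fun w => `|Wpoly W e x w - X w|) <= eps &
        Ex P (fun w => `|Wpoly W e y w - Y0 w|) <= eps].
Proof.
move=> v1 hX hY mX mY e0.
have [s [s1 hs]] := multiple_integral_comb hX mX e0.
have [s' [s1' hs']] := multiple_integral_comb hY mY e0.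
have [k [e [he sp]]] := gram_schmidt (map snd (s ++ s')) v1.
have [x [cx ex]] : exists u : Walg iso he, ch p u /\ {ae P, forall w, Wpoly W e u w = hermite_comb W p s w}.
  by apply: hermite_comb_poly => z zs; split; [exact: s1|apply/sp/map_f; rewrite mem_cat zs].
have [y [cy ey]] : exists u : Walg iso he, ch q u /\ {ae P, forall w, Wpoly W e u w = hermite_comb W q s' w}.
  by apply: hermite_comb_poly => z zs; split; [exact: s1'|apply/sp/map_f; rewrite mem_cat zs orbT].
exists k, e, he, x, y; split=> //.
  apply: le_trans hs; rewrite le_eqVlt; apply/orP; left; apply/eqP; apply: ae_eq_Ex.
  - by apply: meas_abs; apply: measurable_funB => //; exact: am_meas (am_Wpoly iso e x).
  - by apply: meas_abs; apply: measurable_funB => //; exact: meas_hermite_comb.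
  - by apply: filterS ex => w ->.
apply: le_trans hs'; rewrite le_eqVlt; apply/orP; left; apply/eqP; apply: ae_eq_Ex.
- by apply: meas_abs; apply: measurable_funB => //; exact: am_meas (am_Wpoly iso e y).
- by apply: meas_abs; apply: measurable_funB => //; exact: meas_hermite_comb.
- by apply: filterS ey => w ->.
Qed.

(** Without unit vectors the approximating combinations are empty. This degenerate space is excluded
    later by the nondegenerate limit of [X]. *)
Lemma trivial_multiple_integral n (f : ('I_n -> H) -> R) F : (forall v : H, `|v| != 1) ->
  is_multiple_integral dot W f F -> measurable_fun setT F -> Ex P (fun w => `|F w|) = 0.
Proof.
move=> h hF mF; apply/eqP; rewrite eq_le; apply/andP; split; last exact: Ex_ge0.
apply/ler_addgt0Pr => eps e0; rewrite add0r.
have [s [s1 hs]] := multiple_integral_comb hF mF e0.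
apply: le_trans hs; rewrite le_eqVlt; apply/orP; left; apply/eqP; apply: eq_Ex => w.
case: s s1 => [|x s] s1; first by rewrite /hermite_comb big_nil sub0r normrN.
by have := h x.2; rewrite (s1 x (mem_head _ _)) eqxx.
Qed.

Lemma itG_approximation p q a (f : ('I_p -> H) -> R) (g : ('I_q -> H) -> R) X (Y : nat -> T -> R) (v0 : H) (eps : R) : `|v0| = 1 ->
  is_multiple_integral dot W f X -> is_multiple_integral dot W g (Y 0%N) ->
  (forall r, is_derivative_product dot W X (Y r) (Y r.+1)) ->
  measurable_fun setT X -> (forall r, measurable_fun setT (Y r)) -> 0 < eps ->
  exists k (e : 'I_k.+1 -> H) (he : orthonormal_family dot e) (x y : Walg iso he),
    [/\ ch p x, ch q y, Ex P (fun w => `|Wpoly W e x w - X w|) <= eps &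
        forall r, (r <= a)%N -> Ex P (fun w => `|Wpoly W e (itG r x y) w - Y r w|) <= eps].
Proof.
move=> v1 hX hY hd mX mY e0.
have [eta eta0 h] : exists2 eta : R, 0 < eta &
    forall k (e : 'I_k.+1 -> H) (he : orthonormal_family dot e) (x y : Walg iso he),
    deg p x -> deg q y -> Ex P (fun w => `|Wpoly W e x w - X w|) <= eta ->
    Ex P (fun w => `|Wpoly W e y w - Y 0%N w|) <= eta ->
    forall r, (r < a.+1)%N -> Ex P (fun w => `|Wpoly W e (itG r x y) w - Y r w|) <= eps.
  elim: a.+1 => [|b [eta1 eta10 IH]]; first by exists 1.
  have [eta2 eta20 h2] := itG_approx dot_norm iso p q b hd mY e0.
  exists (Num.min eta1 eta2); first by rewrite lt_min eta10.
  move=> k e he x y dx dy; rewrite !le_min => /andP[hx1 hx2] /andP[hy1 hy2] r.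
  by rewrite ltnS leq_eqVlt => /orP[/eqP ->|rb]; [exact: h2|exact: IH].
have em0 : 0 < Num.min eta eps by rewrite lt_min eta0.
have [k [e [he [x [y [cx cy]]]]]] := chaos_approximation v1 hX hY mX (mY 0%N) em0.
rewrite !le_min => /andP[hx1 hx2] /andP[hy1 hy2].
exists k, e, he, x, y; split=> // r ra.
by apply: h => //; exact: ch_deg.
Qed.

End chaos_approximation.

(** * Loeb spaces *)

Section ultralimit.
Context {R : realType} (U : set_system nat) {UU : UltraFilter U}.

Lemma ultra_fmap (T : Type) (u : nat -> T) : UltraFilter (u @ U).
Proof.
split=> [|G GF UG]; first exact: fmap_proper_filter.
rewrite eqEsubset; split => // A GA.
have [//|h] := in_ultra_setVsetC (u @^-1` A) UU.
by have /UG GnA : (u @ U) (~` A) by []; have [x []] := filter_ex (filterI GA GnA).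
Qed.

Lemma ultra_bounded_cvg (u : nat -> R) (M : R) : (\forall N \near U, `|u N| <= M) ->
  u @ U --> lim (u @ U).
Proof.
move=> uM; have := @segment_compact R (- M) M; rewrite compact_ultra => h.
have [||l [_ cl]] := h (u @ U); first exact: ultra_fmap.
  by apply: filterS uM => N; rewrite /= in_itv /= ler_norml.
by rewrite (cvg_lim _ cl).
Qed.

End ultralimit.

Lemma meas_continuous_pair (R : realType) d (T : measurableType d) (f1 f2 : T -> R) (g : R * R -> R) :
  measurable_fun setT f1 -> measurable_fun setT f2 -> continuous g -> measurable_fun setT (fun w => g (f1 w, f2 w)).
Proof.
move=> m1 m2 cg; pose xi w : 'rV[R]_2 := \row_(i < 2) (if i == ord0 then f1 w else f2 w).
have -> : (fun w => g (f1 w, f2 w)) = (fun y : 'rV[R]_2 => g (y 0 ord0, y 0 ord_max)) \o xi.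
  by apply/funext => w; rewrite /= !mxE.
apply: meas_continuous_row => [i|].
  have -> : (fun w => xi w 0 i) = if i == ord0 then f1 else f2.
    by apply/funext => w; rewrite mxE; case: ifP.
  by case: ifP.
apply: (@cont_comp _ _ _ (fun y : 'rV[R]_2 => (y 0 ord0, y 0 ord_max)) g) => // y.
exact: (cvg_pair (@coord_cont R 2 ord0 y) (@coord_cont R 2 ord_max y)).
Qed.

Section loeb.
Context {R : realType} d (T : measurableType d) (P : probability T R).
Context (U : set_system nat) {UU : UltraFilter U}.
Hypothesis U_tail : forall n, U [set N | (n <= N)%N].
Implicit Types A B : nat -> set T.

(** Internal sets of the ultraproduct, pulled back to plain sequences: no quotient is formed, since
    membership depends only on the class of [w] along [U]. *)
Definition internal A : set (nat -> T) := [set w | \forall N \near U, A N (w N)].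

Definition mseq A := forall N, measurable (A N).

Definition ultraprob A : R := lim ((fun N => fine (P (A N))) @ U).

Let pr (B : set T) : R := fine (P B).

Let prE (B : set T) : measurable B -> P B = (pr B)%:E.
Proof. by move=> mB; rewrite /pr fineK// fin_num_measure. Qed.

Let pr_ge0 (B : set T) : 0 <= pr B. Proof. by rewrite /pr fine_ge0. Qed.

Let pr_le1 (B : set T) : measurable B -> pr B <= 1.
Proof. by move=> mB; rewrite -lee_fin -prE// probability_le1. Qed.

Let pr_mono (B C : set T) : measurable B -> measurable C -> B `<=` C -> pr B <= pr C.
Proof. by move=> mB mC BC; rewrite -lee_fin -!prE// le_measure// inE. Qed.

Let prU (B C : set T) : measurable B -> measurable C -> pr (B `|` C) <= pr B + pr C.
Proof.
move=> mB mC; rewrite -lee_fin EFinD -!prE//; last exact: measurableU.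
exact: measureU2.
Qed.

Lemma ultraprob_cvg A : mseq A -> (fun N => fine (P (A N))) @ U --> ultraprob A.
Proof.
move=> mA; apply: (@ultra_bounded_cvg _ _ _ _ 1); apply: nearW => N.
by rewrite ger0_norm ?pr_ge0// pr_le1.
Qed.

Lemma ultraprob_ge0 A : mseq A -> 0 <= ultraprob A.
Proof.
move=> mA; apply: limr_ge; first exact: cvgP (ultraprob_cvg mA).
by apply: nearW => N; exact: pr_ge0.
Qed.

(** Otherwise a choice of counterexamples for [U]-many [N] gives a sequence in [internal A] but not
    in [internal B]. *)
Lemma internal_mono A B : internal A `<=` internal B -> \forall N \near U, A N `<=` B N.
Proof.
move=> AB; have [//|nAB] := in_ultra_setVsetC [set N | A N `<=` B N] UU.
have /choice[w hw] N : exists x, A N `<=` B N \/ (A N x /\ ~ B N x).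
  have [h|] := pselect (A N `<=` B N); first by exists point; left.
  by move=> /existsNP[x /not_implyP[]]; exists x; right.
have /AB wB : internal A w by apply: filterS nAB => N; case: (hw N) => // -[].
have [N [h1 h2]] := filter_ex (filterI nAB wB).
by case: (hw N) => // -[].
Qed.

Lemma le_ultraprob A B : mseq A -> mseq B -> internal A `<=` internal B -> ultraprob A <= ultraprob B.
Proof.
move=> mA mB /internal_mono AB.
apply: ler_lim; [exact: cvgP (ultraprob_cvg mA)|exact: cvgP (ultraprob_cvg mB)|].
by apply: filterS AB => N; exact: pr_mono.
Qed.

Definition loeb_outer (E : set (nat -> T)) : \bar R :=
  ereal_inf [set (ultraprob A)%:E | A in [set A | mseq A /\ E `<=` internal A]].

Lemma loeb_outer_le A E : mseq A -> E `<=` internal A -> (loeb_outer E <= (ultraprob A)%:E)%E.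
Proof. by move=> mA EA; apply: ereal_inf_lbound; exists A. Qed.

Lemma loeb_outer_ge0 E : (0 <= loeb_outer E)%E.
Proof. by apply: le_ereal_inf_tmp => _ [A [mA _] <-]; rewrite lee_fin ultraprob_ge0. Qed.

Lemma internalT : internal (fun=> setT) = setT.
Proof. by apply/seteqP; split=> // w _; exact: nearW. Qed.

Lemma loeb_outer_fin E : loeb_outer E \is a fin_num.
Proof.
rewrite ge0_fin_numE ?loeb_outer_ge0//.
have mT : mseq (fun=> setT) by move=> N; exact: measurableT.
by apply: le_lt_trans (loeb_outer_le mT _) (ltry _); rewrite internalT.
Qed.

Lemma loeb_outer_approx E (eps : R) : 0 < eps ->
  exists A, [/\ mseq A, E `<=` internal A & ((ultraprob A)%:E <= loeb_outer E + eps%:E)%E].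
Proof.
move=> e0; have [_ [A [mA EA] <-] /ltW h] := lb_ereal_inf_adherent e0 (loeb_outer_fin E).
by exists A.
Qed.

Lemma loeb_outer0 : loeb_outer set0 = 0%E.
Proof.
apply/eqP; rewrite eq_le loeb_outer_ge0 andbT.
have m0 : mseq (fun=> set0) by move=> N; exact: measurable0.
apply: le_trans (loeb_outer_le m0 _) _ => //; rewrite lee_fin /ultraprob.
by rewrite measure0 lim_cst.
Qed.

Lemma le_loeb_outer : {homo loeb_outer : E F / E `<=` F >-> (E <= F)%E}.
Proof.
move=> E F EF; apply: le_ereal_inf_tmp => _ [A [mA FA] <-].
by apply: loeb_outer_le => //; exact: subset_trans FA.
Qed.

(* Countably many internal sets of total mass at most [s] are covered by one internal set
   of mass at most [s]: its [N]th section collects the first [K N] sets, where [K] tends to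
   infinity slowly enough. *)
Lemma internal_countable_cover (A : nat -> nat -> set T) (s eps : R) : (forall i, mseq (A i)) ->
  (forall K, \sum_(i < K) ultraprob (A i) <= s) -> 0 < eps -> 0 <= s ->
  exists B, [/\ mseq B, ultraprob B <= s + eps & forall i, internal (A i) `<=` internal B].
Proof.
move=> mA hs e0 s0.
pose C K N := \big[setU/set0]_(i < K) A i N.
have mC K N : measurable (C K N) by apply: bigsetU_measurable => i _; exact: mA.
have prC K N : pr (C K N) <= \sum_(i < K) pr (A i N).
  elim: K => [|K IH]; first by rewrite /C !big_ord0 /pr measure0.
  rewrite /C !big_ord_recr /=; apply: le_trans (prU (mC K N) (mA K N)) _.
  by rewrite lerD2r.
pose G K N := pr (C K N) <= s + eps.
have GU K : \forall N \near U, G K N.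
  have cv : (fun N => \sum_(i < K) pr (A i N)) @ U --> \sum_(i < K) ultraprob (A i).
    elim: (K) => [|k IH].
      by under eq_fun do rewrite big_ord0; rewrite big_ord0; exact: cvg_cst.
    under eq_fun do rewrite big_ord_recr /=.
    by rewrite big_ord_recr; apply: cvgD => //; exact: ultraprob_cvg.
  have se : \sum_(i < K) ultraprob (A i) < s + eps by apply: le_lt_trans (hs K) _; rewrite ltrDl.
  have h : \forall N \near U, \sum_(i < K) pr (A i N) < s + eps by exact: cvgr_lt cv _ se.
  by apply: filterS h => N /ltW; exact: le_trans (prC K N).
have G0 N : G 0%N N by rewrite /G /C big_ord0 /pr measure0 addr_ge0// ltW.
have exQ N : exists K, (K <= N)%N && G K N by exists 0%N; rewrite leq0n G0.
have ubQ N K : (K <= N)%N && G K N -> (K <= N)%N by case/andP.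
pose K N := ex_maxn (exQ N) (ubQ N).
exists (fun N => C (K N) N); split.
- by move=> N; exact: mC.
- apply: limr_le; first by apply: cvgP; apply: ultraprob_cvg => N; exact: mC.
  by apply: nearW => N; rewrite /K; case: ex_maxnP => k /andP[].
- move=> i w wi; have := GU i.+1; have := U_tail i.+1; have := wi.
  move=> h1 h2 h3; apply: filterS (filterI h1 (filterI h2 h3)) => N [wN [iN GN]].
  rewrite /K; case: ex_maxnP => k _ hk; have ik : (i < k)%N by apply: hk; rewrite iN.
  by rewrite /C -(bigcup_mkord k (fun i => A i N)); exists i.
Qed.

Lemma loeb_outer_sigma_subadditive : sigma_subadditive loeb_outer.
Proof.
move=> F; have [->|] := eqVneq (\sum_(i <oo) loeb_outer (F i))%E +oo%E; first exact: leey.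
rewrite -ltey => fin; apply/lee_addgt0Pr => eps e0.
have e20 : 0 < eps / 2 by rewrite divr_gt0.
have /choice[A hA] i : exists A, [/\ mseq A, F i `<=` internal A &
    ((ultraprob A)%:E <= loeb_outer (F i) + (eps / 2 / (2 ^ i.+1)%:R)%:E)%E].
  by apply: loeb_outer_approx; rewrite divr_gt0// ltr0n expn_gt0.
have mA i : mseq (A i) by case: (hA i).
have S0 : (0 <= \sum_(i <oo) loeb_outer (F i))%E by apply: nneseries_ge0 => i _ _; exact: loeb_outer_ge0.
set S := (\sum_(i <oo) loeb_outer (F i))%E in fin S0 *.
have SE : S = (fine S)%:E by rewrite fineK// ge0_fin_numE.
have hs K : \sum_(i < K) ultraprob (A i) <= fine S + eps / 2.
  rewrite -lee_fin EFinD -SE; apply: le_trans (epsilon_trick xpredT (fun i => loeb_outer_ge0 (F i)) (ltW e20)).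
  rewrite -sumEFin -(big_mkord xpredT (fun i => (ultraprob (A i))%:E)).
  apply: le_trans (_ : (\sum_(0 <= i < K) (loeb_outer (F i) + (eps / 2 / (2 ^ i.+1)%:R)%:E) <= _)%E).
    by apply: lee_sum => i _; case: (hA i).
  apply: (nneseries_lim_ge K) => i _ _; rewrite adde_ge0 ?loeb_outer_ge0// lee_fin divr_ge0//.
  exact: ltW.
have s0 : 0 <= fine S + eps / 2 by rewrite addr_ge0 ?fine_ge0// ltW.
have [B [mB hB1 hB2]] := internal_countable_cover mA hs e20 s0.
apply: le_trans (loeb_outer_le mB _) _.
  by apply: bigcup_sub => i _; apply: subset_trans (hB2 i); case: (hA i).
by rewrite SE -EFinD lee_fin; lra.
Qed.

HB.instance Definition _ := isOuterMeasure.Build R (nat -> T) loeb_outer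
  loeb_outer0 loeb_outer_ge0 le_loeb_outer loeb_outer_sigma_subadditive.

Definition loeb_space := caratheodory_type loeb_outer.

Lemma loeb_outer_internal A : mseq A -> loeb_outer (internal A) = (ultraprob A)%:E.
Proof.
move=> mA; apply/eqP; rewrite eq_le loeb_outer_le//=.
by apply: le_ereal_inf_tmp => _ [B [mB AB] <-]; rewrite lee_fin le_ultraprob.
Qed.

(** An internal cover [C] of the test set splits into the internal sets with sections [C N] inside
    and outside [A N]. They cover the two parts of the test set because an ultrafilter decides each
    membership, and [ultraprob] is additive on them. *)
Lemma measurable_internal A : mseq A -> measurable (internal A : set loeb_space).
Proof.
move=> mA; apply: le_caratheodory_measurable => E.
apply/lee_addgt0Pr => eps e0.
have [C [mC EC hC]] := loeb_outer_approx E e0.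
have mI : mseq (fun N => C N `&` A N) by move=> N; exact: measurableI.
have mD : mseq (fun N => C N `\` A N) by move=> N; exact: measurableD.
apply: le_trans hC; apply: le_trans (_ : (ultraprob (fun N => C N `&` A N))%:E +
  (ultraprob (fun N => C N `\` A N))%:E <= _)%E.
  apply: leeD; apply: loeb_outer_le => // w [/EC Cw Aw]; first exact: filterI.
  have [h|h] := in_ultra_setVsetC [set N | A N (w N)] UU; first by [].
  exact: filterI.
rewrite -EFinD lee_fin le_eqVlt; apply/orP; left; apply/eqP.
apply: (cvg_unique _ _ (ultraprob_cvg mC)) => //.
have := cvgD (ultraprob_cvg mI) (ultraprob_cvg mD).
move=> h; apply: cvg_trans (h _); apply: near_eq_cvg; apply: nearW => N.
rewrite fctE -fineD ?fin_num_measure//; congr fine.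
by rewrite addeC -measureDI.
Qed.

Definition loeb_measure : set loeb_space -> \bar R := loeb_outer.

Let loeb_measure_sigma_additive : semi_sigma_additive loeb_measure.
Proof. exact: (@caratheodory_measure_sigma_additive R _ loeb_outer). Qed.

HB.instance Definition _ := measure_function.isMeasure.Build _ loeb_space R loeb_measure
  loeb_outer0 loeb_outer_ge0 loeb_measure_sigma_additive.

Lemma loeb_measureT : loeb_measure setT = 1%E.
Proof.
rewrite /loeb_measure -internalT loeb_outer_internal; last by move=> N; exact: measurableT.
by rewrite /ultraprob probability_setT lim_cst.
Qed.

HB.instance Definition _ := Measure_isProbability.Build _ _ _ loeb_measure loeb_measureT.

Local Notation PL := (loeb_measure : probability loeb_space R).

Section bounded_sequences.
Variables (F : nat -> T -> R) (M : R).
Hypothesis mF : forall N, measurable_fun setT (F N).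
Hypothesis FM : forall N x, `|F N x| <= M.

Definition hat (G : nat -> T -> R) (w : loeb_space) : R := lim ((fun N => G N (w N)) @ U).

Lemma hat_cvg w : (fun N => F N (w N)) @ U --> hat F w.
Proof. by apply: (@ultra_bounded_cvg _ _ _ _ M); exact: nearW. Qed.

Lemma mseq_gt (a : R) : mseq (fun N => [set x | a < F N x]).
Proof.
move=> N; rewrite -[X in measurable X]setTI.
have -> : [set x | a < F N x] = F N @^-1` [set` `]a, +oo[] by apply/seteqP; split=> x /=; rewrite in_itv /= andbT.
exact: mF.
Qed.

Lemma measurable_hat : measurable_fun setT (hat F).
Proof.
apply: (measurability _ (RGenOInfty.measurableE R)) => _ [_ [a ->] <-].
rewrite setTI.
have -> : hat F @^-1` `]a, +oo[%classic =
    \bigcup_n internal (fun N => [set x | a + n.+1%:R^-1 < F N x]).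
  apply/seteqP; split=> w /=; rewrite in_itv /= andbT.
    move=> aw; have [n hn] : exists n : nat, n.+1%:R^-1 < hat F w - a.
      exists (Num.truncn (hat F w - a)^-1); rewrite invf_plt ?posrE ?subr_gt0//.
      exact: truncnS_gt.
    have lt0 : a + n.+1%:R^-1 < hat F w by rewrite -ltrBrDl.
    have h : \forall N \near U, a + n.+1%:R^-1 < F N (w N) by exact: cvgr_gt (@hat_cvg w) _ lt0.
    by exists n.
  move=> [n _ h]; have n0 : 0 < n.+1%:R^-1 :> R by rewrite invr_gt0.
  apply: (@lt_le_trans _ _ (a + n.+1%:R^-1)); first by rewrite ltrDl.
  apply: limr_ge; first exact: cvgP (@hat_cvg w).
  by apply: filterS h => N /= /ltW.
by apply: bigcup_measurable => n _; apply: measurable_internal; exact: mseq_gt.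
Qed.

End bounded_sequences.

(** A number is its count of integer levels up to an error of one; after scaling, functions with
    values in [[0, 1]] become averages of indicators of level sets up to [1 / n]. *)
Lemma staircase_count (y : R) m : 0 <= y -> y <= m%:R ->
  y - 1 <= \sum_(j < m) (nat_of_bool (j.+1%:R < y)%R)%:R <= y.
Proof.
elim: m => [|m IH] y0 ym; first by rewrite big_ord0; lra.
rewrite big_ord_recr /= [_ < y]ltNge ym addr0.
have [|my] := leP y m%:R; first exact: IH.
rewrite (eq_bigr (fun=> 1)) => [|j _].
  by rewrite sumr_const card_ord -natr1 in ym *; lra.
by rewrite (le_lt_trans _ my)// ler_nat ltn_ord.
Qed.

Lemma Ex_indic_le d' (S : measurableType d') (Q : probability S R) (B : set S) : measurable B ->
  itg Q (fun x => (x \in B)%:R) /\ Ex Q (fun x => (x \in B)%:R) = fine (Q B).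
Proof.
move=> mB; have mi : measurable_fun setT (fun x => (x \in B)%:R : R).
  have -> : (fun x => (x \in B)%:R) = \1_B :> (S -> R) by apply/funext => x; rewrite indicE.
  exact: measurable_indic.
split.
  apply: (@itg_bounded _ _ _ _ _ 1) => // x; by case: (x \in B); rewrite /= ?normr1 ?normr0.
rewrite /Ex /Rintegral; congr fine.
have := @integral_indic _ S R Q setT measurableT B mB; rewrite setIT => <-.
by apply: eq_integral => x _; rewrite indicE.
Qed.

(** Both expectations are within [1 / n] of averages of [n] level-set probabilities, and for one
    level set the convergence is the value of the Loeb measure on an internal set. [S'] uses the
    internal level sets, which need not be the level sets of [hat F]. *)
Lemma Ex_hat01 (F : nat -> T -> R) : (forall N, measurable_fun setT (F N)) ->
  (forall N x, 0 <= F N x <= 1) -> (fun N => Ex P (F N)) @ U --> Ex PL (hat F).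
Proof.
move=> mF F01; have FM N x : `|F N x| <= 1 by have /andP[h1 h2] := F01 N x; rewrite ger0_norm.
have itF N : itg P (F N) by apply: (@itg_bounded _ _ _ _ _ 1).
have mH := measurable_hat mF FM.
have hat01 w : 0 <= hat F w <= 1.
  have c := (@hat_cvg _ _ FM w); apply/andP; split.
    by apply: limr_ge; [exact: cvgP c|apply: nearW => N; have /andP[] := F01 N (w N)].
  by apply: limr_le; [exact: cvgP c|apply: nearW => N; have /andP[] := F01 N (w N)].
have itH : itg PL (hat F).
  by apply: (@itg_bounded _ _ _ _ _ 1) => // w; have /andP[h1 h2] := hat01 w; rewrite ger0_norm.
pose B n (j : 'I_n) N := [set x | j.+1%:R / n%:R < F N x].
have mB n j : mseq (B n j) by exact: mseq_gt.
pose S n N x := n%:R^-1 * \sum_(j < n) (x \in B n j N)%:R : R.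
pose S' n (w : loeb_space) := n%:R^-1 * \sum_(j < n) (w \in (internal (B n j) : set loeb_space))%:R : R.
have itS n N : itg P (S n N).
  by apply: itgZ; apply: itg_sum => j; apply: (Ex_indic_le P _).1; exact: mB.
have mI n j : measurable (internal (B n j) : set loeb_space) by exact: measurable_internal.
have itS' n : itg PL (S' n).
  by apply: itgZ; apply: itg_sum => j; apply: (Ex_indic_le PL _).1.
have dS n N x : (0 < n)%N -> `|F N x - S n N x| <= n%:R^-1.
  move=> n0; have np : 0 < n%:R :> R by rewrite ltr0n.
  have /andP[f0 f1] := F01 N x.
  have := @staircase_count (F N x * n%:R) n (mulr_ge0 f0 (ltW np)) (ler_piMl (ltW np) f1).
  rewrite (eq_bigr (fun j : 'I_n => (x \in B n j N)%:R)) => [|j _]; last first.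
    have -> // : (j.+1%:R < F N x * n%:R) = (x \in B n j N).
    by apply/idP/idP => [h|/set_mem]; [apply/mem_set|]; rewrite /B /= ltr_pdivrMr.
  rewrite /S; set s := \sum_(j < n) _ => /andP[h1 h2].
  rewrite -(ler_pM2l np) divff ?gt_eqF// -[X in X * `|_|]ger0_norm ?(ltW np)// -normrM mulrBr mulrA divff ?gt_eqF// mul1r.
  by rewrite ler_norml; lra.
have dS' n w : (0 < n)%N -> `|hat F w - S' n w| <= n%:R^-1.
  move=> n0.
  have cS : (fun N => S n N (w N)) @ U --> S' n w.
    apply: cvgM; first exact: cvg_cst.
    apply: cvgr_sum => j.
    apply: cvg_near_cst.
    have [h|h] := in_ultra_setVsetC [set N | B n j N (w N)] UU.
      have -> : w \in (internal (B n j) : set loeb_space) by rewrite inE.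
      by apply: filterS h => N h; rewrite mem_set.
    have -> : (w \in (internal (B n j) : set loeb_space)) = false.
      by apply/negbTE; rewrite notin_setE => h'; have [N []] := filter_ex (filterI h h').
    by apply: filterS h => N h; rewrite memNset.
  have c : (fun N => `|F N (w N) - S n N (w N)|) @ U --> `|hat F w - S' n w|.
    by apply: cvg_norm; apply: cvgB => //; exact: hat_cvg.
  rewrite -(cvg_lim (@Rhausdorff R) c); apply: limr_le; first exact: cvgP c.
  by apply: nearW => N; exact: dS.
have cES n : (fun N => Ex P (S n N)) @ U --> Ex PL (S' n).
  have e1 N : Ex P (S n N) = n%:R^-1 * \sum_(j < n) fine (P (B n j N)).
    rewrite ExZ; last by apply: itg_sum => j; apply: (Ex_indic_le P _).1; exact: mB.
    rewrite Ex_sum => [|j]; last by apply: (Ex_indic_le P _).1; exact: mB.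
    by congr (_ * _); apply: eq_bigr => j _; rewrite (Ex_indic_le P _).2//; exact: mB.
  under eq_fun do rewrite e1.
  rewrite ExZ; last by apply: itg_sum => j; apply: (Ex_indic_le PL _).1.
  rewrite Ex_sum => [|j]; last by apply: (Ex_indic_le PL _).1.
  apply: cvgM; first exact: cvg_cst.
  apply: cvgr_sum => j; rewrite (Ex_indic_le PL _).2//.
  rewrite /= /loeb_measure loeb_outer_internal; last exact: mB.
  exact: ultraprob_cvg.
apply/cvgrPdist_le => eps e0.
have [n hn] : exists n : nat, n.+1%:R^-1 < eps / 3.
  exists (Num.truncn (eps / 3)^-1); rewrite invf_plt ?posrE ?divr_gt0//.
  exact: truncnS_gt.
have e30 : 0 < eps / 3 by rewrite divr_gt0.
have close d' (V : measurableType d') (Q : probability V R) (f g : V -> R) : itg Q f -> itg Q g ->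
    (forall x, `|f x - g x| <= n.+1%:R^-1) -> `|Ex Q f - Ex Q g| <= n.+1%:R^-1.
  move=> i1 i2 h; rewrite -ExB// -[leRHS](Ex_cst Q); apply: le_abs_Ex => //; first exact: itg_meas (itgB i1 i2).
  exact: itg_cst.
have h1 : \forall N \near U, `|Ex PL (S' n.+1) - Ex P (S n.+1 N)| <= eps / 3.
  by move/cvgrPdist_le: (cES n.+1) => /(_ _ e30).
apply: filterS h1 => N h1.
have h2 := close _ _ _ _ _ itH (itS' n.+1) (fun w => dS' n.+1 w isT).
have h3 := close _ _ _ _ _ (itF N) (itS n.+1 N) (fun x => dS n.+1 N x isT).
move: h1 h2 h3 hn; set a1 := Ex PL (S' n.+1); set a2 := Ex P (S n.+1 N); set a3 := Ex PL (hat F).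
set a4 := Ex P (F N); move: (n.+1%:R^-1 : R) => r; rewrite !ler_norml => /andP[h11 h12] /andP[h21 h22] /andP[h31 h32] hr.
by apply/andP; split; lra.
Qed.

Lemma Ex_hat (F : nat -> T -> R) (M : R) : (forall N, measurable_fun setT (F N)) ->
  (forall N x, `|F N x| <= M) -> (fun N => Ex P (F N)) @ U --> Ex PL (hat F).
Proof.
move=> mF FM; have M0 : 0 <= M by apply: le_trans (FM 0%N point).
pose c := 2 * (M + 1); have c0 : 0 < c by rewrite mulr_gt0// ltr_wpDl.
pose G N x := c^-1 * F N x + 2^-1.
have mG N : measurable_fun setT (G N) by apply: measurable_funD => //; exact: measurable_funM.
have G01 N x : 0 <= G N x <= 1.
  have := FM N x; rewrite ler_norml => /andP[h1 h2].
  have e : G N x = c^-1 * (F N x + (M + 1)).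
    by rewrite /G mulrDr; congr (_ + _); rewrite /c; field; lra.
  rewrite e mulr_ge0 ?invr_ge0 ?(ltW c0)//=; last by lra.
  by rewrite ler_pdivrMl// /c; lra.
have itF N : itg P (F N) by apply: (@itg_bounded _ _ _ _ _ M).
have itH : itg PL (hat F).
  apply: (@itg_bounded _ _ _ _ _ M); first exact: measurable_hat mF FM.
  move=> w; have cv : (fun N => `|F N (w N)|) @ U --> `|hat F w| by apply: cvg_norm; exact: hat_cvg.
  rewrite -(cvg_lim (@Rhausdorff R) cv).
  by apply: limr_le; [exact: cvgP cv|exact: nearW].
have hG : hat G = fun w => c^-1 * hat F w + 2^-1.
  apply/funext => w; apply: cvg_lim => //; apply: cvgD; last exact: cvg_cst.
  by apply: cvgM; [exact: cvg_cst|exact: (@hat_cvg _ _ FM w)].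
have := Ex_hat01 mG G01; rewrite hG.
rewrite ExD ?ExZ ?Ex_cst//; [|exact: itgZ|exact: itg_cst].
have -> : (fun N => Ex P (G N)) = fun N => c^-1 * Ex P (F N) + 2^-1.
  by apply/funext => N; rewrite ExD ?ExZ ?Ex_cst//; [exact: itgZ|exact: itg_cst].
move=> h; have -> : (fun N => Ex P (F N)) = fun N => c * (c^-1 * Ex P (F N) + 2^-1 - 2^-1).
  by apply/funext => N; rewrite addrK mulrA divff ?gt_eqF// mul1r.
have -> : Ex PL (hat F) = c * (c^-1 * Ex PL (hat F) + 2^-1 - 2^-1).
  by rewrite addrK mulrA divff ?gt_eqF// mul1r.
by apply: cvgM; [exact: cvg_cst|apply: cvgB => //; exact: cvg_cst].
Qed.

Section tight_sequences.
Variables (F : nat -> T -> R) (C : R).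
Hypothesis iF : forall N, itg P (F N).
Hypothesis FC : forall N, Ex P (fun x => `|F N x|) <= C.

Let mF N : measurable_fun setT (F N). Proof. exact: itg_meas (iF N). Qed.

Let big (M : nat) N := [set x | M%:R < `|F N x|].

Let mbig M : mseq (big M).
Proof.
move=> N; rewrite -[X in measurable X]setTI.
have -> : big M N = (fun x => `|F N x|) @^-1` [set` `]M%:R, +oo[].
  by apply/seteqP; split=> x /=; rewrite in_itv /= andbT.
exact: meas_abs.
Qed.

(** Points at which the sequence stays bounded along [U], so that its limit is finite. By Markov's
    inequality the bound [C] on the first absolute moments makes this set of full Loeb measure. *)
Definition ubounded : set loeb_space := \bigcup_M internal (fun N => ~` big M N).

Lemma measurable_ubounded : measurable ubounded.
Proof.
apply: bigcup_measurable => M _; apply: measurable_internal => N.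
by apply: measurableC; exact: mbig.
Qed.

Let markov_big M N : (0 < M)%N -> fine (P (big M N)) <= C / M%:R.
Proof.
move=> M0; have Mp : 0 < M%:R :> R by rewrite ltr0n.
have [i1 <-] := Ex_indic_le P (mbig M N).
rewrite ler_pdivlMr// mulrC -ExZ//; apply: le_trans (FC N).
apply: le_Ex => [||x]; [exact: itgZ|exact: itg_abs|].
case: (boolP (x \in big M N)) => [/set_mem h|_]; first by rewrite mulr1; exact: ltW.
by rewrite mulr0.
Qed.

Lemma ae_ubounded : {ae PL, forall w, ubounded w}.
Proof.
exists (~` ubounded); split=> //; first by apply: measurableC; exact: measurable_ubounded.
have h M : (0 < M)%N -> (loeb_measure (~` ubounded) <= (C / M%:R)%:E)%E.
  move=> M0; apply: (@le_trans _ _ (loeb_measure (internal (big M)))).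
    apply: le_measure; rewrite ?inE.
    - by apply: measurableC; exact: measurable_ubounded.
    - by apply: measurable_internal; exact: mbig.
    move=> w nb; have [//|h] := in_ultra_setVsetC [set N | big M N (w N)] UU.
    by exfalso; apply: nb; exists M.
  rewrite /loeb_measure loeb_outer_internal; last exact: mbig.
  rewrite lee_fin; apply: limr_le; first exact: cvgP (ultraprob_cvg (mbig M)).
  by apply: nearW => N; exact: markov_big.
apply/eqP; rewrite eq_le measure_ge0 andbT.
apply/lee_addgt0Pr => eps e0; rewrite add0e.
have C0 : 0 <= C by apply: le_trans (FC 0%N); exact: Ex_ge0.
pose M := (Num.truncn (C / eps)).+1.
apply: le_trans (h M isT) _; rewrite lee_fin ler_pdivrMr// mulrC -ler_pdivrMr//.
exact/ltW/truncnS_gt.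
Qed.

Definition uclamp (M : nat) N x := Num.max (- M%:R) (Num.min M%:R (F N x)).

Lemma uclamp_id (M : nat) N x : `|F N x| <= M%:R -> uclamp M N x = F N x.
Proof. by rewrite ler_norml => /andP[h1 h2]; rewrite /uclamp (min_idPr h2) (max_idPr h1). Qed.

Lemma uclamp_le M N x : `|uclamp M N x| <= M%:R.
Proof.
rewrite ler_norml /uclamp le_max lexx /= ge_max ge_min lexx andbT.
by have := ler0n R M; lra.
Qed.

Lemma measurable_uclamp M N : measurable_fun setT (uclamp M N).
Proof.
apply: measurable_maxr; first exact: measurable_cst.
by apply: measurable_minr => //; exact: measurable_cst.
Qed.

Definition standard_part (w : loeb_space) : R :=
  (w \in ubounded)%:R * lim ((fun N => F N (w N)) @ U).

Lemma standard_part_cvg w : ubounded w -> (fun N => F N (w N)) @ U --> standard_part w.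
Proof.
move=> bw; rewrite /standard_part mem_set// mul1r; case: bw => M _ h.
apply: (@ultra_bounded_cvg _ _ _ _ M%:R); apply: filterS h => N /= /negP.
by rewrite -leNgt.
Qed.

Lemma measurable_standard_part : measurable_fun setT standard_part.
Proof.
apply: (@measurable_fun_cvg _ loeb_space R setT (fun (M : nat) w => (w \in ubounded)%:R * hat (uclamp M) w)).
  move=> M; apply: measurable_funM.
    exact: itg_meas (Ex_indic_le PL measurable_ubounded).1.
  exact: measurable_hat (@measurable_uclamp M) (@uclamp_le M).
move=> w _; apply: cvg_near_cst.
have [bw|nw] := boolP (w \in ubounded); last by apply: nearW => M; rewrite /standard_part (negbTE nw) !mul0r.
have [M0 _ h] := set_mem bw; near=> M.
rewrite /standard_part bw !mul1r; apply: cvg_lim => //.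
have := standard_part_cvg (set_mem bw); rewrite /standard_part bw mul1r.
move=> h'; apply: cvg_trans h'; apply: near_eq_cvg.
apply: filterS h => N /= /negP; rewrite -leNgt => h1.
rewrite uclamp_id//; apply: le_trans h1 _; rewrite ler_nat.
by near: M; exact: nbhs_infty_ge.
Unshelve. all: by end_near.
Qed.

End tight_sequences.

(** A compactness theorem for laws: an L^1-bounded sequence of pairs has a limit law along any
    ultrafilter containing the tails, represented by the standard parts on the Loeb space. *)
Lemma loeb_pair_limit (F G : nat -> T -> R) (C : R) : (forall N, itg P (F N)) -> (forall N, itg P (G N)) ->
  (forall N, Ex P (fun x => `|F N x|) <= C) -> (forall N, Ex P (fun x => `|G N x|) <= C) ->
  exists d' (T' : measurableType d') (P' : probability T' R) (Z Y : T' -> R),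
  [/\ measurable_fun setT Z, measurable_fun setT Y &
    forall g : R * R -> R, continuous g -> (exists M, forall v, `|g v| <= M) ->
      measurable_fun setT (fun w => g (Z w, Y w)) /\
      (fun N => Ex P (fun w => g (F N w, G N w))) @ U --> Ex P' (fun w => g (Z w, Y w))].
Proof.
move=> iF iG FC GC; exists _, loeb_space, PL, (standard_part F), (standard_part G).
have mZ := measurable_standard_part iF; have mY := measurable_standard_part iG.
split; [exact: mZ|exact: mY|move=> g cg [M gM]].
have mg := meas_continuous_pair mZ mY cg; split; first exact: mg.
have mN N : measurable_fun setT (fun x => g (F N x, G N x)).
  by apply: meas_continuous_pair cg; exact: itg_meas.
have gN N x : `|g (F N x, G N x)| <= M by exact: gM.
rewrite (_ : Ex PL _ = Ex PL (hat (fun N x => g (F N x, G N x)))); first exact: Ex_hat mN gN.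
apply: ae_eq_Ex => //; first exact: measurable_hat mN gN.
apply: filterS2 (ae_ubounded iF FC) (ae_ubounded iG GC) => w h1 h2.
apply/esym/cvg_lim => //.
have c1 := @standard_part_cvg _ w h1; have c2 := @standard_part_cvg _ w h2.
apply: (@cvg_comp _ _ _ (fun N => (F N (w N), G N (w N))) g U _ _ _ (cg _)).
exact: (cvg_pair c1 c2).
Qed.

End loeb.

(** * Convergence of moments *)

Section clamped_functions.
Context {R : realType} (k : nat).
Implicit Types (h : 'rV[R]_k.+1 -> R) (x y : 'rV[R]_k.+1).

Lemma dpg_locally_lipschitz h : diff_poly_growth 1 h ->
  exists C m, 0 <= C /\ forall x y, `|h x - h y| <= C * (1 + `|x| + `|y|) ^+ m * `|x - y|.
Proof.
move=> [_ dh /= gh]; have [C [m hC]] : exists C m, 0 <= C /\ forall j x, `|partial j h x| <= C * (1 + `|x|) ^+ m.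
  have /choice[C0 hC0] j : exists C, exists m, forall x, `|partial j h x| <= C * (1 + `|x|) ^+ m by exact: gh.
  have /choice[m0 hm0] := hC0.
  exists (\sum_j `|C0 j|), (\sum_j m0 j)%N; split; first by apply: sumr_ge0.
  move=> j x; apply: le_trans (hm0 j x) _; apply: le_trans (ler_wpM2r _ (ler_norm _)) _.
    by rewrite exprn_ge0// addr_ge0.
  apply: ler_pM; rewrite ?exprn_ge0 ?addr_ge0//.
    by rewrite (bigD1 j)//= lerDl sumr_ge0.
  by apply: ler_weXn2l; [rewrite lerDl|rewrite (bigD1 j)//= leq_addr].
exists (k.+1%:R * C), m; split; first by rewrite mulr_ge0//; case: hC.
move=> x y; case: hC => C0 hC.
pose f z := h (y + z *: (x - y)).
have df (z : R) : is_derive z 1 f (\sum_j (x - y) 0 j * partial j h (y + z *: (x - y))) by exact: is_derive_line.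
have cf : {within `[0, 1], continuous f}.
  apply: continuous_subspaceT => z; apply: differentiable_continuous.
  by apply/derivable1_diffP; have [] := df z.
have [z zi] := MVT_segment ler01 (fun z _ => df z) cf.
rewrite /f scale0r addr0 scale1r [y + _]addrC subrK subr0 mulr1 => ->.
apply: le_trans (ler_norm_sum _ _ _) _.
have yz : 1 + `|y + z *: (x - y)| <= 1 + `|x| + `|y|.
  move: zi; rewrite in_itv /= => /andP[z0 z1].
  have -> : y + z *: (x - y) = z *: x + (1 - z) *: y.
    by rewrite scalerBr scalerBl scale1r addrCA.
  rewrite -addrA lerD2l; apply: le_trans (ler_normD _ _) _; rewrite !normrZ lerD// ler_piMl//.
    by rewrite ger0_norm.
  by rewrite ger0_norm; lra.
apply: le_trans (_ : \sum_(j < k.+1) `|x - y| * (C * (1 + `|x| + `|y|) ^+ m) <= _); last first.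
  by rewrite sumr_const card_ord -mulr_natl le_eqVlt; apply/orP; left; apply/eqP; ring.
apply: ler_sum => j _; rewrite normrM; apply: ler_pM => //; first exact: coord_norm_le.
apply: le_trans (hC _ _) _; rewrite ler_wpM2l// lerXn2r ?nnegrE// ?addr_ge0//.
Qed.

Definition clampv (M : nat) x : 'rV[R]_k.+1 := \row_i Num.max (- M%:R) (Num.min M%:R (x 0 i)).

Lemma clamp_abs_le (M : nat) (z : R) : `|Num.max (- M%:R) (Num.min M%:R z)| <= Num.min M%:R `|z|.
Proof.
have M0 := ler0n R M; rewrite le_min; apply/andP; split; rewrite ler_norml.
  by rewrite le_max lexx /= ge_max ge_min lexx andbT; lra.
have z1 := ler_norm z; have z2 := ler_norm (- z); rewrite normrN in z2.
have z0 := normr_ge0 z.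
rewrite le_max ge_max ge_min; apply/andP; split; last by apply/andP; split; [lra|apply/orP; right; lra].
by apply/orP; right; rewrite le_min; apply/andP; split; lra.
Qed.

Lemma clamp_id (M : nat) (z : R) : `|z| <= M%:R -> Num.max (- M%:R) (Num.min M%:R z) = z.
Proof. by rewrite ler_norml => /andP[h1 h2]; rewrite (min_idPr h2) (max_idPr h1). Qed.

Lemma clampv_norm_le M x : `|clampv M x| <= Num.min M%:R `|x|.
Proof.
rewrite [leLHS]mx_normrE; apply/bigmax_leP; split=> [|[i j] _ /=]; first by rewrite le_min ler0n normr_ge0.
rewrite mxE; apply: le_trans (clamp_abs_le _ _) _.
rewrite le_min !ge_min lexx /=; apply/orP; right; exact: coord_norm_le.
Qed.

Lemma clampv_id M x : `|x| <= M%:R -> clampv M x = x.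
Proof.
move=> xM; apply/rowP => i; rewrite mxE clamp_id//.
by apply: le_trans xM; exact: coord_norm_le.
Qed.

Lemma clampv_cont h M : continuous h -> continuous (fun x => h (clampv M x)).
Proof.
move=> ch; apply: (@cont_comp _ _ _ (clampv M) h) => //; apply: cont_row => i.
under eq_fun do rewrite mxE.
by apply: cont_clamp; exact: coord_cont.
Qed.

Lemma clamp_lip (M : nat) (a b : R) :
  `|Num.max (- M%:R) (Num.min M%:R a) - Num.max (- M%:R) (Num.min M%:R b)| <= `|a - b|.
Proof.
have M0 := ler0n R M; have h1 := ler_norm (a - b); have h2 := ler_norm (- (a - b)); rewrite normrN in h2.
have h0 := normr_ge0 (a - b).
rewrite ler_norml /Num.max /Num.min; apply/andP.
by case: ifPn; case: ifPn; case: ifPn; case: ifPn; rewrite -?leNgt => *; split; lra.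
Qed.

Lemma clampv_lip M x y : `|clampv M x - clampv M y| <= \sum_i `|x 0 i - y 0 i|.
Proof.
apply: le_trans (norm_le_sum _) _; apply: ler_sum => i _; rewrite !mxE.
exact: clamp_lip.
Qed.

Lemma poly_growth_bound h : poly_growth h -> exists C m, 0 <= C /\ forall x, `|h x| <= C * (1 + `|x|) ^+ m.
Proof.
move=> [C [m hC]]; exists `|C|, m; split=> // x; apply: le_trans (hC x) _.
by rewrite ler_wpM2r ?ler_norm// exprn_ge0// addr_ge0.
Qed.

Lemma clampv_bounded h M : poly_growth h -> exists B, forall x, `|h (clampv M x)| <= B.
Proof.
move=> /poly_growth_bound[C [m [C0 hC]]]; exists (C * (1 + M%:R) ^+ m) => x.
apply: le_trans (hC _) _; rewrite ler_wpM2l// lerXn2r ?nnegrE ?addr_ge0// lerD2l.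
by apply: le_trans (clampv_norm_le M x) _; rewrite ge_min lexx.
Qed.

(** The two values differ only where [|x| > M], and there [1 < |x| / M]. The exponent [m] comes from
    the local Lipschitz constant, the extra [2] from bounding the displacement by
    [2 |x| <= 2 |x|^2 / M]. *)
Lemma clampv_error h : diff_poly_growth 1 h -> exists C m, 0 <= C /\
  forall (M : nat) x, (0 < M)%N -> `|h x - h (clampv M x)| <= C / M%:R * (1 + \sum_i `|x 0 i|) ^+ m.
Proof.
move=> /dpg_locally_lipschitz[C [m [C0 hC]]].
exists (C * 2 ^+ m.+1), (m + 2)%N; split; first by rewrite mulr_ge0// exprn_ge0.
move=> M x M0; have Mp : 0 < M%:R :> R by rewrite ltr0n.
have s0 : 0 <= \sum_i `|x 0 i| by apply: sumr_ge0.
have [xM|Mx] := leP `|x| M%:R.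
  rewrite clampv_id// subrr normr0 !mulr_ge0 ?exprn_ge0 ?invr_ge0//.
  by rewrite addr_ge0.
apply: le_trans (hC _ _) _; set S := \sum_i _ in s0 *.
have xS : `|x| <= S := norm_le_sum x.
have cx : `|clampv M x| <= `|x|.
  by apply: le_trans (clampv_norm_le M x) _; rewrite ge_min lexx orbT.
have h1 : (1 + `|x| + `|clampv M x|) ^+ m <= (2 * (1 + S)) ^+ m.
  by rewrite lerXn2r ?nnegrE ?mulr_ge0 ?addr_ge0//; lra.
have h2 : `|x - clampv M x| <= 2 / M%:R * (1 + S) ^+ 2.
  rewrite -mulrA mulrCA ler_pdivlMl//; apply: le_trans (_ : S * (2 * S) <= _); last by nra.
  apply: ler_pM => //; first exact/ltW/(lt_le_trans Mx).
  by apply: le_trans (ler_normB _ _) _; lra.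
apply: le_trans (ler_pM _ _ (ler_wpM2l C0 h1) h2) _; rewrite ?mulr_ge0 ?exprn_ge0 ?addr_ge0//.
by rewrite exprMn exprD [2 ^+ m.+1]exprS le_eqVlt; apply/orP; left; apply/eqP; ring.
Qed.

Lemma exprD_le (s a : R) n : 0 <= s -> 0 <= a -> (s + a) ^+ n <= 2 ^+ n * (s ^+ n + a ^+ n).
Proof.
move=> s0 a0; have [sa|as_] := leP s a.
  apply: le_trans (_ : (2 * a) ^+ n <= _); first by rewrite lerXn2r ?nnegrE ?addr_ge0 ?mulr_ge0//; lra.
  by rewrite exprMn ler_wpM2l ?exprn_ge0// lerDr exprn_ge0.
apply: le_trans (_ : (2 * s) ^+ n <= _); first by rewrite lerXn2r ?nnegrE ?addr_ge0 ?mulr_ge0//; lra.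
by rewrite exprMn ler_wpM2l ?exprn_ge0// lerDl exprn_ge0.
Qed.

Lemma expr_sum_le I (s : seq I) (a : I -> R) n : (forall i, 0 <= a i) ->
  (1 + \sum_(i <- s) a i) ^+ n <= 2 ^+ (n * size s) * (1 + \sum_(i <- s) a i ^+ n).
Proof.
move=> a0; elim: s => [|i s IH]; first by rewrite !big_nil !addr0 muln0 expr1n mulr1.
have S0 : 0 <= \sum_(j <- s) a j by apply: sumr_ge0.
have Sn0 : 0 <= \sum_(j <- s) a j ^+ n by apply: sumr_ge0 => j _; rewrite exprn_ge0.
rewrite !big_cons /= mulnS addrCA addrC.
apply: le_trans (exprD_le _ _ _) _ => //; first by rewrite addr_ge0.
rewrite exprD -mulrA ler_wpM2l ?exprn_ge0//.
have g1 : 1 <= 2 ^+ (n * size s) :> R by rewrite exprn_ege1// ler1n.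
have an : 0 <= a i ^+ n by rewrite exprn_ge0.
apply: le_trans (_ : 2 ^+ (n * size s) * (1 + \sum_(j <- s) a j ^+ n) + 2 ^+ (n * size s) * a i ^+ n <= _).
  by apply: lerD => //; rewrite ler_peMl.
by rewrite -mulrDr ler_wpM2l ?exprn_ge0//; lra.
Qed.

End clamped_functions.

Section moment_convergence.
Context {R : realType} d (T : measurableType d) (P : probability T R).
Context d' (T' : measurableType d') (P' : probability T' R) (k : nat).
Context (F : set_system nat) {FF : ProperFilter F}.
Implicit Types (xi eta : nat -> T -> 'rV[R]_k.+1) (zeta : T' -> 'rV[R]_k.+1).

(** Convergence in law tested on smooth functions composed with clamping: these tests are bounded
    and Lipschitz, hence insensitive to L^1-small perturbations, yet enough to recover moments. *)
Definition clamped_cvg xi zeta := forall (h : 'rV[R]_k.+1 -> R) (M : nat), diff_poly_growth 1 h ->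
  (fun N => Ex P (fun w => h (clampv M (xi N w)))) @ F --> Ex P' (fun w => h (clampv M (zeta w))).

Definition row_meas d0 (V : measurableType d0) (x : V -> 'rV[R]_k.+1) :=
  forall i, measurable_fun setT (fun w => x w 0 i).

Lemma row_meas_clampv d0 (V : measurableType d0) (x : V -> 'rV[R]_k.+1)
    (h : 'rV[R]_k.+1 -> R) (M : nat) : row_meas x -> continuous h -> measurable_fun setT (fun w => h (clampv M (x w))).
Proof.
move=> mx ch; apply: (meas_continuous_row (g := fun y => h (clampv M y)) mx).
exact: clampv_cont.
Qed.

Lemma row_itg_clampv d0 (V : measurableType d0) (Q : probability V R) (x : V -> 'rV[R]_k.+1) h (M : nat) :
  row_meas x -> diff_poly_growth 1 h -> itg Q (fun w => h (clampv M (x w))).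
Proof.
move=> mx hh; have [B hB] := clampv_bounded M (dpg0 hh).
apply: (@itg_bounded _ _ _ _ _ B) => //; apply: row_meas_clampv => //.
exact: dpg_cont hh.
Qed.

(* Smoothness of the test function makes it Lipschitz on the cube, so that an L^1-small
   perturbation is harmless. *)
Lemma clamped_cvg_L1 xi eta zeta : (forall N, row_meas (xi N)) -> (forall N, row_meas (eta N)) ->
  (forall N i, itg P (fun w => xi N w 0 i - eta N w 0 i)) ->
  (forall i, (fun N => Ex P (fun w => `|xi N w 0 i - eta N w 0 i|)) @ F --> (0 : R)) ->
  clamped_cvg xi zeta -> clamped_cvg eta zeta.
Proof.
move=> mx me iD cD cx h M hh; have [C [m [C0 hC]]] := dpg_locally_lipschitz hh.
have cS : (fun N => C * (1 + M%:R + M%:R) ^+ m * \sum_i Ex P (fun w => `|xi N w 0 i - eta N w 0 i|)) @ F --> (0 : R).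
  rewrite -[X in _ --> X](mulr0 (C * (1 + M%:R + M%:R) ^+ m)); apply: cvgM; first exact: cvg_cst.
  have e0 : \sum_(i < k.+1) 0 = 0 :> R by rewrite big1.
  by rewrite -[X in _ --> X]e0; exact: cvgr_sum.
have cd : (fun N => Ex P (fun w => h (clampv M (xi N w))) - Ex P (fun w => h (clampv M (eta N w)))) @ F --> (0 : R).
  apply/cvgr0Pnorm_le => eps e0; move/cvgr0Pnorm_le: cS => /(_ _ e0).
  apply: filterS => N hN; apply: le_trans hN.
  rewrite -ExB; try exact: row_itg_clampv.
  apply: le_trans _ (ler_norm _); rewrite -Ex_sum => [|i]; last exact: itg_abs.
  rewrite -ExZ; last by apply: itg_sum => i; exact: itg_abs.
  apply: le_abs_Ex => [||w].
  - by apply: measurable_funB; apply: row_meas_clampv => //; exact: dpg_cont hh.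
  - by apply: itgZ; apply: itg_sum => i; exact: itg_abs.
  apply: le_trans (hC _ _) _; apply: ler_pM; rewrite ?mulr_ge0 ?exprn_ge0 ?addr_ge0//; last exact: clampv_lip.
  rewrite ler_wpM2l// lerXn2r ?nnegrE ?addr_ge0//.
  have := clampv_norm_le M (xi N w); have := clampv_norm_le M (eta N w); rewrite !le_min => /andP[+ _] /andP[+ _].
  lra.
have -> : (fun N => Ex P (fun w => h (clampv M (eta N w)))) = fun N => Ex P (fun w => h (clampv M (xi N w))) -
    (Ex P (fun w => h (clampv M (xi N w))) - Ex P (fun w => h (clampv M (eta N w)))).
  by apply/funext => N; rewrite subKr.
by rewrite -[X in _ --> X]subr0; apply: cvgB => //; exact: cx.
Qed.

Definition bounded_moments xi := forall i n, exists C : R, forall N, Ex P (fun w => `|xi N w 0 i| ^+ n) <= C.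

Lemma bounded_moments_sum xi : (forall N i, am P (fun w => xi N w 0 i)) -> bounded_moments xi ->
  forall n, exists C : R, forall N, Ex P (fun w => (1 + \sum_i `|xi N w 0 i|) ^+ n) <= C.
Proof.
move=> ax bm n; have /choice[C hC] i := bm i n.
exists (2 ^+ (n * k.+1) * (1 + \sum_i C i)) => N.
have aa i : am P (fun w => `|xi N w 0 i| ^+ n) by apply: amX; exact: am_abs.
apply: le_trans (_ : Ex P (fun w => 2 ^+ (n * k.+1) * (1 + \sum_i `|xi N w 0 i| ^+ n)) <= _).
  apply: le_Ex => [||w].
  - apply: am_itg; apply: amX; apply: amD; first exact: am_cst.
    by apply: am_sum => i; exact: am_abs.
  - by apply: am_itg; apply: amZ; apply: amD; [exact: am_cst|exact: am_sum].
  have := @expr_sum_le R _ (index_enum 'I_k.+1) (fun i => `|xi N w 0 i|) n (fun i => normr_ge0 _).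
  by rewrite /index_enum -enumT size_enum_ord.
rewrite ExZ; last by apply: am_itg; apply: amD; [exact: am_cst|exact: am_sum].
rewrite ExD ?Ex_cst; [|exact: itg_cst|by apply: am_itg; exact: am_sum].
rewrite ler_wpM2l ?exprn_ge0// lerD2l Ex_sum => [|i]; last exact: am_itg.
by apply: ler_sum => i _.
Qed.

(** A Fatou argument: clamped even moments pass to the limit with the uniform bound [C], and
    [itg_trunc] removes the clamping. *)
Lemma clamped_cvg_am xi zeta : (forall N i, am P (fun w => xi N w 0 i)) -> bounded_moments xi ->
  row_meas zeta -> clamped_cvg xi zeta -> forall i, am P' (fun w => zeta w 0 i).
Proof.
move=> ax bm mz cx i; split=> // n.
have [C hC] := bm i (2 * n)%N.
pose h (x : 'rV[R]_k.+1) := x 0 i ^+ (2 * n).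
have dh : diff_poly_growth 1 h.
  rewrite /h; elim: (2 * n)%N => [|j IH]; first exact: dpg_cst.
  have -> : (fun x : 'rV[R]_k.+1 => x 0 i ^+ j.+1) = fun x => x 0 i * x 0 i ^+ j.
    by apply/funext => x; rewrite exprS.
  by apply: dpgM => //; exact: dpg_coord.
have mrow N : row_meas (xi N) by move=> j; exact: am_meas (ax N j).
have e2 (z : R) : z ^+ (2 * n) = `|z| ^+ (2 * n) by rewrite !exprM real_normK ?num_real.
have [it _] : itg P' (fun w => zeta w 0 i ^+ (2 * n)) /\ Ex P' (fun w => zeta w 0 i ^+ (2 * n)) <= C.
  apply: itg_trunc => [|w|M]; [exact: measX|by rewrite e2 exprn_ge0|].
  have le1 : Ex P' (fun w => h (clampv M (zeta w))) <= C.
    rewrite -(cvg_lim (@Rhausdorff R) (cx h M dh)); apply: limr_le; first exact: cvgP (cx h M dh).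
    apply: nearW => N; apply: le_trans (hC N); apply: le_Ex => [||w]; [exact: row_itg_clampv|exact: am_itg (amX _ (am_abs (ax N i)))|].
    rewrite /h e2 lerXn2r ?nnegrE// mxE; apply: le_trans (clamp_abs_le _ _) _.
    by rewrite ge_min lexx orbT.
  apply: le_trans le1; apply: le_Ex => [||w].
  - apply: (@itg_bounded _ _ _ _ _ M%:R) => [|w].
      by apply: measurable_minr; [exact: measX|exact: measurable_cst].
    by rewrite ger0_norm ?ge_min ?lexx ?orbT// le_min ler0n e2 exprn_ge0.
  - exact: row_itg_clampv.
  rewrite /h mxE; have [zM|Mz] := leP `|zeta w 0 i| M%:R.
    by rewrite clamp_id// ge_min lexx.
  rewrite ge_min; have [n0|n0] := posnP n; first by rewrite n0 muln0 !expr0 lexx.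
  (* Outside the window the clamped power is [M ^+ (2 * n)], at least [M] when [n] and [M] are
     positive, so it dominates the power truncated at [M]. *)
  apply/orP; right; have -> : Num.max (- M%:R) (Num.min M%:R (zeta w 0 i)) ^+ (2 * n) = M%:R ^+ (2 * n) :> R.
    have [z0|z0] := leP 0 (zeta w 0 i).
      rewrite ger0_norm// in Mz; rewrite (min_idPl (ltW Mz)) (max_idPr _)//.
      by have := ler0n R M; lra.
    rewrite ltr0_norm// in Mz.
    have zm : zeta w 0 i <= M%:R by have := ler0n R M; lra.
    rewrite (min_idPr zm) (max_idPl _); last by lra.
    by rewrite exprM sqrrN -exprM.
  have [M0|M0] := posnP M; first by rewrite M0 exprn_ge0.
  rewrite ler_eXnr ?ler1n//; lia.
apply: itg_le (itgD (itg_cst P' 1) it) => [|w]; first by apply: measX; exact: meas_abs.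
rewrite ger0_norm ?exprn_ge0// e2 mulnC exprM.
set a := `|_| ^+ n; have := sqr_ge0 (a - 1); rewrite sqrrB; have a0 : 0 <= a by rewrite exprn_ge0.
by lra.
Qed.

(** Clamping at [M] costs [O(1 / M)] uniformly in [N], by [clampv_error] and the bounded moments;
    for fixed [M] the convergence is the hypothesis. *)
Lemma moment_cvg xi zeta h : (forall N i, am P (fun w => xi N w 0 i)) -> bounded_moments xi ->
  row_meas zeta -> clamped_cvg xi zeta -> diff_poly_growth 1 h ->
  (fun N => Ex P (fun w => h (xi N w))) @ F --> Ex P' (fun w => h (zeta w)).
Proof.
move=> ax bm mz cx hh.
have az := clamped_cvg_am ax bm mz cx.
have mx N : row_meas (xi N) by move=> i; exact: am_meas.
have ch := dpg_cont hh; have gh := dpg0 hh.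
have [C [m [C0 hC]]] := clampv_error hh.
have [K hK] := bounded_moments_sum ax bm m.
have as_ d0 (V : measurableType d0) (Q : probability V R) (x : V -> 'rV[R]_k.+1) :
    (forall i, am Q (fun w => x w 0 i)) -> itg Q (fun w => (1 + \sum_i `|x w 0 i|) ^+ m).
  move=> a; apply: am_itg; apply: amX; apply: amD; first exact: am_cst.
  by apply: am_sum => i; exact: am_abs.
pose K' := Ex P' (fun w => (1 + \sum_i `|zeta w 0 i|) ^+ m).
have err d0 (V : measurableType d0) (Q : probability V R) (x : V -> 'rV[R]_k.+1) (M : nat) : (0 < M)%N ->
    (forall i, am Q (fun w => x w 0 i)) ->
    `|Ex Q (fun w => h (x w)) - Ex Q (fun w => h (clampv M (x w)))| <=
    C / M%:R * Ex Q (fun w => (1 + \sum_i `|x w 0 i|) ^+ m).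
  move=> M0 a; have ma : row_meas x by move=> i; exact: am_meas.
  have i1 : itg Q (fun w => h (x w)) by apply: am_itg; exact: am_row.
  have i2 := row_itg_clampv Q M ma hh.
  rewrite -ExB// -ExZ; last exact: as_.
  apply: le_abs_Ex => [||w]; [exact: itg_meas (itgB i1 i2)|by apply: itgZ; exact: as_|exact: hC].
apply/cvgrPdist_le => eps e0.
pose B := C * (`|K| + `|K'|).
have B0 : 0 <= B by rewrite mulr_ge0// addr_ge0.
pose M := (Num.truncn (B / (eps / 3))).+1.
have e30 : 0 < eps / 3 by rewrite divr_gt0.
have Mp : 0 < M%:R :> R by rewrite ltr0n.
have BM : B / M%:R <= eps / 3.
  by rewrite ler_pdivrMr// mulrC -ler_pdivrMr//; exact/ltW/truncnS_gt.
have h1 : \forall N \near F, `|Ex P' (fun w => h (clampv M (zeta w))) - Ex P (fun w => h (clampv M (xi N w)))| <= eps / 3.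
  by move/cvgrPdist_le: (cx h M hh) => /(_ _ e30).
apply: filterS h1 => N h1.
have h2 := err _ _ P' zeta M isT az; have h3 := err _ _ P (xi N) M isT (ax N).
have bnd (x : R) : x <= `|K| + `|K'| -> C / M%:R * x <= eps / 3.
  move=> xK; apply: le_trans BM; rewrite /B mulrAC ler_pM2r ?invr_gt0// ler_wpM2l//.
have k1 : K' <= `|K| + `|K'| by rewrite (le_trans (ler_norm _))// lerDr.
have k2 : Ex P (fun w => (1 + \sum_i `|xi N w 0 i|) ^+ m) <= `|K| + `|K'|.
  by apply: le_trans (hK N) _; rewrite (le_trans (ler_norm _))// lerDl.
have {}h2 := le_trans h2 (bnd _ k1); have {}h3 := le_trans h3 (bnd _ k2).
move: h1 h2 h3; rewrite !ler_norml => /andP[h11 h12] /andP[h21 h22] /andP[h31 h32].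
by apply/andP; split; lra.
Qed.

End moment_convergence.

(** * Limits of the weighted moments *)

(* The last field is the duality formula of the divergence operator, tested on
   [u * cos (v * y + b)]. *)
Record gauss_real (R : realType) d (T : measurableType d) (P : probability T R) := GaussReal {
  gr_alg :> gauss_alg R;
  gr_ev : gr_alg -> T -> R;
  gr_am : forall u, am P (gr_ev u);
  gr_evD : forall u v w, gr_ev (u + v) w = gr_ev u w + gr_ev v w;
  gr_evZ : forall c u w, gr_ev (c *: u) w = c * gr_ev u w;
  gr_evM : forall u v w, gr_ev (u * v) w = gr_ev u w * gr_ev v w;
  gr_evc : forall c w, gr_ev c%:A w = c;
  gr_E : forall u, ga_E u = Ex P (gr_ev u);
  gr_ibp : forall p (x u y : gr_alg) (v b : R), ch p x ->
    p%:R * Ex P (fun w => gr_ev (x * u) w * cos (v * gr_ev y w + b)) =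
    Ex P (fun w => gr_ev (Gam x u) w * cos (v * gr_ev y w + b)) +
    v * Ex P (fun w => gr_ev (u * Gam x y) w * cos (v * gr_ev y w + (b + pi / 2))) }.

Section walg_real.
Context {R : realType} (H : completeNormedModType R).
Variable dot : {dot H for idfun}.
Hypothesis dot_norm : forall x : H, dot x x = `|x| ^+ 2.
Context d (T : measurableType d) (P : probability T R).
Variable W : H -> {RV P >-> R}.
Hypothesis iso : isonormal_process dot W.
Context k (e : 'I_k.+1 -> H) (he : orthonormal_family dot e).
Local Notation A := (Walg iso he).

Lemma cos_shift (x b : R) : cos (x + (b + pi / 2)) = - sin (x + b).
Proof. by rewrite addrA cosDpihalf. Qed.

Lemma am_trig (F : T -> R) (u v b : R) : am P F -> am P (fun w => cos (v * F w + b)).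
Proof.
move=> aF; apply: (@am_bounded _ _ _ _ _ 1) => [|w]; last exact: cos_max.
apply: measurableT_comp; first by apply: continuous_R_meas; exact: continuous_cos.
by apply: measurable_funD => //; apply: measurable_funM => //; exact: am_meas aF.
Qed.

(** This is [grad_duality] against [u * cos (v * y + b)], where [L x = p x] produces the left side.
    The derivative of the cosine is again a cosine, with phase shifted by [pi / 2]. *)
Lemma Walg_ibp p (x u y : A) (v b : R) : ch p x ->
  p%:R * Ex P (fun w => Wpoly W e (x * u) w * cos (v * Wpoly W e y w + b)) =
  Ex P (fun w => Wpoly W e (Gam x u) w * cos (v * Wpoly W e y w + b)) +
  v * Ex P (fun w => Wpoly W e (u * Gam x y) w * cos (v * Wpoly W e y w + (b + pi / 2))).
Proof.
move=> hx.
pose f z := v * pfun y z + b.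
have sx : smooth_poly_growth (pfun x) by move=> n; exact: pfun_smooth.
have sf n : diff_poly_growth n f by apply: dpgD; [apply: dpgZ; exact: pfun_smooth|exact: dpg_cst].
have stf n : diff_poly_growth n (fun z => cos (f z)) by have [] := dpg_trig (sf n).
pose g z := pfun u z * cos (f z).
have sg : smooth_poly_growth g by move=> n; apply: dpgM; [exact: pfun_smooth|exact: stf].
have pf i z : partial i f z = v * pfun (mderiv i y) z.
  rewrite /f partialD; [|by apply: differentiableM => //; have [_ + _] := pfun_smooth 1 y|exact: differentiable_cst].
  rewrite partialM; [|exact: differentiable_cst|by have [_ + _] := pfun_smooth 1 y].
  by rewrite /partial !derive_cst mul0r add0r addr0 -/(partial i (pfun y) z) pfun_partial.
have pg i z : partial i g z = pfun (mderiv i u) z * cos (f z) - v * (pfun u z * pfun (mderiv i y) z * sin (f z)).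
  have df : differentiable f z by have [_ + _] := sf 1%N; exact.
  rewrite /g partialM; [|by have [_ + _] := pfun_smooth 1 u|by have [_ + _] := stf 1%N; exact].
  rewrite (@partial_comp _ _ f cos (fun y => - sin y))// pf pfun_partial; ring.
have := grad_duality iso e e sx sg.
have -> : Ex P (fun w => div_grad dot W e (pfun x) w * g (Wrow W e w)) =
    p%:R * Ex P (fun w => Wpoly W e (x * u) w * cos (v * Wpoly W e y w + b)).
  rewrite -ExZ; last by apply: am_itg; apply: amM; [exact: (am_Wpoly iso)|apply: am_trig => //; exact: (am_Wpoly iso)].
  apply: eq_Ex => w; rewrite (div_gradp x) hx.
  by rewrite WpolyZ /g WpolyM !mulrA.
move=> <-; rewrite -ExZ -?ExD; first last.
- apply: am_itg; apply: amM; first exact: (am_Wpoly iso).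
  by apply: am_trig => //; exact: (am_Wpoly iso).
- apply: am_itg; apply: amZ; apply: amM; first exact: (am_Wpoly iso).
  by apply: am_trig => //; exact: (am_Wpoly iso).
- apply: am_itg; apply: amM; first exact: (am_Wpoly iso).
  by apply: am_trig => //; exact: (am_Wpoly iso).
apply: eq_Ex => w; rewrite dot_grad WpolyM !Wpoly_sum cos_shift.
set C := cos _; set S := - sin _.
rewrite mulr_suml [X in v * (X * _)]mulr_sumr [X in v * X]mulr_suml [X in _ + X]mulr_sumr -big_split.
apply: eq_bigr => i _; rewrite (dot_sym iso) dot_grad (bigD1 i)//= he eqxx mulr1 big1 ?addr0.
  by rewrite pfun_partial pg !WpolyM /C /S /f /Wpoly; ring.
by move=> j ji; rewrite he (negbTE ji) mulr0.
Qed.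

Definition Walg_real : gauss_real P := @GaussReal R d T P A (Wpoly W e) (am_Wpoly iso e) (@WpolyD R H d T P W k e)
  (@WpolyZ R H d T P W k e) (@WpolyM R H d T P W k e) (@Wpolyc R H d T P W k e) (fun u => erefl) Walg_ibp.

End walg_real.

Section derivation.
Context {R : realType} (A : gauss_alg R) (x : A).

Lemma Gam_prod (I : eqType) (s : seq I) (f : I -> A) : uniq s ->
  Gam x (\prod_(i <- s) f i) = \sum_(i <- s) Gam x (f i) * \prod_(j <- s | j != i) f j.
Proof.
have G1 : Gam x 1 = 0 by rewrite /Gam big1// => i _; rewrite D1 mulr0.
elim: s => [|i s IH] /=; first by rewrite !big_nil G1.
move=> /andP[is_ us]; rewrite !big_cons GamMr IH// eqxx /= mulr_sumr.
congr (_ * _ + _); first by rewrite [RHS]big_seq_cond [LHS]big_seq; apply: eq_bigl => j; case: eqVneq => [->|]; rewrite ?andbT// (negbTE is_).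
apply: eq_big_seq => j js.
rewrite big_cons ifT; last by apply: contraNneq is_ => ->.
by rewrite mulrCA.
Qed.

Lemma Gam_exp (f : A) n : Gam x (f ^+ n) = n%:R *: (f ^+ n.-1 * Gam x f).
Proof.
elim: n => [|n IH]; first by rewrite scale0r /Gam big1// => i _; rewrite D1 mulr0.
rewrite exprS GamMr IH -scalerAr mulrA /=.
case: n {IH} => [|n]; first by rewrite expr0 scale0r addr0 mulr1 scale1r mul1r.
rewrite -exprS -[n.+2%:R]natr1 scalerDl scale1r addrC; congr (_ + _); exact: mulrC.
Qed.

End derivation.

Section real_algebra.
Context {R : realType} d (T : measurableType d) (P : probability T R) (A : gauss_real P).
Implicit Types (u x y : A).
Local Notation ev := (@gr_ev _ _ _ _ A).

Lemma gr_ev_exp u n w : ev (u ^+ n) w = ev u w ^+ n.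
Proof.
elim: n => [|n IH]; last by rewrite !exprS gr_evM IH.
by rewrite !expr0 -(scale1r (1 : A)) gr_evc.
Qed.

Lemma gr_ev_prod I (s : seq I) (f : I -> A) w : ev (\prod_(i <- s) f i) w = \prod_(i <- s) ev (f i) w.
Proof.
elim: s => [|i s IH]; last by rewrite !big_cons gr_evM IH.
by rewrite !big_nil -(scale1r (1 : A)) gr_evc.
Qed.

Lemma gr_Nr u : Ex P (fun w => ev u w ^+ 2) = Nr u ^+ 2.
Proof. by rewrite NrX gr_E; apply: eq_Ex => w; rewrite gr_evM expr2. Qed.

(** Real form of [E (u e^{ivy})]: the phase [b = 0] gives its real part and [b = pi / 2] the
    opposite of its imaginary part. *)
Definition trig_moment (y : A) (v : R) (u : A) (b : R) : R :=
  Ex P (fun w => ev u w * cos (v * ev y w + b)).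

Let it_trig y v u b : itg P (fun w => ev u w * cos (v * ev y w + b)).
Proof. by apply: am_itg; apply: amM; [exact: gr_am|apply: am_trig => //; exact: gr_am]. Qed.

Lemma trig_momentD y v u u' b : trig_moment y v (u + u') b = trig_moment y v u b + trig_moment y v u' b.
Proof.
by rewrite /trig_moment -ExD; [apply: eq_Ex => w; rewrite gr_evD mulrDl|exact: it_trig|exact: it_trig].
Qed.

Lemma trig_momentZ y v c u b : trig_moment y v (c *: u) b = c * trig_moment y v u b.
Proof.
by rewrite /trig_moment -ExZ; [apply: eq_Ex => w; rewrite gr_evZ mulrA|exact: it_trig].
Qed.

Lemma trig_momentB y v u u' b : trig_moment y v (u - u') b = trig_moment y v u b - trig_moment y v u' b.
Proof. by rewrite trig_momentD -scaleN1r trig_momentZ mulN1r. Qed.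

Lemma trig_moment_sum y v I (s : seq I) (f : I -> A) b :
  trig_moment y v (\sum_(i <- s) f i) b = \sum_(i <- s) trig_moment y v (f i) b.
Proof.
elim: s => [|i s IH]; last by rewrite !big_cons trig_momentD IH.
by rewrite !big_nil -(scale0r (1 : A)) trig_momentZ mul0r.
Qed.

Lemma trig_moment_le y v u b : `|trig_moment y v u b| <= Nr u.
Proof.
have au := am_l2 (gr_am u).
apply: le_trans (_ : Ex P (fun w => `|ev u w|) <= _).
  apply: le_abs_Ex => [||w]; [exact: itg_meas (it_trig _ _ _ _)|exact: l2_itg (l2_abs au)|].
  by rewrite normrM ler_piMr// cos_max.
apply: sqrt_mono; rewrite ?Nr_ge0//.
by apply: le_trans (Ex_abs_sq au) _; rewrite gr_Nr.
Qed.

Lemma trig_ibp p x u y v b : ch p x ->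
  p%:R * trig_moment y v (x * u) b = trig_moment y v (Gam x u) b + v * trig_moment y v (u * Gam x y) (b + pi / 2).
Proof. exact: gr_ibp. Qed.

End real_algebra.

Lemma Gam_horner (R : realType) (A : gauss_alg R) (x : A) (q : {poly R}) :
  Gam x (horner_alg x q) = horner_alg x q^`() * Gam x x.
Proof.
have G1 c : Gam x c%:A = 0 by rewrite GamZr /Gam big1 ?scaler0// => i _; rewrite D1 mulr0.
elim/poly_ind: q => [|q c IH]; first by rewrite deriv0 !rmorph0 mul0r -[X in Gam x X](scale0r (1 : A)) G1.
rewrite rmorphD rmorphM /= horner_algX horner_algC GamDr G1 addr0 GamMr IH.
rewrite derivD derivM derivX derivC addr0 mulr1 rmorphD rmorphM /= horner_algX.
by rewrite mulrDl [_ * x]mulrC mulrA [x * _]mulrC addrC addrC.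
Qed.

(** Hermite polynomials of variance [s]; the subtracted term is what cancels the limit of [Gam x x]
    divided by [p] in [tm_recursion]. *)
Fixpoint hermite_var (R : comNzRingType) (s : R) (n : nat) : {poly R} :=
  if n is m.+1 then 'X * hermite_var s m - s *: deriv (hermite_var s m) else 1.

(** * Bounded and vanishing sequences in varying Gaussian algebras *)

Section bounded_sequences.
Context {R : realType} (A : nat -> gauss_alg R).
Implicit Types (u w : forall N, A N).

(** The degree bound belongs to the notion: at bounded degree an L^2 bound gives bounds on products
    and on all moments. *)
Definition bdd u : Prop :=
  exists D (B : R), 0 <= B /\ forall N, deg D (u N) /\ Nr (u N) <= B.

Definition small u : Prop :=
  (exists D, forall N, deg D (u N)) /\ (fun N => Nr (u N)) @ \oo --> (0 : R).

Lemma eq_bdd u w : (forall N, u N = w N) -> bdd w -> bdd u.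
Proof. by move=> e [D [B [B0 h]]]; exists D, B; split => // N; rewrite e. Qed.

Lemma bddD u w : bdd u -> bdd w -> bdd (fun N => u N + w N).
Proof.
move=> [D [B [B0 hu]]] [D' [B' [B'0 hw]]]; exists (D + D')%N, (B + B'); split; first exact: addr_ge0.
move=> N; have [du bu] := hu N; have [dw bw] := hw N; split; last by apply: le_trans (NrD _ _) _; exact: lerD.
by apply: degD; [apply: deg_le du; exact: leq_addr|apply: deg_le dw; exact: leq_addl].
Qed.

Lemma bddZ c u : bdd u -> bdd (fun N => c *: u N).
Proof.
move=> [D [B [B0 hu]]]; exists D, (`|c| * B); split; first exact: mulr_ge0.
by move=> N; have [du bu] := hu N; split; [exact: degZ|rewrite NrZ ler_wpM2l].
Qed.

Lemma bddM u w : bdd u -> bdd w -> bdd (fun N => u N * w N).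
Proof.
move=> [D [B [B0 hu]]] [D' [B' [B'0 hw]]]; exists (D + D')%N, (hc D * hc D' * (B * B')).
have hc0 n : 0 <= hc n :> R by apply: le_trans (hc_ge1 n); exact: ler01.
split; first by rewrite !mulr_ge0.
move=> N; have [du bu] := hu N; have [dw bw] := hw N; split; first exact: degM.
apply: le_trans (deg_mulN du dw) _.
by rewrite ler_wpM2l ?mulr_ge0// ler_pM ?Nr_ge0.
Qed.

Lemma bdd_one : bdd (fun N => 1).
Proof.
exists 0%N, 1; split => // N; split; first by exists 1; rewrite scale1r.
by rewrite /Nr mulr1 ga_E1 sqrtr1.
Qed.

Lemma bdd_cst c : bdd (fun N => c%:A).
Proof. exact/bddZ/bdd_one. Qed.

Lemma bdd_exp u n : bdd u -> bdd (fun N => u N ^+ n).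
Proof.
move=> hu; elim: n => [|n IH]; first exact: bdd_one.
by apply: eq_bdd (fun N => exprS _ _) _; exact: bddM.
Qed.

Lemma bdd_prod I (s : seq I) (P : pred I) (f : I -> forall N, A N) : (forall i, bdd (f i)) ->
  bdd (fun N => \prod_(i <- s | P i) f i N).
Proof.
move=> hf; elim: s => [|i s IH].
  by apply: eq_bdd (fun N => big_nil _ _ _ _) _; exact: bdd_one.
by apply: eq_bdd (fun N => big_cons _ _ _ _ _ _) _; case: (P i) => //; exact: bddM.
Qed.

Lemma bdd_horner x (q : {poly R}) : bdd x -> bdd (fun N => horner_alg (x N) q).
Proof.
move=> hx; elim/poly_ind: q => [|q c IH].
  by apply: (@eq_bdd _ (fun N => 0%:A)) => [N|]; [rewrite rmorph0 scale0r|exact: bdd_cst].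
apply: (@eq_bdd _ (fun N => horner_alg (x N) q * x N + c%:A)) => [N|].
  by rewrite rmorphD rmorphM /= horner_algX horner_algC.
by apply: bddD; [exact: bddM|exact: bdd_cst].
Qed.

Lemma small_bddM u w : small u -> bdd w -> small (fun N => w N * u N).
Proof.
move=> [[D du] u0] [D' [B' [B'0 hw]]]; split.
  by exists (D' + D)%N => N; have [dw _] := hw N; exact: degM.
have hc0 n : 0 <= hc n :> R by apply: le_trans (hc_ge1 n); exact: ler01.
apply: (@squeeze_cvgr _ _ _ _ (fun=> 0) (fun N => (hc D' * hc D * B') * Nr (u N))).
- apply: nearW => N; rewrite Nr_ge0 /=; have [dw bw] := hw N.
  apply: le_trans (deg_mulN dw (du N)) _.
  by rewrite -!mulrA !ler_wpM2l// ler_wpM2r// Nr_ge0.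
- exact: cvg_cst.
- by rewrite -[X in _ --> X](mulr0 (hc D' * hc D * B')); apply: cvgM => //; exact: cvg_cst.
Qed.

Lemma bdd_itG p q x y r : (forall N, ch p (x N)) -> (forall N, ch q (y N)) -> bdd x -> bdd y ->
  bdd (fun N => itG r (x N) (y N)).
Proof.
move=> hx hy [Dx [B [B0 bx]]] [Dy [B' [B'0 by_]]].
have [M M0 h] := itG_bounded p q r (addr_ge0 B0 B'0).
exists (q + r * p)%N, M; split => // N; split; first by apply: deg_itG; exact: ch_deg.
apply: h; [exact: ch_deg|exact: ch_deg| |].
  by apply: le_trans (proj2 (bx N)) _; rewrite lerDl.
by apply: le_trans (proj2 (by_ N)) _; rewrite lerDr.
Qed.

Lemma small_itG p q x y r : (0 < p)%N -> (q < r * p)%N ->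
  (forall N, ch p (x N)) -> (forall N, ch q (y N)) -> bdd x -> bdd y ->
  (fun N => Num.sqrt (Num.sqrt (fourth_defect (x N)))) @ \oo --> (0 : R) ->
  small (fun N => itG r (x N) (y N)).
Proof.
move=> p0 qp hx hy [Dx [B [B0 bx]]] [Dy [B' [B'0 by_]]] d0; split.
  by exists (q + r * p)%N => N; apply: deg_itG; exact: ch_deg.
have [K K0 h] := itG_vanish p0 qp (addr_ge0 B0 B'0).
apply: (@squeeze_cvgr _ _ _ _ (fun=> 0) (fun N => K * Num.sqrt (Num.sqrt (fourth_defect (x N))))).
- have hn : \forall N \near \oo, Num.sqrt (Num.sqrt (fourth_defect (x N))) <= 1.
    by move/cvgrPdist_le: d0 => /(_ 1 ltr01); apply: filterS => N; rewrite sub0r normrN ger0_norm// sqrtr_ge0.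
  near=> N; rewrite Nr_ge0 /=; apply: h => //.
  + by apply: le_trans (proj2 (bx N)) _; rewrite lerDl.
  + by apply: le_trans (proj2 (by_ N)) _; rewrite lerDr.
  + by near: N.
- exact: cvg_cst.
- by rewrite -[X in _ --> X](mulr0 K); apply: cvgM => //; exact: cvg_cst.
Unshelve. all: by end_near. Qed.

Lemma small_Gam_const p x (s : R) : (0 < p)%N -> (forall N, ch p (x N)) -> bdd x ->
  (fun N => Num.sqrt (Num.sqrt (fourth_defect (x N)))) @ \oo --> (0 : R) ->
  (fun N => ga_E (x N * x N)) @ \oo --> s ->
  small (fun N => Gam (x N) (x N) - (p%:R * s)%:A).
Proof.
move=> p0 hx [Dx [B [B0 bx]]] d0 xs; split.
  exists (p.-1 + p.-1)%N => N; apply: degB; first by apply: deg_Gam; exact: ch_deg.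
  by apply: (@deg_le _ _ 0) => //; apply: degZ; exists 1; rewrite scale1r.
have c0 : 0 <= contr_cst p p :> R by rewrite /contr_cst !mulr_ge0// exprn_ge0.
apply: (@squeeze_cvgr _ _ _ _ (fun=> 0)
  (fun N => contr_cst p p * B * Num.sqrt (Num.sqrt (fourth_defect (x N))) + p%:R * `|ga_E (x N * x N) - s|)).
- apply: nearW => N; rewrite Nr_ge0 /=.
  rewrite -(subrK (p%:R * ga_E (x N * x N))%:A (Gam _ _)) -addrA.
  apply: le_trans (NrD _ _) _; apply: lerD.
    apply: le_trans (Gam_const p0 (hx N)) _.
    by rewrite -[leRHS]mulrA [B * _]mulrC mulrA ler_wpM2l ?mulr_ge0 ?sqrtr_ge0//; exact: proj2 (bx N).
  by rewrite -scalerBl -mulrBr NrZ /Nr mulr1 ga_E1 sqrtr1 mulr1 normrM ger0_norm.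
- exact: cvg_cst.
- rewrite -[X in _ --> X](addr0 0); apply: cvgD.
    by rewrite -[X in _ --> X](mulr0 (contr_cst p p * B)); apply: cvgM => //; exact: cvg_cst.
  rewrite -[X in _ --> X](mulr0 p%:R); apply: cvgM; first exact: cvg_cst.
  rewrite -(@normr0 _ R) -(subrr s); apply: cvg_norm; apply: cvgB => //; exact: cvg_cst.
Qed.

End bounded_sequences.

Section limit_recursion.
Context {R : realType} d (T : measurableType d) (P : probability T R).
Variable A : nat -> gauss_real P.
Local Notation bdd := (@bdd R A).
Local Notation small := (@small R A).

Lemma bdd_moments (u : forall N, A N) n : bdd u ->
  exists C : R, forall N, Ex P (fun w => `|gr_ev (u N) w| ^+ n) <= C.
Proof.
move=> [D [B [B0 hu]]]; have [C C0 h] := @deg_moments R D n.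
exists (1 + (C * B ^+ (2 ^ n)) ^+ 2) => N; have [du bu] := hu N.
set v := u N ^+ (2 ^ n); have av : am P (fun w => gr_ev v w ^+ 2).
  by apply: amX; exact: gr_am.
apply: le_trans (_ : Ex P (fun w => 1 + gr_ev v w ^+ 2) <= _).
  apply: le_Ex => [||w].
  - by apply: am_itg; apply: amX; apply: am_abs; exact: gr_am.
  - by apply: am_itg; apply: amD => //; exact: am_cst.
  rewrite /v gr_ev_exp -exprM; have [z1|z1] := lerP `|gr_ev (u N) w| 1.
    by apply: le_trans (_ : 1 <= _); [exact: exprn_ile1|rewrite lerDl exprM sqr_ge0].
  apply: le_trans (_ : `|gr_ev (u N) w| ^+ (2 ^ n * 2) <= _).
    by apply: ler_weXn2l; [exact: ltW|have := ltn_expl n (isT : 1 < 2)%N; lia].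
  by rewrite -normrX ger0_norm ?lerDr// exprM sqr_ge0.
rewrite ExD; [|exact: itg_cst|exact: am_itg].
rewrite Ex_cst lerD2l gr_Nr lerXn2r ?nnegrE ?Nr_ge0 ?mulr_ge0 ?exprn_ge0//.
by apply: le_trans (h _ _ du) _; rewrite ler_wpM2l// lerXn2r ?nnegrE ?Nr_ge0.
Qed.

Variables (p q a : nat) (v s : R) (x y : forall N, A N).
Hypotheses (p0 : (0 < p)%N) (qp : (q < a.+2 * p)%N).
Hypotheses (hx : forall N, ch p (x N)) (hy : forall N, ch q (y N)) (bx : bdd x) (by_ : bdd y).
Hypothesis d0 : (fun N => Num.sqrt (Num.sqrt (fourth_defect (x N)))) @ \oo --> (0 : R).
Hypothesis xs : (fun N => ga_E (x N * x N)) @ \oo --> s.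
Implicit Types (m : multinom a.+1).

Definition monoG m N : A N := \prod_(r < a.+1) itG r.+1 (x N) (y N) ^+ m r.

Let tm (u : forall N, A N) b N := trig_moment (y N) v (u N) b.

Lemma small_trig u b : small u -> tm u b @ \oo --> (0 : R).
Proof.
move=> [_ u0]; apply: norm_cvg0.
apply: (@squeeze_cvgr _ _ _ _ (fun=> 0) (fun N => Nr (u N))) => //; last exact: cvg_cst.
by apply: nearW => N; rewrite normr_ge0 trig_moment_le.
Qed.

Lemma bdd_monoG m : bdd (monoG m).
Proof.
apply: (@bdd_prod _ A _ _ xpredT (fun (r : 'I_a.+1) N => itG r.+1 (x N) (y N) ^+ m r)) => r.
by apply: bdd_exp; exact: bdd_itG hx hy bx by_.
Qed.

Lemma monoGD m j N : monoG (mnm_add m (mnm1 j)) N = monoG m N * itG j.+1 (x N) (y N).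
Proof.
rewrite /monoG (bigD1 j)//= [X in _ = X * _](bigD1 j)//= mnmDE mnm1E eqxx addn1 exprSr mulrAC; congr (_ * _ * _).
by apply: eq_bigr => i ij; rewrite mnmDE mnm1E eq_sym (negbTE ij) addn0.
Qed.

Lemma Gam_monoG m N : Gam (x N) (monoG m N) =
  \sum_i (m i)%:R *: (monoG (mnm_sub m (mnm1 i)) N * itG i.+2 (x N) (y N)).
Proof.
rewrite /monoG Gam_prod ?index_enum_uniq//; apply: eq_bigr => i _.
rewrite Gam_exp -scalerAl; congr (_ *: _).
rewrite [X in _ = X * _](bigD1 i)//= mnmBE mnm1E eqxx subn1 mulrAC; congr (_ * _ * _).
by apply: eq_bigr => j ji; rewrite mnmBE mnm1E eq_sym (negbTE ji) subn0.
Qed.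

(** The recursion inherited by the limits of the moments: while the Hermite index falls to [0], one
    factor [Y_i] becomes [Y_{i+1}], or a factor [Y_1] appears with a phase shift. Truncated
    subtraction in [m] is harmless, as the weight [m i] is then zero. *)
Fixpoint limit_rec (base : multinom a.+1 -> R -> R) (l : nat) m (b : R) : R :=
  if l is l'.+1 then
    p%:R^-1 * (\sum_(i < a.+1 | (i.+1 < a.+1)%N)
      (m i)%:R * limit_rec base l' (mnm_add (mnm_sub m (mnm1 i)) (mnm1 (inord i.+1))) b +
    v * limit_rec base l' (mnm_add m (mnm1 ord0)) (b + pi / 2))
  else base m b.

(** Exact identity before the passage to the limit. Integration by parts yields [Gam x] of the
    Hermite factor, of the monomial and of the phase. The first is nearly cancelled by the Hermite
    recursion, and in the second the last factor produces the bracket of order [a.+2]: these are the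
    remainders on the last two lines. *)
Lemma tm_recursion l m b N :
  tm (fun N => horner_alg (x N) (hermite_var s l.+1) * monoG m N) b N =
  p%:R^-1 * (\sum_(i < a.+1 | (i.+1 < a.+1)%N) (m i)%:R *
      tm (fun N => horner_alg (x N) (hermite_var s l) *
                   monoG (mnm_add (mnm_sub m (mnm1 i)) (mnm1 (inord i.+1))) N) b N +
    v * tm (fun N => horner_alg (x N) (hermite_var s l) * monoG (mnm_add m (mnm1 ord0)) N) (b + pi / 2) N) +
  p%:R^-1 * (tm (fun N => horner_alg (x N) (hermite_var s l)^`() * monoG m N * (Gam (x N) (x N) - (p%:R * s)%:A)) b N +
    (m ord_max)%:R * tm (fun N => horner_alg (x N) (hermite_var s l) * monoG (mnm_sub m (mnm1 ord_max)) N *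
       itG a.+2 (x N) (y N)) b N).
Proof.
set h := hermite_var s l; rewrite /tm.
have pn0 : p%:R != 0 :> R by rewrite pnatr_eq0 -lt0n.
apply: (mulfI pn0); rewrite mulrDr !mulrA mulfV// !mul1r.
have -> : horner_alg (x N) (hermite_var s l.+1) * monoG m N =
    x N * (horner_alg (x N) h * monoG m N) - s *: (horner_alg (x N) h^`() * monoG m N).
  by rewrite /= rmorphB rmorphM /= horner_algX linearZ /= mulrBl mulr_algl -scalerAl mulrA.
rewrite trig_momentB mulrBr (trig_ibp _ _ _ _ (hx N)) GamMr Gam_horner Gam_monoG !trig_momentD.
have -> : Gam (x N) (y N) = itG 1 (x N) (y N) by [].
rewrite -(mulrA (horner_alg (x N) h) (monoG m N)) -(monoGD m ord0 N).
set M := \sum_i _.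
have -> : trig_moment (y N) v (horner_alg (x N) h * M) b =
    \sum_(i < a.+1 | (i.+1 < a.+1)%N) (m i)%:R * trig_moment (y N) v (horner_alg (x N) h *
      monoG (mnm_add (mnm_sub m (mnm1 i)) (mnm1 (inord i.+1))) N) b +
    (m ord_max)%:R * trig_moment (y N) v (horner_alg (x N) h *
      monoG (mnm_sub m (mnm1 ord_max)) N * itG a.+2 (x N) (y N)) b.
  rewrite /M mulr_sumr trig_moment_sum (bigID (fun i : 'I_a.+1 => (i.+1 < a.+1)%N)) /=; congr (_ + _).
    apply: eq_bigr => i ia; rewrite -scalerAr trig_momentZ; congr (_ * trig_moment _ _ _ _).
    by rewrite monoGD inordK.
  rewrite (big_pred1 ord_max) => [|i]; first by rewrite -scalerAr trig_momentZ mulrA.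
  by rewrite /pred1 /= -(inj_eq val_inj) /=; have := ltn_ord i; clear; lia.
set G := Gam (x N) (x N); clearbody G.
rewrite (mulrAC _ G) [in RHS]mulrBr [in RHS]trig_momentB.
rewrite -[in RHS]scalerAr mulr1 [in RHS]trig_momentZ trig_momentZ.
ring.
Qed.

(* The remainder terms of [tm_recursion] vanish: [Gam x x] is asymptotically constant, and the
   bracket of order [a.+2] would have negative chaos degree. *)
Lemma trig_moment_limit (base : multinom a.+1 -> R -> R) :
  (forall m b, tm (monoG m) b @ \oo --> base m b) ->
  forall l m b, tm (fun N => horner_alg (x N) (hermite_var s l) * monoG m N) b @ \oo --> limit_rec base l m b.
Proof.
move=> hb; elim=> [|l IH] m b.
  by have -> : tm (fun N => horner_alg (x N) (hermite_var s 0) * monoG m N) b = tm (monoG m) b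
    by apply: funext => N; rewrite /tm /= rmorph1 mul1r.
rewrite (funext (tm_recursion l m b)) /= -[X in _ --> X]addr0; apply: cvgD.
  apply: cvgM; first exact: cvg_cst.
  apply: cvgD; last by apply: cvgM; [exact: cvg_cst|exact: IH].
  rewrite [X in _ --> X]big_mkcond; under eq_fun do rewrite big_mkcond.
  apply: cvgr_sum => i; case: ifP => _; last exact: cvg_cst.
  by apply: cvgM; [exact: cvg_cst|exact: IH].
rewrite -[X in _ --> X](mulr0 p%:R^-1); apply: cvgM; first exact: cvg_cst.
rewrite -[X in _ --> X](addr0 0); apply: cvgD.
  apply: small_trig; apply: small_bddM; first exact: small_Gam_const hx bx d0 xs.
  by apply: bddM; [exact: bdd_horner|exact: bdd_monoG].
rewrite -[X in _ --> X](mulr0 (m ord_max)%:R); apply: cvgM; first exact: cvg_cst.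
apply: small_trig; apply: small_bddM; first exact: (@small_itG R A p q x y a.+2 p0 qp hx hy bx by_ d0).
by apply: bddM; [exact: bdd_horner|exact: bdd_monoG].
Qed.

End limit_recursion.

(** * The coefficients of the series *)

Section monomial_extension.
Variables (K : comNzRingType) (n : nat).
Implicit Types (c : multinom n -> K) (p : mpoly n K).

Lemma mcoeffMX0 (i : 'I_n) (p : mpoly n K) (m : multinom n) : m i = 0%N -> mcoeff m (p * mpolyX K (mnm1 i)) = 0.
Proof.
move=> mi; rewrite [p]mpolyE mulr_suml raddf_sum /= big1// => k _.
rewrite -scalerAl mcoeffZ -mpolyXD mcoeffX; case: eqP => [e|]; last by rewrite mulr0.
by move: mi; rewrite -e mnmDE mnm1E eqxx addn1.
Qed.

(** The linear functional with prescribed values on monomials; it converts a recursion over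
    multi-indices into iterates of one operator. *)
Definition mono_ext c p : K := \sum_(m <- msupp p) mcoeff m p * c m.

Lemma mono_ext_sup c p s : uniq s -> {subset msupp p <= s} -> mono_ext c p = \sum_(m <- s) mcoeff m p * c m.
Proof.
move=> us ss; rewrite (bigID (fun m => m \in msupp p))/= [X in _ + X]big1 ?addr0 => [|m]; last first.
  by move/memN_msupp_eq0 ->; rewrite mul0r.
rewrite -big_filter; apply: perm_big; apply: uniq_perm; rewrite ?filter_uniq ?msupp_uniq// => m.
by rewrite mem_filter; case: (boolP (m \in msupp p)) => // /ss ->.
Qed.

Lemma mono_extD c p q : mono_ext c (p + q) = mono_ext c p + mono_ext c q.
Proof.
pose s := undup (msupp p ++ msupp q ++ msupp (p + q)).
rewrite !(@mono_ext_sup c _ s) ?undup_uniq// -?big_split /=; last 3 first.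
- by move=> m hm; rewrite mem_undup !mem_cat hm ?orbT.
- by move=> m hm; rewrite mem_undup !mem_cat hm ?orbT.
- by move=> m hm; rewrite mem_undup !mem_cat hm ?orbT.
by apply: eq_bigr => m _; rewrite mcoeffD mulrDl.
Qed.

Lemma mono_extZ c k p : mono_ext c (k *: p) = k * mono_ext c p.
Proof.
rewrite (@mono_ext_sup c _ (msupp p)) ?msupp_uniq//; last exact: msuppZ_le.
by rewrite mulr_sumr; apply: eq_bigr => m _; rewrite mcoeffZ mulrA.
Qed.

Lemma mono_extX c m : mono_ext c (mpolyX K m) = c m.
Proof. by rewrite /mono_ext msuppX big_seq1 mcoeffX eqxx mul1r. Qed.

Lemma mono_ext0 c : mono_ext c 0 = 0.
Proof. by rewrite /mono_ext msupp0 big_nil. Qed.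

Lemma mono_ext_sum c I (s : seq I) (Q : pred I) (f : I -> mpoly n K) :
  mono_ext c (\sum_(i <- s | Q i) f i) = \sum_(i <- s | Q i) mono_ext c (f i).
Proof. by apply: (big_morph (mono_ext c)); [exact: mono_extD|exact: mono_ext0]. Qed.

End monomial_extension.

Section transfer.
Variables (K : comNzRingType) (a : nat) (alpha beta : K).
Implicit Types (c : multinom a.+1 -> K) (p : mpoly a.+1 K).

(** Step of the recursion for [A_{l,m}] on generating polynomials: multiplication by the first
    variable, and replacement of one variable by the next through a derivation. By
    [mono_ext_transfer] its transpose is the step of the moment recursion. *)
Definition transfer p : mpoly a.+1 K :=
  alpha *: (p * mpolyX K (mnm1 ord0)) +
  beta *: \sum_(i < a.+1 | (i.+1 < a.+1)%N) mderiv i p * mpolyX K (mnm1 (inord i.+1)).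

Lemma transferD p q : transfer (p + q) = transfer p + transfer q.
Proof.
rewrite /transfer mulrDl scalerDr; under eq_bigr do rewrite mderivD mulrDl.
by rewrite big_split /= scalerDr addrACA.
Qed.

Lemma transferZ k p : transfer (k *: p) = k *: transfer p.
Proof.
rewrite /transfer -scalerAl scalerDr !scalerA mulrC; congr (_ + _).
rewrite [k * beta]mulrC -[RHS]scalerA (scaler_sumr k); congr (_ *: _); apply: eq_bigr => i _.
by rewrite mderivZ -scalerAl.
Qed.

Lemma mono_ext_transfer c c' p :
  (forall m, c' m = alpha * c (mnm_add m (mnm1 ord0)) +
    beta * \sum_(i < a.+1 | (i.+1 < a.+1)%N) (m i)%:R * c (mnm_add (mnm_sub m (mnm1 i)) (mnm1 (inord i.+1)))) ->
  mono_ext c' p = mono_ext c (transfer p).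
Proof.
move=> hc; elim/mpolyind: p => [|k m p _ _ IH].
  have -> : transfer 0 = 0 by rewrite -[X in transfer X](scale0r (0 : mpoly a.+1 K)) transferZ scale0r.
  by rewrite !mono_ext0.
rewrite transferD transferZ (mono_extD c') (mono_extD c) !mono_extZ mono_extX IH hc; congr (_ * _ + _).
rewrite /transfer mono_extD !mono_extZ mono_ext_sum -mpolyXD mono_extX; congr (_ + _ * _).
by apply: eq_bigr => i _; rewrite mderivX -scalerAl mono_extZ -mpolyXD mono_extX.
Qed.

Lemma mono_ext_iter (b : nat -> multinom a.+1 -> K) :
  (forall l m, b l.+1 m = alpha * b l (mnm_add m (mnm1 ord0)) +
    beta * \sum_(i < a.+1 | (i.+1 < a.+1)%N) (m i)%:R * b l (mnm_add (mnm_sub m (mnm1 i)) (mnm1 (inord i.+1)))) ->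
  forall l, b l mnm0 = mono_ext (b 0%N) (iter l transfer 1).
Proof.
move=> hb l; rewrite -[LHS](mono_extX (b l)) mpolyX0.
elim: l 1 => [|l IH] p //; rewrite (mono_ext_transfer (c := b l)) ?IH ?iterSr//.
Qed.

End transfer.

Section coefficients.
Context {R : realType} (a p : nat) (v : R).
Local Notation alpha := (- (v / p%:R)%:C%C : R[i]).
Local Notation beta := ('i%C / p%:R : R[i]).
Local Notation cA := (@coefA R a.+1 p v).

Definition intm (m : multinom a.+1) : {ffun 'I_a.+1 -> int} := [ffun r => (m r)%:Z].

Lemma coefA_neg l (m : {ffun 'I_a.+1 -> int}) r : m r < 0 -> cA l m = 0.
Proof. by move=> mr; have h : [exists r, m r < 0] by [apply/existsP; exists r]; case: l => [|l]; rewrite /= h. Qed.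

Lemma coefA_large l (m : {ffun 'I_a.+1 -> int}) : l%:Z < \sum_r m r -> cA l m = 0.
Proof. by move=> h; case: l h => [|l] h; rewrite /= h orbT. Qed.

Lemma sum_unit_index (s : 'I_a.+1) : \sum_(r : 'I_a.+1) unit_index a.+1 s.+1 r = 1.
Proof.
rewrite (bigD1 s)//= ffunE eqxx big1 ?addr0// => r rs; rewrite ffunE eqSS.
by rewrite (inj_eq val_inj) (negbTE rs).
Qed.

(** The guard in [coefA] can be ignored: when the sum of [m] exceeds [l.+1], every term on the right
    vanishes too, its index having a sum larger than [l]. *)
Lemma coefAS l (m : multinom a.+1) : cA l.+1 (intm m) =
  alpha * cA l (intm m - unit_index a.+1 1) +
  beta * \sum_(s < a.+1 | (s.+1 < a.+1)%N) (intm m s + 1)%:~R *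
    cA l (intm m + unit_index a.+1 s.+1 - unit_index a.+1 s.+2).
Proof.
rewrite [LHS]/=; case: ifP => // /orP[/existsP[r]|hl]; first by rewrite ffunE.
have hs (f : {ffun 'I_a.+1 -> int}) (g h : {ffun 'I_a.+1 -> int}) : \sum_r (f + g - h) r = \sum_r f r + \sum_r g r - \sum_r h r.
  by rewrite -big_split -sumrB; apply: eq_bigr => r _; rewrite !ffunE.
rewrite coefA_large; last first.
  have := hs (intm m) 0 (unit_index a.+1 1); rewrite addr0 => ->.
  rewrite (sum_unit_index ord0) [X in _ + X - _]big1 => [|r _]; last by rewrite ffunE.
  by move: hl; set S := \sum_r _; clear; lia.
rewrite mulr0 add0r big1 ?mulr0// => s sa; rewrite coefA_large ?mulr0// hs sum_unit_index.
have -> : (s.+2 = (inord s.+1 : 'I_a.+1).+1)%N by rewrite inordK.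
rewrite sum_unit_index.
by move: hl; set S := \sum_r _; clear; lia.
Qed.

Lemma mcoeff_transfer l m : mcoeff m (iter l (transfer alpha beta) (1 : mpoly a.+1 R[i])) = cA l (intm m).
Proof.
elim: l m => [|l IH] m.
  rewrite mcoeff1 /=; case: (m =P mnm0) => [->|mn].
    rewrite ifF//; apply/negP => /orP[/existsP[r]|]; first by rewrite ffunE mnm0E.
    by rewrite big1// => r _; rewrite ffunE mnm0E.
  rewrite ifT//; apply/orP; right; rewrite lt_def sumr_ge0 => [|r _]; last by rewrite ffunE.
  rewrite andbT; apply/negP => /eqP h; apply: mn; apply/mnmP => r; rewrite mnm0E.
  move/eqP: h; rewrite psumr_eq0 => [|i _]; last by rewrite ffunE.
  by move/allP => /(_ r (mem_index_enum r)); rewrite ffunE => /eqP [].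
rewrite coefAS iterS; set p0 := iter l _ _ in IH *.
rewrite /transfer mcoeffD !mcoeffZ raddf_sum /=; congr (_ * _ + _ * _).
  (* At a zero component, integer subtraction makes the index negative and [coefA] vanishes, as does
     the coefficient in a multiple of that variable. *)
  have [m0|m0] := posnP (m ord0).
    by rewrite mcoeffMX0// (@coefA_neg _ _ ord0)// !ffunE m0.
  have e : m = mnm_add (mnm1 ord0) (mnm_sub m (mnm1 ord0)).
    by apply/mnmP => r; rewrite mnmDE mnmBE mnm1E; case: eqP => [<-|_] //=; rewrite ?subn0// subnKC.
  rewrite [in LHS]e mcoeffMX IH; congr (coefA _ _ _ _); apply/ffunP => r.
  rewrite !ffunE mnmBE mnm1E eqSS; case: (eqVneq ord0 r) => [<-|r0]; first by rewrite eqxx /= -subzn.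
  by rewrite -[r == 0%N :> nat]/(r == ord0) eq_sym (negbTE r0) subn0 subr0.
apply: eq_bigr => i ia; set j : 'I_a.+1 := inord i.+1.
have ji : j = i.+1 :> nat by rewrite inordK.
have jin : j != i by rewrite -(inj_eq val_inj) /= ji; clear; lia.
have [m0|m0] := posnP (m j).
  rewrite mcoeffMX0// (@coefA_neg _ _ j) ?mulr0// !ffunE m0 ji eqxx.
  by rewrite (_ : (i.+2 == i.+1) = false) // ; apply/negP; clear; lia.
have e : m = mnm_add (mnm1 j) (mnm_sub m (mnm1 j)).
  by apply/mnmP => r; rewrite mnmDE mnmBE mnm1E; case: eqP => [<-|_] //=; rewrite ?subn0// subnKC.
rewrite [in LHS]e mcoeffMX mcoeff_deriv mnmBE mnm1E (negbTE jin) subn0 IH -mulr_natl ffunE.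
have -> : ((m i)%:Z + 1)%:~R = (m i).+1%:R :> R[i] by rewrite (_ : (m i)%:Z + 1 = (m i).+1%:Z)// -[in RHS]addn1 PoszD.
congr (_ * _); congr (coefA _ _ _ _); apply/ffunP => r; rewrite !ffunE mnmDE mnmBE !mnm1E PoszD.
rewrite !eqSS -ji -[(r == i :> nat)]/(r == i) -[(r == j :> nat)]/(r == j) (eq_sym j r) (eq_sym i r).
case: (eqVneq r j) => [->|rj]; last by rewrite subn0 subr0.
by rewrite (negbTE jin) /= !addr0 subzn.
Qed.

Definition bounded_multinom l (f : {ffun 'I_a.+1 -> 'I_l.+1}) : multinom a.+1 := Multinom [tuple (f r : nat) | r < a.+1].

(** Exponents with sum at most [l] exhaust the support of the [l]-th iterate. *)
Lemma sum_coefA l (c : multinom a.+1 -> R[i]) :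
  \sum_(m : {ffun 'I_a.+1 -> 'I_l.+1} | (\sum_r m r <= l)%N) cA l [ffun r => (m r : nat)%:Z] * c (bounded_multinom m) =
  mono_ext c (iter l (transfer alpha beta) 1).
Proof.
pose s := [seq bounded_multinom m | m : {ffun 'I_a.+1 -> 'I_l.+1} <- enum {: {ffun 'I_a.+1 -> 'I_l.+1}} & (\sum_(r : 'I_a.+1) m r <= l)%N].
have bE (f : {ffun 'I_a.+1 -> 'I_l.+1}) r : bounded_multinom f r = f r :> nat by rewrite mnmE.
rewrite (@mono_ext_sup _ _ c _ s).
- rewrite /s big_map big_filter big_enum_cond; apply: eq_bigr => f _.
  rewrite mcoeff_transfer; congr (coefA _ _ _ _ * _); apply/ffunP => r; by rewrite !ffunE bE.
- rewrite map_inj_uniq => [|f g /mnmP fg]; first by apply: filter_uniq; exact: enum_uniq.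
  apply/ffunP => r.
  by apply: val_inj; have := fg r; rewrite !bE.
- move=> m; rewrite mcoeff_msupp mcoeff_transfer => hm.
  have ml : (\sum_r m r <= l)%N.
    rewrite leqNgt; apply: contra hm => hl; rewrite coefA_large//.
    under eq_bigr do rewrite ffunE.
    by rewrite -(big_morph Posz PoszD erefl) ltz_nat.
  have mr r : (m r < l.+1)%N.
    by rewrite ltnS; apply: leq_trans ml; rewrite (bigD1 r)//= leq_addr.
  apply/mapP; exists [ffun r => Ordinal (mr r)].
    by rewrite mem_filter mem_enum andbT; under eq_bigr do rewrite ffunE.
  by apply/mnmP => r; rewrite bE ffunE.
Qed.

End coefficients.

Section limit_term.
Context {R : realType} d (T : measurableType d) (P : probability T R) (a p : nat).
Variables (Y : T -> R) (Yr : 'I_a.+1 -> T -> R) (u v : R).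

Definition base_moment (m : multinom a.+1) (b : R) : R :=
  Ex P (fun w => (\prod_r Yr r w ^+ m r) * cos (v * Y w + b)).

Hypotheses (aY : am P Y) (aYr : forall r, am P (Yr r)).

Let it_base m b : itg P (fun w => (\prod_r Yr r w ^+ m r) * cos (v * Y w + b)).
Proof.
apply: am_itg; apply: amM; last exact: am_trig.
by apply: am_prod => r; exact: amX.
Qed.

Local Notation c_ := (@limit_rec R p a v base_moment).

Lemma limit_rec_antiperiodic l m b : c_ l m (b + pi / 2 + pi / 2) = - c_ l m b.
Proof.
elim: l m b => [|l IH] m b /=.
  rewrite /base_moment -ExN; last exact: it_base.
  by apply: eq_Ex => w; rewrite !addrA cosDpihalf sinDpihalf mulrN.
rewrite -mulrN opprD -mulrN -IH; congr (_ * (_ + _)).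
by rewrite -sumrN; apply: eq_bigr => i _; rewrite IH mulrN.
Qed.

(** The combination [C] of the phases [0] and [pi / 2] reassembles the complex moment, and by
    antiperiodicity a phase shift multiplies it by the imaginary unit. With the factor ['i%C ^+ l]
    the recursion acquires exactly the coefficients [- v / p] and ['i%C / p] of [transfer]. *)
Lemma limit_cf_termE l : limit_cf_term P p Y Yr u v l =
  (u ^+ l / l`!%:R)%:C%C * ('i%C ^+ l * ((c_ l mnm0 0)%:C%C - 'i%C * (c_ l mnm0 (pi / 2))%:C%C)).
Proof.
pose C l m : R[i] := (c_ l m 0)%:C%C - 'i%C * (c_ l m (pi / 2))%:C%C.
pose b l m := 'i%C ^+ l * C l m.
have i2 : 'i%C * 'i%C = -1 :> R[i] by rewrite -expr2 sqr_i.
rewrite /limit_cf_term; congr (_ * _).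
rewrite -[RHS]/(b l mnm0) (@mono_ext_iter _ _ (- (v / p%:R)%:C%C) ('i%C / p%:R) b).
  rewrite -sum_coefA; apply: eq_bigr => m _; congr (_ * _).
  rewrite /b expr0 mul1r /C /cexpectation !fine_expectation /= /base_moment.
  set F := (X in (Ex P X)%:C%C - _); set G := (X in _ - _ * (Ex P X)%:C%C).
  have IE : (fun w => complex.Im ((\prod_r Yr r w ^+ m r)%:C%C * expi (v * Y w))) = (fun w => - G w).
    apply: funext => w; rewrite /G /= mul0r addr0 cosDpihalf mulrN opprK; congr (_ * _).
    by apply: eq_bigr => r _; rewrite mnmE.
  rewrite IE ExN; last exact: it_base.
  have -> : F = (fun w => complex.Re ((\prod_r Yr r w ^+ m r)%:C%C * expi (v * Y w))).
    apply: funext => w; rewrite /F /= mul0r subr0 addr0; congr (_ * _).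
    by apply: eq_bigr => r _; rewrite mnmE.
  by simpc.
move=> {}l m; have anti m' := limit_rec_antiperiodic l m' 0; rewrite add0r in anti.
rewrite /b /C /= add0r anti exprS -mulrA; under [in RHS]eq_bigr do rewrite mulrCA mulrBr (mulrCA _ 'i%C).
rewrite -mulr_sumr sumrB -mulr_sumr !(rmorphM, rmorphD, rmorphN, rmorph_sum, fmorphV) /=.
rewrite !rmorph_nat.
set S0 := \sum_(i < a.+1 | _) _; set S1 := \sum_(i < a.+1 | _) _.
have -> : S0 = \sum_(i < a.+1 | (i.+1 < a.+1)%N)
     (m i)%:R * (c_ l (mnm_add (mnm_sub m (mnm1 i)) (mnm1 (inord i.+1))) 0)%:C%C.
  by apply: eq_bigr => i _; rewrite rmorphM rmorph_nat.
have -> : S1 = \sum_(i < a.+1 | (i.+1 < a.+1)%N)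
     (m i)%:R * (c_ l (mnm_add (mnm_sub m (mnm1 i)) (mnm1 (inord i.+1))) (pi / 2))%:C%C.
  by apply: eq_bigr => i _; rewrite rmorphM rmorph_nat.
ring: i2.
Qed.

End limit_term.

(** * Hermite expansion of a Gaussian character *)

Lemma deriv_hermite_var (R : comNzRingType) (s : R) n :
  (hermite_var s n.+1)^`() = n.+1%:R *: hermite_var s n.
Proof.
elim: n => [|n IH]; first by rewrite /= derivC scaler0 subr0 mulr1 derivX scale1r.
have e1 : hermite_var s n.+1 = 'X * hermite_var s n - s *: (hermite_var s n)^`() by [].
have e2 : hermite_var s n.+2 = 'X * hermite_var s n.+1 - s *: (hermite_var s n.+1)^`() by [].
rewrite e2 derivB derivM derivX mul1r derivZ IH derivZ -addrA.
rewrite -[n.+2%:R]natr1 scalerDl scale1r addrC; congr (_ + _).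
by rewrite e1 scalerBr -scalerAr !scalerA [s * _]mulrC.
Qed.

Section polynomial_growth.
Context {R : realType}.

Lemma pgrowM (f g : R -> R) : pgrow f -> pgrow g -> pgrow (fun x => f x * g x).
Proof.
move=> [C [m hf]] [C' [m' hg]]; exists (C * C'), (m + m')%N => x.
by rewrite normrM exprD mulrACA ler_pM.
Qed.

Lemma pgrowD (f g : R -> R) : pgrow f -> pgrow g -> pgrow (fun x => f x + g x).
Proof.
move=> hf hg; have := @pgrow_sum R bool [:: true; false] (fun=> 1) (fun b => if b then f else g).
under eq_fun do rewrite !big_cons big_nil addr0 !mul1r.
by apply; case.
Qed.

Lemma pgrow_horner (q : {poly R}) : pgrow (horner q).
Proof.
elim/poly.poly_ind: q => [|q c IH]; first by exists 0, 0%N => x; rewrite horner0 normr0 mul0r.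
rewrite (_ : horner _ = (fun x => q.[x] * x + c)); last by apply: funext => x; rewrite hornerD hornerM hornerX hornerC.
apply: pgrowD; last exact: (@pgrow_bounded _ _ `|c|) (fun x => lexx _).
by apply: pgrowM => //; exists 1, 1%N => x; rewrite mul1r expr1 lerDr.
Qed.

End polynomial_growth.

Section gaussian_hermite.
Context {R : realType} d (T : measurableType d) (P : probability T R).
Variables (Z : T -> R) (s : R).
Hypotheses (mZ : measurable_fun setT Z) (gZ : has_centered_gaussian_law P Z s).
Local Notation H := (hermite_var (s ^+ 2)).

Lemma am_horner (q : {poly R}) : am P (fun w => q.[Z w]).
Proof.
elim/poly.poly_ind: q => [|q c IH]; first by under eq_fun do rewrite horner0; exact: am_cst.
under eq_fun do rewrite hornerD hornerM hornerX hornerC.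
by apply: amD; [apply: amM => //; exact: am_gaussian mZ gZ|exact: am_cst].
Qed.

(** Raising the Hermite index is adjoint to differentiation: in Stein's identity for [H l] times
    [g], the term with the derivative of [H l] is the one subtracted in [hermite_var]. *)
Lemma hermite_stein l (g g' : R -> R) : (forall x : R, is_derive x 1 g (g' x)) -> continuous g' ->
  pgrow g -> pgrow g' -> am P (fun w => g (Z w)) -> am P (fun w => g' (Z w)) ->
  Ex P (fun w => (H l.+1).[Z w] * g (Z w)) = s ^+ 2 * Ex P (fun w => (H l).[Z w] * g' (Z w)).
Proof.
move=> dg cg' pg pg' ag ag'; set h := H l.
have dh (x : R) : is_derive x 1 (fun x => h.[x] * g x) (h.[x] * g' x + h^`().[x] * g x).
  by apply: is_deriveMf (dg x); exact: is_derive_poly.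
have ch : continuous (fun x : R => h.[x] * g' x + h^`().[x] * g x).
  move=> x; apply: cvgD; apply: cvgM; [exact: continuous_horner|exact: cg'|exact: continuous_horner|].
  exact: is_derive_cont dg x.
have ph : pgrow (fun x => h.[x] * g' x + h^`().[x] * g x).
  by apply: pgrowD; apply: pgrowM => //; exact: pgrow_horner.
have := gaussian_stein mZ gZ dh ch (pgrowM (pgrow_horner h) pg) ph.
rewrite ExD; [|by apply: am_itg; apply: amM => //; exact: am_horner|by apply: am_itg; apply: amM => //; exact: am_horner].
rewrite mulrDr => e.
rewrite [LHS](_ : _ = Ex P (fun w => Z w * (h.[Z w] * g (Z w)) - s ^+ 2 * (h^`().[Z w] * g (Z w)))).
  rewrite ExB ?ExZ ?e ?addrK//; apply: am_itg; rewrite -?[fun=> s ^+ 2 * _]/(_).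
  - by apply: amM => //; exact: am_horner.
  - by apply: amM; [exact: am_gaussian mZ gZ|apply: amM => //; exact: am_horner].
  - by apply: amZ; apply: amM => //; exact: am_horner.
apply: eq_Ex => w; rewrite /= hornerD hornerN hornerZ hornerM hornerX; ring.
Qed.

Lemma am_cosZ u b : am P (fun w => cos (u * Z w + b)).
Proof. by apply: (@am_trig R d T P Z 0); exact: am_gaussian mZ gZ. Qed.

Lemma hermite_cos l u b : Ex P (fun w => (H l).[Z w] * cos (u * Z w + b)) =
  (s ^+ 2 * u) ^+ l * (cos (b + l%:R * (pi / 2)) * expR (- (s ^+ 2 * u ^+ 2 / 2))).
Proof.
elim: l b => [|l IH] b.
  rewrite (_ : (fun w => _) = (fun w => cos (u * Z w + b))); last by apply: funext => w; rewrite /= hornerC mul1r.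
  by rewrite (gaussian_cos mZ gZ) expr0 mul1r mul0r addr0.
have dlin (x : R) : is_derive x 1 (fun y => u * y + b) u.
  by apply: is_derive_eq; rewrite /GRing.scale/= mulr1 addr0.
have cg : continuous (fun x => u * cos (u * x + (b + pi / 2))).
  move=> x; apply: cvgM; first exact: cvg_cst.
  apply: (@continuous_comp _ _ _ (fun y => u * y + (b + pi / 2)) cos); last exact: continuous_cos.
  by apply: cvgD; [apply: cvgM; [exact: cvg_cst|exact: cvg_id]|exact: cvg_cst].
have dg (x : R) : is_derive x 1 (fun x => cos (u * x + b)) (u * cos (u * x + (b + pi / 2))).
  rewrite cos_shift mulrC.
  by apply: (is_derive_compf (is_derive_cos _)); exact: dlin.
have b1 : pgrow (fun x => cos (u * x + b)) by apply: (@pgrow_bounded _ _ 1) => x; exact: cos_max.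
have b2 : pgrow (fun x => u * cos (u * x + (b + pi / 2))).
  by apply: (@pgrow_bounded _ _ `|u|) => x; rewrite normrM ler_piMr// cos_max.
rewrite (@hermite_stein l _ _ dg cg b1 b2 (am_cosZ _ _) (amZ u (am_cosZ _ _))).
rewrite (_ : (fun w => _) = (fun w => u * ((H l).[Z w] * cos (u * Z w + (b + pi / 2))))); last first.
  by apply: funext => w; ring.
rewrite ExZ ?IH; last by apply: am_itg; apply: amM; [exact: am_horner|exact: am_cosZ].
have -> : b + l.+1%:R * (pi / 2) = b + pi / 2 + l%:R * (pi / 2) by rewrite -natr1; ring.
by set c := cos _; set e := expR _; rewrite [in RHS]exprS; ring.
Qed.

Lemma hermite_orthogonal l k : Ex P (fun w => (H l).[Z w] * (H k).[Z w]) =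
  if l == k then s ^+ (2 * l) * l`!%:R else 0.
Proof.
have st l' k' : Ex P (fun w => (H l'.+1).[Z w] * (H k').[Z w]) =
    s ^+ 2 * Ex P (fun w => (H l').[Z w] * (H k')^`().[Z w]).
  apply: (@hermite_stein l' (horner (H k')) (horner (H k')^`())).
  - by move=> x; exact: continuous_horner.
  - exact: pgrow_horner.
  - exact: pgrow_horner.
  - exact: am_horner.
  - exact: am_horner.
have z l' : Ex P (fun w => (H l'.+1).[Z w] * (H 0).[Z w]) = 0.
  rewrite st (_ : (fun w => _) = (fun=> 0)) ?Ex_cst ?mulr0//.
  by apply: funext => w; rewrite /= derivC horner0 mulr0.
elim: l k => [|l IH] [|k] //.
- rewrite (_ : (fun w => _) = (fun=> 1)); last by apply: funext => w; rewrite /= hornerC mul1r.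
  by rewrite Ex_cst mul1r fact0.
- by rewrite (_ : (fun w => _) = (fun w => (H k.+1).[Z w] * (H 0).[Z w])) ?z//; apply: funext => w; exact: mulrC.
- rewrite st deriv_hermite_var (_ : (fun w => _) = (fun w => k.+1%:R * ((H l).[Z w] * (H k).[Z w]))); last by apply: funext => w; rewrite hornerZ mulrCA.
  rewrite ExZ ?IH ?eqSS; last by apply: am_itg; apply: amM; exact: am_horner.
  case: eqP => [->|_]; last by rewrite !mulr0.
  by rewrite factS natrM mulnS exprD; ring.
Qed.

(** Coefficient of the [l]-th Hermite polynomial in [expR (s ^+ 2 * u ^+ 2 / 2) * cos (u * Z + b)];
    the phase [l * (pi / 2)] stands for the [l]-th power of the imaginary unit. *)
Definition cos_coef (u b : R) (l : nat) : R := u ^+ l / l`!%:R * cos (b + l%:R * (pi / 2)).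

Lemma cos_half_turns (b : R) (l : nat) : cos (b + l%:R * (pi / 2)) ^+ 2 = (1 + (-1) ^+ l * cos (2 * b)) / 2.
Proof.
elim: l b => [|l IH] b.
  by rewrite mul0r addr0 mul1r mulr_natl cos_mulr2n mulr2n; lra.
rewrite -[l.+1%:R]natr1 mulrDl mul1r [_ + pi / 2]addrC addrA IH exprS.
have -> : 2 * (b + pi / 2) = 2 * b + pi :> R by lra.
by rewrite cosDpi; ring.
Qed.

Let am_partial_sum u b n : am P (fun w => \sum_(l < n) cos_coef u b l * (H l).[Z w]).
Proof. by apply: am_sum => l; apply: amZ; exact: am_horner. Qed.

(** Pythagoras with exact values: each step removes the squared norm of one Hermite component, which
    [cos_half_turns] splits into terms of the exponential series at [s ^+ 2 * u ^+ 2] and at its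
    opposite. The error is thus made of tails of these series. *)
Lemma hermite_cos_error u b n :
  Ex P (fun w => (expR (s ^+ 2 * u ^+ 2 / 2) * cos (u * Z w + b) - \sum_(l < n) cos_coef u b l * (H l).[Z w]) ^+ 2) =
  (expR (s ^+ 2 * u ^+ 2) + expR (- (s ^+ 2 * u ^+ 2)) * cos (2 * b)) / 2 -
  (series (exp_coeff (s ^+ 2 * u ^+ 2)) n + series (exp_coeff (- (s ^+ 2 * u ^+ 2))) n * cos (2 * b)) / 2.
Proof.
set x := s ^+ 2 * u ^+ 2.
have aC : am P (fun w => expR (x / 2) * cos (u * Z w + b)) by apply: amZ; exact: am_cosZ.
elim: n => [|n IH].
  rewrite !seriesEnat /= !big_geq// mul0r addr0 mul0r subr0.
  rewrite (_ : (fun w => _) = (fun w => expR x / 2 * (1 + cos (2 * u * Z w + 2 * b)))); last first.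
    apply: funext => w; rewrite big_ord0 subr0 exprMn.
    have := cos_half_turns (u * Z w + b) 0; rewrite mul0r addr0 mul1r mulrDr mulrA => ->.
    have -> : expR (x / 2) ^+ 2 = expR x by rewrite -expRM_natl; congr expR; field.
    by ring.
  rewrite ExZ ?ExD ?Ex_cst; last 3 first.
  - exact: itg_cst.
  - by apply: am_itg; exact: am_cosZ.
  - by apply: itgD; [exact: itg_cst|apply: am_itg; exact: am_cosZ].
  rewrite (gaussian_cos mZ gZ) (_ : s ^+ 2 * (2 * u) ^+ 2 / 2 = x + x); last by rewrite /x; field.
  rewrite opprD expRD (mulrDr (expR x / 2)) mulr1.
  have e1 : expR x * expR (- x) = 1 by rewrite -expRD subrr expR0.
  have -> : expR x / 2 * (cos (2 * b) * (expR (- x) * expR (- x))) =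
    (expR x * expR (- x)) * (expR (- x) * cos (2 * b)) / 2 by ring.
  by rewrite e1; ring.
have -> : (fun w => (expR (x / 2) * cos (u * Z w + b) - \sum_(l < n.+1) cos_coef u b l * (H l).[Z w]) ^+ 2) =
  (fun w => (expR (x / 2) * cos (u * Z w + b) - \sum_(l < n) cos_coef u b l * (H l).[Z w]) ^+ 2 +
   (- (2 * cos_coef u b n) * (expR (x / 2) * ((H n).[Z w] * cos (u * Z w + b)) -
       \sum_(l < n) cos_coef u b l * ((H n).[Z w] * (H l).[Z w])) +
   cos_coef u b n ^+ 2 * ((H n).[Z w] * (H n).[Z w]))).
  apply: funext => w; rewrite big_ord_recr /=.
  under [X in _ = _ + (_ * (_ - X) + _)]eq_bigr do rewrite mulrCA.
  by rewrite -mulr_sumr; ring.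
have aH l := am_horner (H l).
have aHC : am P (fun w => (H n).[Z w] * cos (u * Z w + b)) by apply: amM => //; exact: am_cosZ.
have aHH l : am P (fun w => (H n).[Z w] * (H l).[Z w]) by exact: amM.
have aHS : am P (fun w => \sum_(l < n) cos_coef u b l * ((H n).[Z w] * (H l).[Z w])).
  by apply: am_sum => l; apply: amZ.
rewrite ExD; [|by apply: am_itg; apply: amX; apply: amB|by apply: am_itg; apply: amD; apply: amZ => //; apply: amB => //; exact: amZ].
rewrite IH ExD; [|by apply: am_itg; apply: amZ; apply: amB => //; exact: amZ|by apply: am_itg; exact: amZ].
rewrite !ExZ ?ExB ?ExZ; try by apply: am_itg; first [exact: aHH|exact: aHC|exact: aHS|exact: amZ|
  by apply: amB => //; exact: amZ].
rewrite hermite_cos hermite_orthogonal eqxx Ex_sum => [|l]; last by apply: am_itg; exact: amZ.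
rewrite [X in _ * (_ - X)]big1 => [|l _]; last first.
  by rewrite ExZ ?hermite_orthogonal ?gtn_eqF ?mulr0//; exact: am_itg.
rewrite subr0 -/x !seriesSr /exp_coeff /=.
have kE := cos_half_turns b n; rewrite /cos_coef; set k := cos (b + _) in kE *.
have xE : x ^+ n = s ^+ (2 * n) * u ^+ n * u ^+ n by rewrite /x exprMn -!exprM -mulrA -exprD addnn mul2n.
rewrite exprMn -exprM [in (- x) ^+ n]exprNn xE.
have e1 : expR (x / 2) * expR (- (x / 2)) = 1 by rewrite -expRD subrr expR0.
have kc : (-1) ^+ n * cos (2 * b) = 2 * k ^+ 2 - 1 by rewrite kE; lra.
have fn0 : n`!%:R != 0 :> R by rewrite pnatr_eq0 -lt0n fact_gt0.
move: (s ^+ (2 * n)) (u ^+ n) (n`!%:R : R) fn0 (series _ n : R) (series _ n : R) => S U f f0 S2 S1.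
have -> : (S1 + S * U * U / f + (S2 + (-1) ^+ n * (S * U * U) / f) * cos (2 * b)) =
  S1 + S2 * cos (2 * b) + S * U * U / f * (1 + (-1) ^+ n * cos (2 * b)) by ring.
rewrite kc [expR (x / 2) * _](_ : _ = S * U * k * (expR (x / 2) * expR (- (x / 2)))); last by ring.
by rewrite e1; field.
Qed.

Lemma hermite_cos_cvg u b (F : T -> R) : measurable_fun setT F -> (forall w, `|F w| <= 1) ->
  series (fun l => cos_coef u b l * Ex P (fun w => (H l).[Z w] * F w)) @ \oo -->
  expR (s ^+ 2 * u ^+ 2 / 2) * Ex P (fun w => cos (u * Z w + b) * F w).
Proof.
move=> mF F1; set x := s ^+ 2 * u ^+ 2.
have aF : am P F by exact: (@am_bounded _ _ _ _ _ 1).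
have aC : am P (fun w => expR (x / 2) * cos (u * Z w + b)) by apply: amZ; exact: am_cosZ.
pose D n w := expR (x / 2) * cos (u * Z w + b) - \sum_(l < n) cos_coef u b l * (H l).[Z w].
pose err n := Ex P (fun w => D n w ^+ 2).
have aD n : am P (D n) by exact: amB.
have err0 : err @ \oo --> (0 : R).
  have eE n : err n = _ := hermite_cos_error u b n.
  rewrite (funext eE).
  rewrite -[X in _ --> X](subrr ((expR x + expR (- x) * cos (2 * b)) / 2)); apply: cvgB; first exact: cvg_cst.
  apply: cvgM; last exact: cvg_cst.
  by apply: cvgD; [exact: is_cvg_series_exp_coeff|apply: cvgM; [exact: is_cvg_series_exp_coeff|exact: cvg_cst]].
have diff n : expR (x / 2) * Ex P (fun w => cos (u * Z w + b) * F w) -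
    series (fun l => cos_coef u b l * Ex P (fun w => (H l).[Z w] * F w)) n = Ex P (fun w => D n w * F w).
  have aHF l : am P (fun w => (H l).[Z w] * F w) by apply: amM => //; exact: am_horner.
  have aCF : am P (fun w => cos (u * Z w + b) * F w) by apply: amM => //; exact: am_cosZ.
  have -> : (fun w => D n w * F w) = (fun w => expR (x / 2) * (cos (u * Z w + b) * F w) -
      \sum_(l < n) cos_coef u b l * ((H l).[Z w] * F w)).
    apply: funext => w; rewrite /D mulrBl mulrA; congr (_ - _).
    by rewrite mulr_suml; apply: eq_bigr => l _; rewrite mulrA.
  rewrite ExB ?ExZ; [|exact: am_itg|by apply: am_itg; exact: amZ|by apply: am_itg; apply: am_sum => l; exact: amZ].
  rewrite Ex_sum => [|l]; last by apply: am_itg; exact: amZ.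
  rewrite seriesEnat /= big_mkord; congr (_ - _); apply: eq_bigr => l _.
  by rewrite ExZ//; exact: am_itg.
have le n : `|Ex P (fun w => D n w * F w)| <= Num.sqrt (err n).
  rewrite -sqrtr_sqr; apply: ler_wsqrtr.
  apply: le_trans (Ex_CS (am_meas (aD n)) mF (am_itg (amX 2 (aD n))) (am_itg (amX 2 aF))) _.
  rewrite ler_piMr//; first by apply: Ex_ge0 => w; exact: sqr_ge0.
  rewrite -[leRHS](Ex_cst P 1); apply: le_Ex; [exact: am_itg (amX 2 aF)|exact: itg_cst|move=> w].
  by rewrite -real_normK ?num_real// expr_le1.
apply/cvgrPdist_le => e e0.
have : Num.sqrt (err n) @[n --> \oo] --> (0 : R).
  by rewrite -[X in _ --> X]sqrtr0; apply: continuous_cvg err0; exact: sqrt_continuous.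
move=> /cvgrPdist_le /(_ e e0); apply: filterS => n hn.
rewrite diff; apply: le_trans (le n) _.
by move: hn; rewrite sub0r normrN ger0_norm// sqrtr_ge0.
Qed.

Lemma hermite_bounded_coef (F : T -> R) l : measurable_fun setT F -> (forall w, `|F w| <= 1) ->
  Ex P (fun w => (H l).[Z w] * F w) ^+ 2 <= s ^+ (2 * l) * l`!%:R.
Proof.
move=> mF F1; have aH := am_horner (H l).
have iH : itg P (fun w => (H l).[Z w] ^+ 2) by apply: am_itg; exact: amX.
have aF : am P F by exact: (@am_bounded _ _ _ _ _ 1).
apply: le_trans (Ex_CS (am_meas aH) mF iH (am_itg (amX 2 aF))) _.
under eq_fun do rewrite expr2; rewrite hermite_orthogonal eqxx.
rewrite ler_piMr ?mulr_ge0//; first by rewrite exprM exprn_ge0// sqr_ge0.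
rewrite -[leRHS](Ex_cst P 1); apply: le_Ex; [exact: am_itg (amX 2 aF)|exact: itg_cst|move=> w].
by rewrite -real_normK ?num_real// expr_le1.
Qed.

End gaussian_hermite.

Section gaussian_character_series.
Context {R : realType} d (T : measurableType d) (P : probability T R).
Variables (Z V : T -> R) (s v : R).
Hypotheses (mZ : measurable_fun setT Z) (gZ : has_centered_gaussian_law P Z s) (mV : measurable_fun setT V).
Local Notation H := (hermite_var (s ^+ 2)).

Definition hermite_trig (l : nat) (b : R) : R := Ex P (fun w => (H l).[Z w] * cos (v * V w + b)).
Local Notation K := hermite_trig.

Definition char_term (u : R) (l : nat) : R[i] :=
  (u ^+ l / l`!%:R)%:C%C * ('i%C ^+ l * ((K l 0)%:C%C - 'i%C * (K l (pi / 2))%:C%C)).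

Let mcos b : measurable_fun setT (fun w => cos (v * V w + b)).
Proof.
apply: measurableT_comp; first by apply: continuous_R_meas; exact: continuous_cos.
by apply: measurable_funD => //; apply: measurable_funM.
Qed.

Lemma expr_imaginary l : 'i%C ^+ l = (cos (l%:R * (pi / 2)) +i* sin (l%:R * (pi / 2)))%C :> R[i].
Proof.
elim: l => [|l IH]; first by rewrite expr0 mul0r cos0 sin0.
have -> : l.+1%:R * (pi / 2) = l%:R * (pi / 2) + pi / 2 :> R by rewrite -natr1; ring.
by rewrite exprS IH cosDpihalf sinDpihalf; simpc.
Qed.

Lemma char_termE u l : char_term u l =
  ((cos_coef u 0 l * K l 0 - cos_coef u (pi / 2) l * K l (pi / 2)) +i*
   - (cos_coef u (pi / 2) l * K l 0 + cos_coef u 0 l * K l (pi / 2)))%C.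
Proof.
rewrite /char_term expr_imaginary /cos_coef add0r [pi / 2 + _]addrC cosDpihalf.
by simpc; congr (_ +i* _)%C; ring.
Qed.

Lemma series_lincomb (f g : nat -> R) (a b : R) : series f @ \oo --> a -> series g @ \oo --> b ->
  series (fun l => f l - g l) @ \oo --> a - b.
Proof.
move=> fa gb; rewrite (_ : series _ = (fun n => series f n - series g n)); first exact: cvgB.
by apply: funext => n; rewrite !seriesEnat /= sumrB.
Qed.

Lemma hermite_trig_cvg u b b' : series (fun l => cos_coef u b l * K l b') @ \oo -->
  expR (s ^+ 2 * u ^+ 2 / 2) * Ex P (fun w => cos (u * Z w + b) * cos (v * V w + b')).
Proof. by apply: (hermite_cos_cvg mZ gZ) => // w; exact: cos_max. Qed.

Lemma csum_char_term u : csum (char_term u) =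
  (expR (s ^+ 2 * u ^+ 2 / 2))%:C%C * cexpectation P (fun w => expi (u * Z w + v * V w)).
Proof.
have icc b b' : itg P (fun w => cos (u * Z w + b) * cos (v * V w + b')).
  apply: (@itg_bounded _ _ _ _ _ 1) => [|w]; last by rewrite normrM mulr_ile1// cos_max.
  apply: measurable_funM; last exact: mcos.
  exact: am_meas (am_cosZ mZ gZ _ _).
rewrite /csum /cexpectation !fine_expectation; set E := expR _.
have c00 := hermite_trig_cvg (u := u) (b := 0) (b' := 0).
have c11 := hermite_trig_cvg (u := u) (b := pi / 2) (b' := pi / 2).
have c01 := hermite_trig_cvg (u := u) (b := 0) (b' := pi / 2).
have c10 := hermite_trig_cvg (u := u) (b := pi / 2) (b' := 0).
have cosN (x : R) : cos (x + pi / 2) = - sin x by exact: cosDpihalf.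
rewrite (_ : (fun l => complex.Re (char_term u l)) =
   (fun l => cos_coef u 0 l * K l 0 - cos_coef u (pi / 2) l * K l (pi / 2))); last first.
  by apply: funext => l; rewrite char_termE.
rewrite (cvg_lim _ (series_lincomb c00 c11))//.
rewrite (_ : (fun l => complex.Im (char_term u l)) =
   (fun l => - (cos_coef u (pi / 2) l * K l 0) - cos_coef u 0 l * K l (pi / 2))); last first.
  by apply: funext => l; rewrite char_termE opprD.
have c10' : series (fun l => - (cos_coef u (pi / 2) l * K l 0)) @ \oo -->
    - (E * Ex P (fun w => cos (u * Z w + pi / 2) * cos (v * V w + 0))).
  rewrite (_ : series _ = (fun n => - series (fun l => cos_coef u (pi / 2) l * K l 0) n)); first exact: cvgN c10.
  by apply: funext => n; rewrite !seriesEnat /= sumrN.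
rewrite (cvg_lim _ (series_lincomb c10' c01))//.
simpc; congr (_ +i* _)%C.
  rewrite -mulrBr -ExB; [|exact: icc|exact: icc].
  by congr (E * _); apply: eq_Ex => w; rewrite !addr0 !cosN mulrNN -cosD.
rewrite -opprD -mulrDr -ExD; [|exact: icc|exact: icc].
rewrite -mulrN -ExN; last by apply: itgD; exact: icc.
congr (E * _); apply: eq_Ex => w; rewrite !addr0 !cosN /= sinD; ring.
Qed.

Lemma abs_summable_char_term u : abs_summable (char_term u).
Proof.
pose g l : R := 4 * ((4^-1) ^+ l + exp_coeff (4 * (s ^+ 2 * u ^+ 2)) l).
(* From [|z| <= 1 / w + w z^2] with [w = 4 ^+ l], which avoids the square root of a factorial:
   [w z^2] is bounded by a term of the exponential series at [4 * (s ^+ 2 * u ^+ 2)]. *)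
have hK l b : `|u ^+ l / l`!%:R * K l b| <= (4^-1) ^+ l + exp_coeff (4 * (s ^+ 2 * u ^+ 2)) l.
  have f0 : 0 < l`!%:R :> R by rewrite ltr0n fact_gt0.
  set z := u ^+ l / l`!%:R * K l b.
  have zb : 4 ^+ l * z ^+ 2 <= exp_coeff (4 * (s ^+ 2 * u ^+ 2)) l.
    have := hermite_bounded_coef mZ gZ l (mcos b) (fun w => cos_max _); rewrite -/(K l b) => hb.
    have -> : exp_coeff (4 * (s ^+ 2 * u ^+ 2)) l = 4 ^+ l * (u ^+ l / l`!%:R) ^+ 2 * (s ^+ (2 * l) * l`!%:R).
      rewrite /exp_coeff /= (exprMn l 4) (exprMn l (s ^+ 2)) -!exprM [u ^+ (2 * l)](_ : _ = u ^+ l * u ^+ l).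
        by move: (s ^+ (2 * l)) (u ^+ l) (4 ^+ l) => S U F; field; rewrite gt_eqF.
      by rewrite mul2n -addnn exprD.
    have -> : z ^+ 2 = (u ^+ l / l`!%:R) ^+ 2 * K l b ^+ 2 by exact: exprMn.
    by rewrite mulrA; apply: ler_wpM2l => //; apply: mulr_ge0; [exact: exprn_ge0|exact: sqr_ge0].
  have w0 : 0 < 4 ^+ l :> R by rewrite exprn_gt0.
  apply: le_trans (_ : (4^-1) ^+ l + 4 ^+ l * z ^+ 2 <= _); last by rewrite lerD2l.
  rewrite exprVn -(@ler_pM2l _ (4 ^+ l))// mulrDr mulfV ?gt_eqF// -[z ^+ 2]real_normK ?num_real//.
  by have := normr_ge0 z; set W := 4 ^+ l; have := sqr_ge0 (W * `|z| - 1); nra.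
apply: (@series_le_cvg _ _ g) => [l|l|l|].
- by rewrite /Normc.normc; case: (char_term u l) => x y; exact: sqrtr_ge0.
- apply: mulr_ge0 => //; apply: addr_ge0; first by apply: exprn_ge0; rewrite invr_ge0.
  by apply: exp_coeff_ge0; apply: mulr_ge0 => //; apply: mulr_ge0; exact: sqr_ge0.
- have nle (x y : R) : Normc.normc (x +i* y)%C <= `|x| + `|y|.
    rewrite /Normc.normc -(@ler_pXn2r _ 2)// ?nnegrE ?sqrtr_ge0 ?addr_ge0//.
    rewrite sqr_sqrtr ?addr_ge0 ?sqr_ge0// -[x ^+ 2]real_normK ?num_real// -[y ^+ 2]real_normK ?num_real//.
    by have := normr_ge0 x; have := normr_ge0 y; nra.
  have hc b b' : `|cos_coef u b l * K l b'| <= (4^-1) ^+ l + exp_coeff (4 * (s ^+ 2 * u ^+ 2)) l.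
    apply: le_trans (hK l b'); rewrite /cos_coef mulrAC normrM ler_piMr//; exact: cos_max.
  rewrite char_termE /g; apply: le_trans (nle _ _) _; rewrite normrN.
  have tri (a1 a2 a3 a4 G : R) : `|a1| <= G -> `|a2| <= G -> `|a3| <= G -> `|a4| <= G ->
      `|a1 - a2| + `|a3 + a4| <= 4 * G.
    by move=> *; have := ler_normB a1 a2; have := ler_normD a3 a4; lra.
  exact: tri.
apply: is_cvg_seriesZ; apply: is_cvg_seriesD; last exact: is_cvg_series_exp_coeff.
have h : cvgn (series (geometric 1 (4^-1 : R))).
  by apply: is_cvg_geometric_series; rewrite ger0_norm ?invr_ge0// invf_lt1// ltr1n.
have e : geometric 1 (4^-1 : R) = (fun l => 4^-1 ^+ l) by apply: funext => l; rewrite /geometric /= mul1r.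
by rewrite e in h.
Qed.

End gaussian_character_series.

(** * Convergence in law *)

Section law_convergence.
Context {R : realType}.

Definition law_cvg (F : set_system nat) d (T : measurableType d) (P : probability T R)
    d' (T' : measurableType d') (P' : probability T' R) (V : topologicalType)
    (X : nat -> T -> V) (Z : T' -> V) :=
  forall g : V -> R, continuous g -> (exists M, forall v, `|g v| <= M) ->
    (fun N => Ex P (fun w => g (X N w))) @ F --> Ex P' (fun w => g (Z w)).

Lemma cvg_law_Ex d (T : measurableType d) (P : probability T R)
    d' (T' : measurableType d') (P' : probability T' R) (V : topologicalType)
    (X : nat -> T -> V) (Z : T' -> V) :
  (forall g : V -> R, continuous g -> measurable_fun setT (g \o Z)) ->
  cvg_law P P' X Z -> law_cvg \oo P P' X Z.
Proof.
move=> mZ h g cg [M gM]; have := h g cg (ex_intro _ M gM).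
have iZ : itg P' (g \o Z) by apply: (@itg_bounded _ _ _ _ _ M) => [|w]; [exact: mZ|exact: gM].
rewrite (expectationE iZ) => /fine_cvg; apply: cvg_trans; apply: near_eq_cvg; apply: nearW => N /=.
by rewrite -fine_expectation.
Qed.

Context d (T : measurableType d) (P : probability T R).
Context d' (T' : measurableType d') (P' : probability T' R).

(** For positive [M], a continuous cutoff that is zero for [|z| <= M] and one for [|z| >= 2 * M]. *)
Definition tail (M : nat) (z : R) : R := Num.max 0 (Num.min 1 (`|z| / M%:R - 1)).

Lemma tail01 M z : 0 <= tail M z <= 1.
Proof. by rewrite /tail le_max lexx ge_max ler01 ge_min lexx. Qed.

Lemma tail_cont M : continuous (tail M).
Proof.
apply: cont_clamp => z; apply: cvgB; last exact: cvg_cst.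
by apply: cvgM; [exact: norm_continuous|exact: cvg_cst].
Qed.

Lemma tail_lip M a b : (0 < M)%N -> tail M a <= tail M b + `|a - b|.
Proof.
move=> M0; have Mi : 0 < (M%:R^-1 : R) <= 1 by rewrite invr_gt0 ltr0n M0 invf_le1 ?ltr0n// ler1n.
have h : `|a| / M%:R <= `|b| / M%:R + `|a - b|.
  have := lerB_normD b (a - b); have -> : b + (a - b) = a by ring.
  have := ler_normD b (a - b); have -> : b + (a - b) = a by ring.
  by have := normr_ge0 (a - b); case/andP: Mi; move: (M%:R^-1) => i i0 i1; nra.
have := normr_ge0 (a - b); move: h; rewrite /tail /Num.max /Num.min.
move: (_ / _) (_ / _) => x y.
by case: ifPn; case: ifPn; case: ifPn; case: ifPn; rewrite -?leNgt => *; lra.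
Qed.

Lemma tail_split M z : (0 < M)%N -> `|z| <= 2 * M%:R + `|z| * tail M z.
Proof.
move=> M0; have Mp : 0 < M%:R :> R by rewrite ltr0n.
have z0 := normr_ge0 z; have [h|h] := leP `|z| (2 * M%:R).
  by have /andP[t0 _] := tail01 M z; have := mulr_ge0 z0 t0; lra.
have e : tail M z = 1.
  have h1 : 1 <= `|z| / M%:R - 1.
    by rewrite lerBrDr ler_pdivlMr//; lra.
  by rewrite /tail (min_idPl h1) (max_idPr ler01).
by rewrite e mulr1; lra.
Qed.

Lemma tail_vanish (Z : T' -> R) : measurable_fun setT Z ->
  (fun M => Ex P' (fun w => tail M.+1 (Z w))) @ \oo --> (0 : R).
Proof.
move=> mZ; have [||||_] := @dct_Ex _ _ _ P' (fun M w => tail M.+1 (Z w)) (fun=> 0) (fun=> 1).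
- by move=> M; apply: measurableT_comp mZ; apply: continuous_R_meas; exact: tail_cont.
- move=> w; apply: cvg_near_cst; exists (Num.truncn `|Z w|) => // M /= hM; rewrite /tail.
  have h : `|Z w| <= M.+1%:R by apply: le_trans (ltW (truncnS_gt _)) _; rewrite ler_nat ltnS.
  have h1 : `|Z w| / M.+1%:R - 1 <= 0 by rewrite subr_le0 ler_pdivrMr ?mul1r.
  by apply/max_idPl; rewrite ge_min h1 orbT.
- by move=> M w; have /andP[t0 t1] := tail01 M.+1 (Z w); rewrite ger0_norm.
- exact: itg_cst.
- by rewrite Ex_cst.
Qed.

Lemma itg_tail d0 (S : measurableType d0) (Q : probability S R) M (Z : S -> R) : measurable_fun setT Z ->
  itg Q (fun w => tail M (Z w)).
Proof.
move=> mZ; apply: (@itg_bounded _ _ _ _ _ 1) => [|w].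
  by apply: measurableT_comp mZ; apply: continuous_R_meas; exact: tail_cont.
by have /andP[t0 t1] := tail01 M (Z w); rewrite ger0_norm.
Qed.

Lemma eq_law_borel (Z : T -> R) (Z' : T' -> R) : measurable_fun setT Z -> measurable_fun setT Z' ->
  (forall g : R -> R, continuous g -> (exists M, forall v, `|g v| <= M) ->
    Ex P (fun w => g (Z w)) = Ex P' (fun w => g (Z' w))) ->
  forall A : set R, measurable A -> P (Z @^-1` A) = P' (Z' @^-1` A).
Proof.
move=> mZ mZ' h.
pose Z0 : T -> measurableTypeR R := Z; pose Z0' : T' -> measurableTypeR R := Z'.
pose X : {RV P >-> measurableTypeR R} := HB.pack Z0 (isMeasurableFun.Build _ _ T (measurableTypeR R) Z0 mZ).
pose X' : {RV P' >-> measurableTypeR R} := HB.pack Z0' (isMeasurableFun.Build _ _ T' (measurableTypeR R) Z0' mZ').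
apply: (@measure_unique _ R (measurableTypeR R) (@RGenOInfty.G R) (fun k => `](- k%:R), +oo[%classic)
   (RGenOInfty.measurableE R) _ _ _ (distribution P X) (distribution P' X')).
- move=> _ _ [a ->] [b ->]; exists (Num.max a b); apply/seteqP; split=> x /=.
    by rewrite !in_itv /= !andbT gt_max => -[-> ->].
  by rewrite !in_itv /= !andbT gt_max => /andP[-> ->].
- by move=> k; exists (- k%:R).
- apply/seteqP; split=> // x _; exists (Num.truncn `|x|).+1 => //=.
  rewrite in_itv /= andbT ltrNl; apply: le_lt_trans (ler_norm _) _; rewrite normrN.
  exact: truncnS_gt.
- move=> _ [a ->]; set A := `]a, +oo[%classic.
  (* Continuous ramps converge to the indicator of the open ray, and such rays generate the Borel
     sets and are stable under intersection. *)
  have key d0 (S : measurableType d0) (Q : probability S R) (W : S -> R) : measurable_fun setT W ->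
    (fun n => Ex Q (fun w => Num.max 0 (Num.min 1 (n%:R * (W w - a))))) @ \oo --> fine (Q (W @^-1` A)).
    move=> mW.
    have mA : measurable (W @^-1` A).
      by rewrite -[X in measurable X]setTI; apply: mW => //; exact: measurable_itv.
    have cn n : continuous (fun z : R => Num.max 0 (Num.min 1 (n%:R * (z - a)))).
      apply: cont_clamp => z; apply: cvgM; first exact: cvg_cst.
      by apply: cvgB; [exact: cvg_id|exact: cvg_cst].
    have bn n (z : R) : 0 <= Num.max 0 (Num.min 1 (n%:R * (z - a))) <= 1.
      by rewrite le_max lexx ge_max ler01 ge_min lexx.
    have [||||_] := @dct_Ex _ _ _ Q (fun n w => Num.max 0 (Num.min 1 (n%:R * (W w - a)))) (\1_(W @^-1` A)) (fun=> 1).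
    + move=> n; apply: (@measurableT_comp _ _ _ _ _ _ (fun z : R => Num.max 0 (Num.min 1 (n%:R * (z - a))))) mW.
      by apply: continuous_R_meas; exact: cn.
    + move=> w; have [wa|aw] := leP (W w) a.
        rewrite indicE memNset => [|]; last by rewrite /A /= in_itv /= andbT ltNge wa.
        apply: cvg_near_cst; apply: nearW => n; apply/max_idPl.
        by rewrite ge_min; apply/orP; right; rewrite mulr_ge0_le0// subr_le0.
      rewrite indicE mem_set; last by rewrite /A /= in_itv /= andbT.
      have wa0 : 0 < W w - a by rewrite subr_gt0.
      apply: cvg_near_cst; exists (Num.truncn (W w - a)^-1).+1 => // n /= hn.
      have h1 : 1 <= n%:R * (W w - a).
        rewrite -ler_pdivrMr// mul1r; apply: le_trans (ltW (truncnS_gt _)) _.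
        by rewrite ler_nat.
      by rewrite (min_idPl h1) (max_idPr ler01).
    + by move=> n w; have /andP[t0 t1] := bn n (W w); rewrite ger0_norm.
    + exact: itg_cst.
    + by rewrite -fine_expectation expectation_indic.
  have k1 := key _ _ P _ mZ; have k2 := key _ _ P' _ mZ'.
  have fin d0 (S : measurableType d0) (Q : probability S R) (W : S -> R) : measurable_fun setT W ->
      Q (W @^-1` A) = (fine (Q (W @^-1` A)))%:E.
    move=> mW; rewrite fineK// fin_num_measure// -[X in measurable X]setTI.
    by apply: mW => //; exact: measurable_itv.
  rewrite -[LHS]/(P (Z @^-1` A)) -[RHS]/(P' (Z' @^-1` A)) (fin _ _ P)// (fin _ _ P')//.
  congr (_%:E); rewrite -(cvg_lim (@Rhausdorff R) k1) -(cvg_lim (@Rhausdorff R) k2).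
  congr (lim (_ @ \oo)); apply: funext => n; apply: (h (fun z => Num.max 0 (Num.min 1 (n%:R * (z - a))))).
    apply: cont_clamp => z; apply: cvgM; first exact: cvg_cst.
    by apply: cvgB; [exact: cvg_id|exact: cvg_cst].
  exists 1 => z; rewrite ger0_norm ?le_max ?lexx// ge_max ler01 ge_min lexx//.
- by move=> k; apply: le_lt_trans (probability_le1 (distribution P X) (measurable_itv _)) (ltry _).
Qed.

End law_convergence.

Section tight_chaos.
Context {R : realType} d (T : measurableType d) (P : probability T R).
Context d' (T' : measurableType d') (P' : probability T' R).
Variables (A : nat -> gauss_real P) (n : nat) (x : forall N, A N) (X : nat -> T -> R) (Z : T' -> R).

Lemma gr_Nr_le_abs (B : gauss_real P) (u : B) : deg n u ->
  Nr u ^+ 2 <= 8 * hc n ^+ 2 * Ex P (fun w => `|gr_ev u w|) ^+ 2.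
Proof.
move=> du; rewrite -gr_Nr; apply: Ex_sq_le_abs; [exact: exprn_ege1 (hc_ge1 n)|exact: gr_am|].
have h := deg_hyper du.
rewrite (_ : (fun w => gr_ev u w ^+ 4) = (fun w => gr_ev (u * u) w ^+ 2)); last first.
  by apply: funext => w; rewrite gr_evM; ring.
rewrite gr_Nr gr_Nr -exprMn lerXn2r ?nnegrE ?Nr_ge0//.
by apply: mulr_ge0; [exact: le_trans (hc_ge1 n)|exact: sqr_ge0].
Qed.

Hypotheses (dx : forall N, deg n (x N)) (iX : forall N, itg P (X N)) (mZ : measurable_fun setT Z).
Hypothesis xX : (fun N => Ex P (fun w => `|gr_ev (x N) w - X N w|)) @ \oo --> (0 : R).
Hypothesis XZ : law_cvg \oo P P' X Z.

(* By hypercontractivity the L^2 norms of chaos elements are controlled by their tails. *)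
Lemma tight_bdd : bdd x.
Proof.
pose c : R := 8 * hc n ^+ 2.
have c1 : 8 <= c by rewrite /c ler_peMr// exprn_ege1// hc_ge1.
have e0 : 0 < (16 * c)^-1 by rewrite invr_gt0; lra.
have [M M0 hM] : exists2 M : nat, (0 < M)%N & \forall N \near \oo, Ex P (fun w => tail M (gr_ev (x N) w)) <= (4 * c)^-1.
  have := @tail_vanish _ _ _ P' _ mZ => /cvgrPdist_le /(_ _ e0) [M0 _ /(_ M0 (leqnn _))] /=.
  rewrite sub0r normrN ger0_norm => [hM|]; last by apply: Ex_ge0 => w; have /andP[] := tail01 M0.+1 (Z w).
  exists M0.+1 => //.
  have bt : exists B, forall v, `|tail M0.+1 v| <= B :> R.
    by exists 1 => v; have /andP[t0 t1] := tail01 M0.+1 v; rewrite ger0_norm.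
  have h1 := XZ (@tail_cont R M0.+1) bt.
  have n1 : \forall N \near \oo, `|Ex P' (fun w => tail M0.+1 (Z w)) - Ex P (fun w => tail M0.+1 (X N w))| <= (16 * c)^-1.
    by move/cvgrPdist_le: h1 => /(_ _ e0).
  have n2 : \forall N \near \oo, Ex P (fun w => `|gr_ev (x N) w - X N w|) <= (16 * c)^-1.
    move/cvgrPdist_le: xX => /(_ _ e0); apply: filterS => N; rewrite sub0r normrN ger0_norm//.
    by apply: Ex_ge0.
  near=> N.
  have iz := am_itg (gr_am (x N)).
  have h2 : Ex P (fun w => tail M0.+1 (gr_ev (x N) w)) <=
      Ex P (fun w => tail M0.+1 (X N w)) + Ex P (fun w => `|gr_ev (x N) w - X N w|).
    have i1 := itg_tail P M0.+1 (itg_meas iz); have i2 := itg_tail P M0.+1 (itg_meas (iX N)).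
    have i3 := itg_abs (itgB iz (iX N)).
    rewrite -ExD//; apply: le_Ex => //; first exact: itgD.
    by move=> w; exact: tail_lip.
  have h3 : `|Ex P' (fun w => tail M0.+1 (Z w)) - Ex P (fun w => tail M0.+1 (X N w))| <= (16 * c)^-1 by near: N.
  have h4 : Ex P (fun w => `|gr_ev (x N) w - X N w|) <= (16 * c)^-1 by near: N.
  have -> : (4 * c)^-1 = 4 * (16 * c)^-1 by field; rewrite gt_eqF//; lra.
  move: h2 h3 h4 hM e0; rewrite ler_norml; move: (16 * c)^-1 (Ex _ _) (Ex _ _) (Ex _ _) (Ex _ _) => *; lra.
have Mp : 0 < M%:R :> R by rewrite ltr0n.
have [N0 _ hN0] : \forall N \near \oo, Nr (x N) ^+ 2 <= c * (4 * M%:R) ^+ 2.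
  apply: filterS hM => N hN.
  set z := gr_ev (x N); set m := Ex P (fun w => `|z w|).
  have az : am P z := gr_am (x N).
  have h1 : Nr (x N) ^+ 2 <= c * m ^+ 2 := gr_Nr_le_abs (dx N).
  have m0 : 0 <= m by apply: Ex_ge0.
  have at_ : am P (fun w => tail M (z w)).
    apply: (@am_bounded _ _ _ _ _ 1) => [|w]; first exact: itg_meas (itg_tail P M (am_meas az)).
    by have /andP[t0 t1] := tail01 M (z w); rewrite ger0_norm.
  (* Cauchy-Schwarz: the second moment is at most [c * m ^+ 2] by hypercontractivity, and the tail
     bound [(4 * c)^-1] was chosen to leave [m ^+ 2 / 4]. *)
  have h2 : Ex P (fun w => `|z w| * tail M (z w)) <= m / 2.
    have t0 : 0 <= Ex P (fun w => `|z w| * tail M (z w)).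
      by apply: Ex_ge0 => w; rewrite mulr_ge0//; case/andP: (tail01 M (z w)).
    rewrite -(@ler_pXn2r _ 2)// ?nnegrE ?divr_ge0//.
    apply: le_trans (Ex_CS (am_meas (am_abs az)) (am_meas at_) (am_itg (amX 2 (am_abs az))) (am_itg (amX 2 at_))) _.
    have e1 : Ex P (fun w => `|z w| ^+ 2) <= c * m ^+ 2.
      apply: le_trans h1; rewrite -gr_Nr le_eqVlt; apply/orP; left; apply/eqP; apply: eq_Ex => w.
      by rewrite real_normK ?num_real.
    have e2 : Ex P (fun w => tail M (z w) ^+ 2) <= (4 * c)^-1.
      apply: le_trans hN; apply: le_Ex; [exact: am_itg (amX 2 at_)|exact: am_itg at_|move=> w].
      by have /andP[t1 t2] := tail01 M (z w); rewrite expr2 ler_piMr.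
    apply: le_trans (ler_pM _ _ e1 e2) _; [by apply: Ex_ge0 => w; exact: sqr_ge0|by apply: Ex_ge0 => w; exact: sqr_ge0|].
    by rewrite le_eqVlt; apply/orP; left; apply/eqP; field; rewrite gt_eqF//; lra.
  have h3 : m <= 2 * M%:R + m / 2.
    have h3' : m <= Ex P (fun w => 2 * M%:R + `|z w| * tail M (z w)).
      apply: le_Ex => [||w]; [exact: am_itg (am_abs az)|by apply: am_itg; apply: amD; [exact: am_cst|apply: amM => //; exact: am_abs]|exact: tail_split].
    apply: le_trans h3' _; rewrite ExD ?Ex_cst; [by rewrite lerD2l|exact: itg_cst|by apply: am_itg; apply: amM => //; exact: am_abs].
  apply: le_trans h1 _; rewrite ler_wpM2l//; first lra.
  by rewrite lerXn2r ?nnegrE ?mulr_ge0//; lra.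
(* The bound holds from [N0] on; the finitely many earlier norms are added. *)
exists n, (Num.sqrt (c * (4 * M%:R) ^+ 2) + \sum_(i < N0) Nr (x i)); split.
  by rewrite addr_ge0 ?sqrtr_ge0// sumr_ge0// => i _; exact: Nr_ge0.
move=> N; split => //; have [NN|NN] := leqP N0 N.
  apply: le_trans (_ : Num.sqrt (c * (4 * M%:R) ^+ 2) <= _); last by rewrite lerDl sumr_ge0// => i _; exact: Nr_ge0.
  by rewrite -[leLHS]ger0_norm ?Nr_ge0// -sqrtr_sqr; apply: ler_wsqrtr; exact: hN0.
apply: le_trans (_ : \sum_(i < N0) Nr (x i) <= _); last by rewrite lerDr sqrtr_ge0.
by rewrite (bigD1 (Ordinal NN))//= lerDl sumr_ge0// => i _; exact: Nr_ge0.
Unshelve. all: by end_near. Qed.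

End tight_chaos.

(** * The limit theorem for Gaussian algebras *)

Section law_moments.
Context {R : realType} d (T : measurableType d) (P : probability T R).
Context d' (T' : measurableType d') (P' : probability T' R) (k : nat).
Context (F : set_system nat) {FF : ProperFilter F}.

Lemma law_clamped_cvg (xi : nat -> T -> 'rV[R]_k.+1) (zeta : T' -> 'rV[R]_k.+1) :
  law_cvg F P P' xi zeta -> clamped_cvg P P' F xi zeta.
Proof.
move=> h g M dg; apply: (h (fun x => g (clampv M x))); first by apply: clampv_cont; exact: dpg_cont dg.
exact: clampv_bounded (dpg0 dg).
Qed.

Lemma dpg_exp n (f : 'rV[R]_k.+1 -> R) m : diff_poly_growth n f -> diff_poly_growth n (fun x => f x ^+ m).
Proof.
move=> hf; elim: m => [|m IH]; first by under eq_fun do rewrite expr0; exact: dpg_cst.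
by under eq_fun do rewrite exprS; exact: dpgM.
Qed.

Lemma dpg_prod n I (s : seq I) (f : I -> 'rV[R]_k.+1 -> R) : (forall i, diff_poly_growth n (f i)) ->
  diff_poly_growth n (fun x => \prod_(i <- s) f i x).
Proof.
move=> hf; elim: s => [|i s IH]; first by under eq_fun do rewrite big_nil; exact: dpg_cst.
by under eq_fun do rewrite big_cons; exact: dpgM.
Qed.

Lemma dpg_horner n (i : 'I_k.+1) (q : {poly R}) : diff_poly_growth n (fun x : 'rV[R]_k.+1 => q.[x 0 i]).
Proof.
elim/poly.poly_ind: q => [|q c IH]; first by under eq_fun do rewrite horner0; exact: dpg_cst.
under eq_fun do rewrite hornerD hornerM hornerX hornerC.
by apply: dpgD; [apply: dpgM => //; exact: dpg_coord|exact: dpg_cst].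
Qed.

Lemma dpg_cos n (i : 'I_k.+1) (v b : R) : diff_poly_growth n (fun x : 'rV[R]_k.+1 => cos (v * x 0 i + b)).
Proof.
have hf : diff_poly_growth n (fun x : 'rV[R]_k.+1 => v * x 0 i + b).
  by apply: dpgD; [apply: dpgZ; exact: dpg_coord|exact: dpg_cst].
by have [] := dpg_trig hf.
Qed.

End law_moments.

Lemma gr_ev_horner (R : realType) d (T : measurableType d) (P : probability T R) (A : gauss_real P)
  (x : A) (q : {poly R}) w : gr_ev (horner_alg x q) w = q.[gr_ev x w].
Proof.
elim/poly.poly_ind: q => [|q c IH].
  by rewrite horner0 rmorph0 -(scale0r (1 : A)) gr_evc.
rewrite rmorphD rmorphM /= horner_algX horner_algC gr_evD gr_evM IH gr_evc.
by rewrite hornerD hornerM hornerX hornerC.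
Qed.

Section gauss_limit.
Context {R : realType} d (T : measurableType d) (P : probability T R).
Variables (A : nat -> gauss_real P) (x y : forall N, A N) (p q a : nat) (s : R).
Variables (X : nat -> T -> R) (Y : nat -> nat -> T -> R).
Context d1 (T1 : measurableType d1) (P1 : probability T1 R) (Ylim : 'I_a.+2 -> T1 -> R).
Hypotheses (p0 : (0 < p)%N) (qp : (q < a.+2 * p)%N) (s0 : s != 0).
Hypotheses (hx : forall N, ch p (x N)) (hy : forall N, ch q (y N)).
Hypotheses (iX : forall N, itg P (X N)) (iY : forall r N, itg P (Y r N)).
Hypothesis xX : forall N, Ex P (fun w => `|gr_ev (x N) w - X N w|) <= N.+1%:R^-1.
Hypothesis yY : forall r N, (r <= a.+1)%N ->
  Ex P (fun w => `|gr_ev (itG r (x N) (y N)) w - Y r N w|) <= N.+1%:R^-1.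
Hypothesis XZ : law_cvg \oo P (normal_prob 0 s) X (fun z : R => z).
Hypothesis mYlim : forall r, measurable_fun setT (Ylim r).
Hypothesis YZ : law_cvg \oo P P1 (fun N w => \row_(r < a.+2) Y r N w) (fun w => \row_(r < a.+2) Ylim r w).

Let vanish (f : nat -> R) : (forall N, 0 <= f N) -> (forall N, f N <= N.+1%:R^-1) -> f @ \oo --> (0 : R).
Proof.
move=> f0 f1; apply: (@squeeze_cvgr _ _ _ _ (fun=> 0) (fun N => N.+1%:R^-1)).
- by apply: nearW => N; rewrite f0 f1.
- exact: cvg_cst.
- exact: cvg_harmonic.
Qed.

Let x0 : (fun N => Ex P (fun w => `|gr_ev (x N) w - X N w|)) @ \oo --> (0 : R).
Proof. by apply: vanish => // N; exact: Ex_ge0. Qed.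

Let y0 r : (r <= a.+1)%N -> (fun N => Ex P (fun w => `|gr_ev (itG r (x N) (y N)) w - Y r N w|)) @ \oo --> (0 : R).
Proof. by move=> ra; apply: vanish => N; [exact: Ex_ge0|exact: yY]. Qed.

Let mid : measurable_fun [set: measurableTypeR R] (fun z : R => z).
Proof. exact: measurable_id. Qed.

Lemma gauss_limit_bdd_x : bdd x.
Proof. exact: (tight_bdd (fun N => ch_deg (hx N)) iX mid x0 XZ). Qed.

Lemma gauss_limit_law_y : law_cvg \oo P P1 (Y 0%N) (Ylim ord0).
Proof.
move=> g cg [M gM].
have := YZ (g := fun z => g (z 0 ord0)) _ (ex_intro _ M (fun z => gM _)).
have -> : Ex P1 (fun w => g ((\row_(r < a.+2) Ylim r w) 0 ord0)) = Ex P1 (fun w => g (Ylim ord0 w)).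
  by apply: eq_Ex => w; rewrite mxE.
have -> : (fun N => Ex P (fun w => g ((\row_(r < a.+2) Y r N w) 0 ord0))) = (fun N => Ex P (fun w => g (Y 0%N N w))).
  by apply: funext => N; apply: eq_Ex => w; rewrite mxE.
apply; apply: (@cont_comp _ _ _ (fun z : 'rV[R]_a.+2 => z 0 ord0) g) => //; exact: coord_cont.
Qed.

Lemma gauss_limit_bdd_y : bdd y.
Proof.
exact: (tight_bdd (fun N => ch_deg (hy N)) (iY 0%N) (mYlim ord0) (y0 (r := 0%N) isT) gauss_limit_law_y).
Qed.

Let bx := gauss_limit_bdd_x.
Let by_ := gauss_limit_bdd_y.

Let gauss_id : has_centered_gaussian_law (normal_prob 0 s) (fun z : R => z) s.
Proof. by move=> B mB; rewrite (negbTE s0). Qed.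

Lemma normal_square : Ex (normal_prob 0 s) (fun z : R => z ^+ 2) = s ^+ 2.
Proof.
have := gaussian_stein mid gauss_id (fun z => is_derive_poly 'X z) (@continuous_horner _ _) (pgrow_horner 'X) (pgrow_horner _).
rewrite derivX; under [X in _ = _ * X]eq_Ex do rewrite hornerC; rewrite Ex_cst mulr1 => <-.
by apply: eq_Ex => z; rewrite hornerX expr2.
Qed.

Lemma normal_fourth : Ex (normal_prob 0 s) (fun z : R => z ^+ 4) = 3 * s ^+ 4.
Proof.
have := gaussian_stein mid gauss_id (fun z => is_derive_poly 'X^3 z) (@continuous_horner _ _) (pgrow_horner 'X^3) (pgrow_horner _).
rewrite derivXn /= => e.
have -> : (fun z : R => z ^+ 4) = (fun z => z * 'X^3.[z]) by apply: funext => z; rewrite hornerXn -exprS.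
rewrite e.
have -> : (fun w : measurableTypeR R => ('X^2 *+ 3 : {poly R}).[w]) = (fun z : R => 3 * z ^+ 2).
  by apply: funext => z; rewrite hornerMn hornerXn mulr_natl.
rewrite ExZ ?normal_square; last by apply: am_itg; apply: amX; exact: am_normal.
ring.
Qed.

Lemma gauss_limit_moment_x n : (fun N => Ex P (fun w => gr_ev (x N) w ^+ n)) @ \oo --> Ex (normal_prob 0 s) (fun z : R => z ^+ n).
Proof.
pose xi N w : 'rV[R]_1 := \row_(i < 1) gr_ev (x N) w.
pose zeta (z : measurableTypeR R) : 'rV[R]_1 := \row_(i < 1) z.
have cl : clamped_cvg P (normal_prob 0 s) \oo xi zeta.
  apply: (@clamped_cvg_L1 _ _ _ _ _ _ _ _ _ _ (fun N w => \row_(i < 1) X N w)).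
  - by move=> N i; rewrite /row_meas; under eq_fun do rewrite mxE; exact: itg_meas (iX N).
  - by move=> N i; under eq_fun do rewrite mxE; exact: am_meas (gr_am _).
  - by move=> N i; under eq_fun do rewrite !mxE; apply: itgB => //; exact: am_itg (gr_am _).
  - move=> i; apply: cvg_trans x0; apply: near_eq_cvg; apply: nearW => N.
    by apply: eq_Ex => w; rewrite !mxE distrC.
  apply: law_clamped_cvg => g cg bg.
  have := XZ (g := fun z => g (\row_(i < 1) z)); apply => //; last first.
    by case: bg => M gM; exists M.
  apply: (@cont_comp _ _ _ (fun z : R => \row_(i < 1) z) g) => //; apply: cont_row => i.
  by under eq_fun do rewrite mxE; move=> z; exact: cvg_id.
have := @moment_cvg R d T P _ _ (normal_prob 0 s) 0 \oo eventually_filter xi zeta (fun z => z 0 0 ^+ n).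
have e1 : (fun N => Ex P (fun w => xi N w 0 0 ^+ n)) = (fun N => Ex P (fun w => gr_ev (x N) w ^+ n)).
  by apply: funext => N; apply: eq_Ex => w; rewrite mxE.
have e2 : Ex (normal_prob 0 s) (fun w => zeta w 0 0 ^+ n) = Ex (normal_prob 0 s) (fun z : R => z ^+ n).
  by apply: eq_Ex => w; rewrite mxE.
rewrite e1 e2; apply => //.
- by move=> N i; under eq_fun do rewrite mxE; exact: gr_am.
- move=> i m; have [C hC] := bdd_moments m bx; exists C => N.
  by under eq_fun do rewrite mxE.
- by move=> i; under eq_fun do rewrite mxE; exact: mid.
- by apply: dpg_exp; exact: dpg_coord.
Qed.

Lemma gauss_limit_variance : (fun N => ga_E (x N * x N)) @ \oo --> s ^+ 2.
Proof.
rewrite -normal_square; apply: cvg_trans (gauss_limit_moment_x (n := 2)); apply: near_eq_cvg; apply: nearW => N.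
by rewrite gr_E; apply: eq_Ex => w; rewrite gr_evM expr2.
Qed.

Lemma gauss_limit_defect : (fun N => Num.sqrt (Num.sqrt (fourth_defect (x N)))) @ \oo --> (0 : R).
Proof.
have h : (fun N => fourth_defect (x N)) @ \oo --> (0 : R).
  have -> : 0 = 3 * s ^+ 4 - 3 * (s ^+ 2) ^+ 2 :> R by ring.
  apply: cvgB; last by apply: cvgM; [exact: cvg_cst|apply: cvgM; exact: gauss_limit_variance].
  rewrite -normal_fourth; apply: cvg_trans (gauss_limit_moment_x (n := 4)); apply: near_eq_cvg; apply: nearW => N.
  by rewrite gr_E; apply: eq_Ex => w; rewrite !gr_evM; ring.
rewrite -[X in _ --> X]sqrtr0; apply: continuous_cvg; first exact: sqrt_continuous.
by rewrite -[X in _ --> X]sqrtr0; apply: continuous_cvg h; exact: sqrt_continuous.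
Qed.

Let xiY N w : 'rV[R]_a.+2 := \row_(r < a.+2) gr_ev (itG r (x N) (y N)) w.

Let bdd_xiY : bounded_moments P xiY.
Proof.
move=> r m; have [C hC] := bdd_moments m (bdd_itG r hx hy bx by_); exists C => N.
by rewrite /xiY; under eq_fun do rewrite mxE.
Qed.

Let am_xiY N i : am P (fun w => xiY N w 0 i).
Proof. by under eq_fun do rewrite mxE; exact: gr_am. Qed.

Let clamped_xiY : clamped_cvg P P1 \oo xiY (fun w => \row_(r < a.+2) Ylim r w).
Proof.
apply: (@clamped_cvg_L1 _ _ _ _ _ _ _ _ _ _ (fun N w => \row_(r < a.+2) Y r N w)).
- by move=> N i; under eq_fun do rewrite mxE; exact: itg_meas (iY _ N).
- by move=> N i; exact: am_meas (am_xiY N i).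
- by move=> N i; under eq_fun do rewrite !mxE; apply: itgB => //; exact: am_itg (gr_am _).
- move=> i; have ia : (i <= a.+1)%N by rewrite -ltnS.
  apply: cvg_trans (y0 ia); apply: near_eq_cvg; apply: nearW => N.
  by apply: eq_Ex => w; rewrite !mxE distrC.
exact: law_clamped_cvg.
Qed.

Let row_Ylim : row_meas (fun w => \row_(r < a.+2) Ylim r w).
Proof. by move=> i; under eq_fun do rewrite mxE; exact: mYlim. Qed.

Lemma gauss_limit_am_Ylim r : am P1 (Ylim r).
Proof.
have := clamped_cvg_am (FF := eventually_filter) am_xiY bdd_xiY row_Ylim clamped_xiY r.
by under eq_fun do rewrite mxE.
Qed.

Let base := base_moment P1 (Ylim ord0) (fun r => Ylim (lift ord0 r)).

Lemma gauss_limit_base v (m : multinom a.+1) b :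
  (fun N => trig_moment (y N) v (monoG x y m N) b) @ \oo --> base v m b.
Proof.
pose h (z : 'rV[R]_a.+2) := (\prod_(r < a.+1) z 0 (lift ord0 r) ^+ m r) * cos (v * z 0 ord0 + b).
have := moment_cvg (FF := eventually_filter) (h := h) am_xiY bdd_xiY row_Ylim clamped_xiY.
have -> : Ex P1 (fun w => h (\row_(r < a.+2) Ylim r w)) = base v m b.
  apply: eq_Ex => w; rewrite /h mxE; congr (_ * _); apply: eq_bigr => r _; by rewrite mxE.
have -> : (fun N => Ex P (fun w => h (xiY N w))) = (fun N => trig_moment (y N) v (monoG x y m N) b).
  apply: funext => N; apply: eq_Ex => w; rewrite /h mxE /monoG gr_ev_prod; congr (_ * _).
  by apply: eq_bigr => r _; rewrite mxE gr_ev_exp.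
apply; apply: dpgM; last exact: dpg_cos.
by apply: dpg_prod => r; apply: dpg_exp; exact: dpg_coord.
Qed.

Lemma gauss_limit_rec v l b :
  (fun N => Ex P (fun w => (hermite_var (s ^+ 2) l).[gr_ev (x N) w] * cos (v * gr_ev (y N) w + b))) @ \oo -->
  limit_rec p v (base v) l mnm0 b.
Proof.
have h := trig_moment_limit p0 qp hx hy bx by_ gauss_limit_defect gauss_limit_variance (@gauss_limit_base v) (l := l) (m := mnm0) (b := b).
apply: cvg_trans h; apply: near_eq_cvg; apply: nearW => N; apply: eq_Ex => w.
rewrite /monoG big1 ?mulr1 ?gr_ev_horner// => r _.
by rewrite mnm0E expr0.
Qed.

Let row2 (S : Type) (F G : S -> R) w : 'rV[R]_2 := \row_(i < 2) (if i == ord0 then F w else G w).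

Let row2E (S : Type) (F G : S -> R) (i : 'I_2) : (fun w => row2 F G w 0 i) = if i == ord0 then F else G.
Proof. by apply: funext => w; rewrite mxE; case: ifP. Qed.

Section along_ultrafilter.
Context (U : set_system nat) {UU : UltraFilter U}.
Hypothesis U_tail : forall n, U [set N | (n <= N)%N].

Let cvg_tail (f : nat -> R) (l : R) : f @ \oo --> l -> f @ U --> l.
Proof. by move=> h B /h [n _ hn]; exact: (@filterS _ U _ _ _ hn (U_tail n)). Qed.

Let row20 (S : Type) (F G : S -> R) w : row2 F G w 0 ord0 = F w.
Proof. by rewrite mxE. Qed.

Let row21 (S : Type) (F G : S -> R) w : row2 F G w 0 ord_max = G w.
Proof. by rewrite mxE. Qed.

(** A limit pair along one ultrafilter. Its Hermite moments are limits along [U] of the sequences in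
    [gauss_limit_rec], which converge along all [N]; hence [char_term] is expressed by [Ylim]
    alone. *)
Lemma gauss_pair_limit : exists d' (T' : measurableType d') (P' : probability T' R) (Z V : T' -> R),
  [/\ measurable_fun setT Z /\ measurable_fun setT V,
    forall B : set R, measurable B -> P' (Z @^-1` B) = normal_prob 0 s B,
    forall B : set R, measurable B -> P' (V @^-1` B) = P1 (Ylim ord0 @^-1` B),
    law_cvg U P P' (fun N w => (X N w, Y 0%N N w)) (fun w => (Z w, V w)) &
    forall u v l, char_term P' Z V s v u l =
      limit_cf_term P1 p (Ylim ord0) (fun r => Ylim (lift ord0 r)) u v l].
Proof.
have abs_bound (z : forall N, A N) (F : nat -> T -> R) : bdd z -> (forall N, itg P (F N)) ->
    (forall N, Ex P (fun w => `|gr_ev (z N) w - F N w|) <= N.+1%:R^-1) -> exists C, forall N, Ex P (fun w => `|F N w|) <= C.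
  move=> bz iF zF; have [C hC] := bdd_moments 1 bz; exists (C + 1) => N.
  have iz := am_itg (gr_am (z N)).
  apply: le_trans (_ : Ex P (fun w => `|gr_ev (z N) w| ^+ 1 + `|gr_ev (z N) w - F N w|) <= _).
    apply: le_Ex => [||w]; [exact: itg_abs|by apply: itgD; apply: itg_abs => //; exact: itgB|].
    by rewrite expr1 distrC addrC -lerBlDr; apply: le_trans (lerB_dist _ _) _; rewrite lexx.
  rewrite ExD; [|exact: itg_abs|by apply: itg_abs; exact: itgB].
  apply: lerD => //; apply: le_trans (zF N) _.
  by rewrite invf_le1 ?ltr0n// ler1n.
have [C1 hC1] := abs_bound x X bx iX xX.
have [C2 hC2] := abs_bound y (Y 0%N) by_ (iY 0%N) (fun N => yY N (isT : (0 <= a.+1)%N)).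
have [d' [T' [P' [Z [V [mZ mV hZV]]]]]] := @loeb_pair_limit _ _ _ P U _ U_tail X (Y 0%N) (C1 + C2) iX (iY 0%N)
  (fun N => le_trans (hC1 N) (ler_wpDr (le_trans (Ex_ge0 _ (fun w => normr_ge0 _)) (hC2 N)) (lexx _)))
  (fun N => le_trans (hC2 N) (ler_wpDl (le_trans (Ex_ge0 _ (fun w => normr_ge0 _)) (hC1 N)) (lexx _))).
exists d', T', P', Z, V.
have law : law_cvg U P P' (fun N w => (X N w, Y 0%N N w)) (fun w => (Z w, V w)).
  by move=> g cg bg; exact: (hZV g cg bg).2.
have cfst : continuous (fun z : R * R => z.1) by move=> z; exact: cvg_fst.
have csnd : continuous (fun z : R * R => z.2) by move=> z; exact: cvg_snd.
have lawZ : forall B : set R, measurable B -> P' (Z @^-1` B) = normal_prob 0 s B.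
  move=> B mB; rewrite -[RHS]/(normal_prob 0 s ((fun z : R => z) @^-1` B)).
  apply: (eq_law_borel mZ mid) => // g cg [M gM].
  have c1 := law (fun z => g z.1) (cont_comp cfst cg) (ex_intro _ M (fun z => gM _)).
  have c2 := cvg_tail (XZ cg (ex_intro _ M gM)).
  exact: (cvg_unique (@Rhausdorff R) c1 c2).
have lawV : forall B : set R, measurable B -> P' (V @^-1` B) = P1 (Ylim ord0 @^-1` B).
  move=> B mB; apply: (eq_law_borel mV (mYlim ord0)) => // g cg [M gM].
  have c1 := law (fun z => g z.2) (cont_comp csnd cg) (ex_intro _ M (fun z => gM _)).
  have c2 := cvg_tail (gauss_limit_law_y cg (ex_intro _ M gM)).
  exact: (cvg_unique (@Rhausdorff R) c1 c2).
split=> // u v l.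
have aY := gauss_limit_am_Ylim.
rewrite limit_cf_termE//.
pose xi N w := row2 (gr_ev (x N)) (gr_ev (y N)) w.
have cl : clamped_cvg P P' U xi (row2 Z V).
  apply: (@clamped_cvg_L1 _ _ _ _ _ _ _ _ _ _ (fun N => row2 (X N) (Y 0%N N))).
  - by move=> N i; rewrite row2E; case: ifP => _; [exact: itg_meas (iX N)|exact: itg_meas (iY _ N)].
  - by move=> N i; rewrite row2E; case: ifP => _; exact: am_meas (gr_am _).
  - move=> N i; apply: (@itgB _ _ _ _ (fun w => row2 (X N) (Y 0%N N) w 0 i) (fun w => xi N w 0 i)).
      by rewrite row2E; case: ifP.
    by rewrite row2E; case: ifP => _; exact: am_itg (gr_am _).
  - move=> i; apply: cvg_tail; case: (eqVneq i ord0) => [->|i0].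
      apply: cvg_trans x0; apply: near_eq_cvg; apply: nearW => N.
      by apply: eq_Ex => w; rewrite !row20 distrC.
    apply: cvg_trans (y0 (r := 0%N) isT); apply: near_eq_cvg; apply: nearW => N.
    by apply: eq_Ex => w; rewrite !mxE (negbTE i0) distrC.
  apply: law_clamped_cvg => g cg [M gM].
  have cr : continuous (row2 (@fst R R) (@snd R R)).
    by apply: cont_row => i; rewrite row2E; case: ifP.
  exact: (law (fun z => g (row2 fst snd z)) (cont_comp cr cg) (ex_intro _ M (fun z => gM _))).
have key b : hermite_trig P' Z V s v l b = limit_rec p v (base v) l mnm0 b.
  pose h (z : 'rV[R]_2) := (hermite_var (s ^+ 2) l).[z 0 ord0] * cos (v * z 0 ord_max + b).
  have c1 : (fun N => Ex P (fun w => h (xi N w))) @ U --> Ex P' (fun w => h (row2 Z V w)).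
    apply: moment_cvg => //.
    - by move=> N i; rewrite row2E; case: ifP => _; exact: gr_am.
    - move=> i m; have [Cx hx'] := bdd_moments m bx; have [Cy hy'] := bdd_moments m by_.
      case: (eqVneq i ord0) => [->|i0]; [exists Cx => N|exists Cy => N].
        by under eq_fun do rewrite row20.
      by under eq_fun do rewrite mxE (negbTE i0).
    - by move=> i; rewrite row2E; case: ifP.
    - by apply: dpgM; [exact: dpg_horner|exact: dpg_cos].
  have c2 := cvg_tail (gauss_limit_rec (v := v) (l := l) (b := b)).
  have e1 : (fun N => Ex P (fun w => h (xi N w))) =
     (fun N => Ex P (fun w => (hermite_var (s ^+ 2) l).[gr_ev (x N) w] * cos (v * gr_ev (y N) w + b))).
    by apply: funext => N; apply: eq_Ex => w; rewrite /h row20 row21.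
  rewrite e1 in c1; rewrite -(cvg_unique (@Rhausdorff R) c1 c2).
  by apply: eq_Ex => w; rewrite /h row20 row21.
by rewrite /char_term !key.
Qed.

End along_ultrafilter.

Local Notation term u v := (limit_cf_term P1 p (Ylim ord0) (fun r => Ylim (lift ord0 r)) u v).

Let pair_cf d' (T' : measurableType d') (P' : probability T' R) (Z V : T' -> R) :
  measurable_fun setT Z -> measurable_fun setT V ->
  (forall B : set R, measurable B -> P' (Z @^-1` B) = normal_prob 0 s B) ->
  (forall u v l, char_term P' Z V s v u l = term u v l) ->
  forall u v, abs_summable (term u v) /\
    cexpectation P' (fun w => expi (u * Z w + v * V w)) =
    (expR (- (s ^+ 2 * u ^+ 2 / 2)))%:C%C * csum (term u v).
Proof.
move=> mZ mV lZ ht u v.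
have gZ : has_centered_gaussian_law P' Z s by move=> B mB; rewrite (negbTE s0) lZ.
have <- : char_term P' Z V s v u = term u v by apply: funext => l; exact: ht.
split; first exact: abs_summable_char_term mZ gZ mV u.
rewrite (csum_char_term v mZ gZ mV) mulrA -rmorphM -expRD addNr expR0.
by rewrite mul1r.
Qed.

(** The pair is built along one ultrafilter. If the full sequence did not converge for some [g], an
    ultrafilter on the bad indices would give a second pair with the same characteristic function,
    hence the same law, contradicting that the expectations of [g] stay away from [l] on these
    indices. *)
Lemma gauss_limit : exists d' (T' : measurableType d') (P' : probability T' R) (Z V : T' -> R),
  [/\ measurable_fun setT Z /\ measurable_fun setT V,
    forall B : set R, measurable B -> P' (Z @^-1` B) = normal_prob 0 s B,
    forall B : set R, measurable B -> P' (V @^-1` B) = P1 (Ylim ord0 @^-1` B),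
    law_cvg \oo P P' (fun N w => (X N w, Y 0%N N w)) (fun w => (Z w, V w)) &
    forall u v, abs_summable (term u v) /\
      cexpectation P' (fun w => expi (u * Z w + v * V w)) =
      (expR (- (s ^+ 2 * u ^+ 2 / 2)))%:C%C * csum (term u v)].
Proof.
have [U [UU hU]] := ultraFilterLemma (@eventually_filter).
have tail_oo n : \oo [set N | (n <= N)%N] by exists n.
have [d' [T' [P' [Z [V [[mZ mV] lZ lV _ ht]]]]]] := @gauss_pair_limit U UU (fun n => hU _ (tail_oo n)).
exists d', T', P', Z, V.
have cf := pair_cf mZ mV lZ ht.
split=> //.
move=> g cg bg; apply/cvgrPdist_le => e e0; apply: contrapT => far.
pose f N := Ex P (fun w => g (X N w, Y 0%N N w)); pose l := Ex P' (fun w => g (Z w, V w)).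
pose S := [set N | ~ `|l - f N| <= e].
have FS : ProperFilter (within S \oo).
  apply: Build_ProperFilter => h; apply: far.
  have h1 : \forall N \near \oo, S N -> False by exact: h.
  by apply: filterS h1 => N h1; apply: contrapT => h2; exact: h1 h2.
have [U2 [UU2 hU2]] := ultraFilterLemma FS.
have oo2 (B : set nat) : \oo B -> U2 B by move=> h; apply: hU2; apply: filterS h => N BN _.
have US : U2 S by apply: hU2; apply: nearW => N.
have [d2 [T2 [P2 [Z2 [V2 [[mZ2 mV2] lZ2 _ law2 ht2]]]]]] := @gauss_pair_limit U2 UU2 (fun n => oo2 _ (tail_oo n)).
have cf2 := pair_cf mZ2 mV2 lZ2 ht2.
have row2_meas d3 (T3 : measurableType d3) (F G : T3 -> R) : measurable_fun setT F -> measurable_fun setT G ->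
    forall i, measurable_fun setT (fun w => row2 F G w 0 i).
  by move=> mF mG i; rewrite (row2E F G i); case: ifP.
have phase_row2 d3 (T3 : measurableType d3) (Q : probability T3 R) (F G : T3 -> R) (t : 'rV[R]_2) (b : R) :
    measurable_fun setT F -> measurable_fun setT G ->
    Ex Q (fun w => cos (phase t (row2 F G w) + b)) =
    complex.Re (cexpectation Q (fun w => expi (t 0 ord0 * F w + t 0 ord_max * G w))) * cos b -
    complex.Im (cexpectation Q (fun w => expi (t 0 ord0 * F w + t 0 ord_max * G w))) * sin b.
  move=> mF mG.
  have ml : measurable_fun setT (fun w => t 0 ord0 * F w + t 0 ord_max * G w).
    by apply: measurable_funD; apply: measurable_funM.
  have ic : itg Q (fun w => cos (t 0 ord0 * F w + t 0 ord_max * G w)).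
    apply: (@itg_bounded _ _ _ _ _ 1) => [|w]; last exact: cos_max.
    by apply: measurableT_comp ml; apply: continuous_R_meas; exact: continuous_cos.
  have is_ : itg Q (fun w => sin (t 0 ord0 * F w + t 0 ord_max * G w)).
    apply: (@itg_bounded _ _ _ _ _ 1) => [|w]; last exact: sin_max.
    by apply: measurableT_comp ml; apply: continuous_R_meas; exact: continuous_sin.
  rewrite /cexpectation !fine_expectation /= mulrC [X in _ - X]mulrC -!ExZ// -ExB; [|exact: itgZ|exact: itgZ].
  apply: eq_Ex => w; rewrite cosD /phase big_ord_recl big_ord1 !mxE /=.
  have -> : lift ord0 ord0 = ord_max :> 'I_2 by apply: val_inj.
  by rewrite [_ * cos b]mulrC [_ * sin b]mulrC.
have eq2 : Ex P2 (fun w => g (Z2 w, V2 w)) = l.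
  have -> : l = Ex P' ((fun z : 'rV[R]_2 => g (z 0 ord0, z 0 ord_max)) \o row2 Z V).
    by apply: eq_Ex => w; rewrite /= !mxE.
  have -> : Ex P2 (fun w => g (Z2 w, V2 w)) = Ex P2 ((fun z : 'rV[R]_2 => g (z 0 ord0, z 0 ord_max)) \o row2 Z2 V2).
    by apply: eq_Ex => w; rewrite /= !mxE.
  apply: cf_unique_bounded; [exact: row2_meas|exact: row2_meas| | |].
  - by move=> t b; rewrite !phase_row2// (cf _ _).2 (cf2 _ _).2.
  - apply: (@cont_comp _ _ _ (fun z : 'rV[R]_2 => (z 0 ord0, z 0 ord_max)) g) => // z.
    have c0 : (fun z : 'rV[R]_2 => z 0 ord0) @ z --> z 0 ord0 by exact: coord_cont.
    have c1 : (fun z : 'rV[R]_2 => z 0 ord_max) @ z --> z 0 ord_max by exact: coord_cont.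
    exact: cvg_pair c0 c1.
  - by case: bg => M gM; exists M.
have := law2 g cg bg; rewrite eq2 => /cvgrPdist_le /(_ e e0) near2.
have [N [h1 h2]] := @filter_ex _ U2 _ _ (filterI near2 US).
exact: h2 h1.
Qed.

End gauss_limit.

(** Excludes the space without unit vectors: all truncated second moments of the limit would vanish,
    so its variance would be zero. *)
Lemma nondegenerate_normal_limit (R : realType) d (T : measurableType d) (P : probability T R)
    (X : nat -> T -> R) (s : R) : s != 0 -> (forall N, itg P (X N)) ->
  law_cvg \oo P (normal_prob 0 s) X (fun z : R => z) -> ~ (forall N, Ex P (fun w => `|X N w|) = 0).
Proof.
move=> s0 iX XZ X0.
have mM M : continuous (fun z : R => Num.min (z ^+ 2) M%:R).
  have -> : (fun z : R => Num.min (z ^+ 2) M%:R) = (fun z => Num.max 0 (Num.min M%:R (z ^+ 2))).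
    apply: funext => z; rewrite minC; apply/esym/max_idPr.
    by rewrite le_min ler0n sqr_ge0.
  by apply: cont_clamp => z; exact: exprn_continuous.
have mb M (z : R) : `|Num.min (z ^+ 2) M%:R| <= M%:R.
  by rewrite ger0_norm ?ge_min ?lexx ?orbT// le_min ler0n sqr_ge0.
have [_ h] : itg (normal_prob 0 s) (fun z : R => z ^+ 2) /\ Ex (normal_prob 0 s) (fun z : R => z ^+ 2) <= 0.
  apply: itg_trunc => [|z|M]; [exact: measX (@measurable_id _ _ _)|exact: sqr_ge0|].
  have c := XZ _ (mM M) (ex_intro _ M%:R (mb M)).
  rewrite -(cvg_lim (@Rhausdorff R) c); apply: limr_le; first exact: cvgP c.
  apply: nearW => N; rewrite -(mulr0 M%:R) -(X0 N) -ExZ; last exact: itg_abs.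
  apply: le_Ex => [||w].
  - apply: (@itg_bounded _ _ _ _ _ M%:R) => // .
    apply: (@measurableT_comp _ _ _ _ _ _ (fun z : R => Num.min (z ^+ 2) M%:R)) (itg_meas (iX N)).
    exact: continuous_R_meas (mM M).
  - by apply: itgZ; exact: itg_abs.
  have M0 := ler0n R M; rewrite ge_min -real_normK ?num_real//; set z := `|_|.
  have z0 : 0 <= z by exact: normr_ge0.
  clearbody z; case: M M0 {c} => [|M] M0; first by rewrite mul0r lexx orbT.
  have M1 : 1 <= M.+1%:R :> R by rewrite ler1n.
  by have [z1|z1] := leP z 1; apply/orP; [left|right]; nra.
have := h; rewrite [X in X <= _](normal_square s0).
by rewrite le_eqVlt sqrf_eq0 (negbTE s0) ltNge sqr_ge0.
Qed.

Theorem theorem4 (R : realType)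
    (H : completeNormedModType R) (dot : {dot H for idfun})
    (dot_norm : forall x : H, dot x x = `|x| ^+ 2)
    (H_separable : separable_space H)
    (d : measure_display) (T : measurableType d) (P : probability T R)
    (W : H -> {RV P >-> R}) (W_isonormal : isonormal_process dot W)
    (p q a : nat) (hp : (2 <= p)%N) (ha : (1 <= a)%N)
    (hq : (a * p < q < a.+1 * p)%N)
    (sigma : R) (hsigma : 0 < sigma ^+ 2)
    (f : nat -> ('I_p -> H) -> R) (g : nat -> ('I_q -> H) -> R)
    (hf : forall N, symmetric_tensor dot (f N))
    (hg : forall N, symmetric_tensor dot (g N))
    (X : nat -> {RV P >-> R}) (Y : nat -> nat -> {RV P >-> R})
    (X_int : forall N, is_multiple_integral dot W (f N) (X N))
    (Y0_int : forall N, is_multiple_integral dot W (g N) (Y 0%N N))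
    (Y_rec : forall r N, is_derivative_product dot W (X N) (Y r N) (Y r.+1 N))
    (X_cvg : cvg_law P (normal_prob 0 sigma) X idfun)
    (d' : measure_display) (T' : measurableType d') (P' : probability T' R)
    (Ylim : 'I_a.+1 -> {RV P' >-> R})
    (Y_cvg : cvg_law P P'
       (fun N w => \row_(r < a.+1) Y r N w) (fun w => \row_(r < a.+1) Ylim r w)) :
  (forall m : 'I_a -> nat,
     P'.-integrable setT
       (EFin \o (fun w => \prod_(r < a) Ylim (lift ord0 r) w ^+ m r))) /\
  (forall u v : R,
     abs_summable (limit_cf_term P' p (Ylim ord0)
       (fun r : 'I_a => Ylim (lift ord0 r)) u v)) /\
  exists (d'' : measure_display) (T'' : measurableType d'')
         (P'' : probability T'' R) (Z Y'' : {RV P'' >-> R}),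
    [/\ forall A : set R, measurable A ->
          distribution P'' Z A = normal_prob 0 sigma A,
        forall A : set R, measurable A ->
          distribution P'' Y'' A = distribution P' (Ylim ord0) A,
        cvg_law P P'' (fun N w => (X N w, Y 0%N N w)) (fun w => (Z w, Y'' w)) &
        forall u v : R,
          cexpectation P'' (fun w => expi (u * Z w + v * Y'' w)) =
          (expR (- (sigma ^+ 2 * u ^+ 2 / 2)))%:C%C *
          csum (limit_cf_term P' p (Ylim ord0)
            (fun r : 'I_a => Ylim (lift ord0 r)) u v)].
Proof.
(* From here [a] is the original one minus one: the brackets of order [1] to [a.+1] have limits, and
   the one of order [a.+2] vanishes asymptotically because [q < a.+2 * p]. *)
case: a ha hq Ylim Y_cvg => [//|a] _ /andP[_ qp] Ylim Y_cvg.
have s0 : sigma != 0 by move: hsigma; rewrite exprn_even_gt0.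
have p0 : (0 < p)%N by apply: leq_trans hp.
have mX N : measurable_fun setT (X N : T -> R) by [].
have mY r N : measurable_fun setT (Y r N : T -> R) by [].
have mL r : measurable_fun setT (Ylim r : T' -> R) by [].
have l2XY r N : l2 P (X N) /\ l2 P (Y r N).
  have [DF [DG [mF mG _]]] := Y_rec r N.
  by split; [refine (mall_l2 dot_norm W_isonormal mF)|refine (mall_l2 dot_norm W_isonormal mG)].
have iX N : itg P (X N) := l2_itg (l2XY 0%N N).1.
have iY r N : itg P (Y r N) := l2_itg (l2XY r N).2.
have XZ : law_cvg \oo P (normal_prob 0 sigma) (fun N => X N : T -> R) (fun z : R => z).
  by apply: cvg_law_Ex X_cvg => phi cphi; exact: continuous_R_meas.
have YZ : law_cvg \oo P P' (fun N w => \row_(r < a.+2) Y r N w) (fun w => \row_(r < a.+2) Ylim r w).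
  apply: cvg_law_Ex Y_cvg => phi cphi; apply: meas_continuous_row cphi => i.
  by under eq_fun do rewrite mxE; exact: mL.
(* A unit vector is needed to start Gram-Schmidt; without one every [X N] would be zero almost
   surely. *)
have [v0 hv0] : exists v0 : H, `|v0| = 1.
  apply: contrapT => nov; apply: (nondegenerate_normal_limit s0 iX XZ) => N.
  have hn (v : H) : `|v| != 1 by apply/eqP => hv; apply: nov; exists v.
  refine (trivial_multiple_integral hn (X_int N) (mX N)).
(* Each [N] has its own finite family and algebra, with L^1 error at most [N.+1%:R^-1]. The algebra
   and its two elements are chosen together because the type of the elements depends on the
   algebra. *)
have /choice[B hB] : forall N, exists B : {A : gauss_real P & (A * A)%type},
    [/\ ch p (projT2 B).1, ch q (projT2 B).2,
      Ex P (fun w => `|gr_ev (projT2 B).1 w - X N w|) <= N.+1%:R^-1 &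
      forall r, (r <= a.+1)%N ->
        Ex P (fun w => `|gr_ev (itG r (projT2 B).1 (projT2 B).2) w - Y r N w|) <= N.+1%:R^-1].
  move=> N; have e0 : 0 < N.+1%:R^-1 :> R by rewrite invr_gt0 ltr0n.
  have [k [e [he [x [y [cx cy h1 h2]]]]]] := itG_approximation (Y := fun r => Y r N) dot_norm W_isonormal a.+1 hv0
    (X_int N) (Y0_int N) (fun r => Y_rec r N) (mX N) (fun r => mY r N) e0.
  by exists (existT _ (Walg_real W_isonormal he) (x, y)).
have hx N : ch p (projT2 (B N)).1 by case: (hB N).
have hy N : ch q (projT2 (B N)).2 by case: (hB N).
have xX N : Ex P (fun w => `|gr_ev (projT2 (B N)).1 w - X N w|) <= N.+1%:R^-1 by case: (hB N).
have yY r N : (r <= a.+1)%N ->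
    Ex P (fun w => `|gr_ev (itG r (projT2 (B N)).1 (projT2 (B N)).2) w - Y r N w|) <= N.+1%:R^-1.
  by case: (hB N) => _ _ _; apply.
have aL := gauss_limit_am_Ylim hx hy iX iY xX yY XZ mL YZ.
have [d'' [T'' [P'' [Z [V [[mZ mV] lZ lV law cf]]]]]] := gauss_limit p0 qp s0 hx hy iX iY xX yY XZ mL YZ.
split; first by move=> m; apply: am_itg; apply: am_prod => r; apply: amX; exact: aL.
split; first by move=> u v; exact: (cf u v).1.
pose Z' : {RV P'' >-> R} := HB.pack Z (isMeasurableFun.Build _ _ T'' R Z mZ).
pose V' : {RV P'' >-> R} := HB.pack V (isMeasurableFun.Build _ _ T'' R V mV).
exists d'', T'', P'', Z', V'; split => //; last by move=> u v; exact: (cf u v).2.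
move=> phi cphi [M phiM].
have pair_itg d0 (S : measurableType d0) (Q : probability S R) (F G : S -> R) :
    measurable_fun setT F -> measurable_fun setT G -> itg Q (fun w => phi (F w, G w)).
  by move=> mF mG; apply: (@itg_bounded _ _ _ _ _ M) => //; exact: meas_continuous_pair.
rewrite (expectationE (pair_itg _ _ P'' _ _ mZ mV)).
have -> : (fun N => expectation P (phi \o (fun w => (X N w, Y 0%N N w)))) =
    (fun N => (Ex P (fun w => phi (X N w, Y 0%N N w)))%:E).
  by apply: funext => N; rewrite -(expectationE (pair_itg _ _ P _ _ (mX N) (mY 0%N N))).
apply: cvg_EFin; first exact: nearW.
by apply: law => //; exists M.
Qed.
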